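(* Let $L$ be a homogeneous Lévy basis on $\mathbb{R}^2$ with characteristic triplet $(\gamma,b,\nu)$ and seed $L'$ satisfying $\mathbb{E}|L'|<\infty$, and let $X$ be the trawl process with trawl function $a$, where $a$ is continuously differentiable on a neighborhood of $0$. Let $\Delta_n\downarrow 0$ with $n\Delta_n\to 0$ as $n\to\infty$. Put $$Z^n_t:=\frac{[nt]}{n}\tilde X_0-\frac1n\mathbf{S}^n_t,\qquad t\ge 0 .$$ Then the following holds as $n\to\infty$. (i) If $b>0$, then $$\frac{1}{\sqrt{n\Delta_n}}Z^n_t\ \overset{\mathcal{F}\text{-}fd}{\longrightarrow}\ \sigma\int_0^t (t-r)\,\mathrm{d}\big(B^{(1)}_r+B^{(2)}_r\big),\qquad t\ge 0,$$ where $B^{(1)},B^{(2)}$ are two independent Brownian motions, defined on an extension of the probability space and independent of $\mathcal F$ (in particular of $L$), and $\sigma^2=b^2a(0)$. (ii) Suppose that $b=0$ and that there is $0<\beta<2$ such that $x^{\beta}\nu^{\pm}(x)\to\tilde K_\pm$ as $x\to0^+$, for some constants $\tilde K_\pm\geq 0$ with $\tilde K_++\tilde K_->0$; if $\beta=1$ assume in addition that $\tilde K_+=\tilde K_-$ and that the Cauchy principal value $\mathrm{PV}\int_{-1}^1x\,\nu(\mathrm{d}x)$ exists. Then $$\frac{1}{(n\Delta_n)^{1/\beta}}Z^n_t\ \overset{\mathcal{F}\text{-}fd}{\longrightarrow}\ \int_0^t(t-s)\,\mathrm{d}\big(Y^{(1)}_s-Y^{(2)}_s\big),\qquad t\ge0,$$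 where $Y^{(1)},Y^{(2)}$ are two i.i.d. strictly $\beta$-stable Lévy processes, defined on an extension of the probability space and independent of $\mathcal F$ (in particular of $L$), with $$\log\mathbb{E}\big(e^{izY^{(q)}_1}\big)=\psi(z;\beta,\varrho\tilde K_+,\varrho\tilde K_-,\tilde\gamma),\qquad z\in\mathbb{R},\ q=1,2,$$ where $\varrho=\beta a(0)$ and, when $\beta=1$, $\tilde\gamma=\gamma+\mathrm{PV}\int_{-1}^1x\,\nu(\mathrm{d}x)$ (for $\beta\ne1$ the parameter $\tilde\gamma$ plays no role).
   Context: $(\Omega,\mathcal F,\mathbb P)$ is a complete probability space; $[\cdot]$ denotes the integer part; $\mathbb{R}^+=[0,\infty)$. Lévy basis. A homogeneous Lévy basis on $\mathbb{R}^2$ with characteristic triplet $(\gamma,b,\nu)$ ($\gamma\in\mathbb R$, $b\ge0$, $\nu$ a Lévy measure on $\mathbb R$) is a family $L=\{L(A)\}$ of real random variables, indexed by Borel sets $A\subset\mathbb{R}^2$ of finite Lebesgue measure, that is a.s. $\sigma$-additive, takes independent values on disjoint sets, and satisfies $\log\mathbb{E}e^{izL(A)}=\mathrm{Leb}(A)\psi(z)$ with $\psi(z)=i\gamma z-\frac12b^2z^2+\int_{\mathbb{R}\setminus\{0\}}(e^{izx}-1-izx\mathbf 1_{|x|\le1})\nu(\mathrm{d}x)$. The seed $L'$ is a random variable with $\log\mathbb{E}e^{izL'}=\psi(z)$. Put $\nu^+(x)=\nu((x,\infty))$ and $\nu^-(x)=\nu((-\infty,-x))$ for $x>0$. Trawl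 process. The trawl function $a:\mathbb{R}^+\to\mathbb{R}^+$ is non-increasing, integrable and continuous on $[0,\infty)$; $A=\{(r,y):r\le0,\ 0\le y\le a(-r)\}$, $A_t=A+(t,0)$, and $X_t=L(A_t)$, $t\in\mathbb R$. Write $\tilde X_t=X_t-\mathbb E(X_t)$ and $\mathbf S^n_t=\sum_{k=0}^{[nt]-1}\big(X_{k\Delta_n}-\mathbb{E}(X_{k\Delta_n})\big)$, $t\ge0$. Stable convergence. For a sub-$\sigma$-field $\mathcal G\subseteq\mathcal F$, $\xi_n\to\xi$ $\mathcal G$-stably in distribution ($\xi$ possibly defined on an extension of the probability space) means that for every $E\in\mathcal G$ with $\mathbb P(E)>0$, $\xi_n$ under $\mathbb P(\cdot|E)$ converges in distribution to $\xi$ under $\mathbb P(\cdot|E)$. $X^n\overset{\mathcal G\text{-}fd}{\longrightarrow}X$ means that all finite-dimensional distributions converge $\mathcal G$-stably. Strictly stable exponents. For $0<\beta<2$, $K_\pm\ge0$, $K_++K_->0$ (with $K_+=K_-$ if $\beta=1$), $\gamma\in\mathbb R$: $\psi(z;\beta,K_+,K_-,\gamma)=-\varsigma|z|^\beta\big(1-i\rho\,\mathrm{sign}(z)\tan(\pi\beta/2)\big)$ if $\beta\ne1$, and $=-K_+\pi|z|+i\gamma z$ if $\beta=1$, where $\varsigma=\frac{\Gamma(2-\beta)}{\beta(1-\beta)}\cos(\pi\beta/2)(K_++K_-)$ and $\rho=\frac{K_+-K_-}{K_++K_-}$. This is the exponent of the strictly $\beta$-stable law with Lévy density $K_+|x|^{-1-\beta}\mathbf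 1_{x>0}+K_-|x|^{-1-\beta}\mathbf 1_{x<0}$. *)

(* Defs.v *)
From HB Require Import structures.
From mathcomp Require Import all_boot all_order all_algebra.
From mathcomp Require Import all_classical all_reals all_analysis.
From mathcomp Require Import complex.

Set Implicit Arguments.
Unset Strict Implicit.
Unset Printing Implicit Defensive.

Import Order.TTheory GRing.Theory Num.Theory.
Import numFieldNormedType.Exports.

Local Open Scope classical_set_scope.
Local Open Scope ring_scope.
Local Open Scope complex_scope.

Definition cexp (R : realType) (z : R[i]) : R[i] :=
  (expR (complex.Re z))%:C * (cos (complex.Im z) +i* sin (complex.Im z)).

Definition cintegral d (T : measurableType d) (R : realType)
    (mu : {measure set T -> \bar R}) (D : set T) (f : T -> R[i]) : R[i] :=
  (\int[mu]_(x in D) complex.Re (f x)) +i* (\int[mu]_(x in D) complex.Im (f x)).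

Definition charfun d (T : measurableType d) (R : realType)
    (P : probability T R) (X : T -> R) (z : R) : R[i] :=
  cintegral P setT (fun w => cexp ((z * X w) *i)).

(* log E e^{izX} = psi z with the distinguished logarithm, for [psi] continuous
   and [psi 0 = 0]. *)
Definition has_exponent d (T : measurableType d) (R : realType)
    (P : probability T R) (X : T -> R) (psi : R -> R[i]) : Prop :=
  forall z : R, charfun P X z = cexp (psi z).

Definition levy_measure (R : realType) (nu : {measure set R -> \bar R}) : Prop :=
  nu [set 0] = 0%E /\
  (\int[nu]_x (Num.min 1 (x ^+ 2))%:E < +oo)%E.

Definition levy_exponent (R : realType) (gamma b : R)
    (nu : {measure set R -> \bar R}) (z : R) : R[i] :=
  (gamma * z) *i - (2^-1 * b ^+ 2 * z ^+ 2)%:C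
  + cintegral nu [set~ 0] (fun x : R =>
      cexp ((z * x) *i) - 1
      - (z * x * \1_[set y : R | `|y| <= 1] x) *i).

Definition Gamma (R : realType) (s : R) : R :=
  \int[lebesgue_measure]_(x in `]0, +oo[) (x `^ (s - 1) * expR (- x)).

Definition stable_exponent (R : realType) (beta Kp Km gamma z : R) : R[i] :=
  if beta == 1 then - (Kp * pi * `|z|)%:C + (gamma * z) *i
  else
    let varsigma := Gamma (2 - beta) / (beta * (1 - beta))
                    * cos (pi * beta / 2) * (Kp + Km) in
    let rho := (Kp - Km) / (Kp + Km) in
    - (varsigma * `|z| `^ beta)%:C
      * (1 - (rho * Num.sg z * tan (pi * beta / 2)) *i).

Definition mutually_independent d (T : measurableType d) (R : realType)
    (P : probability T R) (n : nat) (X : 'I_n -> T -> R) : Prop :=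
  forall U : 'I_n -> set R, (forall i, measurable (U i)) ->
    P (\bigcap_(i in [set: 'I_n]) X i @^-1` U i)
    = (\prod_(i < n) P (X i @^-1` U i))%E.

Definition independent_systems d (T : measurableType d) (R : realType)
    (P : probability T R) (G1 G2 : set_system T) : Prop :=
  forall A B, G1 A -> G2 B -> P (A `&` B) = (P A * P B)%E.

Definition sigma_process (T : Type) (R : realType) (Y : R -> T -> R)
    : set_system T :=
  <<s [set C | exists t, 0 <= t /\
         exists U : set R, measurable U /\ C = Y t @^-1` U] >>.

Definition leb2 (R : realType) : set (R * R) -> \bar R :=
  (@lebesgue_measure R \x @lebesgue_measure R)%E.

Record levy_basis d (T : measurableType d) (R : realType)
    (P : probability T R) (gamma b : R) (nu : {measure set R -> \bar R})
    (L : set (R * R) -> T -> R) : Prop := LevyBasis {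
  levy_basis_measurable : forall A, measurable A -> (leb2 A < +oo)%E ->
    measurable_fun setT (L A) ;
  levy_basis_sigma_additive : forall A : nat -> set (R * R),
    (forall i, measurable (A i)) -> trivIset setT A ->
    (leb2 (\bigcup_i A i) < +oo)%E ->
    {ae P, forall w,
      (fun n => \sum_(i < n) L (A i) w) @ \oo --> L (\bigcup_i A i) w} ;
  levy_basis_independent : forall (n : nat) (A : 'I_n -> set (R * R)),
    (forall i, measurable (A i)) -> (forall i, (leb2 (A i) < +oo)%E) ->
    trivIset setT A -> mutually_independent P (fun i => L (A i)) ;
  levy_basis_exponent : forall A, measurable A -> (leb2 A < +oo)%E ->
    has_exponent P (L A)
      (fun z => (fine (leb2 A))%:C * levy_exponent gamma b nu z) }.

Record trawl_function (R : realType) (a : R -> R) : Prop := TrawlFunction {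
  trawl_ge0 : forall x, 0 <= x -> 0 <= a x ;
  trawl_noninc : forall x y, 0 <= x -> x <= y -> a y <= a x ;
  trawl_integrable : (@lebesgue_measure R).-integrable `[0, +oo[ (EFin \o a) ;
  trawl_continuous : {within `[0, +oo[, continuous a} }.

(* [a] lives on [0, +oo[, so neighborhoods of 0 and difference quotients are
   taken inside [0, +oo[; at 0 the derivative is one-sided. *)
Definition C1_near0 (R : realType) (a : R -> R) : Prop :=
  exists e : R, 0 < e /\ exists a' : R -> R,
    {within `[0, e[, continuous a'} /\
    forall x, 0 <= x < e ->
      (a y - a x) / (y - x) @[y --> within [set y | 0 <= y] x^'] --> a' x.

Definition trawl_set (R : realType) (a : R -> R) : set (R * R) :=
  [set p | p.1 <= 0 /\ 0 <= p.2 <= a (- p.1)].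

Definition trawl_set_at (R : realType) (a : R -> R) (t : R) : set (R * R) :=
  (fun p : R * R => (p.1 + t, p.2)) @` trawl_set a.

Definition trawl_process (T : Type) (R : realType) (L : set (R * R) -> T -> R)
    (a : R -> R) (t : R) : T -> R :=
  L (trawl_set_at a t).

Definition centered d (T : measurableType d) (R : realType)
    (P : probability T R) (X : R -> T -> R) (t : R) (w : T) : R :=
  X t w - fine 'E_P[X t].

Definition partial_sum d (T : measurableType d) (R : realType)
    (P : probability T R) (X : R -> T -> R) (Delta : nat -> R)
    (n : nat) (t : R) (w : T) : R :=
  \sum_(0 <= k < Num.truncn (n%:R * t)) centered P X (k%:R * Delta n) w.

Definition Zproc d (T : measurableType d) (R : realType)
    (P : probability T R) (X : R -> T -> R) (Delta : nat -> R)
    (n : nat) (t : R) (w : T) : R :=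
  (Num.truncn (n%:R * t))%:R / n%:R * centered P X 0 w
  - n%:R^-1 * partial_sum P X Delta n t w.

Definition prob_extension d d' (T : measurableType d) (T' : measurableType d')
    (R : realType) (P : probability T R) (P' : probability T' R)
    (pr : {mfun T' >-> T}) : Prop :=
  forall A, measurable A -> P' (pr @^-1` A) = P A.

(* P( . | E); [mnormalize] falls back to [P] itself when P(E) = 0. *)
Definition cond_prob d (T : measurableType d) (R : realType)
    (P : probability T R) (E : set T) (mE : measurable E) : probability T R :=
  mnormalize (mrestr P mE) P.

Definition cvg_distribution d d' (T : measurableType d) (T' : measurableType d')
    (R : realType) (k : nat) (P : probability T R) (xi : nat -> T -> 'rV[R]_k)
    (P' : probability T' R) (zeta : T' -> 'rV[R]_k) : Prop :=
  forall f : 'rV[R]_k -> R, continuous f -> (exists M, forall x, `|f x| <= M) ->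
    (fun n => \int[P]_w f (xi n w)) @ \oo --> \int[P']_w f (zeta w).

(* [xi] lives on [T] and its limit on the extension [T']; on the latter an
   event E of the sub-sigma-field [G] is read as [pr @^-1` E]. *)
Definition stable_cvg d d' (T : measurableType d) (T' : measurableType d')
    (R : realType) (k : nat) (G : set_system T)
    (P : probability T R) (xi : nat -> T -> 'rV[R]_k)
    (P' : probability T' R) (pr : {mfun T' >-> T}) (zeta : T' -> 'rV[R]_k)
    : Prop :=
  forall (E : set T) (mE : measurable E), G E -> (0 < P E)%E ->
    cvg_distribution (cond_prob P mE) xi
      (cond_prob P' (measurable_funPTI pr mE)) zeta.

Definition stable_fd_cvg d d' (T : measurableType d) (T' : measurableType d')
    (R : realType) (G : set_system T)
    (P : probability T R) (X : nat -> R -> T -> R)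
    (P' : probability T' R) (pr : {mfun T' >-> T}) (Y : R -> T' -> R) : Prop :=
  forall (k : nat) (t : 'I_k -> R), (forall i, 0 <= t i) ->
    stable_cvg G P (fun n w => \row_(i < k) X n (t i) w)
      P' pr (fun w => \row_(i < k) Y (t i) w).

Definition independent_increments d (T : measurableType d) (R : realType)
    (P : probability T R) (Y : R -> T -> R) : Prop :=
  forall (n : nat) (t : nat -> R), 0 <= t 0%N ->
    (forall j, t j <= t j.+1) ->
    mutually_independent P (fun (j : 'I_n) w => Y (t j.+1) w - Y (t j) w).

Definition cadlag (R : realType) (y : R -> R) : Prop :=
  (forall t, 0 <= t -> y s @[s --> t^'+] --> y t) /\
  (forall t, 0 < t -> exists l : R, y s @[s --> t^'-] --> l).

Record levy_process d (T : measurableType d) (R : realType)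
    (P : probability T R) (Y : R -> T -> R) : Prop := LevyProcess {
  levy_measurable : forall t, 0 <= t -> measurable_fun setT (Y t) ;
  levy_start : {ae P, forall w, Y 0 w = 0} ;
  levy_stationary : forall s h, 0 <= s -> 0 <= h ->
    forall U : set R, measurable U ->
    P ((fun w => Y (s + h) w - Y s w) @^-1` U) = P (Y h @^-1` U) ;
  levy_independent : independent_increments P Y ;
  levy_cadlag : {ae P, forall w, cadlag (fun t => Y t w)} }.

Record brownian_motion d (T : measurableType d) (R : realType)
    (P : probability T R) (B : R -> T -> R) : Prop := BrownianMotion {
  bm_measurable : forall t, 0 <= t -> measurable_fun setT (B t) ;
  bm_start : {ae P, forall w, B 0 w = 0} ;
  bm_independent : independent_increments P B ;
  bm_normal : forall s t, 0 <= s -> s < t ->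
    forall U : set R, measurable U ->
    P ((fun w => B t w - B s w) @^-1` U) = normal_prob 0 (Num.sqrt (t - s)) U ;
  bm_continuous : {ae P, forall w,
    {within `[0, +oo[, continuous (fun t => B t w)}} }.

Definition cvg_probability d (T : measurableType d) (R : realType)
    (P : probability T R) (xi : nat -> T -> R) (zeta : T -> R) : Prop :=
  forall e : R, 0 < e ->
    (fun n => P [set w | e <= `|xi n w - zeta w|]) @ \oo --> 0%E.

(* [I] is (a version of) the integral over ]0, t] of the deterministic function
   [f] with respect to the process [M]: whenever the step functions
     f_n = \sum_(j < m n) c n j * \1_]s n j, s n j.+1],
     0 = s n 0 <= s n 1 <= ... <= s n (m n) = t,
   converge uniformly to [f] on ]0, t], the elementary integrals
     \sum_(j < m n) c n j * (M_(s n j.+1) - M_(s n j))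
   converge to [I] in probability. *)
Definition is_stoch_integral d (T : measurableType d) (R : realType)
    (P : probability T R) (M : R -> T -> R) (f : R -> R) (t : R) (I : T -> R)
    : Prop :=
  measurable_fun setT I /\
  forall (m : nat -> nat) (s c : nat -> nat -> R),
    (forall n, s n 0%N = 0) -> (forall n, s n (m n) = t) ->
    (forall n j, (j < m n)%N -> s n j <= s n j.+1) ->
    (forall e, 0 < e -> \forall n \near \oo,
       forall j r, (j < m n)%N -> s n j < r <= s n j.+1 -> `|c n j - f r| <= e) ->
    cvg_probability P
      (fun n w => \sum_(j < m n) c n j * (M (s n j.+1) w - M (s n j) w)) I.

Definition stoch_integral d (T : measurableType d) (R : realType)
    (P : probability T R) (M : R -> T -> R) (f : R -> R) (t : R) : T -> R :=
  xget (fun=> 0) [set I | is_stoch_integral P M f t I].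

(* The two processes are independent of each other, and jointly independent of
   the sigma-field of the original space. *)
Definition independent_pair_of_base d d' (T : measurableType d)
    (T' : measurableType d') (R : realType) (P' : probability T' R)
    (pr : {mfun T' >-> T}) (Y1 Y2 : R -> T' -> R) : Prop :=
  independent_systems P' (sigma_process Y1) (sigma_process Y2) /\
  independent_systems P' (<<s sigma_process Y1 `|` sigma_process Y2 >>)
    [set pr @^-1` A | A in measurable].

Definition pv_integrand (R : realType) (nu : {measure set R -> \bar R})
    (e : R) : R :=
  \int[nu]_(x in [set x : R | e <= `|x| <= 1]) x.

Definition pv_exists (R : realType) (nu : {measure set R -> \bar R}) : Prop :=
  exists l : R, pv_integrand nu e @[e --> 0^'+] --> l.

Definition pv (R : realType) (nu : {measure set R -> \bar R}) : R :=
  lim (pv_integrand nu e @[e --> 0^'+]).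

Definition tails_regular (R : realType) (nu : {measure set R -> \bar R})
    (beta Kp Km : R) : Prop :=
  ((x `^ beta)%:E * nu `]x, +oo[%classic)%E @[x --> 0^'+] --> Kp%:E /\
  ((x `^ beta)%:E * nu `]-oo, (- x)%R[%classic)%E @[x --> 0^'+] --> Km%:E.

(* Main.v *)
(* The increments [X_0 - X_{k Delta_n}] are sums of values of [L] over the atoms cut out by the
   shifted trawl sets.  Since [a] is continuous at 0 and [n Delta_n -> 0], up to a set of
   negligible area there are two kinds of atoms: those left between [j Delta_n] and
   [(j+1) Delta_n] and those entered then, each of area about [Delta_n a 0]; they carry the
   weights [+- ([nt] - j)^+ / n].  Near infinity [Re psi u ~ - C0 |u|^beta], and the drift part of
   the exponent cancels between the two kinds, so the characteristic function of a linear
   combination of the normalised [Z^n_{t_i}] is close to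
   [exp(- 2 a 0 C0 n^-1 sum_j |ramp n j|^beta)].
   Stability: two such functionals at scales [n] and [m] are asymptotically independent as
   [n -> oo] with [m] fixed, because [psi (u + v) - psi u - psi v] is of lower order there; hence
   their correlation with any fixed event vanishes.
   On the limit side, approximating [\int_0^t (t - r) dM_r] by the step function with values
   [([nt] - j)^+ / n] gives exactly the same expression, so that no limit of the sums has to be
   computed; Levy's continuity theorem in R^k, applied under each [P( . | E)], concludes. *)

Require Import Defs.
From HB Require Import structures.
From mathcomp Require Import all_boot all_order all_algebra.
From mathcomp Require Import all_classical all_reals all_analysis.
From mathcomp Require Import measurable_realfun complex.
From mathcomp Require Import ring lra.

Set Implicit Arguments.
Unset Strict Implicit.
Unset Printing Implicit Defensive.

Import Order.TTheory GRing.Theory Num.Theory.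
Import numFieldNormedType.Exports.

Local Open Scope classical_set_scope.
Local Open Scope ring_scope.

(** * Bounded expectations and independence *)

(** Both cases run through one argument with two interfaces: [regular_exponent] for the prelimit,
    with index 2 and [C0 = b^2/2] or with index [beta], and [stable_increments] for the limit. The
    obstacle on the first side is that at the frequencies in play the exponent is of size
    [1/(n Delta_n)], the inverse of the order of the total area involved, so that areas must be
    known up to [o(n Delta_n)]; this comes from the monotonicity of [a] and from the equality of the
    areas of all shifted sets. The drift may exceed that size when [beta < 1]. What is removed is
    the linear function of u that agrees with Im psi at the current scale; it integrates to zero
    because the coefficients of X sum to zero. The asymptotics of Re psi reduce to the integral of
    [(1 - cos y) y^(-1-beta)] over the half-line, which a rotation of the contour turns into Gamma(2
    - beta). On the limit side the laws of Y^(1) and Y^(2) are given at time 1 only, and an integral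
    is known only through the convergence in probability of its step sums; hence a halving argument
    for the increments of Y^(1) - Y^(2), and a proof that the integral exists. *)

Lemma cvg_Rintegral d (T : measurableType d) (R : realType)
    (mu : {measure set T -> \bar R}) (D : set T) (f_ : nat -> T -> R) (f g : T -> R) :
  measurable D -> (forall n, measurable_fun D (f_ n)) ->
  (forall x, D x -> f_ ^~ x @ \oo --> f x) ->
  mu.-integrable D (EFin \o g) -> (forall n x, D x -> `|f_ n x| <= g x) ->
  \int[mu]_(x in D) f_ n x @[n --> \oo] --> \int[mu]_(x in D) f x.
Proof.
move=> mD mf_ ff ig fg.
have mf : measurable_fun D f by exact: measurable_fun_cvg mf_ ff.
have [| | | | |intf _ cv] := @dominated_convergence _ _ _ mu _ mD (fun n x => (f_ n x)%:E)
  (EFin \o f) (EFin \o g).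
- by move=> n; exact/measurable_EFinP.
- exact/measurable_EFinP.
- by apply: aeW => x Dx; apply/fine_cvgP; split; [exact: nearW|exact: ff].
- exact: ig.
- by apply: aeW => x n Dx; rewrite lee_fin; exact: fg.
apply: fine_cvg; rewrite fineK//.
exact: integrable_fin_num.
Qed.

Section bounded_expectation.
Context d (T : measurableType d) (R : realType) (P : probability T R).
Implicit Types (f g : T -> R) (M Mf Mg c e : R).

Lemma bounded_integrable f M : measurable_fun setT f ->
  (forall w, `|f w| <= M) -> P.-integrable setT (EFin \o f).
Proof.
move=> mf bf; apply: measurable_bounded_integrable => //.
- by rewrite (le_lt_trans (probability_le1 _ _))// ltry.
- exists M; split; first by rewrite num_real.
  by move=> x Mx w _; apply: (le_trans (bf w)); exact: ltW.
Qed.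

Lemma expectation_cst (c : R) : \int[P]_w c = c.
Proof. by rewrite Rintegral_cst//= [P _]probability_setT mulr1. Qed.

Lemma ler_norm_expectation f M : measurable_fun setT f ->
  (forall w, `|f w| <= M) -> `|\int[P]_w f w| <= M.
Proof.
move=> mf bf; have fi := bounded_integrable mf bf.
apply: (le_trans (le_normr_Rintegral _ fi)) => //.
rewrite -[leRHS](expectation_cst M); apply: le_Rintegral => //.
- exact/integrable_norm.
- by apply: (@bounded_integrable _ `|M|) => //; exact: measurable_cst.
Qed.

Lemma ler_expectation f g Mf Mg : measurable_fun setT f -> measurable_fun setT g ->
  (forall w, `|f w| <= Mf) -> (forall w, `|g w| <= Mg) ->
  (forall w, f w <= g w) -> \int[P]_w f w <= \int[P]_w g w.
Proof.
move=> mf mg bf bg fg.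
by apply: le_Rintegral => //; [exact: bounded_integrable bf|exact: bounded_integrable bg].
Qed.

Lemma expectationD f g Mf Mg : measurable_fun setT f -> measurable_fun setT g ->
  (forall w, `|f w| <= Mf) -> (forall w, `|g w| <= Mg) ->
  \int[P]_w (f w + g w) = \int[P]_w f w + \int[P]_w g w.
Proof.
move=> mf mg bf bg.
by apply: RintegralD => //; [exact: bounded_integrable bf|exact: bounded_integrable bg].
Qed.

Lemma expectationB f g Mf Mg : measurable_fun setT f -> measurable_fun setT g ->
  (forall w, `|f w| <= Mf) -> (forall w, `|g w| <= Mg) ->
  \int[P]_w (f w - g w) = \int[P]_w f w - \int[P]_w g w.
Proof.
move=> mf mg bf bg.
by apply: RintegralB => //; [exact: bounded_integrable bf|exact: bounded_integrable bg].
Qed.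

Lemma expectationZl f c M : measurable_fun setT f -> (forall w, `|f w| <= M) ->
  \int[P]_w (c * f w) = c * \int[P]_w f w.
Proof. by move=> mf bf; apply: RintegralZl => //; exact: bounded_integrable bf. Qed.

Lemma expectation_sum (I : finType) (F : I -> T -> R) (M : R) :
  (forall i, measurable_fun setT (F i)) -> (forall i w, `|F i w| <= M) ->
  \int[P]_w (\sum_i F i w) = \sum_i \int[P]_w F i w.
Proof.
move=> mF bF; rewrite /index_enum; elim: (Finite.enum I) => [|i s IH].
  under eq_Rintegral do rewrite big_nil.
  by rewrite big_nil expectation_cst.
under eq_Rintegral do rewrite big_cons.
rewrite big_cons -IH (@expectationD _ _ M (\sum_(i <- s) M))//.
- by apply: measurable_sum => j.
- move=> w; apply: (le_trans (ler_norm_sum _ _ _)).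
  exact: ler_sum.
Qed.

Lemma expectation_close f g (Mf Mg e : R) : measurable_fun setT f -> measurable_fun setT g ->
  (forall w, `|f w| <= Mf) -> (forall w, `|g w| <= Mg) ->
  (forall w, `|f w - g w| <= e) ->
  `|\int[P]_w f w - \int[P]_w g w| <= e.
Proof.
move=> mf mg bf bg fg; rewrite -(expectationB mf mg bf bg).
by apply: ler_norm_expectation => //; exact: measurable_funB.
Qed.

Lemma eq_ae_expectation f g : measurable_fun setT f -> measurable_fun setT g ->
  {ae P, forall w, f w = g w} -> \int[P]_w f w = \int[P]_w g w.
Proof.
move=> mf mg fg; congr fine; apply: ae_eq_integral => //.
- exact/measurable_EFinP.
- exact/measurable_EFinP.
- by apply: filterS fg => w fgw _; rewrite fgw.
Qed.

Lemma expectation_indic (U : set T) : measurable U ->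
  \int[P]_w (\1_U w : R) = fine (P U).
Proof.
by move=> mU; rewrite /Rintegral integral_indic// setIT.
Qed.

Lemma measurable_cos (X : T -> R) : measurable_fun setT X ->
  measurable_fun setT (fun w => cos (X w)).
Proof.
move=> mX; apply: measurableT_comp mX.
by apply: continuous_measurable_fun; exact: continuous_cos.
Qed.

Lemma measurable_sin (X : T -> R) : measurable_fun setT X ->
  measurable_fun setT (fun w => sin (X w)).
Proof.
move=> mX; apply: measurableT_comp mX.
by apply: continuous_measurable_fun; exact: continuous_sin.
Qed.

Lemma norm_cos_le1 (x : R) : `|cos x| <= 1.
Proof. by rewrite ler_norml cos_geN1 cos_le1. Qed.

Lemma norm_sin_le1 (x : R) : `|sin x| <= 1.
Proof. by rewrite ler_norml sin_geN1 sin_le1. Qed.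

End bounded_expectation.

Section independence.
Context d (T : measurableType d) (R : realType) (P : probability T R).

(* The value of [f] rounded down to a multiple of 1/K, for |f| <= 1. *)
Let level (f : R -> R) (K : nat) (l : nat) : set R :=
  [set x | Num.truncn (K%:R * (f x + 1)) = l].

Let measurable_level (f : R -> R) K l : measurable_fun setT f -> (forall x, `|f x| <= 1) ->
  measurable (level f K l).
Proof.
move=> mf bf; rewrite (_ : level f K l =
    (fun x => K%:R * (f x + 1)) @^-1` `[l%:R, l.+1%:R[%classic).
  have mg : measurable_fun setT (fun x => K%:R * (f x + 1)).
    by apply: measurable_funM => //; apply: measurable_funD.
  by rewrite -[X in measurable X]setTI; exact: mg.
have ge0 x : 0 <= K%:R * (f x + 1).
  by rewrite mulr_ge0//; have := bf x; rewrite ler_norml => /andP[]; lra.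
apply/seteqP; split => [x /= <-|x /=]; rewrite in_itv/=.
- exact: truncn_itv.
- by move=> /andP[h1 h2]; apply: truncn_def; rewrite h1 h2.
Qed.

(** Since [f + 1] lies in [0, 2], the levels 0 to 2K cover all values; the last one is reached where
    [f = 1]. *)
Let step_approx (f : R -> R) (K : nat) (x : R) : (0 < K)%N -> `|f x| <= 1 ->
  `|f x - \sum_(l < (2 * K).+1) ((l%:R - K%:R) / K%:R) * (\1_(level f K l) x)|
  <= K%:R^-1.
Proof.
move=> K0 bf; set y := K%:R * (f x + 1).
have K0' : 0 < K%:R :> R by rewrite ltr0n.
have y0 : 0 <= y.
  by rewrite mulr_ge0//; have := bf; rewrite ler_norml => /andP[]; lra.
have y2 : y <= (2 * K)%:R.
  rewrite /y natrM mulrC ler_pM2r//; have := bf; rewrite ler_norml => /andP[]; lra.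
have lt_l : (Num.truncn y < (2 * K).+1)%N.
  by rewrite truncn_lt_nat// (le_lt_trans y2)// ltr_nat.
rewrite (bigD1 (Ordinal lt_l))//= big1 => [|i ineq]; last first.
  rewrite indicE memNset ?mulr0// /level/= => yi; move/eqP: ineq; apply.
  exact/val_inj.
rewrite addr0 indicE mem_set// mulr1.
have /andP[h1 h2] := truncn_itv y0.
have -> : f x = (y - K%:R) / K%:R by rewrite /y; field; rewrite gt_eqF.
rewrite -mulrBl normrM normfV (ger0_norm (ler0n _ _)).
rewrite ler_pdivrMr// mulVf ?gt_eqF// ler_norml.
by move: h2; rewrite -natr1; lra.
Qed.

(** Induction on the number m of arbitrary factors: from index m on the functions are indicators.
    For m = 0 this is the definition of independence. In the step, the last arbitrary function is
    replaced by a uniformly close step function, and linearity reduces to an indicator in its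
    place. *)
Lemma expectation_prod_mutually_independent n (X : 'I_n -> T -> R)
    (f : 'I_n -> R -> R) :
  (forall i, measurable_fun setT (X i)) -> mutually_independent P X ->
  (forall i, measurable_fun setT (f i)) -> (forall i x, `|f i x| <= 1) ->
  \int[P]_w (\prod_i f i (X i w)) = \prod_i \int[P]_w f i (X i w).
Proof.
move=> mX indX.
have mfX (g : 'I_n -> R -> R) : (forall i, measurable_fun setT (g i)) ->
    forall i, measurable_fun setT (fun w => g i (X i w)).
  by move=> mg i; exact: measurableT_comp (mg i) (mX i).
have bprod (g : 'I_n -> R -> R) : (forall i x, `|g i x| <= 1) ->
    forall (Q : pred 'I_n) w, `|\prod_(i | Q i) g i (X i w)| <= 1.
  by move=> bg Q w; rewrite normr_prod prodr_ile1// => i _; rewrite normr_ge0 bg.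
suff claim m : forall f : 'I_n -> R -> R,
    (forall i, measurable_fun setT (f i)) -> (forall i x, `|f i x| <= 1) ->
    (forall i : 'I_n, (m <= i)%N -> exists2 U : set R, measurable U & f i = \1_U) ->
    \int[P]_w (\prod_i f i (X i w)) = \prod_i \int[P]_w f i (X i w).
  move=> mf bf; apply: (claim n) => // i; by rewrite leqNgt ltn_ord.
elim: m => [|m IH] {}f mf bf indf.
  have {}indf i : exists U, measurable U /\ f i = \1_U.
    by have [//|U mU fU] := indf i; exists U.
  have {indf}[U UP] := choice indf.
  transitivity (\int[P]_w (\1_(\bigcap_(i in [set: 'I_n]) X i @^-1` U i) w : R)).
    apply: eq_Rintegral => w _.
    under eq_bigr do rewrite (UP _).2.
    rewrite indicE; have [/set_mem h|/negP h] := boolP (_ \in _).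
      by rewrite big1// => i _; rewrite indicE mem_set//; exact: h.
    have [i hi] : exists i, ~ U i (X i w).
      by apply/existsNP => h'; apply: h; apply/mem_set => i _; exact: h'.
    by rewrite (bigD1 i)//= indicE memNset// mul0r.
  have mXU i : measurable (X i @^-1` U i).
    by rewrite -[X in measurable X]setTI; apply: mX => //; exact: (UP i).1.
  rewrite expectation_indic; last first.
    by apply: fin_bigcap_measurable => // i _; exact: mXU.
  rewrite indX; last by move=> i; exact: (UP i).1.
  transitivity (\prod_i fine (P (X i @^-1` U i))).
    rewrite /index_enum; elim: (Finite.enum _) => [|i s IHs]; first by rewrite !big_nil.
    rewrite !big_cons fineM ?IHs//; first exact: fin_num_measure.
    by elim/big_ind : _ => // [x y|j _]; [exact: fin_numM|exact: fin_num_measure].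
  apply: eq_bigr => i _; rewrite -expectation_indic//.
  by apply: eq_Rintegral => w _; rewrite (UP i).2 !indicE.
have [mn|nm] := ltnP m n; last first.
  apply: IH => // i mi; exfalso; move: (leq_trans nm mi).
  by rewrite leqNgt ltn_ord.
pose j := Ordinal mn.
pose rho w := \prod_(i | i != j) f i (X i w).
pose c := \prod_(i | i != j) \int[P]_w f i (X i w).
rewrite (bigD1 j)//= -/c.
under eq_Rintegral do rewrite (bigD1 j)//= -/(rho _).
have mrho : measurable_fun setT rho.
  have -> : rho = fun w => \prod_i (if i != j then f i (X i w) else 1).
    by apply/funext => w; rewrite /rho big_mkcond.
  by apply: measurable_prod => i _; case: (i != j) => //; exact: mfX.
have brho w : `|rho w| <= 1 by exact: bprod.
have bc : `|c| <= 1.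
  rewrite normr_prod prodr_ile1// => i _; rewrite normr_ge0/=.
  by apply: ler_norm_expectation => //; exact: mfX.
have indicator U : measurable U ->
    \int[P]_w (\1_U (X j w) * rho w) = (\int[P]_w (\1_U (X j w))) * c.
  move=> mU; pose g (i : 'I_n) : R -> R := if i == j then \1_U else f i.
  have gj : g j = \1_U by rewrite /g eqxx.
  have gN i : i != j -> g i = f i by rewrite /g => /negbTE ->.
  have := IH g; rewrite (bigD1 j)//= gj.
  rewrite (eq_bigr (fun i => \int[P]_w f i (X i w))) => [<-|i ij]; last by rewrite gN.
  - apply: eq_Rintegral => w _; rewrite (bigD1 j)//= gj; congr (_ * _).
    by apply: eq_bigr => i ij; rewrite gN.
  - by move=> i; rewrite /g; case: ifP => // _; exact: measurable_indic.
  - move=> i x; rewrite /g; case: ifP => // _; rewrite indicE.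
    by case: (_ \in _); rewrite ?normr1 ?normr0.
  - move=> i mi; rewrite /g; case: ifP => [_|ij]; first by exists U.
    apply: indf; rewrite ltn_neqAle mi andbT; apply: contraFN ij => /eqP mi'.
    by apply/eqP/val_inj.
apply/eqP; rewrite -subr_eq0 -normr_le0; apply/ler_addgt0Pr => e e0; rewrite add0r.
(* [f j] is replaced by [g] once on each side of the identity, at the cost of [1/K] each time. *)
pose K := (Num.truncn (2 / e)).+1.
have K0 : (0 < K)%N by [].
have Ke : 2 * K%:R^-1 <= e.
  rewrite ler_pdivrMr ?ltr0n// mulrC -ler_pdivrMr//.
  by rewrite ltW// truncnS_gt.
pose a (l : 'I_(2 * K).+1) : R := (l%:R - K%:R) / K%:R.
pose g (x : R) := \sum_(l < (2 * K).+1) a l * (\1_(level (f j) K l) x : R).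
have fg x : `|f j x - g x| <= K%:R^-1 by exact: step_approx.
have mlev l : measurable (level (f j) K l) by exact: measurable_level.
have ba l : `|a l| <= 1.
  rewrite /a normrM normfV (ger0_norm (ler0n _ _)) ler_pdivrMr ?ltr0n// mul1r.
  rewrite ler_norml; have : l%:R <= (2 * K)%:R :> R by rewrite ler_nat -ltnS.
  by rewrite natrM => ?; apply/andP; split; have := ler0n R l; lra.
have b1 U (x : R) : `|\1_U x : R| <= 1.
  by rewrite indicE; case: (_ \in _); rewrite ?normr1 ?normr0.
have mind U : measurable U -> measurable_fun setT (fun w => \1_U (X j w) : R).
  by move=> mU; exact: measurableT_comp (measurable_indic _) (mX j).
have baU l x : `|a l * (\1_(level (f j) K l) x : R)| <= 1.
  by rewrite normrM mulr_ile1// ?ba ?b1.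
have gE : \int[P]_w (g (X j w) * rho w) = (\int[P]_w g (X j w)) * c.
  rewrite /g.
  under eq_Rintegral do rewrite mulr_suml.
  rewrite (@expectation_sum _ _ _ _ _ _ 1); last 2 first.
    by move=> l; apply: measurable_funM => //; apply: measurable_funM => //; exact: mind.
    by move=> l w; rewrite normrM mulr_ile1// ?baU ?brho.
  rewrite (@expectation_sum _ _ _ _ _ _ 1); last 2 first.
    by move=> l; apply: measurable_funM => //; exact: mind.
    by move=> l w; exact: baU.
  rewrite mulr_suml; apply: eq_bigr => l _.
  rewrite (@expectationZl _ _ _ _ _ _ 1); last 2 first.
    exact: mind.
    by move=> w; exact: b1.
  rewrite -mulrA -indicator// -(@expectationZl _ _ _ _ _ _ 1).
  - by apply: eq_Rintegral => w _; rewrite mulrA.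
  - by apply: measurable_funM => //; exact: mind.
  - by move=> w; rewrite normrM mulr_ile1// ?b1 ?brho.
have mg : measurable_fun setT (fun w => g (X j w)).
  rewrite /g; apply: measurable_sum => l.
  by apply: measurable_funM => //; exact: mind.
have Kinv1 : K%:R^-1 <= 1 :> R by rewrite invf_le1 ?ltr0n// ler1n.
have bg x : `|g x| <= 2.
  have := ler_normD (g x - f j x) (f j x); rewrite subrK distrC => /le_trans; apply.
  by have := fg x; have := bf j x; have := Kinv1; lra.
have e1 : `|\int[P]_w (f j (X j w) * rho w) - \int[P]_w (g (X j w) * rho w)| <= K%:R^-1.
  apply: (@expectation_close _ _ _ _ _ _ 1 2).
  - by apply: measurable_funM => //; exact: mfX.
  - exact: measurable_funM.
  - by move=> w; rewrite normrM mulr_ile1.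
  - move=> w; rewrite normrM -[leRHS]mulr1; apply: ler_pM => //.
  - move=> w; rewrite -mulrBl normrM -[leRHS]mulr1; exact: ler_pM.
have e2 : `|\int[P]_w f j (X j w) - \int[P]_w g (X j w)| <= K%:R^-1.
  apply: (@expectation_close _ _ _ _ _ _ 1 2) => //.
  exact: mfX.
have e3 : `|(\int[P]_w f j (X j w)) * c - (\int[P]_w g (X j w)) * c| <= K%:R^-1.
  by rewrite -mulrBl normrM -[leRHS]mulr1; exact: ler_pM.
rewrite gE in e1; have := ler_distD ((\int[P]_w g (X j w)) * c)
  (\int[P]_w (f j (X j w) * rho w)) ((\int[P]_w f j (X j w)) * c).
by move=> /le_trans; apply; rewrite [X in _ + X]distrC; lra.
Qed.

(* [E e^{iX} = rho e^{i theta}]. *)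
Definition polar_charfun (X : T -> R) (rho theta : R) : Prop :=
  \int[P]_w cos (X w) = rho * cos theta /\ \int[P]_w sin (X w) = rho * sin theta.

Lemma polar_charfun_sum n (X : 'I_n -> T -> R) (rho theta : 'I_n -> R) :
  (forall i, measurable_fun setT (X i)) -> mutually_independent P X ->
  (forall i, polar_charfun (X i) (rho i) (theta i)) ->
  polar_charfun (fun w => \sum_i X i w) (\prod_i rho i) (\sum_i theta i).
Proof.
move=> mX indX pX.
suff claim m : (m <= n)%N -> forall f : 'I_n -> R -> R,
    (forall i, measurable_fun setT (f i)) -> (forall i x, `|f i x| <= 1) ->
    \int[P]_w (cos (\sum_(i < n | (i < m)%N) X i w) *
               \prod_(i < n | ~~ (i < m)%N) f i (X i w)) =
      (\prod_(i < n | (i < m)%N) rho i) * cos (\sum_(i < n | (i < m)%N) theta i) *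
      \prod_(i < n | ~~ (i < m)%N) \int[P]_w f i (X i w) /\
    \int[P]_w (sin (\sum_(i < n | (i < m)%N) X i w) *
               \prod_(i < n | ~~ (i < m)%N) f i (X i w)) =
      (\prod_(i < n | (i < m)%N) rho i) * sin (\sum_(i < n | (i < m)%N) theta i) *
      \prod_(i < n | ~~ (i < m)%N) \int[P]_w f i (X i w).
  have all_lt (V : nmodType) (F : 'I_n -> V) : \sum_(i < n | (i < n)%N) F i = \sum_i F i.
    by apply: eq_bigl => i; rewrite ltn_ord.
  have no_ge (F : 'I_n -> R) : \prod_(i < n | ~~ (i < n)%N) F i = 1.
    by apply: big_pred0 => i; rewrite ltn_ord.
  have all_lt' (F : 'I_n -> R) : \prod_(i < n | (i < n)%N) F i = \prod_i F i.
    by apply: eq_bigl => i; rewrite ltn_ord.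
  have [||h1 h2] := claim n (leqnn n) (fun _ _ => 1).
  - by move=> i; exact: measurable_cst.
  - by move=> i x; rewrite normr1.
  rewrite all_lt all_lt' !no_ge mulr1 in h1; rewrite all_lt all_lt' !no_ge mulr1 in h2.
  split; [rewrite -h1|rewrite -h2]; apply: eq_Rintegral => w _;
    by rewrite mulr1 all_lt.
elim: m => [_ f mf bf|m IH mn f mf bf].
  have s0 (V : nmodType) (F : 'I_n -> V) : \sum_(i < n | (i < 0)%N) F i = 0.
    by apply: big_pred0 => i; rewrite ltn0.
  have p0 (F : 'I_n -> R) : \prod_(i < n | (i < 0)%N) F i = 1.
    by apply: big_pred0 => i; rewrite ltn0.
  have pall (F : 'I_n -> R) : \prod_(i < n | ~~ (i < 0)%N) F i = \prod_i F i.
    by apply: eq_bigl => i; rewrite ltn0.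
  rewrite s0 p0 cos0 sin0 !mul1r mul0r pall; split.
    rewrite -expectation_prod_mutually_independent//.
    by apply: eq_Rintegral => w _; rewrite s0 cos0 mul1r pall.
  under eq_Rintegral do rewrite s0 sin0 mul0r.
  by rewrite expectation_cst.
pose j := Ordinal mn.
have sumS (V : nmodType) (F : 'I_n -> V) : \sum_(i < n | (i < m.+1)%N) F i =
    F j + \sum_(i < n | (i < m)%N) F i.
  rewrite (bigD1 j)/= ?ltnS//; congr (_ + _); apply: eq_bigl => i.
  rewrite ltnS leq_eqVlt -(inj_eq val_inj)/= andb_orl andbN/=.
  by case: ltngtP.
have prodS (F : 'I_n -> R) : \prod_(i < n | (i < m.+1)%N) F i =
    F j * \prod_(i < n | (i < m)%N) F i.
  rewrite (bigD1 j)/= ?ltnS//; congr (_ * _); apply: eq_bigl => i.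
  rewrite ltnS leq_eqVlt -(inj_eq val_inj)/= andb_orl andbN/=.
  by case: ltngtP.
have prodN (F : 'I_n -> R) : \prod_(i < n | ~~ (i < m)%N) F i =
    F j * \prod_(i < n | ~~ (i < m.+1)%N) F i.
  rewrite (bigD1 j)/= ?ltnn//; congr (_ * _); apply: eq_bigl => i.
  by rewrite -(inj_eq val_inj)/= -!leqNgt ltn_neqAle andbC eq_sym.
have mn' := ltnW mn.
(* [fc h] puts [h] in the place of the function of the variable about to be absorbed. *)
pose fc h i := if i == j then h else f i.
have mfc h : measurable_fun setT h -> forall i, measurable_fun setT (fc h i).
  by move=> mh i; rewrite /fc; case: ifP.
have bfc h : (forall x, `|h x| <= 1) -> forall i x, `|fc h i x| <= 1.
  by move=> bh i x; rewrite /fc; case: ifP.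
have fcE (h : R -> R) w :
    \prod_(i < n | ~~ (i < m)%N) fc h i (X i w) =
    h (X j w) * \prod_(i < n | ~~ (i < m.+1)%N) f i (X i w).
  rewrite prodN {1}/fc eqxx; congr (_ * _); apply: eq_bigr => i im.
  by rewrite /fc ifN//; apply: contra im => /eqP ->.
have fcE' (h : R -> R) :
    \prod_(i < n | ~~ (i < m)%N) \int[P]_w fc h i (X i w) =
    (\int[P]_w h (X j w)) * \prod_(i < n | ~~ (i < m.+1)%N) \int[P]_w f i (X i w).
  rewrite prodN {1}/fc eqxx; congr (_ * _); apply: eq_bigr => i im.
  by rewrite /fc ifN//; apply: contra im => /eqP ->.
have mcos : measurable_fun setT (@cos R) by exact: measurable_cos.
have msin : measurable_fun setT (@sin R) by exact: measurable_sin.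
have [Ccc Csc] := IH mn' (fc cos) (mfc _ mcos) (bfc _ (@norm_cos_le1 R)).
have [Ccs Css] := IH mn' (fc sin) (mfc _ msin) (bfc _ (@norm_sin_le1 R)).
have fcI (g h : R -> R) :
    \int[P]_w (g (\sum_(i < n | (i < m)%N) X i w) *
      \prod_(i < n | ~~ (i < m)%N) fc h i (X i w)) =
    \int[P]_w (g (\sum_(i < n | (i < m)%N) X i w) *
      (h (X j w) * \prod_(i < n | ~~ (i < m.+1)%N) f i (X i w))).
  by apply: eq_Rintegral => w _; rewrite fcE.
rewrite !fcE' !fcI in Ccc Csc Ccs Css.
have [pc ps] := pX j; rewrite pc in Ccc Csc; rewrite ps in Ccs Css.
have mS : measurable_fun setT (fun w => \sum_(i < n | (i < m)%N) X i w).
  under eq_fun do rewrite big_mkcond/=.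
  by apply: measurable_sum => i; case: (_ < _)%N.
have mfp : measurable_fun setT (fun w => \prod_(i < n | ~~ (i < m.+1)%N) f i (X i w)).
  under eq_fun do rewrite big_mkcond/=.
  by apply: measurable_prod => i _; case: (~~ _) => //; exact: measurableT_comp (mf i) (mX i).
have bfp w : `|\prod_(i < n | ~~ (i < m.+1)%N) f i (X i w)| <= 1.
  by rewrite normr_prod prodr_ile1// => i _; rewrite normr_ge0 bf.
have mt (g h : R -> R) : measurable_fun setT g -> measurable_fun setT h ->
    measurable_fun setT (fun w => g (\sum_(i < n | (i < m)%N) X i w) *
      (h (X j w) * \prod_(i < n | ~~ (i < m.+1)%N) f i (X i w))).
  move=> mg mh; apply: measurable_funM; first exact: measurableT_comp mg mS.
  by apply: measurable_funM => //; exact: measurableT_comp mh (mX j).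
have bt (g h : R -> R) : (forall x, `|g x| <= 1) -> (forall x, `|h x| <= 1) ->
    forall w, `|g (\sum_(i < n | (i < m)%N) X i w) *
      (h (X j w) * \prod_(i < n | ~~ (i < m.+1)%N) f i (X i w))| <= 1.
  by move=> bg bh w; rewrite !normrM !mulr_ile1// mulr_ge0.
split.
  rewrite prodS sumS cosD.
  rewrite [RHS](_ : _ = (\prod_(i < n | (i < m)%N) rho i) *
      cos (\sum_(i < n | (i < m)%N) theta i) *
      ((rho j * cos (theta j)) * \prod_(i < n | ~~ (i < m.+1)%N) \int[P]_w f i (X i w)) -
    (\prod_(i < n | (i < m)%N) rho i) *
      sin (\sum_(i < n | (i < m)%N) theta i) *
      ((rho j * sin (theta j)) * \prod_(i < n | ~~ (i < m.+1)%N) \int[P]_w f i (X i w)));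
    last by ring.
  rewrite -Ccc -Css.
  rewrite -(@expectationB _ _ _ _ _ _ 1 1)//.
  - apply: eq_Rintegral => w _; rewrite sumS cosD; ring.
  - exact: mt.
  - exact: mt.
  - by apply: bt; [exact: norm_cos_le1|exact: norm_cos_le1].
  - by apply: bt; [exact: norm_sin_le1|exact: norm_sin_le1].
rewrite prodS sumS sinD.
rewrite [RHS](_ : _ = (\prod_(i < n | (i < m)%N) rho i) *
      cos (\sum_(i < n | (i < m)%N) theta i) *
      ((rho j * sin (theta j)) * \prod_(i < n | ~~ (i < m.+1)%N) \int[P]_w f i (X i w)) +
    (\prod_(i < n | (i < m)%N) rho i) *
      sin (\sum_(i < n | (i < m)%N) theta i) *
      ((rho j * cos (theta j)) * \prod_(i < n | ~~ (i < m.+1)%N) \int[P]_w f i (X i w)));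
    last by ring.
rewrite -Ccs -Csc.
rewrite -(@expectationD _ _ _ _ _ _ 1 1)//.
- apply: eq_Rintegral => w _; rewrite sumS sinD; ring.
- exact: mt.
- exact: mt.
- by apply: bt; [exact: norm_cos_le1|exact: norm_sin_le1].
- by apply: bt; [exact: norm_sin_le1|exact: norm_cos_le1].
Qed.

End independence.

(** * Asymptotics of Levy exponents *)

(* [is_derive] outside the type class mechanism, so that the rules below are
   chosen by the shape of the function only. *)
Definition has_derivative (R : realType) (f : R -> R) (x a : R) := is_derive x 1 f a.

Section derivation_rules.
Context (R : realType).
Implicit Types (f g : R -> R) (x a b c : R).

Lemma has_derivativeP f x a b : has_derivative f x a -> a = b -> is_derive x 1 f b.
Proof. by move=> + <-. Qed.

Lemma has_derivative_cst c x : has_derivative (fun=> c) x 0.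
Proof. exact: is_derive_cst. Qed.

Lemma has_derivative_id x : has_derivative (fun t => t) x 1.
Proof. exact: is_derive_id. Qed.

Lemma has_derivativeD f g x a b : has_derivative f x a -> has_derivative g x b ->
  has_derivative (fun t => f t + g t) x (a + b).
Proof. by move=> fa gb; exact: is_deriveD. Qed.

Lemma has_derivativeN f x a : has_derivative f x a ->
  has_derivative (fun t => - f t) x (- a).
Proof. by move=> fa; exact: is_deriveN. Qed.

Lemma has_derivativeM f g x a b : has_derivative f x a -> has_derivative g x b ->
  has_derivative (fun t => f t * g t) x (f x * b + g x * a).
Proof. by move=> fa gb; exact: is_deriveM. Qed.

Lemma has_derivative_cos f x a : has_derivative f x a ->
  has_derivative (fun t => cos (f t)) x (- sin (f x) * a).
Proof. by move=> fa; exact: (@is_derive1_comp _ cos f). Qed.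

Lemma has_derivative_sin f x a : has_derivative f x a ->
  has_derivative (fun t => sin (f t)) x (cos (f x) * a).
Proof. by move=> fa; exact: (@is_derive1_comp _ sin f). Qed.

Lemma has_derivative_expR f x a : has_derivative f x a ->
  has_derivative (fun t => expR (f t)) x (expR (f x) * a).
Proof. by move=> fa; exact: (@is_derive1_comp _ expR f). Qed.

Lemma has_derivative_powR c x : 0 < x ->
  has_derivative (fun t => t `^ c) x (c * x `^ (c - 1)).
Proof. exact: is_derive1_powR. Qed.

End derivation_rules.

Ltac derive_rules :=
  lazymatch goal with
  | |- has_derivative (fun=> ?c) _ _ => exact (has_derivative_cst c _)
  | |- has_derivative (fun t => t) _ _ => exact (has_derivative_id _)
  | |- has_derivative (fun t => @GRing.add _ (@?f t) (@?g t)) _ _ =>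
      refine (@has_derivativeD _ f g _ _ _ _ _); derive_rules
  | |- has_derivative (fun t => @GRing.opp _ (@?f t)) _ _ =>
      refine (@has_derivativeN _ f _ _ _); derive_rules
  | |- has_derivative (fun t => @GRing.mul _ (@?f t) (@?g t)) _ _ =>
      refine (@has_derivativeM _ f g _ _ _ _ _); derive_rules
  | |- has_derivative (fun t => cos (@?f t)) _ _ =>
      refine (@has_derivative_cos _ f _ _ _); derive_rules
  | |- has_derivative (fun t => sin (@?f t)) _ _ =>
      refine (@has_derivative_sin _ f _ _ _); derive_rules
  | |- has_derivative (fun t => expR (@?f t)) _ _ =>
      refine (@has_derivative_expR _ f _ _ _); derive_rules
  | |- has_derivative (fun t => t `^ ?c) _ _ => refine (@has_derivative_powR _ c _ _)
  | |- _ => idtac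
  end.
(** The goals left are first the positivity conditions of the powers, then the equality of the
    computed derivative with the wanted one; when the latter is still to be chosen, [reflexivity]
    chooses it. *)
Ltac derive_by := refine (has_derivativeP _ _); [derive_rules|cbv beta].

Lemma cvg_sumr (R : realType) (T I : Type) (F : set_system T) (s : seq I)
    (f : I -> T -> R) (a : I -> R) : Filter F ->
  (forall i, f i x @[x --> F] --> a i) ->
  \sum_(i <- s) f i x @[x --> F] --> \sum_(i <- s) a i.
Proof.
move=> FF fa; elim: s => [|i s IH].
  by under eq_fun do rewrite big_nil; rewrite big_nil; exact: cvg_cst.
by under eq_fun do rewrite big_cons; rewrite big_cons; apply: cvgD.
Qed.

(** * Mean value estimates and elementary inequalities *)

Section calculus.
Context (R : realType).
Implicit Types (f g F : R -> R) (x a b c : R).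

Lemma is_derive_continuous f x a : is_derive x 1 f a -> {for x, continuous f}.
Proof.
by move=> [df _]; apply: differentiable_continuous; exact/derivable1_diffP.
Qed.

Lemma is_derive_within_continuous f f' a b :
  (forall x, a <= x <= b -> is_derive x 1 f (f' x)) ->
  {within `[a, b], continuous f}.
Proof.
move=> df; apply: continuous_in_subspaceT => x /set_mem /=.
by rewrite in_itv/= => xab; exact: is_derive_continuous (df _ xab).
Qed.

Lemma derive_within_continuous f a b :
  (forall x, a <= x <= b -> exists l, is_derive x 1 f l) ->
  {within `[a, b], continuous f}.
Proof.
move=> df; apply: continuous_in_subspaceT => x /set_mem /=.
by rewrite in_itv/= => /df[l]; exact: is_derive_continuous.
Qed.

Lemma nonneg_derive_nondecreasing f f' a : (forall x, a <= x -> is_derive x 1 f (f' x)) ->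
  (forall x, a <= x -> 0 <= f' x) -> forall x, a <= x -> f a <= f x.
Proof.
move=> df f'0 x; rewrite le_eqVlt => /predU1P[-> //|ax].
have [||] := @MVT _ f f' a x ax.
- by move=> y; rewrite in_itv/= => /andP[ay yx]; apply: df; exact: ltW.
- by apply: is_derive_within_continuous => y /andP[ay _]; exact: df.
- move=> c; rewrite in_itv/= => /andP[ac cx] fE.
  by rewrite -subr_ge0 fE mulr_ge0// ?f'0 ?subr_ge0// ltW.
Qed.

Lemma mean_value_bound f f' a b c e : a <= b ->
  (forall x, a <= x <= b -> is_derive x 1 f (f' x)) ->
  (forall x, a <= x <= b -> `|f' x - c| <= e) ->
  `|f b - f a - c * (b - a)| <= e * (b - a).
Proof.
rewrite le_eqVlt => /predU1P[-> _ _|ab df f'c].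
  by rewrite !subrr !mulr0 subrr normr0.
have [||] := @MVT _ f f' a b ab.
- by move=> y; rewrite in_itv/= => /andP[ay yx]; apply: df; rewrite !ltW.
- exact: is_derive_within_continuous df.
- move=> d; rewrite in_itv/= => /andP[ad db] ->.
  rewrite -mulrBl normrM [X in _ * X]ger0_norm; last by rewrite subr_ge0 ltW.
  apply: ler_wpM2r; first by rewrite subr_ge0 ltW.
  by apply: f'c; rewrite !ltW.
Qed.

Lemma continuous_itv_integrable f a b : {within `[a, b], continuous f} ->
  (@lebesgue_measure R).-integrable `[a, b] (EFin \o f).
Proof. by move=> cf; apply: continuous_compact_integrable => //; exact: segment_compact. Qed.

Lemma Rintegral_FTC2 F f a b : a <= b ->
  (forall x, a <= x <= b -> is_derive x 1 F (f x)) ->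
  {within `[a, b], continuous f} ->
  \int[lebesgue_measure]_(x in `[a, b]) f x = F b - F a.
Proof.
rewrite le_eqVlt => /predU1P[-> _ _|ab dF cf].
  by rewrite set_itv1 Rintegral_set1 subrr.
rewrite /Rintegral (@continuous_FTC2 _ _ F)//.
- split.
  + by move=> x; rewrite in_itv/= => /andP[ax xb]; have [] := dF x; rewrite ?ltW.
  + have h : a <= a <= b by rewrite lexx ltW.
    by have /cvg_at_right_filter := is_derive_continuous (dF _ h).
  + have h : a <= b <= b by rewrite lexx ltW.
    by have /cvg_at_left_filter := is_derive_continuous (dF _ h).
- move=> x; rewrite in_itv/= => /andP[ax xb].
  by rewrite derive1E; have [] := dF x; rewrite ?ltW.
Qed.

(** This bound and the next two follow from one another by comparing derivatives, starting from
    [1 - cos >= 0]. The upper bound on [expR (- x)] below is obtained in the same way from the lower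
    one. *)
Lemma sin_le x : 0 <= x -> sin x <= x.
Proof.
move=> x0; rewrite -subr_ge0.
have := @nonneg_derive_nondecreasing (fun t => t - sin t) (fun t => 1 - cos t) 0.
rewrite sin0 subrr => h; by apply: (h _ _ x x0) => y _; rewrite subr_ge0 cos_le1.
Qed.

Lemma one_sub_cos_le x : 1 - cos x <= x ^+ 2 / 2.
Proof.
wlog x0 : x / 0 <= x => [h|].
  by have [/h//|x0] := leP 0 x; rewrite -cosN -sqrrN; apply: h; rewrite oppr_ge0 ltW.
rewrite -subr_ge0.
have := @nonneg_derive_nondecreasing (fun t => t * t / 2 - (1 - cos t)) (fun t => t - sin t) 0.
rewrite cos0 subrr mulr0 mul0r subrr expr2; apply; last exact: x0.
- by move=> y _; derive_by; field.
- by move=> y y0; rewrite subr_ge0 sin_le.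
Qed.

Lemma sub_sin_le x : 0 <= x -> x - sin x <= x ^+ 3 / 6.
Proof.
move=> x0; rewrite -subr_ge0.
have := @nonneg_derive_nondecreasing (fun t => t * t * t / 6 - (t - sin t))
  (fun t => t ^+ 2 / 2 - (1 - cos t)) 0.
rewrite sin0 subrr mulr0 mul0r subrr (_ : x ^+ 3 = x * x * x); last by ring.
apply; last exact: x0.
- by move=> y _; derive_by; field.
- by move=> y y0; rewrite subr_ge0 one_sub_cos_le.
Qed.

Lemma norm_sin_le x : `|sin x| <= `|x|.
Proof.
wlog x0 : x / 0 <= x => [h|].
  have [/h//|x0] := leP 0 x; rewrite -normrN -sinN -[leRHS]normrN.
  by apply: h; rewrite oppr_ge0 ltW.
rewrite (ger0_norm x0) ler_norml sin_le// andbT.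
rewrite lerNl.
have := @nonneg_derive_nondecreasing (fun t => t + sin t) (fun t => 1 + cos t) 0.
rewrite sin0 addr0 => h; rewrite -subr_ge0 opprK; apply: (h _ _ x x0) => y _.
by have := cos_geN1 y; lra.
Qed.

Lemma expRN_ge x : 1 - x <= expR (- x).
Proof. exact: expR_ge1Dx. Qed.

Lemma expRN_le x : 0 <= x -> expR (- x) <= 1 - x + x ^+ 2 / 2.
Proof.
move=> x0; rewrite -subr_ge0.
have := @nonneg_derive_nondecreasing (fun t => 1 - t + t * t / 2 - expR (- t))
  (fun t => - 1 + t + expR (- t)) 0.
rewrite oppr0 expR0 mulr0 mul0r !addr0 subrr expr2; apply; last exact: x0.
- by move=> y _; derive_by; field.
- by move=> y y0; have := expRN_ge y; lra.
Qed.

Lemma expRN_le1 x : 0 <= x -> expR (- x) <= 1.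
Proof. by move=> x0; rewrite -expR0 ler_expR oppr_le0. Qed.

End calculus.

Section norm_bounds.
Context (R : numDomainType).
Implicit Types a b A B : R.

Lemma ler_normD_bound a b A B : `|a| <= A -> `|b| <= B -> `|a + b| <= A + B.
Proof. by move=> aA bB; rewrite (le_trans (ler_normD _ _))// lerD. Qed.

Lemma ler_normB_bound a b A B : `|a| <= A -> `|b| <= B -> `|a - b| <= A + B.
Proof. by move=> aA bB; rewrite (le_trans (ler_normB _ _))// lerD. Qed.

Lemma ler_normN_bound a A : `|a| <= A -> `|- a| <= A.
Proof. by rewrite normrN. Qed.

Lemma ler_normM_bound a b A B : `|a| <= A -> `|b| <= B -> `|a * b| <= A * B.
Proof. by move=> aA bB; rewrite normrM ler_pM. Qed.

End norm_bounds.

(** * Rotation of the contour, in real terms *)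

Section contour_rotation.
Context (R : realType) (beta kappa delta M : R).
Hypotheses (beta0 : 0 < beta) (kappa0 : 0 <= kappa) (delta0 : 0 < delta) (deltaM : delta <= M).

(* Real and imaginary parts of [k(z) = 1 - e^{-z} - kappa z] at [z = y e^{i phi}]. *)
Let p (y phi : R) : R := 1 - expR (- (y * cos phi)) * cos (y * sin phi) - kappa * (y * cos phi).
Let q (y phi : R) : R := expR (- (y * cos phi)) * sin (y * sin phi) - kappa * (y * sin phi).
Let theta (phi : R) : R := beta * (pi / 2 - phi).

(* Real and imaginary parts of [e^{i beta (pi/2 - phi)} k(y e^{i phi})]. *)
Let g (y phi : R) : R := p y phi * cos (theta phi) - q y phi * sin (theta phi).
Let h (y phi : R) : R := p y phi * sin (theta phi) + q y phi * cos (theta phi).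

(** [pphi], [qphi] and [gphi] are the derivatives of [p], [q] and [g] in [phi], written out so that
    the Cauchy-Riemann identity below can be checked by [ring]. *)
Let pphi (y phi : R) : R := expR (- (y * cos phi)) *
  (y * cos phi * sin (y * sin phi) - y * sin phi * cos (y * sin phi)) + kappa * (y * sin phi).
Let qphi (y phi : R) : R := expR (- (y * cos phi)) *
  (y * sin phi * sin (y * sin phi) + y * cos phi * cos (y * sin phi)) - kappa * (y * cos phi).
Let gphi (y phi : R) : R := pphi y phi * cos (theta phi) - qphi y phi * sin (theta phi)
  + beta * (p y phi * sin (theta phi) + q y phi * cos (theta phi)).

Let g_derive (y phi : R) : is_derive phi 1 (g y) (gphi y phi).
Proof.
rewrite /gphi /g /pphi /qphi /p /q /theta; derive_by; ring.
Qed.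

Let powRS (y c : R) : 0 < y -> y `^ (c + 1) = y * y `^ c.
Proof.
move=> y0; rewrite powRD; last by rewrite (gt_eqF y0) implybT.
by rewrite powRr1 ?ltW// mulrC.
Qed.

(* Cauchy-Riemann: [d/dphi (w F(y w)) = i d/dy (y w F(y w))] for [w = e^{i phi}]
   and [F(z) = k(z) z^{-1-beta}]. *)
Let h_derive (y phi : R) : 0 < y ->
  is_derive y 1 (fun y : R => - (h y phi * y `^ (- beta))) (gphi y phi * y `^ (- 1 - beta)).
Proof.
move=> y0; rewrite /gphi /h /pphi /qphi /p /q; derive_by; first exact: y0.
have -> : y `^ (- beta) = y * y `^ (- 1 - beta).
  by rewrite -powRS//; congr (_ `^ _); ring.
have -> : - beta - 1 = - 1 - beta by ring.
ring.
Qed.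

Let gpow_continuous (phi : R) : {within `[delta, M], continuous (fun y : R => g y phi * y `^ (- 1 - beta))}.
Proof.
apply: derive_within_continuous => y /andP[dy _].
have y0 : 0 < y by exact: lt_le_trans dy.
by eexists; rewrite /g /p /q; derive_by; [exact: y0|reflexivity].
Qed.

Let gphipow_continuous (phi : R) :
  {within `[delta, M], continuous (fun y : R => gphi y phi * y `^ (- 1 - beta))}.
Proof.
apply: derive_within_continuous => y /andP[dy _].
have y0 : 0 < y by exact: lt_le_trans dy.
by eexists; rewrite /gphi /pphi /qphi /p /q; derive_by; [exact: y0|reflexivity].
Qed.

Let pow_continuous : {within `[delta, M], continuous (fun y : R => y `^ (- 1 - beta))}.
Proof.
apply: (@is_derive_within_continuous _ _ (fun y => (- 1 - beta) * y `^ (- 1 - beta - 1))).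
move=> y /andP[dy _].
have y0 : 0 < y by exact: lt_le_trans dy.
by derive_by; [exact: y0|].
Qed.

(** Crude but uniform in the angle: it provides the domination for differentiating under the
    integral sign. *)
Let gphi_bound (y phi : R) : 0 <= y <= M ->
  `|gphi y phi| <= (expR M * (M + M) + kappa * M) + (expR M * (M + M) + kappa * M)
    + beta * ((1 + expR M + kappa * M) + (expR M + kappa * M)).
Proof.
move=> /andP[y0 yM].
have M0 : 0 <= M by exact: le_trans yM.
have c1 := @norm_cos_le1 R; have s1 := @norm_sin_le1 R.
have yc : `|y * cos phi| <= M by rewrite -[M]mulr1; apply: ler_normM_bound => //; rewrite ger0_norm.
have ys : `|y * sin phi| <= M by rewrite -[M]mulr1; apply: ler_normM_bound => //; rewrite ger0_norm.
have e1 : `|expR (- (y * cos phi))| <= expR M.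
  rewrite ger0_norm ?expR_ge0// ler_expR.
  by move: yc; rewrite ler_norml => /andP[]; lra.
have k1 : `|kappa| <= kappa by rewrite ger0_norm.
have b1 : `|beta| <= beta by rewrite gtr0_norm.
have M1 (a b : R) : `|a| <= M -> `|b| <= 1 -> `|a * b| <= M.
  by move=> aM bb; rewrite -[M]mulr1; exact: ler_normM_bound.
have E1 (a b : R) : `|a| <= expR M -> `|b| <= 1 -> `|a * b| <= expR M.
  by move=> aM bb; rewrite -[expR M]mulr1; exact: ler_normM_bound.
have T1 (a b A : R) : `|a| <= A -> `|b| <= 1 -> `|a * b| <= A.
  by move=> aA b1'; rewrite -[A]mulr1; exact: ler_normM_bound.
have one1 : `|1 : R| <= 1 by rewrite normr1.
have kc : `|kappa * (y * cos phi)| <= kappa * M by exact: ler_normM_bound.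
have ks : `|kappa * (y * sin phi)| <= kappa * M by exact: ler_normM_bound.
have pb : `|p y phi| <= 1 + expR M + kappa * M.
  by apply: ler_normB_bound => //; apply: ler_normB_bound => //; exact: E1.
have qb : `|q y phi| <= expR M + kappa * M.
  by apply: ler_normB_bound => //; exact: E1.
apply: ler_normD_bound; last first.
  by apply: ler_normM_bound => //; apply: ler_normD_bound; exact: T1.
apply: ler_normB_bound.
  apply: T1 => //; apply: ler_normD_bound => //; apply: ler_normM_bound => //.
  by apply: ler_normB_bound; exact: M1.
apply: T1 => //; apply: ler_normB_bound => //; apply: ler_normM_bound => //.
by apply: ler_normD_bound; exact: M1.
Qed.

Let G (phi : R) : R := \int[lebesgue_measure]_(y in `[delta, M]) (g y phi * y `^ (- 1 - beta)).

(** The derivative of the integrand in [phi] is a derivative in [y], so that only the end points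
    [delta] and [M], that is the two arcs of the contour, contribute. *)
Let G_derive (phi : R) : 0 <= phi <= pi / 2 ->
  is_derive phi 1 G (h delta phi * delta `^ (- beta) - h M phi * M `^ (- beta)).
Proof.
move=> /andP[phi0 phi1].
pose f (phi y : R) := g y phi * y `^ (- 1 - beta).
have df (x y : R) : is_derive x 1 (f ^~ y) (gphi y x * y `^ (- 1 - beta)).
  rewrite /f; apply: (has_derivativeP (a := g y x * 0 + y `^ (- 1 - beta) * gphi y x)); last by ring.
  by apply: has_derivativeM; [exact: g_derive|exact: has_derivative_cst].
have p1E (x y : R) : partial1of2 f x y = gphi y x * y `^ (- 1 - beta).
  by rewrite partial1of2E; have [_ ->] := df x y.
pose B := (expR M * (M + M) + kappa * M) + (expR M * (M + M) + kappa * M)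
    + beta * ((1 + expR M + kappa * M) + (expR M + kappa * M)).
have M0 : 0 <= M by exact: le_trans (ltW delta0) deltaM.
have B0 : 0 <= B.
  have := @gphi_bound 0 0; rewrite lexx M0 => /(_ isT); exact: le_trans.
have Iphi : `] (- 1), 2[%classic phi.
  rewrite /= in_itv/=; have := @pihalf_lt2 R; lra.
have intf (x : R) : `](- 1), 2[%classic x ->
    lebesgue_measure.-integrable `[delta, M] (EFin \o f x).
  by move=> _; apply: continuous_itv_integrable; exact: gpow_continuous.
have derf (x y : R) : `](- 1), 2[%classic x -> `[delta, M]%classic y -> derivable (f ^~ y) x 1.
  by move=> _ _; have [] := df x y.
have dom0 (y : R) : 0 <= B * y `^ (- 1 - beta) by rewrite mulr_ge0// powR_ge0.
have intdom : lebesgue_measure.-integrable `[delta, M]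
    (EFin \o (fun y => B * y `^ (- 1 - beta))).
  apply: continuous_itv_integrable.
  by move=> y; apply: cvgM; [exact: cvg_cst|exact: pow_continuous].
have fdom (x y : R) : `](- 1), 2[%classic x -> `[delta, M]%classic y ->
    `|partial1of2 f x y| <= B * y `^ (- 1 - beta).
  move=> _; rewrite /= in_itv/= => /andP[dy yM]; rewrite p1E normrM.
  rewrite [X in _ * X]ger0_norm ?powR_ge0// ler_wpM2r ?powR_ge0// gphi_bound//.
  by rewrite yM andbT (le_trans (ltW delta0)).
have dG : derivable G phi 1.
  by apply: (derivable_under_integral _ Iphi intf derf dom0 intdom fdom).
have : G^`()%classic phi = \int[lebesgue_measure]_(y in `[delta, M]) partial1of2 f phi y.
  by apply: (differentiation_under_integral _ Iphi intf derf dom0 intdom fdom).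
rewrite derive1E => dGE.
apply: DeriveDef => //; rewrite dGE.
rewrite (_ : (fun _ => _) = fun y => gphi y phi * y `^ (- 1 - beta)); last first.
  by apply/funext => y; exact: p1E.
have hd y : delta <= y <= M -> is_derive y 1 (fun y : R => - (h y phi * y `^ (- beta)))
    (gphi y phi * y `^ (- 1 - beta)).
  by move=> /andP[dy _]; apply: h_derive; exact: lt_le_trans dy.
by have := Rintegral_FTC2 deltaM hd (@gphipow_continuous phi) => ->; ring.
Qed.

(** This is Cauchy's theorem on the sector delta <= |z| <= M, 0 <= arg z <= pi/2, for the function
    e^(i beta pi/2) k(z) z^(-1-beta). [G phi] is the real part of its integral along the ray of
    angle [phi]: at [pi/2] the kernel becomes [1 - cos y], at 0 the factor [cos (beta pi/2)] comes
    out. The hypothesis says that the arcs contribute [c] up to [e] per unit of angle. It is applied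
    with [c = 0], except for [beta = 1], where [c = 1]. *)
Lemma contour_rotation (c e : R) :
  (forall phi, 0 <= phi <= pi / 2 ->
    `|(p delta phi * sin (theta phi) + q delta phi * cos (theta phi)) * delta `^ (- beta)
      - (p M phi * sin (theta phi) + q M phi * cos (theta phi)) * M `^ (- beta) - c| <= e) ->
  `|\int[lebesgue_measure]_(y in `[delta, M]) ((1 - cos y) * y `^ (- 1 - beta))
    - cos (beta * (pi / 2)) *
      \int[lebesgue_measure]_(y in `[delta, M]) ((1 - expR (- y) - kappa * y) * y `^ (- 1 - beta))
    - c * (pi / 2)| <= e * (pi / 2).
Proof.
move=> hbd.
have pi0 : 0 <= (pi : R) / 2 by rewrite divr_ge0// pi_ge0.
have := @mean_value_bound R G _ 0 (pi / 2) c e pi0 G_derive hbd.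
rewrite subr0.
have -> : G (pi / 2) = \int[lebesgue_measure]_(y in `[delta, M]) ((1 - cos y) * y `^ (- 1 - beta)).
  rewrite /G; apply: eq_Rintegral => y _; rewrite /g /p /q /theta subrr mulr0 cos0 sin0.
  rewrite cos_pihalf sin_pihalf !mulr0 oppr0 expR0 ?mulr1; ring.
suff -> : G 0 = cos (beta * (pi / 2)) *
    \int[lebesgue_measure]_(y in `[delta, M]) ((1 - expR (- y) - kappa * y) * y `^ (- 1 - beta)) by [].
  rewrite /G -RintegralZl//.
  + apply: eq_Rintegral => y _; rewrite /g /p /q /theta subr0 cos0 sin0.
    by rewrite !mulr0 sin0 cos0 !mulr1 mulr0 subr0 mul0r subr0; ring.
  + apply: continuous_itv_integrable.
    apply: derive_within_continuous => y /andP[dy _].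
    have y0 : 0 < y by exact: lt_le_trans dy.
    by eexists; derive_by; [exact: y0|reflexivity].
Qed.

End contour_rotation.

(** * The integral of (1 - cos y) y^(-1-beta) over the half-line *)

Section one_sub_cos_integral.
Context (R : realType).
Implicit Types (beta delta y c s : R).

(** Here and in the next two bounds [c] and [s] stand for the cosine and the sine of an angle in
    [0, pi/2]. Removing the linear term makes the kernel quadratic at 0. *)
Let kernel_bound1 y c s : 0 <= y -> 0 <= c <= 1 -> 0 <= s <= 1 ->
  `|1 - expR (- (y * c)) * cos (y * s) - y * c| <= y ^+ 2 /\
  `|expR (- (y * c)) * sin (y * s) - y * s| <= 2 * y ^+ 2.
Proof.
move=> y0 /andP[c0 c1] /andP[s0 s1].
have yc0 : 0 <= y * c by exact: mulr_ge0.
have ys0 : 0 <= y * s by exact: mulr_ge0.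
have ycy : y * c <= y by rewrite -[leRHS]mulr1 ler_wpM2l.
have ysy : y * s <= y by rewrite -[leRHS]mulr1 ler_wpM2l.
have yc2 : (y * c) ^+ 2 <= y ^+ 2 by rewrite lerXn2r// nnegrE.
have ys2 : (y * s) ^+ 2 <= y ^+ 2 by rewrite lerXn2r// nnegrE.
have e0 := expR_ge0 (- (y * c)); have e1 := expRN_le1 yc0.
have e2 := expRN_ge (y * c); have e3 := expRN_le yc0.
have c2 := one_sub_cos_le (y * s); have c3 := cos_le1 (y * s).
split.
  have A : 0 <= expR (- (y * c)) * (1 - cos (y * s)) <= y ^+ 2 / 2.
    apply/andP; split; first by rewrite mulr_ge0// subr_ge0.
      rewrite -[leRHS]mul1r; by apply: ler_pM => //; lra.
  rewrite (_ : _ - _ = expR (- (y * c)) * (1 - cos (y * s)) - (expR (- (y * c)) - (1 - y * c)));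
    last by ring.
  by move: A => /andP[A1 A2]; rewrite ler_norml; apply/andP; split; lra.
have s2 := sin_le ys0.
have s3 : y * s - sin (y * s) <= (y * s) ^+ 2.
  have := sub_sin_le ys0; have := sin_geN1 (y * s); set z := y * s => z1 z3.
  have [h|h] := leP z 2.
    by apply: (le_trans z3); rewrite exprS; have := sqr_ge0 z; nra.
  by nra.
rewrite (_ : expR _ * sin _ - y * s = - (expR (- (y * c)) * (y * s - sin (y * s))) - (1 - expR (- (y * c))) * (y * s));
  last by ring.
have A : 0 <= expR (- (y * c)) * (y * s - sin (y * s)) <= y ^+ 2.
  apply/andP; split; first by rewrite mulr_ge0// subr_ge0.
  rewrite -[leRHS]mul1r; apply: ler_pM => //; first by rewrite subr_ge0.
  exact: (le_trans s3).
have B : 0 <= (1 - expR (- (y * c))) * (y * s) <= y ^+ 2.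
  apply/andP; split; first by rewrite mulr_ge0// subr_ge0.
  rewrite expr2; apply: ler_pM => //; first by rewrite subr_ge0.
  lra.
by move: A B => /andP[A1 A2] /andP[B1 B2]; rewrite ler_norml; apply/andP; split; lra.
Qed.

Let kernel_bound0 y c s : 0 <= y <= 1 -> 0 <= c <= 1 -> 0 <= s <= 1 ->
  `|1 - expR (- (y * c)) * cos (y * s)| <= 2 * y /\
  `|expR (- (y * c)) * sin (y * s)| <= y.
Proof.
move=> /andP[y0 y1] c01 s01; have [h _] := kernel_bound1 y0 c01 s01.
move: c01 s01 => /andP[c0 c1] /andP[s0 s1].
have ycy : y * c <= y by rewrite -[leRHS]mulr1 ler_wpM2l.
have ysy : y * s <= y by rewrite -[leRHS]mulr1 ler_wpM2l.
have yc0 : 0 <= y * c by exact: mulr_ge0.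
have ys0 : 0 <= y * s by exact: mulr_ge0.
have y2 : y ^+ 2 <= y by rewrite expr2 -[leRHS]mulr1 ler_wpM2l.
split.
  by move: h; rewrite !ler_norml => /andP[h1 h2]; apply/andP; split; lra.
rewrite -[y in _ <= y]mul1r; apply: ler_normM_bound.
  by rewrite ger0_norm ?expR_ge0// expRN_le1.
by apply: (le_trans (norm_sin_le _)); rewrite ger0_norm.
Qed.

Let kernel_bound_far y c s : 0 <= y -> 0 <= c <= 1 -> 0 <= s <= 1 ->
  `|1 - expR (- (y * c)) * cos (y * s)| <= 2 /\
  `|expR (- (y * c)) * sin (y * s)| <= 1.
Proof.
move=> y0 /andP[c0 c1] /andP[s0 s1].
have e1 : `|expR (- (y * c))| <= 1.
  by rewrite ger0_norm ?expR_ge0// expRN_le1// mulr_ge0.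
split.
  rewrite (_ : 2 = 1 + 1 * 1); last by ring.
  apply: ler_normB_bound; first by rewrite normr1.
  by apply: ler_normM_bound => //; exact: norm_cos_le1.
by rewrite -[leRHS]mul1r; apply: ler_normM_bound => //; exact: norm_sin_le1.
Qed.

Let rot_bound (p q t P Q : R) : `|p| <= P -> `|q| <= Q ->
  `|p * sin t + q * cos t| <= P + Q.
Proof.
move=> pP qQ; apply: ler_normD_bound.
  by rewrite -[P]mulr1; apply: ler_normM_bound => //; exact: norm_sin_le1.
by rewrite -[Q]mulr1; apply: ler_normM_bound => //; exact: norm_cos_le1.
Qed.

Let quarter (phi : R) : 0 <= phi <= pi / 2 -> 0 <= cos phi <= 1 /\ 0 <= sin phi <= 1.
Proof.
move=> /andP[p0 p1]; have pi0 := pi_ge0 R.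
rewrite cos_le1 sin_le1 !andbT; split.
  by apply: cos_ge0_pihalf; lra.
by apply: sin_ge0_pi; lra.
Qed.

Let powRV y c : 0 < y -> (y^-1) `^ (- c) = y `^ c.
Proof.
by move=> y0; rewrite -(powR_inv1 (ltW y0)) -powRrM mulrNN mul1r.
Qed.

Let mul_powR y a b : 0 < y -> y `^ a * y `^ b = y `^ (a + b).
Proof. by move=> y0; rewrite powRD// (gt_eqF y0) implybT. Qed.

Let mulX_powR y c n : 0 < y -> y ^+ n * y `^ c = y `^ (n%:R + c).
Proof. by move=> y0; rewrite -powR_mulrn ?ltW// mul_powR. Qed.

Let truncated (delta : R) (f : R -> R) :=
  \int[lebesgue_measure]_(y in `[delta, delta^-1]) f y.

(** With kappa = 0 the kernel is O(z) at 0 and bounded far away, so that the inner arc contributes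
    [delta^(1-beta)] and the outer one [delta^beta]. Both vanish in the limit when [beta < 1]. *)
Let rotation0 beta delta : 0 < beta -> 0 < delta <= 1 ->
  `|truncated delta (fun y => (1 - cos y) * y `^ (- 1 - beta))
    - cos (beta * (pi / 2)) *
      truncated delta (fun y => (1 - expR (- y) - 0 * y) * y `^ (- 1 - beta))|
  <= (3 * delta `^ (1 - beta) + 3 * delta `^ beta) * (pi / 2).
Proof.
move=> b0 /andP[d0 d1].
have dV : delta <= delta^-1.
  by rewrite (le_trans d1)// invf_ge1.
have := @contour_rotation R beta 0 delta delta^-1 b0 (lexx _) d0 dV 0
  (3 * delta `^ (1 - beta) + 3 * delta `^ beta).
rewrite mul0r subr0; apply => phi /quarter[c01 s01].
rewrite !mul0r !subr0; apply: ler_normB_bound.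
  have d01 : 0 <= delta <= 1 by rewrite ltW.
  have [h1 h2] := kernel_bound0 d01 c01 s01.
  rewrite -[delta `^ (1 - beta)](mulX_powR _ 1)// expr1 mulrA.
  apply: ler_normM_bound; last by rewrite ger0_norm// powR_ge0.
  by rewrite (_ : 3 * delta = 2 * delta + delta); [exact: rot_bound|ring].
have d01 : 0 <= delta^-1 by rewrite invr_ge0 ltW.
have [h1 h2] := kernel_bound_far d01 c01 s01.
rewrite powRV//.
apply: ler_normM_bound; last by rewrite ger0_norm// powR_ge0.
by rewrite (_ : 3 = 2 + 1); [exact: rot_bound|ring].
Qed.

(** With kappa = 1 the inner arc improves to [delta^(2-beta)], while the linear term makes the outer
    one as large as [delta^(beta-1)]. Both vanish in the limit when [1 < beta < 2]. *)
Let rotation1 beta delta : 0 < beta -> 0 < delta <= 1 ->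
  `|truncated delta (fun y => (1 - cos y) * y `^ (- 1 - beta))
    - cos (beta * (pi / 2)) *
      truncated delta (fun y => (1 - expR (- y) - 1 * y) * y `^ (- 1 - beta))|
  <= (3 * delta `^ (2 - beta) + 5 * delta `^ (beta - 1)) * (pi / 2).
Proof.
move=> b0 /andP[d0 d1].
have dV1 : 1 <= delta^-1 by rewrite invf_ge1.
have dV : delta <= delta^-1 by rewrite (le_trans d1).
have := @contour_rotation R beta 1 delta delta^-1 b0 ler01 d0 dV 0
  (3 * delta `^ (2 - beta) + 5 * delta `^ (beta - 1)).
rewrite mul0r subr0; apply => phi /quarter[c01 s01].
rewrite !mul1r !subr0; apply: ler_normB_bound.
  have [h1 h2] := kernel_bound1 (ltW d0) c01 s01.
  rewrite -[delta `^ (2 - beta)](mulX_powR _ 2)// mulrA.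
  apply: ler_normM_bound; last by rewrite ger0_norm// powR_ge0.
  by rewrite (_ : 3 * delta ^+ 2 = delta ^+ 2 + 2 * delta ^+ 2); [exact: rot_bound|ring].
have d01 : 0 <= delta^-1 by rewrite invr_ge0 ltW.
have [h1 h2] := kernel_bound_far d01 c01 s01.
rewrite powRV// (_ : delta `^ (beta - 1) = delta^-1 * delta `^ beta); last first.
  by rewrite -(powR_inv1 (ltW d0)) mul_powR// addrC.
rewrite mulrA; apply: ler_normM_bound; last by rewrite ger0_norm// powR_ge0.
have le1 (c : R) : 0 <= c <= 1 -> `|delta^-1 * c| <= delta^-1.
  move=> /andP[c0 c1]; rewrite ger0_norm ?mulr_ge0//.
  by rewrite -[leRHS]mulr1 ler_wpM2l.
apply: (@le_trans _ _ ((2 + delta^-1) + (1 + delta^-1))); last by lra.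
by apply: rot_bound; apply: ler_normB_bound => //; exact: le1.
Qed.

(** For [beta = 1] and kappa = 0 the inner arc does not vanish: k(z)/z tends to 1, so that each unit
    of angle contributes 1, while [cos (pi/2) = 0] removes the exponential integral. The value is
    the angle itself, pi/2. *)
Let rotation_beta1 delta : 0 < delta <= 1 ->
  `|truncated delta (fun y => (1 - cos y) * y `^ (- 1 - 1)) - pi / 2| <= 6 * delta * (pi / 2).
Proof.
move=> /andP[d0 d1].
have dV : delta <= delta^-1 by rewrite (le_trans d1)// invf_ge1.
have := @contour_rotation R 1 0 delta delta^-1 ltr01 (lexx _) d0 dV 1 (6 * delta).
rewrite !mul1r cos_pihalf mul0r subr0; apply => phi ph; have [c01 s01] := quarter ph.
have -> : sin (1 * (pi / 2 - phi)) = cos phi by rewrite mul1r sinB sin_pihalf cos_pihalf; ring.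
have -> : cos (1 * (pi / 2 - phi)) = sin phi by rewrite mul1r cosB sin_pihalf cos_pihalf; ring.
rewrite !mul0r !subr0.
rewrite addrAC (_ : 6 * delta = 3 * delta + 3 * delta); last by ring.
apply: ler_normB_bound; last first.
  have d01 : 0 <= delta^-1 by rewrite invr_ge0 ltW.
  have [h1 h2] := kernel_bound_far d01 c01 s01.
  rewrite powRV// (powRr1 (ltW d0)); apply: ler_normM_bound; last by rewrite ger0_norm// ltW.
  rewrite (_ : 3 = 2 + 1); last by ring.
  apply: ler_normD_bound.
    by rewrite -[2]mulr1; apply: ler_normM_bound => //; exact: norm_cos_le1.
  by rewrite -[1]mulr1; apply: ler_normM_bound => //; exact: norm_sin_le1.
have [h1 h2] := kernel_bound1 (ltW d0) c01 s01.
rewrite (powR_inv1 (ltW d0)).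
set p := 1 - _ in h1 *; set q := _ * sin _ in h2 *.
(* Writing 1 as [cos^2 + sin^2] leaves the two kernels with their linear terms removed. *)
have -> : (p * cos phi + q * sin phi) / delta - 1 =
  ((p - delta * cos phi) * cos phi + (q - delta * sin phi) * sin phi) / delta.
  have := cos2Dsin2 phi; set c := cos phi; set s := sin phi => cs.
  rewrite -[X in _ - X]cs; field; rewrite gt_eqF//.
rewrite normrM normfV (gtr0_norm d0) ler_pdivrMr// -mulrA -expr2.
rewrite (_ : 3 * delta ^+ 2 = delta ^+ 2 + 2 * delta ^+ 2); last by ring.
apply: ler_normD_bound.
  by rewrite -[delta ^+ 2]mulr1; apply: ler_normM_bound => //; exact: norm_cos_le1.
by rewrite -[2 * _]mulr1; apply: ler_normM_bound => //; exact: norm_sin_le1.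
Qed.

Let dlt (m : nat) : R := m.+1%:R^-1.

Let dlt01 m : 0 < dlt m <= 1.
Proof. by rewrite invr_gt0 ltr0n/= invf_le1 ?ltr0n// ler1n. Qed.

Let dlt_powR_cvg0 c : 0 < c -> dlt m `^ c @[m --> \oo] --> 0.
Proof.
move=> c0; have /cvg_at_rightP := powR_cvg0 c0; apply; split.
  by move=> m; have /andP[] := dlt01 m.
exact: cvg_harmonic.
Qed.

Let truncated_integrable delta (f : R -> R) : 0 < delta ->
  (forall y, 0 < y -> exists l, is_derive y 1 f l) ->
  lebesgue_measure.-integrable `[delta, delta^-1] (EFin \o f).
Proof.
move=> d0 df; apply: continuous_itv_integrable; apply: derive_within_continuous => y /andP[dy _].
by apply: df; exact: lt_le_trans dy.
Qed.

Let Gamma_integrand_derive c y : 0 < y ->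
  exists l, is_derive y 1 (fun y : R => expR (- y) * y `^ c) l.
Proof. by move=> y0; eexists; derive_by; [exact: y0|reflexivity]. Qed.

(** The integrand is at most [y^c] up to 1 and at most [2 exp(-y/2)] beyond. The bound shows that
    the integral over ]0, +oo[ is finite, so that its monotone approximation can be read in the
    reals. *)
Let Gamma_truncated_bound c d : -1 < c <= 1 -> 0 < d <= 1 ->
  truncated d (fun y => expR (- y) * y `^ c) <= (c + 1)^-1 + 4.
Proof.
move=> /andP[c0 c1] /andP[d0 d1].
have dV1 : 1 <= d^-1 by rewrite invf_ge1.
have c10 : 0 < c + 1 by lra.
pose f (y : R) := expR (- y) * y `^ c.
have fi : lebesgue_measure.-integrable `[d, d^-1] (EFin \o f).
  by apply: truncated_integrable => // y; exact: Gamma_integrand_derive.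
have h := @Rintegral_itvB R f (BLeft d) (BRight d^-1) 1 fi.
rewrite /truncated -/f -(subrK (\int[lebesgue_measure]_(y in `[d, 1]) f y)
  (\int[lebesgue_measure]_(y in `[d, d^-1]) f y)) h ?bnd_simp//.
rewrite Rintegral_itv_obnd_cbnd; last first.
  apply: integrableS fi => //.
  by apply: subset_itvr; rewrite bnd_simp.
rewrite addrC; apply: lerD.
  have pc : {within `[d, 1], continuous (fun y : R => y `^ c)}.
    apply: derive_within_continuous => y /andP[dy _].
    have y0 : 0 < y by exact: lt_le_trans dy.
    by eexists; derive_by; [exact: y0|reflexivity].
  apply: (@le_trans _ _ (\int[lebesgue_measure]_(y in `[d, 1]) y `^ c)).
    apply: le_Rintegral => //.
    - by apply: integrableS fi => //; apply: subset_itvl; rewrite bnd_simp.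
    - exact: continuous_itv_integrable.
    - move=> y /=; rewrite in_itv/= => /andP[dy _].
      rewrite -[leRHS]mul1r ler_wpM2r ?powR_ge0// expRN_le1//.
      by rewrite (le_trans (ltW d0)).
  have dF y : d <= y <= 1 -> is_derive y 1 (fun y : R => (c + 1)^-1 * y `^ (c + 1)) (y `^ c).
    move=> /andP[dy _]; derive_by; first exact: lt_le_trans dy.
    by rewrite addrK; field; rewrite gt_eqF.
  have -> := Rintegral_FTC2 d1 dF pc.
  rewrite powR1 mulr1 lerBlDr lerDl mulr_ge0 ?powR_ge0// invr_ge0 ltW//.
have ec : {within `[1, d^-1], continuous (fun y : R => 2 * expR (- (y / 2)))}.
  by apply: derive_within_continuous => y _; eexists; derive_by; reflexivity.
apply: (@le_trans _ _ (\int[lebesgue_measure]_(y in `[1, d^-1]) (2 * expR (- (y / 2))))).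
  apply: le_Rintegral => //.
  - by apply: integrableS fi => //; apply: subset_itvr; rewrite bnd_simp.
  - exact: continuous_itv_integrable.
  - move=> y /=; rewrite in_itv/= => /andP[y1 _].
    have y0 : 0 <= y by lra.
    have yc : y `^ c <= y by rewrite -[leRHS]powRr1// ler_powR.
    rewrite /f (_ : - y = - (y / 2) + - (y / 2)); last by field.
    rewrite expRD -mulrA mulrCA mulrC; apply: ler_pM => //; rewrite ?expR_ge0//.
      by rewrite mulr_ge0 ?expR_ge0// powR_ge0.
    (* From [y^c <= y <= 2 exp(y/2)], valid because [y >= 1] and [c <= 1]. *)
    apply: (@le_trans _ _ (expR (- (y / 2)) * (2 * expR (y / 2)))).
      rewrite ler_wpM2l ?expR_ge0//; apply: (le_trans yc).
      by have := expR_ge1Dx (y / 2); lra.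
    by rewrite mulrCA -expRD addNr expR0 mulr1.
have dF y : 1 <= y <= d^-1 -> is_derive y 1 (fun y : R => - (4 * expR (- (y / 2)))) (2 * expR (- (y / 2))).
  by move=> _; derive_by; field.
have -> := Rintegral_FTC2 dV1 dF ec.
rewrite opprK -[leRHS]add0r; apply: lerD; first by rewrite oppr_le0 mulr_ge0 ?expR_ge0.
rewrite -[leRHS]mulr1 ler_wpM2l// expRN_le1//; lra.
Qed.

Let cvg_Gamma_truncated c : -1 < c <= 1 ->
  truncated (dlt m) (fun y => expR (- y) * y `^ c) @[m --> \oo] --> Gamma (c + 1).
Proof.
move=> c01.
pose F m : set R := `[dlt m, (dlt m)^-1]%classic.
have ndF : {homo F : n m / (n <= m)%N >-> (n <= m)%O}.
  move=> n m nm; rewrite subsetEset /F => y /=; rewrite !in_itv/= /dlt !invrK => /andP[h1 h2].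
  apply/andP; split; last by rewrite (le_trans h2)// ler_nat ltnS.
  by apply: le_trans h1; rewrite lef_pV2 ?posrE ?ltr0n// ler_nat ltnS.
have UF : \bigcup_m F m = `]0, +oo[%classic.
  apply/seteqP; split => [y [m _]|y].
    rewrite /F /= !in_itv/= andbT => /andP[h _]; apply: lt_le_trans h.
    by have /andP[] := dlt01 m.
  rewrite /= in_itv/= andbT => y0.
  exists (Num.truncn (y + y^-1)) => //; rewrite /F /= in_itv/= /dlt invrK.
  have h : y + y^-1 < (Num.truncn (y + y^-1)).+1%:R by exact: truncnS_gt.
  have yV0 : 0 < y^-1 by rewrite invr_gt0.
  rewrite -[y in _ <= y]invrK lef_pV2 ?posrE ?ltr0n ?invr_gt0 ?invrK//.
  by apply/andP; split; lra.
have mf : measurable_fun setT (fun y : R => ((expR (- y) * y `^ c)%:E : \bar R)).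
  apply/measurable_EFinP; apply: measurable_funM; last exact: measurable_powR.
  by apply: measurableT_comp; [exact: measurable_expR|exact: measurable_funN].
have f0 (y : R) : 0 <= expR (- y) * y `^ c by rewrite mulr_ge0 ?expR_ge0// powR_ge0.
have : (\int[lebesgue_measure]_(y in F m) (expR (- y) * y `^ c)%:E)%E @[m --> \oo] -->
    (\int[lebesgue_measure]_(y in \bigcup_m F m) (expR (- y) * y `^ c)%:E)%E.
  apply: ge0_nondecreasing_set_cvg_integral => //.
  - by move=> m; rewrite /F.
  - by move=> m; exact: measurable_funTS.
  - by move=> m y _; rewrite lee_fin.
rewrite UF => hcvg.
have fin m : (\int[lebesgue_measure]_(y in F m) (expR (- y) * y `^ c)%:E)%E =
    (truncated (dlt m) (fun y => expR (- y) * y `^ c))%:E.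
  rewrite /truncated /Rintegral fineK//; apply: integrable_fin_num => //.
  apply: truncated_integrable => [|y]; first by have /andP[] := dlt01 m.
  exact: Gamma_integrand_derive.
have GE : Gamma (c + 1) =
    fine (\int[lebesgue_measure]_(y in `]0%R, +oo[) (expR (- y) * y `^ c)%:E)%E.
  by rewrite /Gamma; apply: eq_Rintegral => y _; rewrite addrK mulrC.
rewrite GE; apply: fine_cvg.
have hb : (\int[lebesgue_measure]_(y in `]0%R, +oo[) (expR (- y) * y `^ c)%:E <= ((c + 1)^-1 + 4)%:E)%E.
  rewrite -(cvg_lim _ hcvg)//; apply: lime_le; first by apply/cvg_ex; eexists; exact: hcvg.
  by near=> m; rewrite fin lee_fin Gamma_truncated_bound.
rewrite fineK.
  by move: hcvg; under eq_fun do rewrite fin.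
rewrite ge0_fin_numE; first by rewrite (le_lt_trans hb)// ltry.
by apply: integral_ge0 => y _; rewrite lee_fin.
Unshelve. all: end_near. Qed.

(** The value of the integral of [(1 - cos y) y^(-1-beta)] over ]0, +oo[. For [beta <> 1] it is the
    factor of [Kp + Km] in the constant [varsigma] of the stable exponent. *)
Definition one_sub_cos_constant beta : R :=
  if beta == 1 then pi / 2
  else Gamma (2 - beta) / (beta * (1 - beta)) * cos (pi * beta / 2).

(** The boundary terms of two integrations by parts that turn k(y) y^(-1-beta) into e^(-y)
    y^(1-beta), the integrand of Gamma(2 - beta). *)
Let primitive beta kappa y :=
  - (beta^-1 * ((1 - expR (- y) - kappa * y) * y `^ (- beta)))
  + (beta * (1 - beta))^-1 * ((expR (- y) - kappa) * y `^ (1 - beta)).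

Let by_parts beta kappa d : beta != 0 -> beta != 1 -> 0 < d <= 1 ->
  truncated d (fun y => (1 - expR (- y) - kappa * y) * y `^ (- 1 - beta)) =
  (beta * (1 - beta))^-1 * truncated d (fun y => expR (- y) * y `^ (1 - beta)) +
  (primitive beta kappa d^-1 - primitive beta kappa d).
Proof.
move=> b0 b1 /andP[d0 d1].
have dV : d <= d^-1 by rewrite (le_trans d1)// invf_ge1.
have b10 : 1 - beta != 0 by rewrite subr_eq0 eq_sym.
pose k y : R := (1 - expR (- y) - kappa * y) * y `^ (- 1 - beta).
pose e y : R := expR (- y) * y `^ (1 - beta).
have dk y : 0 < y -> exists l, is_derive y 1 k l.
  by move=> y0; eexists; rewrite /k; derive_by; [exact: y0|reflexivity].
have de y : 0 < y -> exists l, is_derive y 1 (fun y => (beta * (1 - beta))^-1 * e y) l.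
  by move=> y0; eexists; rewrite /e; derive_by; [exact: y0|reflexivity].
have dF y : d <= y <= d^-1 ->
    is_derive y 1 (primitive beta kappa) (k y - (beta * (1 - beta))^-1 * e y).
  move=> /andP[dy _]; have y0 : 0 < y by exact: lt_le_trans dy.
  rewrite /primitive /k /e; derive_by; [exact: y0|exact: y0|].
  have -> : - beta - 1 = - 1 - beta by ring.
  have -> : 1 - beta - 1 = - beta by ring.
  by field; rewrite b0 b10.
have cF : {within `[d, d^-1], continuous (fun y => k y - (beta * (1 - beta))^-1 * e y)}.
  apply: derive_within_continuous => y /andP[dy _].
  have y0 : 0 < y by exact: lt_le_trans dy.
  by eexists; rewrite /k /e; derive_by; [exact: y0|exact: y0|reflexivity].
have := Rintegral_FTC2 dV dF cF.
rewrite RintegralB//; last 2 first.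
- exact: truncated_integrable.
- exact: truncated_integrable.
rewrite RintegralZl//; last by apply: truncated_integrable => // y; exact: Gamma_integrand_derive.
by rewrite /truncated -/k -/e => <-; ring.
Qed.

Let primitive_bound0 beta d : 0 < beta < 1 -> 0 < d <= 1 ->
  `|primitive beta 0 d^-1 - primitive beta 0 d| <=
  (beta^-1 + (beta * (1 - beta))^-1) * (d `^ beta + d `^ (1 - beta)).
Proof.
move=> /andP[b0 b1] /andP[d0 d1].
have dV1 : 1 <= d^-1 by rewrite invf_ge1.
have dV0 : 0 < d^-1 by rewrite invr_gt0.
have c1 : `|beta^-1| <= beta^-1 by rewrite ger0_norm// invr_ge0 ltW.
have c2 : `|(beta * (1 - beta))^-1| <= (beta * (1 - beta))^-1.
  by rewrite ger0_norm// invr_ge0 mulr_ge0//; lra.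
rewrite mulrDr; apply: ler_normB_bound.
  rewrite /primitive mul0r !subr0 [leRHS]mulrDl; apply: ler_normD_bound.
    apply: ler_normN_bound; apply: ler_normM_bound => //.
    rewrite powRV// -[leRHS]mul1r; apply: ler_normM_bound; last by rewrite ger0_norm// powR_ge0.
    have := expR_ge0 (- d^-1); have := expRN_le1 (ltW dV0).
    by rewrite ler_norml => ? ?; apply/andP; split; lra.
  apply: ler_normM_bound => //.
  rewrite normrM [X in _ * X]ger0_norm ?powR_ge0// ger0_norm ?expR_ge0//.
  rewrite -mul_powR// powRV// (powRr1 (ltW dV0)) mulrA.
  rewrite -[leRHS]mul1r ler_wpM2r ?powR_ge0//.
  rewrite -(expR0 R) -(addNr d^-1) expRD ler_wpM2l ?expR_ge0//.
  by have := expR_ge1Dx d^-1; lra.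
rewrite /primitive mul0r !subr0 [leRHS]mulrDl; apply: ler_normD_bound.
  apply: ler_normN_bound; apply: ler_normM_bound => //.
  rewrite -[d `^ (1 - beta)]mul_powR// (powRr1 (ltW d0)).
  apply: ler_normM_bound; last by rewrite ger0_norm// powR_ge0.
  have := expRN_ge d; have := expRN_le1 (ltW d0).
  by rewrite ler_norml => ? ?; apply/andP; split; lra.
apply: ler_normM_bound => //.
rewrite normrM [X in _ * X]ger0_norm ?powR_ge0// ger0_norm ?expR_ge0//.
by rewrite -[leRHS]mul1r ler_wpM2r ?powR_ge0// expRN_le1// ltW.
Qed.

Let primitive_bound1 beta d : 1 < beta < 2 -> 0 < d <= 1 ->
  `|primitive beta 1 d^-1 - primitive beta 1 d| <=
  (beta^-1 + `|(beta * (1 - beta))^-1|) * (d `^ (beta - 1) + d `^ (2 - beta)).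
Proof.
move=> /andP[b1 b2] /andP[d0 d1].
have dV1 : 1 <= d^-1 by rewrite invf_ge1.
have dV0 : 0 < d^-1 by rewrite invr_gt0.
have c1 : `|beta^-1| <= beta^-1 by rewrite ger0_norm// invr_ge0; lra.
have dVb : d^-1 `^ (1 - beta) = d `^ (beta - 1) by rewrite -opprB powRV.
rewrite mulrDr; apply: ler_normB_bound.
  rewrite /primitive mul1r [leRHS]mulrDl; apply: ler_normD_bound.
    apply: ler_normN_bound; apply: ler_normM_bound => //.
    rewrite -dVb -mul_powR// (powRr1 (ltW dV0)).
    apply: ler_normM_bound; last by rewrite ger0_norm// powR_ge0.
    have := expR_ge0 (- d^-1); have := expRN_le1 (ltW dV0).
    have := expRN_ge d^-1.
    by rewrite ler_norml => ? ? ?; apply/andP; split; lra.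
  apply: ler_normM_bound => //; rewrite dVb.
  rewrite -[leRHS]mul1r; apply: ler_normM_bound; last by rewrite ger0_norm// powR_ge0.
  have := expR_ge0 (- d^-1); have := expRN_le1 (ltW dV0).
  by rewrite ler_norml => ? ?; apply/andP; split; lra.
rewrite /primitive mul1r [leRHS]mulrDl; apply: ler_normD_bound.
  apply: ler_normN_bound; apply: ler_normM_bound => //.
  rewrite -[d `^ (2 - beta)](mulX_powR _ 2)//.
  apply: ler_normM_bound; last by rewrite ger0_norm// powR_ge0.
  have := expRN_ge d; have := expRN_le (ltW d0); have := sqr_ge0 d.
  by rewrite ler_norml => ? ? ?; apply/andP; split; lra.
apply: ler_normM_bound => //.
rewrite (_ : 2 - beta = 1 + (1 - beta)); last by ring.
rewrite -[d `^ (1 + (1 - beta))]mul_powR// (powRr1 (ltW d0)).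
apply: ler_normM_bound; last by rewrite ger0_norm// powR_ge0.
have := expRN_ge d; have := expRN_le1 (ltW d0).
by rewrite ler_norml => ? ?; apply/andP; split; lra.
Qed.

Let cvg_squeeze (u e : nat -> R) (l : R) : (forall m, `|u m - l| <= e m) ->
  e m @[m --> \oo] --> 0 -> u m @[m --> \oo] --> l.
Proof.
move=> ue e0; apply/cvgrPdist_le => eps eps0.
move/cvgrPdist_le : e0 => /(_ _ eps0); apply: filterS => m; rewrite sub0r normrN => h.
by rewrite distrC (le_trans (ue m))// (le_trans (ler_norm _)).
Qed.

(** The common end of the cases [beta < 1] and [beta > 1], with [kappa] equal to 0 and to 1: up to
    errors that vanish, rotation leads to the exponential kernel and integration by parts leads from
    there to the Gamma integral. *)
Let cvg_generic beta kappa (c1 c2 C1 C2 : R) : 0 < c1 -> 0 < c2 ->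
  beta != 0 -> beta != 1 -> -1 < 1 - beta <= 1 ->
  (forall d, 0 < d <= 1 ->
  `|truncated d (fun y => (1 - cos y) * y `^ (- 1 - beta))
    - cos (beta * (pi / 2)) *
      truncated d (fun y => (1 - expR (- y) - kappa * y) * y `^ (- 1 - beta))|
    <= C1 * (d `^ c1 + d `^ c2)) ->
  (forall d, 0 < d <= 1 -> `|primitive beta kappa d^-1 - primitive beta kappa d| <=
     C2 * (d `^ c1 + d `^ c2)) ->
  truncated (dlt m) (fun y => (1 - cos y) * y `^ (- 1 - beta)) @[m --> \oo]
    --> one_sub_cos_constant beta.
Proof.
move=> c10 c20 b0 b1 bb h1 h2.
have d0 C : C * (dlt m `^ c1 + dlt m `^ c2) @[m --> \oo] --> 0.
  rewrite -[X in _ --> X](mulr0 C) -[X in C * X](addr0 0).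
  by apply: cvgMr; apply: cvgD; exact: dlt_powR_cvg0.
have p0 : primitive beta kappa (dlt m)^-1 - primitive beta kappa (dlt m) @[m --> \oo] --> 0.
  by apply: cvg_squeeze (d0 C2) => m; rewrite subr0; exact: h2.
have r0 : truncated (dlt m) (fun y => (1 - cos y) * y `^ (- 1 - beta))
    - cos (beta * (pi / 2)) *
      truncated (dlt m) (fun y => (1 - expR (- y) - kappa * y) * y `^ (- 1 - beta))
      @[m --> \oo] --> 0.
  by apply: cvg_squeeze (d0 C1) => m; rewrite subr0; exact: h1.
have g := cvg_Gamma_truncated bb.
have -> : one_sub_cos_constant beta = 0 + cos (beta * (pi / 2)) *
    ((beta * (1 - beta))^-1 * Gamma (1 - beta + 1) + 0).
  rewrite /one_sub_cos_constant (negbTE b1) add0r addr0.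
  rewrite (_ : 1 - beta + 1 = 2 - beta); last by ring.
  by rewrite (_ : beta * (pi / 2) = pi * beta / 2); ring.
have -> : (fun m => truncated (dlt m) (fun y => (1 - cos y) * y `^ (- 1 - beta))) =
  (fun m => (truncated (dlt m) (fun y => (1 - cos y) * y `^ (- 1 - beta))
    - cos (beta * (pi / 2)) *
      truncated (dlt m) (fun y => (1 - expR (- y) - kappa * y) * y `^ (- 1 - beta))) +
    cos (beta * (pi / 2)) * ((beta * (1 - beta))^-1 *
      truncated (dlt m) (fun y => expR (- y) * y `^ (1 - beta)) +
      (primitive beta kappa (dlt m)^-1 - primitive beta kappa (dlt m)))).
  by apply/funext => m; rewrite -by_parts// subrK.
by apply: cvgD => //; apply: cvgMr; apply: cvgD => //; exact: cvgMr.
Qed.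

Lemma cvg_one_sub_cos_integral beta : 0 < beta < 2 ->
  \int[lebesgue_measure]_(y in `[m.+1%:R^-1, m.+1%:R]) ((1 - cos y) * y `^ (- 1 - beta))
    @[m --> \oo] --> one_sub_cos_constant beta.
Proof.
move=> /andP[b0 b2].
suff : truncated (dlt m) (fun y => (1 - cos y) * y `^ (- 1 - beta)) @[m --> \oo]
    --> one_sub_cos_constant beta.
  by apply: cvg_trans; apply: near_eq_cvg; apply: nearW => m; rewrite /truncated /dlt invrK.
have pi0 : 0 <= (pi : R) / 2 by rewrite divr_ge0// pi_ge0.
have [b1|b1|->] := ltgtP beta 1.
- apply: (@cvg_generic beta 0 beta (1 - beta) (3 * (pi / 2)) (beta^-1 + (beta * (1 - beta))^-1)) => //.
  + lra.
  + by rewrite gt_eqF.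
  + by rewrite lt_eqF.
  + by apply/andP; split; lra.
  + move=> d d01; apply: (le_trans (rotation0 b0 d01)).
    by rewrite le_eqVlt; apply/orP; left; apply/eqP; ring.
  + by move=> d d01; apply: primitive_bound0 => //; rewrite b0.
- apply: (@cvg_generic beta 1 (beta - 1) (2 - beta) (5 * (pi / 2))
    (beta^-1 + `|(beta * (1 - beta))^-1|)) => //.
  + lra.
  + lra.
  + by rewrite gt_eqF.
  + by rewrite gt_eqF.
  + by apply/andP; split; lra.
  + move=> d d01; apply: (le_trans (rotation1 b0 d01)).
    rewrite mulrAC; apply: ler_wpM2r => //.
    by have := powR_ge0 d (2 - beta); have := powR_ge0 d (beta - 1); lra.
  + by move=> d d01; apply: primitive_bound1 => //; rewrite b1.
- rewrite /one_sub_cos_constant eqxx.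
  apply: (@cvg_squeeze _ (fun m => 6 * (dlt m) * (pi / 2))).
    by move=> m; exact: rotation_beta1.
  rewrite -[X in _ --> X](mul0r (pi / 2)); apply: cvgMl.
  rewrite -[X in _ --> X](mulr0 6); apply: cvgMr.
  exact: cvg_harmonic.
Qed.

End one_sub_cos_integral.

(** * Integration against a Levy measure *)

Section levy_integral.
Context (R : realType) (nu : {measure set R -> \bar R}).
Hypothesis nu_levy : levy_measure nu.
Implicit Types (f g : R -> R) (x y u v : R).

Definition levy_weight x : R := Num.min 1 (x ^+ 2).

Definition levy_integral f : R := \int[nu]_(x in [set~ 0]) f x.

(* A sufficient condition for integrability against the Levy measure. *)
Definition levy_dominated f : Prop :=
  measurable_fun setT f /\ exists C, forall x, `|f x| <= C * levy_weight x.

Lemma levy_weight_ge0 x : 0 <= levy_weight x.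
Proof. by rewrite /levy_weight le_min ler01 sqr_ge0. Qed.

Lemma measurable_levy_weight : measurable_fun setT levy_weight.
Proof.
apply: measurable_minr; first exact: measurable_cst.
exact: measurable_funX.
Qed.

Lemma levy_dominated_integrable f : levy_dominated f ->
  nu.-integrable [set~ 0] (EFin \o f).
Proof.
move=> [mf [C fC]].
have mD : measurable [set~ (0 : R)] by apply: measurableC; exact: measurable_set1.
have iw : nu.-integrable [set~ (0 : R)] (EFin \o levy_weight).
  have mw : measurable_fun setT (EFin \o levy_weight).
    by apply/measurable_EFinP; exact: measurable_levy_weight.
  apply: (@integrableS _ _ _ nu setT) => //.
  apply/integrableP; split => //.
  apply: le_lt_trans nu_levy.2; apply: ge0_le_integral => //.
  - exact: measurableT_comp.
  - by move=> x _; rewrite /= ger0_norm ?levy_weight_ge0.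
have iCw : nu.-integrable [set~ (0 : R)] (fun x => C%:E * (EFin \o levy_weight) x)%E.
  exact: integrableZl.
apply: le_integrable iCw => //.
- by apply/measurable_EFinP; exact: measurable_funTS.
- move=> x _ /=; by rewrite lee_fin (le_trans (fC x))// ler_norm.
Qed.

Lemma levy_dominatedD f g : levy_dominated f -> levy_dominated g ->
  levy_dominated (fun x => f x + g x).
Proof.
move=> [mf [C fC]] [mg [D gD]]; split; first exact: measurable_funD.
by exists (C + D) => x; rewrite mulrDl; exact: ler_normD_bound.
Qed.

Lemma levy_dominatedZ c f : levy_dominated f -> levy_dominated (fun x => c * f x).
Proof.
move=> [mf [C fC]]; split; first exact: measurable_funM.
exists (`|c| * C) => x; rewrite -mulrA; exact: ler_normM_bound.
Qed.

Lemma levy_dominatedB f g : levy_dominated f -> levy_dominated g ->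
  levy_dominated (fun x => f x - g x).
Proof.
move=> [mf [C fC]] [mg [D gD]]; split; first exact: measurable_funB.
by exists (C + D) => x; rewrite mulrDl; exact: ler_normB_bound.
Qed.

Lemma levy_dominatedW f g : measurable_fun setT f -> levy_dominated g ->
  (forall x, `|f x| <= `|g x|) -> levy_dominated f.
Proof.
by move=> mf [_ [C gC]] fg; split => //; exists C => x; exact: le_trans (fg x) (gC x).
Qed.

Lemma levy_integralD f g : levy_dominated f -> levy_dominated g ->
  levy_integral (fun x => f x + g x) = levy_integral f + levy_integral g.
Proof.
move=> df dg; apply: RintegralD; try exact: levy_dominated_integrable.
by apply: measurableC; exact: measurable_set1.
Qed.

Lemma levy_integralB f g : levy_dominated f -> levy_dominated g ->
  levy_integral (fun x => f x - g x) = levy_integral f - levy_integral g.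
Proof.
move=> df dg; apply: RintegralB; try exact: levy_dominated_integrable.
by apply: measurableC; exact: measurable_set1.
Qed.

Lemma levy_integralZ c f : levy_dominated f ->
  levy_integral (fun x => c * f x) = c * levy_integral f.
Proof.
move=> df; apply: RintegralZl; last exact: levy_dominated_integrable.
by apply: measurableC; exact: measurable_set1.
Qed.

Lemma ler_levy_integral f g : levy_dominated f -> levy_dominated g ->
  (forall x, f x <= g x) -> levy_integral f <= levy_integral g.
Proof.
move=> df dg fg; apply: le_Rintegral => //; try exact: levy_dominated_integrable.
by apply: measurableC; exact: measurable_set1.
Qed.

Lemma levy_integral_ge0 f : (forall x, 0 <= f x) -> 0 <= levy_integral f.
Proof. by move=> f0; apply: Rintegral_ge0. Qed.

Lemma ler_norm_levy_integral f g : measurable_fun setT f -> levy_dominated g ->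
  (forall x, `|f x| <= g x) -> `|levy_integral f| <= levy_integral g.
Proof.
move=> mf dg fg; have df : levy_dominated f.
  by apply: levy_dominatedW mf dg _ => x; rewrite (le_trans (fg x))// ler_norm.
have mD : measurable [set~ (0 : R)] by apply: measurableC; exact: measurable_set1.
apply: (le_trans (le_normr_Rintegral mD (levy_dominated_integrable df))).
apply: le_Rintegral => //; last exact: levy_dominated_integrable.
by apply: (levy_dominated_integrable (f := fun x => `|f x|)); case: df => _ [C fC]; split;
  [exact: measurableT_comp|exists C => x; rewrite normr_id].
Qed.

Lemma levy_dominated_scaled e : 0 < e -> levy_dominated (fun x => levy_weight (x / e)).
Proof.
move=> e0; split.
  by apply: measurableT_comp; [exact: measurable_levy_weight|exact: measurable_funM].
exists (1 + (e ^-1) ^+ 2) => x.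
rewrite ger0_norm ?levy_weight_ge0// mulrDl mul1r /levy_weight.
have ei0 : 0 <= (e^-1) ^+ 2 by exact: sqr_ge0.
have x2 : 0 <= x ^+ 2 by exact: sqr_ge0.
rewrite exprMn.
have [h1|h1] := leP 1 (x ^+ 2); have [h2|h2] := leP 1 (x ^+ 2 * e^-1 ^+ 2); nra.
Qed.

Lemma measurable_gtr_norm y : measurable [set x : R | y < `|x|].
Proof.
rewrite -[X in measurable X]setTI; apply: (@measurable_fun_ltr _ _ _ setT (cst y) (fun x : R => `|x|)) => //.
Qed.

Lemma levy_dominated_tail y : 0 < y -> levy_dominated \1_[set x : R | y < `|x|].
Proof.
move=> y0; split; first by apply: measurable_indic; exact: measurable_gtr_norm.
exists (1 + (y^-1) ^+ 2) => x.
rewrite indicE; have [/set_mem/= yx|_] := boolP (_ \in _); last first.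
  by rewrite normr0 mulr_ge0 ?levy_weight_ge0// addr_ge0// sqr_ge0.
rewrite normr1 /levy_weight.
have h : 1 <= x ^+ 2 * (y^-1) ^+ 2.
  rewrite -exprMn -[1](expr1n _ 2) -[X in _ <= X]real_normK ?num_real//.
  rewrite lerXn2r ?nnegrE// normrM normfV (gtr0_norm y0) ler_pdivlMr ?mul1r//.
  exact: ltW.
have y2 : 0 <= (y^-1) ^+ 2 by exact: sqr_ge0.
by have [h1|h1] := leP 1 (x ^+ 2); nra.
Qed.

Lemma levy_dominated_sqr r : 0 < r ->
  levy_dominated (fun x => x ^+ 2 * \1_[set x : R | `|x| <= r] x).
Proof.
move=> r0; split.
  apply: measurable_funM; first exact: measurable_funX.
  apply: measurable_indic; rewrite (_ : [set x | _] = ~` [set x : R | r < `|x|]).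
    by apply: measurableC; exact: measurable_gtr_norm.
  by apply/seteqP; split => x /=; [rewrite leNgt => /negP|move/negP; rewrite -leNgt].
exists (1 + r ^+ 2) => x.
have w0 := levy_weight_ge0 x.
rewrite indicE; have [/set_mem/= yx|_] := boolP (_ \in _); last first.
  by rewrite mulr0 normr0 mulr_ge0// addr_ge0// sqr_ge0.
rewrite mulr1 ger0_norm ?sqr_ge0//.
have h : x ^+ 2 <= r ^+ 2.
  by rewrite -(real_normK (num_real x)) lerXn2r ?nnegrE// ltW.
rewrite /levy_weight.
have y2 : 0 <= x ^+ 2 by exact: sqr_ge0.
have r2 : 0 <= r ^+ 2 by exact: sqr_ge0.
by have [h1|h1] := leP 1 (x ^+ 2); nra.
Qed.

(** Dominated convergence along the cut-offs [1/(n+1)], with [levy_weight] as the dominating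
    function; monotonicity in the cut-off extends the bound to every smaller [s]. *)
Lemma levy_small_jumps_cvg0 : forall e, 0 < e -> exists2 r, 0 < r <= 1 &
  forall s, 0 < s <= r ->
  levy_integral (fun x => x ^+ 2 * \1_[set x : R | `|x| <= s] x) <= e.
Proof.
pose f (n : nat) x : R := x ^+ 2 * \1_[set x : R | `|x| <= n.+1%:R^-1] x.
have df n : levy_dominated (f n).
  by apply: levy_dominated_sqr; rewrite invr_gt0.
have mD : measurable [set~ (0 : R)] by apply: measurableC; exact: measurable_set1.
have dw : levy_dominated levy_weight.
  split; first exact: measurable_levy_weight.
  by exists 1 => x; rewrite mul1r ger0_norm ?levy_weight_ge0.
have fw n x : `|f n x| <= levy_weight x.
  rewrite /f indicE; have [/set_mem/= h|_] := boolP (_ \in _); last first.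
    by rewrite mulr0 normr0 levy_weight_ge0.
  rewrite mulr1 ger0_norm ?sqr_ge0// /levy_weight le_min lexx andbT.
  rewrite -(real_normK (num_real x)) expr_le1//.
  by rewrite (le_trans h)// invf_le1 ?ltr0n// ler1n.
have cv : levy_integral (f n) @[n --> \oo] --> levy_integral (cst 0).
  apply: (@cvg_Rintegral _ _ _ _ _ _ _ levy_weight) => //.
  - by move=> n; apply: measurable_funTS; exact: (df n).1.
  - move=> x /= x0; apply: cvg_near_cst.
    have ax : 0 < `|x| by rewrite normr_gt0; exact/eqP.
    near=> n; rewrite /f indicE memNset ?mulr0//= => h.
    have : n.+1%:R^-1 < `|x|.
      near: n; have := @cvg_harmonic R; move=> /cvgrPdist_lt/(_ _ ax); apply: filterS => m.
      by rewrite /harmonic sub0r normrN ger0_norm ?invr_ge0 ?ler0n.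
    by rewrite ltNge h.
  - exact: levy_dominated_integrable.
move=> e e0; move/cvgrPdist_lt : cv => /(_ _ e0)[n _ /(_ n (leqnn n))].
rewrite {1}/levy_integral Rintegral_cst ?mul0r ?sub0r ?normrN; last first.
  by [].
rewrite ger0_norm; last first.
  by apply: levy_integral_ge0 => x; rewrite mulr_ge0 ?sqr_ge0// indicE.
move=> fe; exists n.+1%:R^-1; first by rewrite invr_gt0 ltr0n/= invf_le1 ?ltr0n// ler1n.
move=> s /andP[s0 sr]; apply/ltW; apply: le_lt_trans fe; apply: ler_levy_integral => //.
  exact: levy_dominated_sqr.
move=> x; rewrite ler_wpM2l ?sqr_ge0// !indicE.
have [/set_mem/= xs|_] := boolP (_ \in [set x | `|x| <= s]); last by [].
by rewrite mem_set//= (le_trans xs).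
Unshelve. all: end_near. Qed.

End levy_integral.

(** * Bounds on the real and imaginary parts of a Levy exponent *)

Section levy_exponent_bounds.
Context (R : realType) (gamma b : R) (nu : {measure set R -> \bar R}).
Hypothesis nu_levy : levy_measure nu.
Implicit Types (x y u v e A : R).

Definition psi_re u : R := complex.Re (levy_exponent gamma b nu u).
Definition psi_im u : R := complex.Im (levy_exponent gamma b nu u).

Definition levy_cos u : R := levy_integral nu (fun x => 1 - cos (u * x)).

(** The order of magnitude of the jump part of the exponent at frequencies of order [1/e]: the
    bounds below compare integrands with [levy_weight (x / e)], writing [u x] as the product of
    [u e], which stays bounded, and [x / e]. *)
Definition levy_scale e : R := levy_integral nu (fun x => levy_weight (x / e)).

Let norm_sub_sin_le x : `|sin x - x| <= `|x| ^+ 3.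
Proof.
wlog x0 : x / 0 <= x => [h|].
  have [/h//|x0] := leP 0 x.
  by have := h (- x); rewrite oppr_ge0 ltW// => /(_ isT); rewrite sinN -opprD !normrN.
rewrite (ger0_norm x0) distrC ger0_norm ?subr_ge0 ?sin_le//.
apply: (le_trans (sub_sin_le x0)).
by rewrite ler_pdivrMr// ler_peMr ?exprn_ge0//; lra.
Qed.

Let weight_cases y : (`|y| <= 1 /\ levy_weight y = `|y| ^+ 2) \/ (1 < `|y| /\ levy_weight y = 1).
Proof.
rewrite /levy_weight -(real_normK (num_real y)).
have [h|h] := leP `|y| 1.
  by left; split => //; apply/min_idPr; rewrite exprn_ile1.
by right; split => //; apply/min_idPl; rewrite exprn_ege1// ltW.
Qed.

Let cos_weight (a : R) y A : `|a| <= A -> 1 - cos (a * y) <= (2 + A ^+ 2) * levy_weight y.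
Proof.
move=> aA; have A2 : 0 <= A ^+ 2 by exact: sqr_ge0.
have [[y1 ->]|[y1 ->]] := weight_cases y; last first.
  by have := cos_geN1 (a * y); lra.
apply: (le_trans (one_sub_cos_le _)).
have -> : (a * y) ^+ 2 = `|a| ^+ 2 * `|y| ^+ 2.
  by rewrite exprMn -[in LHS](real_normK (num_real a)) -[in LHS](real_normK (num_real y)).
have h : `|a| ^+ 2 * `|y| ^+ 2 <= A ^+ 2 * `|y| ^+ 2.
  by rewrite ler_wpM2r ?sqr_ge0// lerXn2r ?nnegrE// (le_trans _ aA).
have y2 : 0 <= `|y| ^+ 2 by exact: sqr_ge0.
have := mulr_ge0 A2 y2; lra.
Qed.

Let sin_weight (a : R) y A : `|a| <= A ->
  `|sin (a * y) - a * sin y| <= (1 + A + A ^+ 3) * levy_weight y.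
Proof.
move=> aA; have A0 : 0 <= A by exact: le_trans aA.
have A3 : 0 <= A ^+ 3 by exact: exprn_ge0.
have [[y1 ->]|[y1 ->]] := weight_cases y; last first.
  rewrite mulr1; apply: (@le_trans _ _ (1 + A)); last by rewrite lerDl.
  apply: ler_normB_bound; first exact: norm_sin_le1.
  by rewrite -[A]mulr1; apply: ler_normM_bound => //; exact: norm_sin_le1.
rewrite (_ : sin _ - _ = (sin (a * y) - a * y) - a * (sin y - y)); last by ring.
have h1 := norm_sub_sin_le (a * y); have h2 := norm_sub_sin_le y.
have y3 : `|y| ^+ 3 <= `|y| ^+ 2 by rewrite exprS ler_piMl ?sqr_ge0.
apply: (le_trans (ler_normB_bound h1 (ler_normM_bound aA h2))).
rewrite normrM exprMn.
have h3 : `|a| ^+ 3 * `|y| ^+ 3 <= A ^+ 3 * `|y| ^+ 2.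
  by apply: ler_pM => //; rewrite ?exprn_ge0// lerXn2r ?nnegrE.
have h4 : A * `|y| ^+ 3 <= A * `|y| ^+ 2 by rewrite ler_wpM2l.
have y2 : 0 <= `|y| ^+ 2 by exact: sqr_ge0.
by lra.
Qed.

Lemma levy_dominated_cos u : levy_dominated (fun x => 1 - cos (u * x)).
Proof.
split; first by apply: measurable_funB => //; exact: measurable_cos.
exists (2 + `|u| ^+ 2) => x; rewrite ger0_norm ?subr_ge0 ?cos_le1//.
exact: cos_weight.
Qed.

Let compensator u : R -> R := fun x => sin (u * x) - u * x * \1_[set y : R | `|y| <= 1] x.

Lemma levy_dominated_sin u : levy_dominated (compensator u).
Proof.
have m1 : measurable [set y : R | `|y| <= 1].
  rewrite (_ : [set x | _] = ~` [set x : R | 1 < `|x|]).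
    by apply: measurableC; exact: measurable_gtr_norm.
  by apply/seteqP; split => x /=; [rewrite leNgt => /negP|move/negP; rewrite -leNgt].
split.
  apply: measurable_funB; first exact: measurable_sin.
  by apply: measurable_funM => //; exact: measurable_indic.
exists (1 + `|u| ^+ 3) => x; rewrite /compensator indicE.
have u3 : 0 <= `|u| ^+ 3 by exact: exprn_ge0.
have [[x1 ->]|[x1 ->]] := weight_cases x.
  rewrite mem_set// mulr1; apply: (le_trans (norm_sub_sin_le _)).
  rewrite normrM exprMn mulrDl mul1r.
  have x3 : `|x| ^+ 3 <= `|x| ^+ 2 by rewrite exprS ler_piMl ?sqr_ge0.
  have := ler_wpM2l u3 x3; have : 0 <= `|x| ^+ 2 by exact: sqr_ge0.
  by lra.
rewrite memNset ?mulr0 ?subr0 ?mulr1; last by rewrite /= leNgt x1.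
by have := @norm_sin_le1 R (u * x); lra.
Qed.

Lemma psi_reE u : psi_re u = - (b ^+ 2 * u ^+ 2 / 2 + levy_cos u).
Proof.
rewrite /psi_re /levy_exponent /cintegral /=.
rewrite (_ : \int[nu]_(x in [set~ 0]) _ = - levy_cos u); first by ring.
rewrite -[RHS]mulN1r /levy_cos -levy_integralZ//; last exact: levy_dominated_cos.
apply: eq_Rintegral => x _ /=; rewrite expR0 mul1r !mul0r subr0; ring.
Qed.

Lemma psi_imE u : psi_im u = gamma * u + levy_integral nu (compensator u).
Proof.
rewrite /psi_im /levy_exponent /cintegral /= oppr0 addr0; congr (_ + _).
by apply: eq_Rintegral => x _ /=; rewrite expR0 mul1r !mul0r !addr0.
Qed.

Lemma levy_cos_ge0 u : 0 <= levy_cos u.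
Proof. by apply: levy_integral_ge0 => x; rewrite subr_ge0 cos_le1. Qed.

Lemma levy_cosN u : levy_cos (- u) = levy_cos u.
Proof. by apply: eq_Rintegral => x _; rewrite mulNr cosN. Qed.

Lemma levy_cos_norm u : levy_cos `|u| = levy_cos u.
Proof. by have [u0|u0] := leP 0 u; [rewrite ger0_norm|rewrite ltr0_norm// levy_cosN]. Qed.

Lemma psi_re_le0 u : psi_re u <= 0.
Proof.
by rewrite psi_reE oppr_le0 addr_ge0 ?levy_cos_ge0// divr_ge0// mulr_ge0// sqr_ge0.
Qed.

Lemma psi_re0 : psi_re 0 = 0.
Proof.
rewrite psi_reE expr0n mulr0 mul0r add0r (_ : levy_cos 0 = 0) ?oppr0//.
rewrite /levy_cos /levy_integral (_ : (fun _ => _) = cst 0).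
  by rewrite Rintegral_cst ?mul0r//; apply: measurableC; exact: measurable_set1.
by apply/funext => x /=; rewrite mul0r cos0 subrr.
Qed.

Lemma psi_reN u : psi_re (- u) = psi_re u.
Proof. by rewrite !psi_reE sqrrN levy_cosN. Qed.

Lemma psi_imN u : psi_im (- u) = - psi_im u.
Proof.
rewrite !psi_imE mulrN opprD; congr (_ + _).
rewrite -[RHS]mulN1r -levy_integralZ//; last exact: levy_dominated_sin.
by apply: eq_Rintegral => x _; rewrite /compensator mulNr sinN; ring.
Qed.

Lemma psi_im0 : psi_im 0 = 0.
Proof. by apply/eqP; rewrite -eqNr -psi_imN oppr0. Qed.

Lemma levy_cos_le_scale u e A : 0 < e -> `|u| * e <= A ->
  levy_cos u <= (2 + A ^+ 2) * levy_scale e.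
Proof.
move=> e0 ueA; have ds := levy_dominated_scaled e0.
rewrite -levy_integralZ//; apply: ler_levy_integral => //.
- exact: levy_dominated_cos.
- exact: levy_dominatedZ.
- move=> x; rewrite (_ : u * x = (u * e) * (x / e)); last by field; rewrite gt_eqF.
  by apply: cos_weight; rewrite normrM (gtr0_norm e0).
Qed.

(** The drift and the truncation at [|x| <= 1] enter Im psi linearly in u. Subtracting the linear
    function that agrees with it at [1/e] removes both and leaves [sin (a y) - a sin y] with
    [a = u e] and [y = x / e], which is bounded by a multiple of min(1, y^2). *)
Lemma psi_im_compensated u e A : 0 < e -> `|u| * e <= A ->
  `|psi_im u - u * e * psi_im e^-1| <= (1 + A + A ^+ 3) * levy_scale e.
Proof.
move=> e0 ueA; have ds := levy_dominated_scaled e0.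
rewrite !psi_imE mulrDr opprD addrACA.
rewrite (_ : gamma * u - _ = 0); last by field; rewrite gt_eqF.
rewrite add0r -levy_integralZ//; last exact: levy_dominated_sin.
rewrite -levy_integralB//; last 2 first.
- exact: levy_dominated_sin.
- by apply: levy_dominatedZ; exact: levy_dominated_sin.
rewrite -levy_integralZ//; apply: ler_norm_levy_integral => //.
- have [m1 _] := levy_dominated_sin u; have [m2 _] := levy_dominated_sin e^-1.
  by apply: measurable_funB => //; apply: measurable_funM.
- exact: levy_dominatedZ.
- move=> x; rewrite /compensator.
  rewrite (_ : _ - _ = sin (u * e * (x / e)) - u * e * sin (x / e)).
    by apply: sin_weight; rewrite normrM (gtr0_norm e0).
  rewrite (_ : u * e * (x / e) = u * x); last by field; rewrite gt_eqF.
  by rewrite [e^-1 * x]mulrC; field; rewrite gt_eqF.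
Qed.

Let amgm (l p q : R) : 0 < l -> `|p * q| <= (l * p ^+ 2 + l^-1 * q ^+ 2) / 2.
Proof.
move=> l0; rewrite normrM -(real_normK (num_real p)) -(real_normK (num_real q)).
have := sqr_ge0 (l * `|p| - `|q|); set P := `|p|; set Q := `|q| => h.
rewrite -(ler_pM2l l0).
rewrite (_ : l * ((l * P ^+ 2 + l^-1 * Q ^+ 2) / 2) = ((l * P) ^+ 2 + Q ^+ 2) / 2);
  last by field; rewrite gt_eqF.
by nra.
Qed.

(** The two left-hand sides are the real and imaginary parts of (e^(ia) - 1)(e^(ic) - 1), up to
    sign, and |e^(ia) - 1|^2 = 2(1 - cos a); the weighted inequality of arithmetic and geometric
    means concludes. *)
Let trig_cs (l a c : R) : 0 < l ->
  `|cos (a + c) - cos a - cos c + 1| <= l * (1 - cos a) + l^-1 * (1 - cos c) /\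
  `|sin (a + c) - sin a - sin c| <= l * (1 - cos a) + l^-1 * (1 - cos c).
Proof.
move=> l0.
have ea : (1 - cos a) = ((cos a - 1) ^+ 2 + sin a ^+ 2) / 2.
  by rewrite sin2cos2; field.
have ec : (1 - cos c) = ((cos c - 1) ^+ 2 + sin c ^+ 2) / 2.
  by rewrite sin2cos2; field.
rewrite cosD sinD; split.
  rewrite (_ : _ + 1 = (cos a - 1) * (cos c - 1) - sin a * sin c); last by ring.
  apply: (le_trans (ler_normB_bound (amgm _ _ l0) (amgm _ _ l0))).
  by rewrite [in leRHS]ea [in leRHS]ec; lra.
rewrite (_ : _ - sin c = sin a * (cos c - 1) + (cos a - 1) * sin c); last by ring.
apply: (le_trans (ler_normD_bound (amgm _ _ l0) (amgm _ _ l0))).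
by rewrite [in leRHS]ea [in leRHS]ec; lra.
Qed.

(** [trig_cs] integrated against the Levy measure, the Gaussian cross term being treated alike. The
    right-hand side is non-negative since [psi_re <= 0]. The free weight [l] lets the contribution
    of one frequency be made small at the expense of the other, which is how two scales are
    decoupled. *)
Lemma psi_re_subadditive (l : R) u v : 0 < l ->
  `|psi_re (u + v) - psi_re u - psi_re v| <= - (l * psi_re u + l^-1 * psi_re v).
Proof.
move=> l0; rewrite !psi_reE.
set I := levy_cos.
have dl : levy_dominated (fun x => l * (1 - cos (u * x)) + l^-1 * (1 - cos (v * x))).
  by apply: levy_dominatedD; apply: levy_dominatedZ; exact: levy_dominated_cos.
have key : `|I (u + v) - I u - I v| <= l * I u + l^-1 * I v.
  have du := levy_dominated_cos u; have dv := levy_dominated_cos v.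
  have duv := levy_dominated_cos (u + v).
  rewrite /I /levy_cos -levy_integralZ// -levy_integralZ// -levy_integralB// -levy_integralB//;
    last exact: levy_dominatedB.
  rewrite -levy_integralD//; try exact: levy_dominatedZ.
  apply: ler_norm_levy_integral => //.
    by apply: (levy_dominatedB (levy_dominatedB duv du) dv).1.
  move=> x; rewrite mulrDl.
  have [h _] := trig_cs (u * x) (v * x) l0.
  rewrite (_ : _ - _ = - (cos (u * x + v * x) - cos (u * x) - cos (v * x) + 1)); last by ring.
  by rewrite normrN.
have h := amgm (b * u) (b * v) l0.
rewrite (_ : _ - _ - _ = - ((b * u) * (b * v)) - (I (u + v) - I u - I v)); last by field.
apply: (le_trans (ler_normB_bound (ler_normN_bound h) key)).
by rewrite !exprMn le_eqVlt; apply/orP; left; apply/eqP; field; rewrite gt_eqF.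
Qed.

Lemma psi_im_subadditive (l : R) u v : 0 < l ->
  `|psi_im (u + v) - psi_im u - psi_im v| <= - (l * psi_re u + l^-1 * psi_re v).
Proof.
move=> l0; rewrite !psi_reE !psi_imE.
have du := levy_dominated_cos u; have dv := levy_dominated_cos v.
have su := levy_dominated_sin u; have sv := levy_dominated_sin v.
have suv := levy_dominated_sin (u + v).
have key : `|levy_integral nu (compensator (u + v)) - levy_integral nu (compensator u)
    - levy_integral nu (compensator v)| <= l * levy_cos u + l^-1 * levy_cos v.
  rewrite /levy_cos -levy_integralZ// -levy_integralZ// -levy_integralB// -levy_integralB//;
    last exact: levy_dominatedB.
  rewrite -levy_integralD//; try exact: levy_dominatedZ.
  apply: ler_norm_levy_integral => //.
    by apply: (levy_dominatedB (levy_dominatedB suv su) sv).1.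
    by apply: levy_dominatedD; apply: levy_dominatedZ.
  move=> x; rewrite /compensator !mulrDl.
  have [_ h] := trig_cs (u * x) (v * x) l0.
  by rewrite (_ : _ - _ = sin (u * x + v * x) - sin (u * x) - sin (v * x)); last by ring.
rewrite mulrDr (_ : _ - _ - _ = levy_integral nu (compensator (u + v))
  - levy_integral nu (compensator u) - levy_integral nu (compensator v)); last by ring.
apply: (le_trans key).
have b2 (w : R) : 0 <= b ^+ 2 * w ^+ 2 / 2 by rewrite divr_ge0// mulr_ge0// sqr_ge0.
have := mulr_ge0 (ltW l0) (b2 u).
have li0 : 0 <= l^-1 by rewrite invr_ge0 ltW.
have := mulr_ge0 li0 (b2 v).
by rewrite !mulrN !mulrDr; lra.
Qed.

End levy_exponent_bounds.

(** * Riemann-Stieltjes sums *)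

Section riemann_stieltjes.
Context (R : realType).

Lemma cos_lipschitz (x y : R) : x <= y -> `|cos y - cos x| <= y - x.
Proof.
move=> xy; have := @mean_value_bound R cos (fun t => - sin t) x y 0 1 xy.
rewrite mul0r subr0 mul1r => h; apply: h => t _.
by rewrite subr0 normrN norm_sin_le1.
Qed.

Definition grid (a c : R) (L l : nat) : R := a + l%:R * ((c - a) / L%:R).

(** [J] and [m] are arbitrary additive functions of intervals, so that the statement serves both for
    the density [y^(-1-beta)] and for a rescaled Levy measure. The two integrals of [1 - cos] can
    then be compared through sums in which each measure enters only by its tail at finitely many
    points. *)
Lemma riemann_stieltjes_sum (f : R -> R) (J m : R -> R -> R) (a c : R) (L : nat) :
  (0 < L)%N -> a <= c ->
  (forall x y z, a <= x -> x <= y -> y <= z -> z <= c -> J x z = J x y + J y z) ->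
  (forall x y z, a <= x -> x <= y -> y <= z -> z <= c -> m x z = m x y + m y z) ->
  (forall x y, a <= x -> x <= y -> y <= c -> `|J x y - f x * m x y| <= (y - x) * m x y) ->
  `|J a c - \sum_(l < L) f (grid a c L l) * m (grid a c L l) (grid a c L l.+1)|
  <= (c - a) / L%:R * m a c.
Proof.
move=> L0 ac Jadd madd Jm.
pose h := (c - a) / L%:R; pose p (l : nat) := a + l%:R * h.
rewrite -/h (_ : grid a c L = p)//.
have L0' : 0 < L%:R :> R by rewrite ltr0n.
have h0 : 0 <= h by rewrite divr_ge0 ?subr_ge0// ltW.
have pS l : p l.+1 = p l + h by rewrite /p -natr1; ring.
have pa l : a <= p l by rewrite lerDl mulr_ge0.
have pc l : (l <= L)%N -> p l <= c.
  move=> lL; rewrite /p -lerBrDl (_ : c - a = L%:R * h); last by rewrite /h; field; rewrite gt_eqF.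
  by rewrite ler_wpM2r// ler_nat.
have pL : p L = c by rewrite /p /h; field; rewrite gt_eqF.
suff claim k : (k <= L)%N ->
    `|J a (p k) - \sum_(l < k) f (p l) * m (p l) (p l.+1)| <= h * m a (p k).
  by have := claim L (leqnn L); rewrite pL.
elim: k => [_|k IH kL].
  have p0 : p 0 = a by rewrite /p mul0r addr0.
  have J0 : J a a = 0.
    have := Jadd a a a (lexx a) (lexx a) (lexx a) ac; lra.
  have m0 : m a a = 0.
    have := madd a a a (lexx a) (lexx a) (lexx a) ac; lra.
  by rewrite p0 big_ord0 J0 m0 subrr normr0 mulr0.
have kL' := ltnW kL.
have pkS : p k <= p k.+1 by rewrite pS lerDl.
rewrite big_ord_recr/= (Jadd a (p k) (p k.+1)) ?pc// (madd a (p k) (p k.+1)) ?pc//.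
rewrite opprD addrACA mulrDr; apply: ler_normD_bound; first exact: IH.
have := Jm (p k) (p k.+1) (pa k) pkS (pc _ kL).
by rewrite {3}pS (addrC (p k) h) addrK.
Qed.

Lemma powR_anti (beta x y : R) : 0 <= beta -> 0 < x -> x <= y ->
  y `^ (- beta) <= x `^ (- beta).
Proof.
move=> b0 x0 xy; have y0 : 0 < y by exact: lt_le_trans xy.
rewrite !powRN lef_pV2 ?posrE ?powR_gt0//.
by apply: ge0_ler_powR => //; rewrite nnegrE ltW.
Qed.

(** The measure here has tail [y^(-beta)], hence density [beta y^(-1-beta)], which explains the
    factor [beta] in front of the integral. *)
Lemma stable_riemann_stieltjes (beta a c : R) (L : nat) : (0 < L)%N -> 0 < beta ->
  0 < a -> a <= c ->
  `|beta * (\int[lebesgue_measure]_(y in `[a, c]) ((1 - cos y) * y `^ (- 1 - beta)))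
    - \sum_(l < L) (1 - cos (grid a c L l)) *
        ((grid a c L l) `^ (- beta) - (grid a c L l.+1) `^ (- beta))|
  <= (c - a) / L%:R * (a `^ (- beta)).
Proof.
move=> L0 b0 a0 ac.
have contf (f : R -> R) (x y : R) : a <= x ->
    (forall t : R, 0 < t -> exists l : R, is_derive t 1 f l) ->
    {within `[x, y], continuous f}.
  move=> ax df; apply: derive_within_continuous => t /andP[xt _]; apply: df.
  by apply: lt_le_trans a0 _; exact: le_trans xt.
have dw (t : R) : 0 < t -> exists l, is_derive t 1 (fun y : R => y `^ (- 1 - beta)) l.
  by move=> t0; eexists; derive_by; [exact: t0|reflexivity].
have df (t : R) : 0 < t -> exists l, is_derive t 1 (fun y : R => (1 - cos y) * y `^ (- 1 - beta)) l.
  by move=> t0; eexists; derive_by; [exact: t0|reflexivity].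
pose J x y := beta * (\int[lebesgue_measure]_(y in `[x, y]) ((1 - cos y) * y `^ (- 1 - beta))).
pose m x y : R := x `^ (- beta) - y `^ (- beta).
have mE x y : a <= x -> x <= y ->
    m x y = beta * \int[lebesgue_measure]_(y in `[x, y]) y `^ (- 1 - beta).
  move=> ax xy; have dF t : x <= t <= y -> is_derive t 1
      (fun t : R => - (beta^-1 * t `^ (- beta))) (t `^ (- 1 - beta)).
    move=> /andP[xt _]; derive_by; first by apply: lt_le_trans a0 _; exact: le_trans xt.
    rewrite (_ : - beta - 1 = - 1 - beta); last by ring.
    by field; rewrite gt_eqF.
  have -> := Rintegral_FTC2 xy dF (contf _ _ _ ax dw).
  by rewrite /m; field; rewrite gt_eqF.
apply: le_trans (@riemann_stieltjes_sum (fun x => 1 - cos x) J m a c L L0 ac _ _ _) _.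
- move=> x y z ax xy yz zc; rewrite /J -mulrDr; congr (_ * _).
  have fi : lebesgue_measure.-integrable `[x, z]
      (EFin \o (fun y : R => (1 - cos y) * y `^ (- 1 - beta))).
    by apply: continuous_itv_integrable; exact: contf.
  have := @Rintegral_itvB R _ (BLeft x) (BRight z) y fi.
  rewrite !bnd_simp => /(_ xy yz); rewrite Rintegral_itv_obnd_cbnd; last first.
    by apply: integrableS fi => //; apply: subset_itvr; rewrite bnd_simp.
  by move=> <-; ring.
- by move=> x y z _ _ _ _; rewrite /m; ring.
- move=> x y ax xy yc; have wi : lebesgue_measure.-integrable `[x, y]
      (EFin \o (fun y : R => y `^ (- 1 - beta))).
    by apply: continuous_itv_integrable; exact: contf.
  have fi : lebesgue_measure.-integrable `[x, y]
      (EFin \o (fun y : R => (1 - cos y) * y `^ (- 1 - beta))).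
    by apply: continuous_itv_integrable; exact: contf.
  rewrite mE// /J mulrCA -mulrBr -[X in _ * (_ - X)]RintegralZl// -RintegralB//; last first.
    by apply: (integrableZl _ (1 - cos x) wi).
  rewrite mulrCA normrM (gtr0_norm b0) ler_wpM2l ?(ltW b0)// -RintegralZl//.
  have gi : lebesgue_measure.-integrable `[x, y] (EFin \o
      (fun t : R => (1 - cos t) * t `^ (- 1 - beta) - (1 - cos x) * t `^ (- 1 - beta))).
    apply: continuous_itv_integrable; apply: contf => // t t0.
    by eexists; derive_by; [exact: t0|exact: t0|reflexivity].
  apply: (le_trans (le_normr_Rintegral _ gi)) => //.
  apply: le_Rintegral => //.
  + exact/integrable_norm.
  + by apply: (integrableZl _ (y - x) wi).
  + move=> t /=; rewrite in_itv/= => /andP[xt ty].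
    rewrite -mulrBl normrM [X in _ * X]ger0_norm ?powR_ge0// ler_wpM2r ?powR_ge0//.
    rewrite (_ : 1 - cos t - (1 - cos x) = - (cos t - cos x)); last by ring.
    by rewrite normrN (le_trans (cos_lipschitz xt))// lerD2r.
- rewrite ler_wpM2l ?divr_ge0 ?subr_ge0//.
  by rewrite /m gerBl powR_ge0.
Qed.

End riemann_stieltjes.

(** * Levy measures with power tails at 0 *)

Section stable_tails.
Context (R : realType) (nu : {measure set R -> \bar R}).
Hypothesis nu_levy : levy_measure nu.
Context (beta Kp Km : R).
Hypotheses (beta02 : 0 < beta < 2) (Kp0 : 0 <= Kp) (Km0 : 0 <= Km).
Hypothesis tails : tails_regular nu beta Kp Km.

Let tail (y : R) : R := levy_integral nu \1_[set x : R | y < `|x|].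

Let b0 : 0 < beta. Proof. by case/andP : beta02. Qed.

Let tailE y : 0 < y -> (tail y)%:E = (nu `]y, +oo[%classic + nu `]-oo, (- y)%R[%classic)%E.
Proof.
move=> y0; have d := levy_dominated_tail y0.
have mD : measurable [set~ (0 : R)] by apply: measurableC; exact: measurable_set1.
rewrite /tail /levy_integral /Rintegral fineK; last first.
  by apply: integrable_fin_num => //; exact: levy_dominated_integrable.
rewrite integral_indic//; last exact: measurable_gtr_norm.
rewrite -measureU//; last first.
  apply/seteqP; split => // x [] /=; rewrite !in_itv/= andbT => h1 h2; lra.
congr (nu _); apply/seteqP; split => x /=; rewrite !in_itv/= andbT.
  move=> [yx _]; have [x0|x0] := leP 0 x.
    by left; rewrite -(ger0_norm x0).
  by right; move: yx; rewrite ltr0_norm//; lra.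
move=> h; split; last by move=> xe; move: h; rewrite xe => -[]; lra.
by case: h => h; [rewrite ger0_norm|rewrite ltr0_norm]; lra.
Qed.

Let tail_cvg : x `^ beta * tail x @[x --> 0^'+] --> Kp + Km.
Proof.
have [hp hm] := tails.
have : ((x `^ beta * tail x)%:E @[x --> 0^'+] --> (Kp + Km)%:E)%E.
  rewrite EFinD; have c : ((x `^ beta)%:E * nu `]x, +oo[%classic +
      (x `^ beta)%:E * nu `]-oo, (- x)%R[%classic)%E @[x --> 0^'+] --> (Kp%:E + Km%:E)%E.
    exact: cvgeD.
  apply: cvg_trans c; apply: near_eq_cvg; near=> x.
  have x0 : 0 < x by near: x; exact: nbhs_right_gt.
  rewrite -ge0_muleDr//.
  by rewrite EFinM tailE.
by move/fine_cvgP => [].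
Unshelve. all: end_near. Qed.

Let tail_ge0 y : 0 <= tail y.
Proof. by apply: levy_integral_ge0 => x; rewrite indicE. Qed.

Let tail_anti x y : 0 < x -> x <= y -> tail y <= tail x.
Proof.
move=> x0 xy; apply: ler_levy_integral => //.
- by apply: levy_dominated_tail => //; exact: lt_le_trans xy.
- exact: levy_dominated_tail.
- move=> t; rewrite !indicE; have [/set_mem/= yt|_] := boolP (t \in [set t | y < `|t|]).
    by rewrite mem_set//= (le_lt_trans xy).
  by case: (_ \in _).
Qed.

(** Close to 0 this is the convergence of [x^beta tail x]. Up to 1 the tail is at most its value at
    a fixed point, while [x^(-beta)] is at least 1. *)
Let tail_bound : exists2 C, 0 <= C & forall x, 0 < x <= 1 -> tail x <= C * x `^ (- beta).
Proof.
have [x1 x10 h1] : exists2 x1 : R, 0 < x1 & forall x, 0 < x < x1 -> x `^ beta * tail x <= Kp + Km + 1.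
  have /cvgrPdist_le/(_ 1 ltr01) := tail_cvg.
  move=> [x1 /= x10 h]; exists x1 => // x /andP[x0 xx1].
  have := h x; rewrite /= sub0r normrN (gtr0_norm x0) => /(_ xx1 x0).
  by rewrite ler_norml => /andP[]; lra.
pose z := Num.min (x1 / 2) 1.
have z0 : 0 < z by rewrite lt_min ltr01 divr_gt0.
have zx : z < x1 by rewrite gt_min (_ : x1 / 2 < x1)//; lra.
exists (Kp + Km + 1 + tail z); first by rewrite addr_ge0 ?tail_ge0// addr_ge0// addr_ge0.
move=> x /andP[x0 xle1]; rewrite mulrDl.
have p0 := powR_ge0 x (- beta); have pp : 0 < x `^ beta by exact: powR_gt0.
have [xz|zx'] := ltP x z.
  rewrite -[leLHS]addr0; apply: lerD; last by rewrite mulr_ge0.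
  by rewrite powRN ler_pdivlMr// mulrC h1// x0 (lt_trans xz).
rewrite -[leLHS]add0r; apply: lerD; first by rewrite mulr_ge0// addr_ge0// addr_ge0.
apply: (@le_trans _ _ (tail z)); first exact: tail_anti.
rewrite -[leLHS]mulr1; apply: ler_wpM2l => //.
rewrite [X in X <= _](_ : 1 = 1 `^ (- beta)); last by rewrite powR1.
by apply: powR_anti => //; exact: ltW.
Qed.

Let small (r : R) : R := levy_integral nu (fun x => x ^+ 2 * \1_[set x : R | `|x| <= r] x).

Let small_half r : 0 < r -> small r <= small (r / 2) + r ^+ 2 * tail (r / 2).
Proof.
move=> r0; have r20 : 0 < r / 2 by lra.
have d1 := @levy_dominated_sqr R _ r0; have d2 := @levy_dominated_sqr R _ r20.
have d3 := levy_dominated_tail r20.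
rewrite -levy_integralZ// -levy_integralD//; last exact: levy_dominatedZ.
apply: ler_levy_integral => //; first by apply: levy_dominatedD => //; exact: levy_dominatedZ.
move=> x; rewrite !indicE.
have [/set_mem/= h1|h1] := boolP (x \in [set x | `|x| <= r]); last first.
  by rewrite mulr0 addr_ge0// mulr_ge0// sqr_ge0.
have x2 : x ^+ 2 <= r ^+ 2.
  by rewrite -(real_normK (num_real x)) lerXn2r ?nnegrE// ltW.
have [h2|h2] := leP `|x| (r / 2).
  by rewrite [x \in [set x | `|x| <= r / 2]]mem_set// lerDl mulr_ge0// sqr_ge0.
rewrite [x \in [set x | r / 2 < `|x|]]mem_set// !mulr1 (le_trans x2)// lerDr.
by rewrite mulr_ge0// sqr_ge0.
Qed.

Let mul_powR (y p q : R) : 0 < y -> y `^ p * y `^ q = y `^ (p + q).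
Proof. by move=> y0; rewrite powRD// (gt_eqF y0) implybT. Qed.

(** The shell between [r/2] and [r] contributes at most [r^2 tail (r/2)], of order [r^(2-beta)].
    Summing over dyadic shells gives a geometric series of ratio [2^(-(2-beta)) < 1], and what
    remains below [r/2^k] tends to 0 because small jumps carry little second moment. *)
Let small_bound : exists2 C, 0 <= C & forall r, 0 < r <= 1 -> small r <= C * r `^ (2 - beta).
Proof.
have [C C0 tC] := tail_bound.
have b2 : beta < 2 by case/andP : beta02.
pose q : R := 2^-1 `^ (2 - beta).
have half0 : 0 < 2^-1 :> R by lra.
have half1 : 2^-1 < 1 :> R by lra.
have q1 : q < 1.
  rewrite /q [X in _ < X](_ : 1 = 1 `^ (2 - beta)); last by rewrite powR1.
  by apply: gt0_ltr_powR; rewrite ?nnegrE ?ler01 ?subr_gt0// ltW.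
have q0 : 0 <= q by exact: powR_ge0.
pose D := C * 2 `^ beta.
have D0 : 0 <= D by rewrite mulr_ge0// powR_ge0.
exists (D / (1 - q)); first by rewrite divr_ge0// subr_ge0 ltW.
move=> r /andP[r0 r1].
have step s : 0 < s <= 1 -> small s <= small (s / 2) + D * s `^ (2 - beta).
  move=> /andP[s0 s1]; apply: (le_trans (small_half s0)); rewrite lerD2l.
  have s20 : 0 < s / 2 <= 1 by apply/andP; split; lra.
  apply: (@le_trans _ _ (s ^+ 2 * (C * (s / 2) `^ (- beta)))).
    by rewrite ler_wpM2l ?sqr_ge0// tC.
  rewrite powRM ?invr_ge0 ?(ltW s0)//.
  have -> : (2^-1 : R) `^ (- beta) = 2 `^ beta.
    by rewrite -powR_inv1// -powRrM mulrNN mul1r.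
  rewrite -mul_powR// -[s ^+ 2]powR_mulrn ?(ltW s0)// /D.
  by rewrite le_eqVlt; apply/orP; left; apply/eqP; ring.
have iter k : small r <= small (r / 2 ^+ k) + D * r `^ (2 - beta) * \sum_(j < k) q ^+ j.
  elim: k => [|k IH]; first by rewrite expr0 divr1 big_ord0 mulr0 addr0.
  apply: (le_trans IH); rewrite big_ord_recr/= mulrDr.
  have k2 : 0 < 2 ^+ k :> R by rewrite exprn_gt0.
  have sk : 0 < r / 2 ^+ k <= 1.
    rewrite divr_gt0//= ler_pdivrMr// mul1r (le_trans r1)// exprn_ege1//; lra.
  have := step _ sk; rewrite (_ : r / 2 ^+ k / 2 = r / 2 ^+ k.+1); last first.
    by rewrite exprSr invfM mulrA.
  rewrite powRM ?invr_ge0 ?(ltW r0) ?(ltW k2)//.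
  have -> : (2 ^+ k)^-1 `^ (2 - beta) = q ^+ k.
    by rewrite /q -powR_mulrn ?powR_ge0// -powRrM mulrC powRrM powR_mulrn ?invr_ge0// exprVn.
  by rewrite mulrA; lra.
have geo k : \sum_(j < k) q ^+ j <= (1 - q)^-1.
  rewrite -[leRHS]mul1r ler_pdivlMr ?subr_gt0//.
  have -> : (\sum_(j < k) q ^+ j) * (1 - q) = 1 - q ^+ k.
    have := subrX1 q k; lra.
  by rewrite gerBl exprn_ge0.
apply/ler_addgt0Pr => e e0.
have [s /andP[s0 s1] sms] := levy_small_jumps_cvg0 nu_levy e0.
have [k ks] : exists k, r / 2 ^+ k <= s.
  exists (Num.truncn s^-1).+1; rewrite ler_pdivrMr ?exprn_gt0//.
  apply: (le_trans r1); rewrite -ler_pdivrMl// mulr1.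
  apply: (@le_trans _ _ (Num.truncn s^-1).+1%:R); first exact/ltW/truncnS_gt.
  by rewrite -natrX ler_nat; apply/ltnW/ltn_expl.
have := iter k; have := sms (r / 2 ^+ k).
rewrite ks andbT divr_gt0 ?exprn_gt0// => /(_ isT); rewrite -/(small _) => h1 h2.
apply: (le_trans h2); rewrite addrC; apply: lerD => //.
rewrite [leRHS]mulrAC; apply: ler_wpM2l; last exact: geo.
by rewrite mulr_ge0// powR_ge0.
Qed.

(** The weight is split at [|x| = e] into [e^(-2)] times the second moment of the small jumps and
    the mass of the large ones; both are of order [e^(-beta)]. *)
Lemma stable_levy_scale_bound : exists2 C, 0 <= C &
  forall e, 0 < e <= 1 -> levy_scale nu e <= C * e `^ (- beta).
Proof.
have [C1 C10 h1] := small_bound; have [C2 C20 h2] := tail_bound.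
exists (C1 + C2); first exact: addr_ge0.
move=> e e01; have /andP[e0 e1] := e01.
apply: (@le_trans _ _ ((e^-1) ^+ 2 * small e + tail e)).
  have d1 := levy_dominated_scaled e0; have d2 := levy_dominated_sqr e0.
  have d3 := levy_dominated_tail e0.
  rewrite -levy_integralZ// -levy_integralD//; last exact: levy_dominatedZ.
  apply: ler_levy_integral => //; first by apply: levy_dominatedD => //; exact: levy_dominatedZ.
  move=> x; rewrite !indicE /levy_weight.
  have [h|h] := leP `|x| e.
    rewrite [x \in [set x | `|x| <= e]]mem_set// [x \in _]memNset; last first.
      by rewrite /= ltNge h.
    by rewrite mulr1 addr0 ge_min exprMn mulrC lexx orbT.
  rewrite [x \in [set x | e < `|x|]]mem_set// mulr1n ge_min; apply/orP; left.
  by rewrite lerDr mulr_ge0 ?sqr_ge0// mulr_ge0 ?sqr_ge0.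
rewrite mulrDl; apply: lerD; last exact: h2.
have -> : e `^ (- beta) = (e^-1) ^+ 2 * e `^ (2 - beta).
  rewrite -mul_powR// powR_mulrn ?(ltW e0)// mulrA -exprMn mulVf ?gt_eqF// expr1n mul1r //.
by rewrite mulrCA ler_wpM2l ?sqr_ge0// h1.
Qed.

Let K := Kp + Km.

(** The part of [levy_cos] at frequency [1/e] due to jumps whose size, in units of [e], lies between
    x and y. *)
Let middle (e x y : R) : R := levy_integral nu
  (fun t => (1 - cos (t / e)) * \1_[set t : R | e * x < `|t| <= e * y] t).

Let ring_ind (x y t : R) : x <= y ->
  \1_[set t : R | x < `|t| <= y] t = \1_[set t : R | x < `|t|] t - \1_[set t : R | y < `|t|] t :> R.
Proof.
move=> xy; rewrite !indicE.
have [h1|h1] := leP `|t| x.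
  rewrite !memNset ?subrr//= => -h; lra.
have [h2|h2] := leP `|t| y.
  rewrite (@mem_set _ [set t | x < `|t| <= y])//= ?h1// (@mem_set _ [set t | x < `|t|])//.
  by rewrite memNset ?subr0//= ltNge h2.
rewrite memNset; last by move=> /= /andP[_]; lra.
by rewrite !mem_set ?subrr//=; exact: h1.
Qed.

Let middle_riemann_stieltjes e x y (L : nat) : (0 < L)%N -> 0 < e -> 0 < x -> x <= y ->
  `|middle e x y - \sum_(l < L) (1 - cos (grid x y L l)) *
      (tail (e * grid x y L l) - tail (e * grid x y L l.+1))|
  <= (y - x) / L%:R * tail (e * x).
Proof.
move=> L0 e0 x0 xy.
have dI a c : 0 < a -> a <= c ->
    levy_dominated (fun t => \1_[set t : R | e * a < `|t| <= e * c] t : R).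
  move=> a0 ac; have c0 : 0 < c by exact: lt_le_trans ac.
  rewrite (_ : (fun t => _) = fun t => \1_[set t : R | e * a < `|t|] t - \1_[set t : R | e * c < `|t|] t).
    by apply: levy_dominatedB; apply: levy_dominated_tail; rewrite mulr_gt0.
  by apply/funext => t; rewrite ring_ind// ler_wpM2l// ltW.
have mc : measurable_fun setT (fun t : R => 1 - cos (t / e)).
  by apply: measurable_funB => //; apply: measurable_cos; exact: measurable_funM.
have dM a c : 0 < a -> a <= c -> levy_dominated
    (fun t => (1 - cos (t / e)) * \1_[set t : R | e * a < `|t| <= e * c] t).
  move=> a0 ac; apply: (@levy_dominatedW _ _ (fun t => 2 * \1_[set t : R | e * a < `|t| <= e * c] t)).
  - by apply: measurable_funM => //; exact: (dI _ _ a0 ac).1.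
  - by apply: levy_dominatedZ; exact: dI.
  - move=> t; rewrite !normrM ler_wpM2r// (ger0_norm (_ : 0 <= 1 - _)) ?subr_ge0 ?cos_le1//.
    by rewrite ger0_norm//; have := cos_geN1 (t / e); lra.
pose m a c := tail (e * a) - tail (e * c).
have mE a c : 0 < a -> a <= c -> m a c = levy_integral nu (\1_[set t : R | e * a < `|t| <= e * c]).
  move=> a0 ac; rewrite /m /tail -levy_integralB//; last 2 first.
  - by apply: levy_dominated_tail; rewrite mulr_gt0.
  - by apply: levy_dominated_tail; rewrite mulr_gt0// (lt_le_trans a0).
  by apply: eq_Rintegral => t _; rewrite ring_ind// ler_wpM2l// ltW.
apply: le_trans (@riemann_stieltjes_sum R (fun x => 1 - cos x) (middle e) m x y L L0 xy _ _ _) _.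
- move=> a c f xa ac cf fy; have a0 : 0 < a by exact: lt_le_trans xa.
  have c0 : 0 < c by exact: lt_le_trans ac.
  rewrite /middle -levy_integralD//; last 2 first.
  - exact: dM.
  - exact: dM.
  apply: eq_Rintegral => t _; rewrite -mulrDr; congr (_ * _).
  rewrite !ring_ind ?ler_wpM2l ?(ltW e0) ?(le_trans ac)//; ring.
- by move=> a c f _ _ _ _; rewrite /m; ring.
- move=> a c xa ac cy; have a0 : 0 < a by exact: lt_le_trans xa.
  rewrite mE// /middle -[X in _ - X]levy_integralZ//; last exact: dI.
  rewrite -levy_integralB//; last 2 first.
  - exact: dM.
  - by apply: levy_dominatedZ; exact: dI.
  rewrite -[leRHS]levy_integralZ//; last exact: dI.
  apply: ler_norm_levy_integral => //.
  - by apply: (levy_dominatedB (dM _ _ a0 ac) (levy_dominatedZ _ (dI _ _ a0 ac))).1.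
  - by apply: levy_dominatedZ; exact: dI.
  - move=> t; rewrite -mulrBl normrM indicE.
    have [/set_mem/= /andP[h1 h2]|_] := boolP (_ \in _); last by rewrite normr0 !mulr0.
    rewrite normr1 !mulr1 (_ : _ - _ = - (cos (`|t| / e) - cos a)); last first.
      have -> : cos (t / e) = cos (`|t| / e).
        have [t0|t0] := leP 0 t; first by rewrite ger0_norm.
        by rewrite ltr0_norm// mulNr cosN.
      ring.
    have at' : a <= `|t| / e by rewrite ler_pdivlMr// mulrC ltW.
    rewrite normrN (le_trans (cos_lipschitz at'))// lerD2r ler_pdivrMr// mulrC//.
- apply: ler_wpM2l; first by rewrite divr_ge0 ?subr_ge0.
  by rewrite /m gerBl.
Qed.

(** After multiplication by [e^beta], jumps below [e x] contribute at most order [x^(2-beta)] and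
    jumps above [e y] at most order [y^(-beta)]. On the ring between, both this integral and its
    candidate limit are close to sums over a grid of [x, y], and the tails at the grid points
    converge: [e^beta tail (e z)] tends to [K z^(-beta)]. *)
Lemma levy_cos_stable_limit :
  e `^ beta * levy_cos nu e^-1 @[e --> 0^'+] --> beta * K * one_sub_cos_constant beta.
Proof.
have [Cs Cs0 hs] := small_bound; have [Ct Ct0 ht] := tail_bound.
have b2 : beta < 2 by case/andP : beta02.
apply/cvgrPdist_le => eta eta0.
pose I (m : nat) : R :=
  \int[lebesgue_measure]_(y in `[m.+1%:R^-1, m.+1%:R]) ((1 - cos y) * y `^ (- 1 - beta)).
have K0 : 0 <= K by rewrite addr_ge0.
have cI := cvg_one_sub_cos_integral beta02.
have harm (c : R) : 0 < c -> m.+1%:R^-1 `^ c @[m --> \oo] --> (0 : R).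
  move=> c0; have /cvg_at_rightP := powR_cvg0 c0; apply; split.
    by move=> m; rewrite invr_gt0.
  exact: cvg_harmonic.
(* The cut-offs [x = 1/(m+1)] and [y = m+1] are fixed first, then the mesh, and only then is [e]
   sent to 0. *)
have [m [hI hsm htl]] : exists m, [/\ `|beta * K * one_sub_cos_constant beta - beta * K * I m| <= eta / 8,
    Cs * m.+1%:R^-1 `^ (2 - beta) <= eta / 8 & 2 * Ct * m.+1%:R^-1 `^ beta <= eta / 8].
  have e8 : 0 < eta / 8 by lra.
  have c1 : beta * K * I m @[m --> \oo] --> beta * K * one_sub_cos_constant beta by exact: cvgMr.
  have c2 : Cs * m.+1%:R^-1 `^ (2 - beta) @[m --> \oo] --> Cs * 0.
    by apply: cvgMr; apply: harm; lra.
  have c3 : 2 * Ct * m.+1%:R^-1 `^ beta @[m --> \oo] --> 2 * Ct * 0.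
    by apply: cvgMr; exact: harm.
  near \oo => m; exists m; split.
  - by near: m; move/cvgrPdist_le : c1 => /(_ _ e8).
  - near: m; move: c2; rewrite mulr0 => /cvgrPdist_le/(_ _ e8); apply: filterS => m.
    by rewrite sub0r normrN => /(le_trans (ler_norm _)).
  - near: m; move: c3; rewrite mulr0 => /cvgrPdist_le/(_ _ e8); apply: filterS => m.
    by rewrite sub0r normrN => /(le_trans (ler_norm _)).
pose x : R := m.+1%:R^-1; pose y : R := m.+1%:R.
have x0 : 0 < x by rewrite invr_gt0.
have x1 : x <= 1 by rewrite invf_le1 ?ltr0n// ler1n.
have y1 : 1 <= y by rewrite ler1n.
have xy : x <= y by exact: le_trans y1.
have y0 : 0 < y by exact: lt_le_trans y1.
(* One mesh for both discretisation errors: [Ct] bounds the rescaled Levy tail, [K] is the constant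
   of the limiting tail. *)
have [L L0 hL] : exists2 L : nat, (0 < L)%N &
    (y - x) / L%:R * ((Ct + K) * x `^ (- beta)) <= eta / 8.
  pose A := (y - x) * ((Ct + K) * x `^ (- beta)).
  have A0 : 0 <= A by rewrite mulr_ge0 ?subr_ge0// mulr_ge0 ?powR_ge0// addr_ge0.
  exists (Num.truncn ((eta / 8)^-1 * A)).+1 => //.
  rewrite mulrAC ler_pdivrMr ?ltr0n// -/A -ler_pdivrMl; last by lra.
  exact/ltW/truncnS_gt.
pose h := (y - x) / L%:R; pose p := grid x y L.
have h0 : 0 <= h by rewrite divr_ge0// subr_ge0.
have p0 l : 0 < p l by rewrite /p /grid ltr_pwDl// mulr_ge0.
pose f (l : nat) := 1 - cos (p l).
have tcv (z : R) : 0 < z -> e `^ beta * tail (e * z) @[e --> 0^'+] --> K * z `^ (- beta).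
  move=> z0; have zb0 : 0 < z `^ beta by exact: powR_gt0.
  apply/cvgrPdist_le => ep ep0.
  have /cvgrPdist_le/(_ (ep * z `^ beta) (mulr_gt0 ep0 zb0))[x2 /= x20 h2] := tail_cvg.
  exists (x2 / z); first exact: divr_gt0.
  move=> e /=; rewrite sub0r normrN => ex2 e0.
  have ez0 : 0 < e * z by exact: mulr_gt0.
  have := h2 (e * z); rewrite /= sub0r normrN (gtr0_norm ez0).
  rewrite -ltr_pdivlMr// -{1}(gtr0_norm e0) => /(_ ex2 ez0).
  rewrite powRM ?(ltW e0) ?(ltW z0)// -/K.
  rewrite -ler_pdivrMr// -[X in _ / X](gtr0_norm zb0) -normfV -normrM powRN.
  by congr (`|_| <= _); field; rewrite gt_eqF.
(* [S e] depends on the Levy measure through finitely many tails only, and so converges with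
   them. *)
pose S (e : R) := \sum_(l < L) f l * (e `^ beta * tail (e * p l) - e `^ beta * tail (e * p l.+1)).
pose S0 := \sum_(l < L) f l * (p l `^ (- beta) - p l.+1 `^ (- beta)).
have Scv : S e @[e --> 0^'+] --> K * S0.
  rewrite /S0 mulr_sumr; apply: cvg_sumr => l.
  rewrite mulrCA mulrBr; apply: cvgMr.
  by apply: cvgB; apply: tcv; exact: p0.
have yxb : y `^ (- beta) = x `^ beta.
  by rewrite /x -powR_inv1 ?(ltW y0)// -powRrM mulN1r.
have bI : `|beta * K * I m - K * S0| <= h * (K * x `^ (- beta)).
  rewrite (_ : _ - _ = K * (beta * I m - S0)); last by ring.
  rewrite mulrCA normrM (ger0_norm K0) ler_wpM2l//.
  exact: stable_riemann_stieltjes.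
have e8 : 0 < eta / 8 by lra.
near=> e.
have e0 : 0 < e by near: e; exact: nbhs_right_gt.
have ey : e * y <= 1.
  rewrite -ler_pdivlMr// mul1r; near: e; apply: nbhs_right_le; rewrite invr_gt0//.
have ex : e * x <= 1 by apply: le_trans ey; rewrite ler_wpM2l// ltW.
have ex0 : 0 < e * x by exact: mulr_gt0.
have ey0 : 0 < e * y by exact: mulr_gt0.
have eb0 : 0 < e `^ beta by exact: powR_gt0.
have hS : `|K * S0 - S e| <= eta / 8.
  by near: e; move/cvgrPdist_le : Scv => /(_ _ e8).
have hM : `|e `^ beta * middle e x y - S e| <= h * (Ct * x `^ (- beta)).
  have -> : S e = e `^ beta * \sum_(l < L) f l * (tail (e * p l) - tail (e * p l.+1)).
    by rewrite mulr_sumr; apply: eq_bigr => l _; ring.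
  rewrite -mulrBr normrM (gtr0_norm eb0).
  apply: (@le_trans _ _ (e `^ beta * (h * tail (e * x)))).
    by rewrite ler_wpM2l ?(ltW eb0)//; exact: middle_riemann_stieltjes.
  rewrite mulrCA ler_wpM2l//.
  have -> : Ct * x `^ (- beta) = e `^ beta * (Ct * (e * x) `^ (- beta)).
    rewrite powRM ?(ltW e0) ?(ltW x0)// mulrCA; congr (_ * _).
    by rewrite mulrA mul_powR// subrr powRr0 mul1r.
  by rewrite ler_wpM2l ?(ltW eb0)// ht// ex0.
have hD : `|levy_cos nu e^-1 - middle e x y| <= 2^-1 * (e^-1) ^+ 2 * small (e * x) + 2 * tail (e * y).
  have ds := levy_dominated_sqr ex0; have dt := levy_dominated_tail ey0.
  rewrite /small /tail -levy_integralZ// -levy_integralZ// -levy_integralD//;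
    [|exact: levy_dominatedZ|exact: levy_dominatedZ].
  have mI : measurable_fun setT (fun t : R => \1_[set t : R | e * x < `|t| <= e * y] t : R).
    rewrite (_ : (fun t => _) = fun t => \1_[set t : R | e * x < `|t|] t - \1_[set t : R | e * y < `|t|] t).
      by apply: measurable_funB; apply: measurable_indic; exact: measurable_gtr_norm.
    by apply/funext => t; rewrite ring_ind// ler_wpM2l// ltW.
  have mM : measurable_fun setT (fun t : R => (1 - cos (t / e)) * \1_[set t : R | e * x < `|t| <= e * y] t).
    apply: measurable_funM => //.
    by apply: measurable_funB => //; apply: measurable_cos; exact: measurable_funM.
  have dc := levy_dominated_cos e^-1.
  have dM : levy_dominated (fun t : R => (1 - cos (t / e)) * \1_[set t : R | e * x < `|t| <= e * y] t).
    apply: (levy_dominatedW mM dc) => t; rewrite normrM [e^-1 * t]mulrC ler_piMr//.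
    by rewrite indicE; case: (_ \in _); rewrite ?normr1 ?normr0.
  rewrite /levy_cos /middle -levy_integralB//.
  apply: ler_norm_levy_integral => //.
  - exact: (levy_dominatedB dc dM).1.
  - by apply: levy_dominatedD; apply: levy_dominatedZ.
  - move=> t; rewrite [e^-1 * t]mulrC -[X in X - _]mulr1 -mulrBr !indicE.
    have c0 : 0 <= 1 - cos (t / e) by rewrite subr_ge0 cos_le1.
    have [h1|h1] := leP `|t| (e * x).
      rewrite [t \in [set t | `|t| <= e * x]]mem_set// (@memNset _ [set t | _ < _ <= _]); last first.
        by move=> /= /andP[]; rewrite ltNge h1.
      rewrite subr0 !mulr1 ger0_norm//.
      apply: (@le_trans _ _ (2^-1 * e^-1 ^+ 2 * t ^+ 2)); last by rewrite lerDl mulr_ge0.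
      by apply: (le_trans (one_sub_cos_le _)); rewrite exprMn; lra.
    have [h2|h2] := leP `|t| (e * y).
      rewrite (@mem_set _ [set t | _ < _ <= _]) /= ?h1//.
      rewrite subrr mulr0 normr0; apply: addr_ge0; last by apply: mulr_ge0; rewrite ?ler0n.
      by apply: mulr_ge0; [by rewrite mulr_ge0 ?invr_ge0 ?sqr_ge0|by apply: mulr_ge0; rewrite ?sqr_ge0 ?ler0n].
    rewrite (@memNset _ [set t | _ < _ <= _]); last by move=> /= /andP[_]; rewrite leNgt h2.
    rewrite [t \in [set t | e * y < `|t|]]mem_set// subr0 !mulr1 ger0_norm//.
    apply: (@le_trans _ _ 2); first by have := cos_geN1 (t / e); lra.
    by rewrite lerDr; apply: mulr_ge0; [by rewrite mulr_ge0 ?invr_ge0 ?sqr_ge0|by apply: mulr_ge0; rewrite ?sqr_ge0 ?ler0n].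
have hD2 : `|e `^ beta * levy_cos nu e^-1 - e `^ beta * middle e x y| <= eta / 8 + eta / 8.
  rewrite -mulrBr normrM (gtr0_norm eb0).
  apply: (@le_trans _ _ (e `^ beta * (2^-1 * (e^-1) ^+ 2 * small (e * x) + 2 * tail (e * y)))).
    by rewrite ler_wpM2l ?(ltW eb0).
  rewrite mulrDr; apply: lerD.
    apply: (@le_trans _ _ (Cs * x `^ (2 - beta))); last exact: hsm.
    apply: (@le_trans _ _ (e `^ beta * (2^-1 * (e^-1) ^+ 2 * (Cs * (e * x) `^ (2 - beta))))).
      apply: ler_wpM2l; first exact: ltW.
      apply: ler_wpM2l; first by rewrite mulr_ge0 ?invr_ge0 ?sqr_ge0.
      by apply: hs; rewrite ex0.
    rewrite powRM ?(ltW e0) ?(ltW x0)//.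
    have h1 : e `^ beta * (e^-1 ^+ 2 * e `^ (2 - beta)) = 1.
      rewrite mulrCA mul_powR// addrC subrK powR_mulrn ?(ltW e0)//.
      by rewrite -exprMn mulVf ?gt_eqF// expr1n.
    rewrite (_ : _ * _ = (e `^ beta * (e^-1 ^+ 2 * e `^ (2 - beta))) * (2^-1 * (Cs * x `^ (2 - beta))));
      last by ring.
    rewrite h1 mul1r ler_piMl//; last by lra.
    by rewrite mulr_ge0// powR_ge0.
  apply: (@le_trans _ _ (2 * Ct * x `^ beta)); last exact: htl.
  rewrite -yxb.
  have -> : 2 * Ct * y `^ (- beta) = e `^ beta * (2 * (Ct * (e * y) `^ (- beta))).
    rewrite powRM ?(ltW e0) ?(ltW y0)//.
    rewrite [RHS](_ : _ = (e `^ beta * e `^ (- beta)) * (2 * Ct * y `^ (- beta))); last by ring.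
    by rewrite mul_powR// subrr powRr0 mul1r.
  by rewrite ler_wpM2l ?(ltW eb0)// ler_wpM2l// ht// ey0.
have hL' : h * (Ct * x `^ (- beta)) + h * (K * x `^ (- beta)) <= eta / 8.
  by rewrite -mulrDr -mulrDl.
have tri (a1 a2 a3 a4 a5 a6 : R) : `|a1 - a6| <=
    `|a1 - a2| + `|a2 - a3| + `|a3 - a4| + `|a4 - a5| + `|a5 - a6|.
  rewrite (_ : a1 - a6 = (a1 - a2) + (a2 - a3) + (a3 - a4) + (a4 - a5) + (a5 - a6)); last by ring.
  by do 4 (apply: (le_trans (ler_normD _ _)); rewrite lerD2r).
apply: (le_trans (tri _ (beta * K * I m) (K * S0) (S e) (e `^ beta * middle e x y) _)).
rewrite distrC in hM; rewrite distrC in hD2.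
by move: hI bI hS hM hD2 hL'; lra.
Unshelve. all: end_near. Qed.

End stable_tails.

(** * The properties of an exponent used by the limit theorem, and their proof in the two cases *)

Section regular_exponent.
Context (R : realType).

(* What the limit theorem needs to know about the real and imaginary parts [r]
   and [i] of a Levy exponent: [r u ~ - C0 |u|^beta] at infinity, and [i] is
   of the same order up to a drift. *)
Record regular_exponent (r i : R -> R) (beta C0 : R) : Prop := RegularExponent {
  regular_re0 : r 0 = 0 ;
  regular_reN : forall u, r (- u) = r u ;
  regular_re_le0 : forall u, r u <= 0 ;
  regular_imN : forall u, i (- u) = - i u ;
  regular_re_sub : forall l u v, 0 < l ->
    `|r (u + v) - r u - r v| <= - (l * r u + l^-1 * r v) ;
  regular_im_sub : forall l u v, 0 < l ->
    `|i (u + v) - i u - i v| <= - (l * r u + l^-1 * r v) ;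
  regular_bound : forall A, 0 <= A -> exists2 C, 0 <= C &
    forall e u, 0 < e <= 1 -> `|u| * e <= A ->
    `|r u| <= C * e `^ (- beta) /\ `|i u - u * e * i e^-1| <= C * e `^ (- beta) ;
  regular_asymptotics : forall eta, 0 < eta -> exists2 C, 0 <= C &
    forall u, `|r u + C0 * `|u| `^ beta| <= eta * `|u| `^ beta + C }.

End regular_exponent.

Section exponent_regularity.
Context (R : realType) (gamma b : R) (nu : {measure set R -> \bar R}).
Hypothesis nu_levy : levy_measure nu.
Implicit Types u e A eta C : R.

Let mul_powR (y p q : R) : 0 < y -> y `^ p * y `^ q = y `^ (p + q).
Proof. by move=> y0; rewrite powRD// (gt_eqF y0) implybT. Qed.

Let gauss_powR e : 0 < e -> e `^ (- 2) = (e^-1) ^+ 2.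
Proof. by move=> e0; rewrite powRN powR_mulrn ?(ltW e0)// exprVn. Qed.

(** The Gaussian part [b^2 u^2 / 2] is at most of order [e^(-2)], which fits the bound if [beta = 2]
    or [b = 0]; the jump part is governed by [levy_scale]. *)
Let scale_bound beta : 0 <= beta ->
  (b = 0 \/ beta = 2) ->
  (exists2 C, 0 <= C & forall e, 0 < e <= 1 -> levy_scale nu e <= C * e `^ (- beta)) ->
  forall A, 0 <= A -> exists2 C, 0 <= C &
    forall e u, 0 < e <= 1 -> `|u| * e <= A ->
    `|psi_re gamma b nu u| <= C * e `^ (- beta) /\
    `|psi_im gamma b nu u - u * e * psi_im gamma b nu e^-1| <= C * e `^ (- beta).
Proof.
move=> beta0 bb [C C0 hC] A A0.
have A2 : 0 <= A ^+ 2 by exact: sqr_ge0.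
have A3 : 0 <= A ^+ 3 by exact: exprn_ge0.
have b2 : 0 <= b ^+ 2 by exact: sqr_ge0.
exists (b ^+ 2 * A ^+ 2 + (3 + A + A ^+ 2 + A ^+ 3) * C).
  by rewrite addr_ge0// mulr_ge0//; lra.
move=> e u e01 ueA; have /andP[e0 e1] := e01.
have hs := hC e e01.
have s0 : 0 <= levy_scale nu e.
  by apply: levy_integral_ge0 => x; exact: levy_weight_ge0.
have p0 := powR_ge0 e (- beta).
have Cp0 : 0 <= C * e `^ (- beta) by rewrite mulr_ge0.
have quad : b ^+ 2 * u ^+ 2 / 2 <= b ^+ 2 * A ^+ 2 * e `^ (- beta).
  case: bb => [->|->]; first by rewrite expr0n !mul0r.
  rewrite gauss_powR//.
  have h : u ^+ 2 <= A ^+ 2 * e^-1 ^+ 2.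
    rewrite -exprMn -(real_normK (num_real u)) lerXn2r ?nnegrE//.
      by rewrite mulr_ge0// invr_ge0 ltW.
    by rewrite ler_pdivlMr.
  by have := ler_wpM2l b2 h; have := mulr_ge0 b2 (sqr_ge0 u); rewrite !mulrA; lra.
have k1 : levy_cos nu u <= (2 + A ^+ 2) * (C * e `^ (- beta)).
  apply: (le_trans (levy_cos_le_scale nu_levy e0 ueA)).
  by rewrite ler_wpM2l//; lra.
have k2 := psi_im_compensated gamma b nu_levy e0 ueA.
have k3 : (1 + A + A ^+ 3) * levy_scale nu e <= (1 + A + A ^+ 3) * (C * e `^ (- beta)).
  by rewrite ler_wpM2l//; lra.
have q0 := mulr_ge0 (mulr_ge0 b2 A2) p0.
have q1 := mulr_ge0 A0 Cp0; have q2 := mulr_ge0 A2 Cp0; have q3 := mulr_ge0 A3 Cp0.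
have c0 := levy_cos_ge0 nu u.
have u2 : 0 <= b ^+ 2 * u ^+ 2 / 2 by rewrite divr_ge0// mulr_ge0// sqr_ge0.
split.
  rewrite psi_reE// normrN ger0_norm ?addr_ge0//.
  by move: k1; rewrite !mulrDl -!mulrA; move: quad; rewrite -!mulrA; lra.
apply: (le_trans k2); apply: (le_trans k3).
by rewrite !mulrDl -!mulrA; move: q0; rewrite -!mulrA; lra.
Qed.

(** Jumps below a small r contribute at most [u^2] times their second moment, which is at most
    [eta]; those above r contribute at most twice their mass. Next to a Gaussian part the jumps are
    therefore negligible at high frequency. *)
Lemma levy_cos_subquadratic eta : 0 < eta -> exists2 C, 0 <= C &
  forall u, levy_cos nu u <= eta * u ^+ 2 + C.
Proof.
move=> eta0; have [r /andP[r0 r1] hr] := levy_small_jumps_cvg0 nu_levy eta0.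
have dt := levy_dominated_tail r0; have ds := levy_dominated_sqr r0.
exists (2 * levy_integral nu \1_[set x : R | r < `|x|]).
  by rewrite mulr_ge0// levy_integral_ge0// => x; rewrite indicE.
move=> u; have u2 := sqr_ge0 u.
apply: (@le_trans _ _ (u ^+ 2 * levy_integral nu (fun x => x ^+ 2 * \1_[set x : R | `|x| <= r] x)
  + 2 * levy_integral nu \1_[set x : R | r < `|x|])).
  rewrite -levy_integralZ// -levy_integralZ// -levy_integralD//; try exact: levy_dominatedZ.
  apply: ler_levy_integral => //.
  - exact: levy_dominated_cos.
  - by apply: levy_dominatedD; apply: levy_dominatedZ.
  move=> x; rewrite !indicE; have [h|h] := leP `|x| r.
    rewrite [x \in [set x | `|x| <= r]]mem_set// [x \in _]memNset; last first.
      by rewrite /= ltNge h.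
    rewrite mulr1 mulr0 addr0; apply: (le_trans (one_sub_cos_le _)).
    by rewrite exprMn; have := mulr_ge0 u2 (sqr_ge0 x); lra.
  rewrite [x \in [set x | r < `|x|]]mem_set// mulr1.
  apply: (@le_trans _ _ 2); first by have := cos_geN1 (u * x); lra.
  by rewrite lerDr mulr_ge0// mulr_ge0 ?sqr_ge0.
rewrite lerD2r mulrC ler_wpM2r//; apply: hr; rewrite r0 lexx//.
Qed.

Lemma gaussian_regular_exponent :
  regular_exponent (psi_re gamma b nu) (psi_im gamma b nu) 2 (b ^+ 2 / 2).
Proof.
split.
- exact: psi_re0.
- exact: psi_reN.
- exact: psi_re_le0.
- exact: psi_imN.
- by move=> l u v; exact: psi_re_subadditive.
- by move=> l u v; exact: psi_im_subadditive.
- apply: scale_bound => //; first by right.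
  exists (levy_scale nu 1); first by apply: levy_integral_ge0 => x; exact: levy_weight_ge0.
  move=> e /andP[e0 e1]; rewrite gauss_powR// mulrC -levy_integralZ//; last exact: levy_dominated_scaled.
  apply: ler_levy_integral.
  + exact: nu_levy.
  + exact: levy_dominated_scaled.
  + by apply: levy_dominatedZ; exact: levy_dominated_scaled.
  move=> x; rewrite /levy_weight divr1 exprMn.
  have e2 : 1 <= e^-1 ^+ 2 by rewrite exprn_ege1// invf_ge1.
  have x2 := sqr_ge0 x.
  by have [h1|h1] := leP 1 (x ^+ 2); have [h2|h2] := leP 1 (x ^+ 2 * e^-1 ^+ 2); nra.
- move=> eta eta0; have [C C0 hC] := levy_cos_subquadratic eta0.
  exists C => // u; rewrite psi_reE// powR_mulrn// real_normK ?num_real//.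
  rewrite (_ : _ + _ = - levy_cos nu u); last by field.
  by rewrite normrN ger0_norm ?levy_cos_ge0.
Qed.

Lemma stable_regular_exponent (beta Kp Km : R) : b = 0 -> 0 < beta < 2 ->
  0 <= Kp -> 0 <= Km -> tails_regular nu beta Kp Km ->
  regular_exponent (psi_re gamma b nu) (psi_im gamma b nu) beta
    (beta * (Kp + Km) * one_sub_cos_constant beta).
Proof.
move=> bE beta02 Kp0 Km0 tails; have /andP[beta0 beta2] := beta02.
have sb := stable_levy_scale_bound nu_levy beta02 Kp0 Km0 tails.
split.
- exact: psi_re0.
- exact: psi_reN.
- exact: psi_re_le0.
- exact: psi_imN.
- by move=> l u v; exact: psi_re_subadditive.
- by move=> l u v; exact: psi_im_subadditive.
- by apply: scale_bound => //; [exact: ltW|left].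
- move=> eta eta0; set c := _ * one_sub_cos_constant beta.
  have := levy_cos_stable_limit nu_levy beta02 Kp0 Km0 tails.
  move=> /cvgrPdist_le/(_ _ eta0)[e0 /= e00 he].
  (* Frequencies beyond [U] fall within reach of the limit at [e = 1/|u|]; below [U] both terms are
     bounded and go into the additive constant. *)
  pose U := e0^-1 + 1.
  have U0 : 0 < U by rewrite addr_gt0// invr_gt0.
  exists ((2 + U ^+ 2) * levy_scale nu 1 + `|c| * U `^ beta).
    rewrite addr_ge0// mulr_ge0 ?powR_ge0//; last first.
      by apply: levy_integral_ge0 => x; exact: levy_weight_ge0.
    by have := sqr_ge0 U; lra.
  move=> u; rewrite psi_reE// bE expr0n !mul0r add0r addrC distrC.
  have s0 : 0 <= levy_scale nu 1.
    by apply: levy_integral_ge0 => x; exact: levy_weight_ge0.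
  have t0 : 0 <= (2 + U ^+ 2) * levy_scale nu 1.
    by rewrite mulr_ge0//; have := sqr_ge0 U; lra.
  have r0 : 0 <= `|c| * U `^ beta by rewrite mulr_ge0 ?powR_ge0.
  have [uU|uU] := leP `|u| U.
    rewrite -[leLHS]add0r; apply: lerD; first by rewrite mulr_ge0 ?powR_ge0// ltW.
    apply: ler_normB_bound.
      rewrite ger0_norm ?levy_cos_ge0//.
      by apply: levy_cos_le_scale => //; rewrite mulr1.
    rewrite normrM [X in _ * X]ger0_norm ?powR_ge0// ler_wpM2l//.
    by apply: ge0_ler_powR; rewrite ?nnegrE ?(ltW beta0)// ltW.
  rewrite -[leLHS]addr0; apply: lerD; last exact: addr_ge0.
  have u0 : 0 < `|u| by exact: lt_trans uU.
  have up0 : 0 < `|u| `^ beta by exact: powR_gt0.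
  have ue : `|u|^-1 < e0.
    rewrite -[e0]invrK ltf_pV2 ?posrE ?invr_gt0//; apply: lt_trans uU; rewrite /U; lra.
  have := he `|u|^-1; rewrite /= sub0r normrN normfV normr_id => /(_ ue).
  rewrite invr_gt0 => /(_ u0); rewrite invrK levy_cos_norm.
  have -> : `|u|^-1 `^ beta = (`|u| `^ beta)^-1.
    by rewrite -[X in X `^ _](powR_inv1 (ltW u0)) -powRrM mulN1r powRN.
  move=> h; rewrite -(ler_pM2r up0) in h; apply: le_trans h.
  rewrite -[X in _ <= _ * X](gtr0_norm up0) -normrM distrC.
  by rewrite -/c mulrBl [_^-1 * _ * _]mulrAC mulVf ?gt_eqF// mul1r.
Qed.

End exponent_regularity.

(** * Levy's continuity theorem *)

Section trigonometric_polynomials.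
Context (R : realType) (k : nat).
Implicit Types (z u : 'I_k -> R) (x : 'rV[R]_k).

(** Measurability, boundedness and convergence of expectations pass to sums and multiples, so that
    each is proved for the whole class by induction from the characteristic functions. *)
Inductive trig_poly : ('rV[R]_k -> R) -> Prop :=
| trig_cos z : trig_poly (fun x => cos (\sum_j z j * x 0 j))
| trig_sin z : trig_poly (fun x => sin (\sum_j z j * x 0 j))
| trig_add f g : trig_poly f -> trig_poly g -> trig_poly (fun x => f x + g x)
| trig_scale c f : trig_poly f -> trig_poly (fun x => c * f x).

Lemma trig_cst c : trig_poly (fun=> c).
Proof.
rewrite (_ : (fun=> c) = (fun x : 'rV[R]_k => c * cos (\sum_j (fun=> 0) j * x 0 j))).
  by apply: trig_scale; exact: trig_cos.
by apply/funext => x; rewrite big1 ?cos0 ?mulr1// => i _; rewrite mul0r.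
Qed.

Let sum_shift z z' (e : R) x : \sum_j (z j + e * z' j) * x 0 j =
  \sum_j z j * x 0 j + e * \sum_j z' j * x 0 j.
Proof. by rewrite mulr_sumr -big_split/=; apply: eq_bigr => j _; ring. Qed.

Let trig_cos_shift z z' e :
  trig_poly (fun x => cos (\sum_j z j * x 0 j + e * \sum_j z' j * x 0 j)).
Proof. by under eq_fun do rewrite -sum_shift; exact: trig_cos. Qed.

Let trig_sin_shift z z' e :
  trig_poly (fun x => sin (\sum_j z j * x 0 j + e * \sum_j z' j * x 0 j)).
Proof. by under eq_fun do rewrite -sum_shift; exact: trig_sin. Qed.

(** Two nested inductions reduce to a product of two sines or cosines, which the product-to-sum
    formulas rewrite with the frequencies added and subtracted. *)
Lemma trig_mul f g : trig_poly f -> trig_poly g -> trig_poly (fun x => f x * g x).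
Proof.
move=> tf; elim: tf g => [z|z|f1 f2 _ IH1 _ IH2|c f' _ IH] g tg.
- elim: tg => [z'|z'|g1 g2 _ IH1 _ IH2|c g' _ IH].
  + rewrite (_ : (fun x => _) = fun x => 2^-1 *
       (cos (\sum_j z j * x 0 j + 1 * \sum_j z' j * x 0 j) +
        cos (\sum_j z j * x 0 j + (-1) * \sum_j z' j * x 0 j))); last first.
      by apply/funext => x; rewrite mul1r !mulN1r cosD cosB; field.
    by apply: trig_scale; apply: trig_add; exact: trig_cos_shift.
  + rewrite (_ : (fun x => _) = fun x => 2^-1 *
       (sin (\sum_j z j * x 0 j + 1 * \sum_j z' j * x 0 j) +
        (-1) * sin (\sum_j z j * x 0 j + (-1) * \sum_j z' j * x 0 j))); last first.
      by apply/funext => x; rewrite mul1r !mulN1r sinD sinB; field.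
    by apply: trig_scale; apply: trig_add; [|apply: trig_scale]; exact: trig_sin_shift.
  + by under eq_fun do rewrite mulrDr; exact: trig_add.
  + by under eq_fun do rewrite mulrCA; exact: trig_scale.
- elim: tg => [z'|z'|g1 g2 _ IH1 _ IH2|c g' _ IH].
  + rewrite (_ : (fun x => _) = fun x => 2^-1 *
       (sin (\sum_j z j * x 0 j + 1 * \sum_j z' j * x 0 j) +
        sin (\sum_j z j * x 0 j + (-1) * \sum_j z' j * x 0 j))); last first.
      by apply/funext => x; rewrite mul1r !mulN1r sinD sinB; field.
    by apply: trig_scale; apply: trig_add; exact: trig_sin_shift.
  + rewrite (_ : (fun x => _) = fun x => 2^-1 *
       (cos (\sum_j z j * x 0 j + (-1) * \sum_j z' j * x 0 j) +
        (-1) * cos (\sum_j z j * x 0 j + 1 * \sum_j z' j * x 0 j))); last first.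
      by apply/funext => x; rewrite mul1r !mulN1r cosB cosD; field.
    by apply: trig_scale; apply: trig_add; [|apply: trig_scale]; exact: trig_cos_shift.
  + by under eq_fun do rewrite mulrDr; exact: trig_add.
  + by under eq_fun do rewrite mulrCA; exact: trig_scale.
- by under eq_fun do rewrite mulrDl; apply: trig_add; [exact: IH1|exact: IH2].
- by under eq_fun do rewrite -mulrA; apply: trig_scale; exact: IH.
Qed.

Lemma trig_bounded f : trig_poly f -> exists M, forall x, `|f x| <= M.
Proof.
elim => [z|z|f1 f2 _ [M1 b1] _ [M2 b2]|c f' _ [M b]].
- by exists 1 => x; exact: norm_cos_le1.
- by exists 1 => x; exact: norm_sin_le1.
- by exists (M1 + M2) => x; apply: (le_trans (ler_normD _ _)); exact: lerD.
- by exists (`|c| * M) => x; rewrite normrM ler_wpM2l.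
Qed.

End trigonometric_polynomials.

(* Bernstein polynomials: [bernstein N phi u] is the expectation of [phi] under
   the binomial law with parameters N and u. *)
Section bernstein.
Context (R : realType).
Implicit Types (phi : nat -> R) (u c : R).

Fixpoint bernstein (N : nat) phi u : R :=
  if N is N'.+1 then u * bernstein N' (phi \o S) u + (1 - u) * bernstein N' phi u
  else phi 0%N.

Lemma bernstein_cst N c u : bernstein N (fun=> c) u = c.
Proof. by elim: N => [//|N IH] /=; rewrite (_ : _ \o S = fun=> c)// IH; ring. Qed.

Lemma bernsteinD N phi psi u :
  bernstein N (fun l => phi l + psi l) u = bernstein N phi u + bernstein N psi u.
Proof.
elim: N phi psi => [//|N IH] phi psi /=.
by rewrite (IH phi) (_ : _ \o S = fun l => (phi \o S) l + (psi \o S) l)// IH; ring.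
Qed.

Lemma bernsteinZ N phi c u : bernstein N (fun l => c * phi l) u = c * bernstein N phi u.
Proof.
elim: N phi => [//|N IH] phi /=.
by rewrite (IH phi) (_ : _ \o S = fun l => c * (phi \o S) l)// IH; ring.
Qed.

Lemma ler_bernstein N phi psi u : 0 <= u <= 1 -> (forall l, (l <= N)%N -> phi l <= psi l) ->
  bernstein N phi u <= bernstein N psi u.
Proof.
move=> /andP[u0 u1]; elim: N phi psi => [|N IH] phi psi le_l /=; first exact: le_l.
apply: lerD; rewrite ler_wpM2l ?subr_ge0//; apply: IH => l lN; apply: le_l => //.
exact: leqW.
Qed.

Lemma ler_norm_bernstein N phi psi u : 0 <= u <= 1 ->
  (forall l, (l <= N)%N -> `|phi l| <= psi l) ->
  `|bernstein N phi u| <= bernstein N psi u.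
Proof.
move=> u01 le_l; rewrite ler_norml; apply/andP; split.
  rewrite -mulN1r -bernsteinZ; apply: ler_bernstein => // l /le_l.
  by rewrite ler_norml mulN1r => /andP[].
by apply: ler_bernstein => // l /le_l; rewrite ler_norml => /andP[].
Qed.

(** Variance plus squared bias of a binomial variable around [c]. In the induction a success shifts
    the centre to [c - 1]. *)
Lemma bernstein_variance N c u :
  bernstein N (fun l => (l%:R - c) ^+ 2) u = N%:R * u * (1 - u) + (N%:R * u - c) ^+ 2.
Proof.
elim: N c => [|N IH] c /=; first by rewrite !mul0r !add0r.
rewrite (_ : _ \o S = fun l => (l%:R - (c - 1)) ^+ 2); last first.
  by apply/funext => l /=; rewrite -natr1; ring.
by rewrite !IH -natr1; ring.
Qed.

Lemma bernstein_deviation N u : (0 < N)%N -> 0 <= u <= 1 ->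
  bernstein N (fun l => (l%:R / N%:R - u) ^+ 2) u <= (4 * N%:R)^-1.
Proof.
move=> N0 /andP[u0 u1]; have N0' : 0 < N%:R :> R by rewrite ltr0n.
rewrite (_ : (fun l => _) = fun l => (N%:R ^- 2) * (l%:R - N%:R * u) ^+ 2); last first.
  by apply/funext => l; field; rewrite gt_eqF.
rewrite bernsteinZ bernstein_variance subrr expr0n addr0.
rewrite (_ : _ * _ = (u * (1 - u)) * N%:R^-1); last by field; rewrite gt_eqF.
rewrite invfM ler_wpM2r ?invr_ge0 ?ler0n//.
have : 0 <= (u - 2^-1) ^+ 2 by exact: sqr_ge0.
by lra.
Qed.

Context (k : nat).
Implicit Types (F : ('I_k -> nat) -> R) (s : seq 'I_k) (l : 'I_k -> nat) (v : 'I_k -> R).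

Definition set_coordinate l j m : 'I_k -> nat := fun i => if i == j then m else l i.

(** The expectation of [F] when the coordinates listed in [s] are drawn independently from binomial
    laws with parameters N and [v j], the others keeping their values in [l]. *)
Fixpoint multi_bernstein N s F v l : R :=
  if s is j :: s' then
    bernstein N (fun m => multi_bernstein N s' F v (set_coordinate l j m)) (v j)
  else F l.

(** An error bounded by a sum of functions of one coordinate each stays so under averaging: drawing
    one coordinate averages one term and leaves the others fixed. *)
Lemma multi_bernstein_close N s F v l c (q : 'I_k -> nat -> R) : uniq s ->
  (forall j, 0 <= v j <= 1) -> (forall j, (l j <= N)%N) ->
  (forall l, (forall j, (l j <= N)%N) -> `|F l - c| <= \sum_j q j (l j)) ->
  `|multi_bernstein N s F v l - c| <=
    \sum_j (if j \in s then bernstein N (q j) (v j) else q j (l j)).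
Proof.
move=> + v01 + Fc; elim: s l => [|j s IH] l /=.
  by move=> _ lN; exact: Fc.
move=> /andP[js us] lN.
rewrite -(bernstein_cst N c (v j)) -[X in _ - X]mul1r -mulNr -bernsteinZ -bernsteinD.
pose A := \sum_(i < k | i != j) (if i \in s then bernstein N (q i) (v i) else q i (l i)).
apply: (@le_trans _ _ (bernstein N (fun m => A + q j m) (v j))).
  apply: ler_norm_bernstein => // m mN; rewrite mulN1r.
  apply: (le_trans (IH _ us _)).
    by move=> i; rewrite /set_coordinate; case: ifP.
  rewrite (bigD1 j)//= (negbTE js) /set_coordinate eqxx addrC lerD2r.
  by apply: ler_sum => i ij; rewrite (negbTE ij).
rewrite bernsteinD bernstein_cst [leRHS](bigD1 j)//= in_cons eqxx/= -/A [leLHS]addrC lerD2l.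
by apply: ler_sum => i ij; rewrite in_cons (negbTE ij).
Qed.

Lemma trig_multi_bernstein k' N s F (v : 'I_k -> 'rV[R]_k' -> R) l :
  (forall j, trig_poly (v j)) ->
  trig_poly (fun x => multi_bernstein N s F (fun j => v j x) l).
Proof.
move=> tv; elim: s l => [|j s IH] l /=; first exact: trig_cst.
suff gen n (G : nat -> 'rV[R]_k' -> R) : (forall m, trig_poly (G m)) ->
    trig_poly (fun x => bernstein n (G ^~ x) (v j x)).
  by apply: (gen N (fun m x => multi_bernstein N s F (v ^~ x) (set_coordinate l j m))).
elim: n G => [|n IHn] G tG /=; first exact: tG.
apply: trig_add; apply: trig_mul.
- exact: tv.
- exact: (IHn (fun m x => G m.+1 x)).
- under eq_fun do rewrite -mulN1r.
  by apply: trig_add; [exact: trig_cst|apply: trig_scale; exact: tv].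
- exact: IHn.
Qed.

End bernstein.

Section trigonometric_approximation.
Context (R : realType) (k : nat).
Implicit Types (x y : 'rV[R]_k) (f g : 'rV[R]_k -> R).

(** Compactness of the cube. The second point may lie outside it. *)
Lemma uniform_continuity_cube g : continuous g -> forall e : R, 0 < e ->
  exists2 delta : R, 0 < delta & forall x y, (forall j, 0 <= x 0 j <= 1) ->
    (forall j, `|x 0 j - y 0 j| < delta) -> `|g x - g y| < e.
Proof.
move=> cg e e0.
have cpt := @rV_compact R k (fun=> `[0, 1]%classic) (fun=> @segment_compact R 0 1).
have /compact_near_coveringP/(_ R (0^'+) (fun delta x => forall y,
    (forall j, `|x 0 j - y 0 j| < delta) -> `|g x - g y| < e)) := cpt.
have [h|] := pselect (forall x : 'rV[R]_k,
    [set x : 'rV[R]_k | forall j, `[0, 1]%classic (x ord0 j)] x ->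
    \forall x' \near x & delta \near 0^'+, forall y,
    (forall j, `|(x' : 'rV[R]_k) 0 j - y 0 j| < delta) -> `|g x' - g y| < e); last first.
  move=> h _; exfalso; apply: h => x0 _.
  have e2 : 0 < e / 2 by rewrite divr_gt0.
  have /cvgrPdist_lt/(_ _ e2)/nbhs_ballP[r /= r0 hr] := cg x0.
  have r2 : 0 < r / 2 by rewrite divr_gt0.
  exists (ball x0 (r / 2), [set delta | delta < r / 2]) => /=.
    split; first exact: nbhsx_ballx.
    by apply: nbhs_right_lt.
  move=> [x' delta] /= [[_ xx'] dr] y xy.
  have h1 : `|g x0 - g x'| < e / 2.
    apply: hr; split => // i j; apply: (le_ball _ (xx' i j)).
    by lra.
  have h2 : `|g x0 - g y| < e / 2.
    apply: hr; split => // i j; rewrite (_ : r = r / 2 + r / 2); last by field.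
    apply: (ball_triangle (xx' i j)); rewrite /ball/= (ord1 i).
    exact: (lt_trans (xy j)).
  have := ler_distD (g x0) (g x') (g y); rewrite (distrC (g x') (g x0)).
  by lra.
move=> /(_ _ h) {}h.
near (0 : R)^'+ => delta.
exists delta; first by near: delta; exact: nbhs_right_gt.
move=> x y x01 xy; have : forall x, (forall j, 0 <= x 0 j <= 1) -> forall y,
    (forall j, `|x 0 j - y 0 j| < delta) -> `|g x - g y| < e.
  near: delta; apply: filterS h => delta hdelta x1 hx1; apply: hdelta => j /=.
  by rewrite in_itv/=; exact: hx1.
by apply.
Unshelve. all: by end_near. Qed.

(** Bernstein's argument: a grid point within [delta] of v in all coordinates costs [e1] by uniform
    continuity; otherwise some coordinate deviates by at least [delta], and the crude bound [2 Mg]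
    is dominated by a multiple of its squared deviation, whose mean is at most [1/(4N)]. *)
Lemma bernstein_approx g (Mg : R) : continuous g -> (forall x, `|g x| <= Mg) ->
  forall e : R, 0 < e -> exists N, forall v : 'I_k -> R, (forall j, 0 <= v j <= 1) ->
    `|multi_bernstein N (enum 'I_k) (fun l => g (\row_j ((l j)%:R / N%:R))) v (fun=> 0%N)
      - g (\row_j v j)| <= e.
Proof.
move=> cg bg e e0.
have Mg0 : 0 <= Mg by exact: le_trans (normr_ge0 _) (bg 0).
have k0 : 0 < k.+1%:R :> R by rewrite ltr0n.
(* [k.+1] instead of [k] keeps the denominator positive in dimension 0. *)
pose e1 := e / (2 * k.+1%:R).
have e10 : 0 < e1 by rewrite divr_gt0// mulr_gt0.
have e1E : k.+1%:R * (2 * e1) = e by rewrite /e1; field; rewrite gt_eqF.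
have [|delta delta0 hdelta] := uniform_continuity_cube cg (e := e1) _ => //.
pose C := 2 * Mg / delta ^+ 2.
have C0 : 0 <= C by rewrite divr_ge0 ?sqr_ge0// mulr_ge0.
have [N [N0 CN]] : exists N : nat, (0 < N)%N /\ C * (4 * N%:R)^-1 <= e1.
  exists (Num.truncn (C / e1)).+1; split=> //; set N := (Num.truncn _).+1.
  have N0 : 0 < N%:R :> R by rewrite ltr0n.
  rewrite ler_pdivrMr ?mulr_gt0// mulrC -ler_pdivrMr//.
  have : C / e1 < N%:R by exact: truncnS_gt.
  lra.
exists N => v v01.
pose q (j : 'I_k) (m : nat) := e1 + C * (m%:R / N%:R - v j) ^+ 2.
apply: (le_trans (multi_bernstein_close (q := q) _ v01 _ _)).
- exact: enum_uniq.
- by [].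
- move=> l lN; have [near_l|] := pselect (forall j, `|v j - (l j)%:R / N%:R| < delta).
  + have [k_eq0|k_neq0] := posnP k.
      rewrite [leLHS](_ : _ = 0); last first.
        apply/eqP; rewrite normr_eq0 subr_eq0; apply/eqP; congr g; apply/rowP => j.
        by exfalso; have := ltn_ord j; rewrite [X in (_ < X)%N]k_eq0.
      by apply: sumr_ge0 => j _; rewrite addr_ge0// ?(ltW e10)// mulr_ge0// sqr_ge0.
    rewrite distrC; apply: (le_trans (ltW (hdelta _ _ _ _))).
    * by move=> j; rewrite mxE.
    * by move=> j; rewrite !mxE.
    * rewrite (bigD1 (Ordinal k_neq0))//= -[leLHS]addr0 lerD//.
        by rewrite lerDl mulr_ge0// sqr_ge0.
      by apply: sumr_ge0 => j _; rewrite addr_ge0// ?(ltW e10)// mulr_ge0// sqr_ge0.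
  + move=> /existsNP[j /negP]; rewrite -leNgt => far.
    apply: (@le_trans _ _ (2 * Mg)).
      by apply: (le_trans (ler_normB _ _)); have := bg (\row_j ((l j)%:R / N%:R));
        have := bg (\row_j v j); lra.
    rewrite (bigD1 j)//= -[leLHS]addr0 lerD//; last first.
      by apply: sumr_ge0 => i _; rewrite addr_ge0// ?(ltW e10)// mulr_ge0// sqr_ge0.
    apply: (@le_trans _ _ (C * ((l j)%:R / N%:R - v j) ^+ 2)); last first.
      by rewrite lerDr (ltW e10).
    rewrite [leLHS](_ : _ = C * delta ^+ 2); last by rewrite /C; field; rewrite gt_eqF.
    rewrite ler_wpM2l// -[leRHS]ger0_norm ?sqr_ge0// normrX ler_sqr ?nnegrE ?(ltW delta0)//.
    by rewrite distrC.
- apply: (@le_trans _ _ (\sum_(j < k) (2 * e1))).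
    apply: ler_sum => j _; rewrite mem_enum inE /q.
    rewrite bernsteinD bernsteinZ bernstein_cst.
    have := ler_wpM2l C0 (bernstein_deviation N0 (v01 j)).
    by move: CN; lra.
  rewrite sumr_const card_ord -[leLHS]mulr_natl -e1E ler_wpM2r ?ler_nat// mulr_ge0//.
  exact: ltW.
Qed.

Lemma continuous_row_map (h : R -> R) : continuous h ->
  continuous (fun x : 'rV[R]_k => \row_j h (x 0 j)).
Proof.
move=> ch x A /= [Q hQ QA]; exists (fun i j => h @^-1` Q i j) => [i j|y hy].
  by have := hQ i j; rewrite mxE (ord1 i) => /ch.
by apply: QA => i j; rewrite mxE; have := hy i j; rewrite (ord1 i).
Qed.

(** On the cube of half-side M the map from x to [(1 + sin (x_j / (2M))) / 2] is injective, since
    its arguments stay in [-1/2, 1/2], and takes values in [0, 1]. Hence f is there a continuous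
    function g of these variables, and a Bernstein polynomial of g in them is a trigonometric
    polynomial in x. As g keeps the bound K, the approximant is bounded by [K + e] on the whole
    space, which is what controls expectations outside the cube. *)
Lemma trig_approx f (K : R) : continuous f -> (forall x, `|f x| <= K) ->
  forall M e : R, 0 < M -> 0 < e -> exists p, [/\ trig_poly p,
    forall x, (forall j, `|x 0 j| <= M) -> `|p x - f x| <= e &
    forall x, `|p x| <= K + e].
Proof.
move=> cf bf M e M0 e0.
have sin2 : 0 < sin (2^-1 : R).
  by apply: sin_gt0_pihalf; have := pi_ge2 R; lra.
(* Clipping at [sin (1/2) < 1] keeps [asin] away from the ends of its domain, so that g is
   continuous everywhere. *)
pose clip (y : R) := Num.max (- sin 2^-1) (Num.min (sin 2^-1) (2 * y - 1)).
have clipK (y : R) : - sin (2^-1 : R) <= clip y <= sin 2^-1.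
  rewrite /clip le_max lexx/= ge_max ge_min lexx/= andbT; lra.
have sin21 : sin (2^-1 : R) < 1.
  rewrite lt_neqAle sin_le1 andbT; apply/eqP => s1.
  have := cos2Dsin2 (2^-1 : R); rewrite s1 expr1n => /eqP.
  rewrite -[X in _ == X]add0r (inj_eq (addIr _)) sqrf_eq0 gt_eqF//.
  by apply: cos_gt0_pihalf; have := pi_ge2 R; lra.
pose h (y : R) := asin (clip y) * (2 * M).
have ch : continuous h.
  move=> y; apply: cvgMl; apply: (@continuous_comp _ _ _ clip asin); last first.
    by apply: continuous_asin; have := clipK y; lra.
  apply: (@continuous_max _ _ (fun=> - sin 2^-1)); first exact: cvg_cst.
  apply: (@continuous_min _ _ (fun=> sin 2^-1)); first exact: cvg_cst.
  by apply: cvgB; [apply: cvgMr; exact: cvg_id|exact: cvg_cst].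
pose g x := f (\row_j h (x 0 j)).
have cg : continuous g.
  move=> x; apply: continuous_comp; [exact: continuous_row_map|exact: cf].
pose v (j : 'I_k) x : R := 2^-1 * (1 + sin (\sum_i ((i == j)%:R / (2 * M)) * x 0 i)).
have vE j (x : 'rV[R]_k) : v j x = 2^-1 * (1 + sin (x 0 j / (2 * M))).
  rewrite /v (bigD1 j)//= eqxx big1 => [|i /negbTE ->]; last by rewrite !mul0r.
  by rewrite addr0 mul1r [_^-1 * x 0 j]mulrC.
have v01 (x : 'rV[R]_k) j : 0 <= v j x <= 1.
  by rewrite vE; have := sin_geN1 (x 0 j / (2 * M)); have := sin_le1 (x 0 j / (2 * M)); lra.
have [N hN] := bernstein_approx cg (fun x => bf _) e0.
pose p x := multi_bernstein N (enum 'I_k) (fun l => g (\row_j ((l j)%:R / N%:R)))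
  (fun j => v j x) (fun=> 0%N).
exists p; split.
- apply: trig_multi_bernstein => j.
  by apply: trig_scale; apply: trig_add; [exact: trig_cst|exact: trig_sin].
- move=> x xM; rewrite (_ : f x = g (\row_j v j x)); first exact: hN (v01 x).
  congr f; apply/rowP => j; rewrite !mxE vE /h /clip.
  have xj : `|x 0 j / (2 * M)| <= 2^-1.
    rewrite normrM (gtr0_norm (x := _^-1)) ?invr_gt0 ?mulr_gt0//.
    by rewrite ler_pdivrMr ?mulr_gt0// mulrA mulVf ?mul1r.
  rewrite (_ : 2 * (2^-1 * _) - 1 = sin (x 0 j / (2 * M))); last by field.
  move: xj; rewrite ler_norml => /andP[xj1 xj2].
  have pi2 := pi_ge2 R.
  have ord (a b : R) : - 2^-1 <= a -> a <= b -> b <= 2^-1 -> sin a <= sin b :> R.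
    move=> a1 ab b1; have [->//|neq] := eqVneq a b.
    by apply/ltW; rewrite ltr_sin ?in_itv/= ?lt_neqAle ?neq//; lra.
  have sN : - sin 2^-1 = sin (- 2^-1) :> R by rewrite sinN.
  rewrite min_r; last by apply: ord => //; lra.
  rewrite max_r; last by rewrite sN; apply: ord => //; lra.
  by rewrite sinK ?in_itv/=; [field; rewrite gt_eqF|lra].
- move=> x; have := hN _ (v01 x); rewrite -/(p x) => hx.
  have := ler_normD (p x - g (\row_j v j x)) (g (\row_j v j x)); rewrite subrK.
  by move/le_trans; apply; rewrite addrC lerD//; exact: bf.
Qed.

End trigonometric_approximation.

Section exchange.
Context d d' (U : measurableType d) (T : measurableType d') (R : realType).
Context (Q : probability U R) (P : probability T R).
Context (g : U * T -> R) (M : R).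
Hypotheses (mg : measurable_fun setT g) (g0 : forall x, 0 <= g x) (gM : forall x, g x <= M).

Let EFin_g0 x : (0 <= (EFin \o g) x)%E. Proof. by rewrite lee_fin. Qed.

Let mEg : measurable_fun setT (EFin \o g). Proof. exact/measurable_EFinP. Qed.

Lemma measurable_expectation : measurable_fun setT (fun v => \int[P]_w g (v, w)).
Proof.
apply: (measurableT_comp (@fine_measurable R setT measurableT)).
exact: (measurable_fun_fubini_tonelli_F (m2 := P) _ mEg EFin_g0).
Qed.

Lemma expectation_exchange :
  \int[Q]_v \int[P]_w g (v, w) = \int[P]_w \int[Q]_v g (v, w).
Proof.
have normg x : `|g x| <= M by rewrite ger0_norm.
rewrite /Rintegral.
have h1 v : (fine (\int[P]_w (g (v, w))%:E))%:E = (\int[P]_w (g (v, w))%:E)%E.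
  rewrite fineK//; apply: integrable_fin_num => //.
  apply: (@bounded_integrable _ _ _ _ _ M) => //.
  exact: measurableT_comp mg _.
have h2 w : (fine (\int[Q]_v (g (v, w))%:E))%:E = (\int[Q]_v (g (v, w))%:E)%E.
  rewrite fineK//; apply: integrable_fin_num => //.
  apply: (@bounded_integrable _ _ _ _ _ M) => //.
  exact: measurableT_comp mg _.
under eq_integral do rewrite h1.
under [in RHS]eq_integral do rewrite h2.
congr fine.
exact: (fubini_tonelli (m1 := Q) (m2 := P) _ mEg EFin_g0).
Qed.

End exchange.

(** * Tails of a law from its characteristic function *)

Section tail.
Context (R : realType).
Implicit Types y u : R.

Let unif : probability _ R := uniform_prob (@ltr01 R).

Lemma uniform_one_sub_cos y : y != 0 ->
  \int[unif]_v (1 - cos (v * y)) = 1 - sin y / y.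
Proof.
move=> y0; rewrite /Rintegral (@integral_uniform _ _ _ (@ltr01 R)); last 2 first.
- apply/measurable_EFinP; apply: measurable_funB => //.
  by apply: measurable_cos; exact: measurable_funM.
- by move=> v; rewrite lee_fin subr_ge0 cos_le1.
rewrite subr0 invr1 mul1e.
have dF (v : R) : 0 <= v <= 1 -> is_derive v 1 (fun v : R => v - sin (v * y) / y) (1 - cos (v * y)).
  by move=> _; derive_by; field.
have cf : {within `[0, 1], continuous (fun v : R => 1 - cos (v * y))}.
  by apply: derive_within_continuous => v _; eexists; derive_by; reflexivity.
have := Rintegral_FTC2 (@ler01 R) dF cf; rewrite /Rintegral => ->.
by rewrite !mul0r !mul1r sin0; ring.
Qed.

Lemma uniform_one_sub_cos_ge0 y : 0 <= \int[unif]_v (1 - cos (v * y)).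
Proof. by apply: Rintegral_ge0 => v _; rewrite subr_ge0 cos_le1. Qed.

Context d (T : measurableType d) (P : probability T R).

(** The average of [1 - cos (v y)] over v in [0, 1] is [1 - sin y / y], which is at least 1/2 as
    soon as [|y| >= 2]; expectations and average are then exchanged. *)
Lemma tail_charfun (Y : T -> R) u : measurable_fun setT Y -> 0 < u ->
  fine (P [set w | 2 / u <= `|Y w|]) <=
    2 * \int[unif]_v \int[P]_w (1 - cos (v * (u * Y w))).
Proof.
move=> mY u0.
have mg : measurable_fun setT (fun x : R * T => 1 - cos (x.1 * (u * Y x.2))).
  apply: measurable_funB => //; apply: measurable_cos; apply: measurable_funM => //.
  apply: measurable_funM => //; exact: measurableT_comp mY _.
have g0 (x : R * T) : 0 <= 1 - cos (x.1 * (u * Y x.2)) by rewrite subr_ge0 cos_le1.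
have g2 (x : R * T) : 1 - cos (x.1 * (u * Y x.2)) <= 2.
  by have := cos_geN1 (x.1 * (u * Y x.2)); lra.
rewrite (expectation_exchange unif P mg g0 g2)/=.
have mS : measurable [set w | 2 / u <= `|Y w|].
  rewrite -[X in measurable X]setTI; apply: measurable_fun_le => //.
  exact: measurableT_comp.
rewrite -(expectation_indic P mS) -(@expectationZl _ _ _ _ _ _ 2); last 2 first.
- have := @measurable_expectation _ _ T _ R unif (fun x => 1 - cos (x.2 * (u * Y x.1))).
  apply => //.
  apply: measurable_funB => //; apply: measurable_cos; apply: measurable_funM => //.
  apply: measurable_funM => //; exact: measurableT_comp mY _.
- move=> w; apply: ler_norm_expectation => [|v].
    apply: measurable_funB => //; apply: measurable_cos; exact: measurable_funM.
  by rewrite ger0_norm ?(g0 (v, w)) ?(g2 (v, w)).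
apply: (@ler_expectation _ _ _ _ _ _ 1 4).
- exact: measurable_indic.
- apply: measurable_funM => //.
  have := @measurable_expectation _ _ T _ R unif (fun x => 1 - cos (x.2 * (u * Y x.1))).
  apply => //.
  apply: measurable_funB => //; apply: measurable_cos; apply: measurable_funM => //.
  apply: measurable_funM => //; exact: measurableT_comp mY _.
- by move=> w; rewrite indicE; case: (_ \in _); rewrite ?normr1 ?normr0.
- move=> w; rewrite normrM (gtr0_norm (_ : 0 < 2))// (_ : 4 = 2 * 2 :> R) ?ler_wpM2l//; last by ring.
  apply: ler_norm_expectation => [|v].
    apply: measurable_funB => //; apply: measurable_cos; exact: measurable_funM.
  by rewrite ger0_norm ?(g0 (v, w)) ?(g2 (v, w)).
- move=> w; rewrite indicE; have [/set_mem/= uY|_] := boolP (_ \in _); last first.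
    by rewrite mulr_ge0// uniform_one_sub_cos_ge0.
  have uY2 : 2 <= `|u * Y w| by rewrite normrM (gtr0_norm u0) mulrC -ler_pdivrMr.
  have uY0 : u * Y w != 0 by rewrite -normr_gt0; exact: lt_le_trans uY2.
  rewrite uniform_one_sub_cos//.
  have : sin (u * Y w) / (u * Y w) <= 2^-1.
    apply: (le_trans (ler_norm _)); rewrite normrM normfV.
    rewrite ler_pdivrMr ?normr_gt0//.
    apply: (le_trans (norm_sin_le1 _)).
    lra.
  by lra.
Qed.

(** Two applications of dominated convergence. Together with [tail_charfun] this is the tightness of
    a single law. *)
Lemma cvg_uniform_one_sub_cos (Y : T -> R) : measurable_fun setT Y ->
  \int[unif]_v \int[P]_w (1 - cos (v * (m.+1%:R^-1 * Y w))) @[m --> \oo] --> 0.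
Proof.
move=> mY.
have b (x : R) : `|1 - cos x| <= 2.
  by rewrite ler_norml; have := cos_geN1 x; have := cos_le1 x; lra.
have mc (v : R) m : measurable_fun setT (fun w => 1 - cos (v * (m.+1%:R^-1 * Y w))).
  apply: measurable_funB => //; apply: measurable_cos; apply: measurable_funM => //.
  exact: measurable_funM.
rewrite -[X in _ --> X](expectation_cst unif).
apply: (@cvg_Rintegral _ _ _ _ _ _ _ (fun=> 2)) => //.
- move=> m; have := @measurable_expectation _ _ R _ R P
    (fun x => 1 - cos (x.1 * (m.+1%:R^-1 * Y x.2))); apply => //.
  apply: measurable_funB => //; apply: measurable_cos; apply: measurable_funM => //.
  apply: measurable_funM => //; exact: measurableT_comp mY _.
- move=> v _; rewrite -[X in _ --> X](expectation_cst P).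
  apply: (@cvg_Rintegral _ _ _ _ _ _ _ (fun=> 2)) => //.
  + move=> w _; rewrite -[X in _ --> X](_ : 1 - cos (v * (0 * Y w)) = 0); last first.
      by rewrite mul0r mulr0 cos0 subrr.
    apply: cvgB; first exact: cvg_cst.
    apply: continuous_cvg; first exact: continuous_cos.
    by apply: cvgMr; apply: cvgMl; exact: cvg_harmonic.
  + by apply: (@bounded_integrable _ _ _ _ _ 2) => // w; rewrite ger0_norm.
- by apply: (@bounded_integrable _ _ _ _ _ 2) => // w; rewrite ger0_norm.
- by move=> m v _; apply: ler_norm_expectation.
Qed.

End tail.

Section levy_continuity.
Context (R : realType) (k : nat).

Section one_space.
Context d (T : measurableType d) (P : probability T R) (X : T -> 'rV[R]_k).
Hypothesis mX : forall j, measurable_fun setT (fun w => X w 0 j).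

Lemma measurable_linear_combination (z : 'I_k -> R) :
  measurable_fun setT (fun w => \sum_j z j * X w 0 j).
Proof. by apply: measurable_sum => j; exact: measurable_funM. Qed.

Lemma measurable_trig p : trig_poly p -> measurable_fun setT (p \o X).
Proof.
elim => [z|z|f1 f2 _ m1 _ m2|c f' _ m].
- by apply: measurable_cos; exact: measurable_linear_combination.
- by apply: measurable_sin; exact: measurable_linear_combination.
- exact: measurable_funD.
- exact: measurable_funM.
Qed.

(** Only the coordinates of X are known to be measurable. The composite is the pointwise limit of
    trigonometric polynomials in X, the m-th being within [1/(m+1)] on the cube of half-side
    [m+1]. *)
Lemma measurable_bounded_continuous (f : 'rV[R]_k -> R) (K : R) : continuous f -> (forall x, `|f x| <= K) ->
  measurable_fun setT (f \o X).
Proof.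
move=> cf bf.
have approx m := trig_approx cf bf (ltr0Sn R m) (_ : 0 < m.+1%:R^-1).
have {approx}/choice[p hp] m : exists p, trig_poly p /\
    forall x : 'rV[R]_k, (forall j, `|x 0 j| <= m.+1%:R) -> `|p x - f x| <= m.+1%:R^-1.
  by have [|p [tp h _]] := approx _ m; [move=> ?; rewrite invr_gt0|exists p].
apply: (measurable_fun_cvg (h := fun m => p m \o X)).
  by move=> m; apply: measurable_trig; exact: (hp m).1.
move=> w _; apply/cvgrPdist_le => e e0.
have xb : \forall m \near \oo, forall j, `|X w 0 j| <= m.+1%:R.
  apply: filter_forall => j; near=> m.
  apply: (@le_trans _ _ m%:R); last by rewrite ler_nat.
  by near: m; exact: nbhs_infty_ger.
near=> m; rewrite distrC; apply: (le_trans ((hp m).2 _ _)); first by near: m.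
have : `|0 - m.+1%:R^-1| <= e :> R.
  near: m; have /cvgrPdist_le := @cvg_harmonic R; exact.
by rewrite sub0r normrN ger0_norm.
Unshelve. all: by end_near. Qed.

(** On the cube the error is [e]; outside, it is at most [2K + e] times the number [D] of
    coordinates that reach M, whose mean is the sum of the tails. *)
Lemma expectation_trig_close (f p : 'rV[R]_k -> R) (K M e e1 : R) : continuous f -> (forall x, `|f x| <= K) ->
  trig_poly p -> (forall x : 'rV[R]_k, (forall j, `|x 0 j| <= M) -> `|p x - f x| <= e) ->
  (forall x, `|p x| <= K + e) -> 0 < e ->
  (forall j, fine (P [set w | M <= `|X w 0 j|]) <= e1) ->
  `|\int[P]_w p (X w) - \int[P]_w f (X w)| <= e + (2 * K + e) * (k%:R * e1).
Proof.
move=> cf bf tp pf bp e0 tail.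
have K0 : 0 <= 2 * K + e.
  have := le_trans (normr_ge0 _) (bf 0); have := le_trans (normr_ge0 _) (bp 0); lra.
have mf := measurable_bounded_continuous cf bf; have mp := measurable_trig tp.
have mS j : measurable [set w | M <= `|X w 0 j|].
  rewrite -[X in measurable X]setTI; apply: measurable_fun_le => //.
  exact: measurableT_comp.
rewrite -(expectationB P mp mf (fun w => bp (X w)) (fun w => bf (X w))).
pose D w : R := \sum_j (\1_[set w | M <= `|X w 0 j|] w : R).
have b1 j w : `|\1_[set w | M <= `|X w 0 j|] w : R| <= 1.
  by rewrite indicE; case: (_ \in _); rewrite ?normr1 ?normr0.
have mD : measurable_fun setT D by apply: measurable_sum => j; exact: measurable_indic.
have D0 w : 0 <= D w by apply: sumr_ge0.
have Dk w : `|D w| <= k%:R.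
  apply: (le_trans (ler_norm_sum _ _ _)).
  rewrite -[k in leRHS]card_ord -sumr_const; exact: ler_sum.
have DE : \int[P]_w D w <= k%:R * e1.
  rewrite (@expectation_sum _ _ _ _ _ _ 1)//; last by move=> j; exact: measurable_indic.
  rewrite -[k in leRHS]card_ord mulr_natl -sumr_const; apply: ler_sum => j _.
  by rewrite expectation_indic.
have bound w : `|(p \o X) w - (f \o X) w| <= e + (2 * K + e) * D w.
  have [h|/existsNP[j /negP]] := pselect (forall j, `|X w 0 j| <= M).
    by apply: (le_trans (pf _ h)); rewrite lerDl mulr_ge0.
  rewrite -ltNge => h.
  have D1 : 1 <= D w.
    rewrite /D (bigD1 j)//= indicE mem_set/=; last exact: ltW.
    by rewrite lerDl sumr_ge0.
  apply: (le_trans (ler_normB _ _)).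
  have := bp (X w); have := bf (X w); have := ler_wpM2l K0 D1.
  by rewrite mulr1 /=; lra.
have mDD : measurable_fun setT (fun w => e + (2 * K + e) * D w).
  by apply: measurable_funD => //; exact: measurable_funM.
have bDD w : `|e + (2 * K + e) * D w| <= e + (2 * K + e) * k%:R.
  rewrite ger0_norm; last by rewrite addr_ge0 ?mulr_ge0// ltW.
  by rewrite lerD2l ler_wpM2l//; apply: le_trans (Dk w); rewrite ger0_norm.
apply: (@le_trans _ _ (\int[P]_w (e + (2 * K + e) * D w))); last first.
  rewrite (@expectationD _ _ _ _ _ _ e ((2 * K + e) * k%:R))//; last 3 first.
  - exact: measurable_funM.
  - by move=> w; rewrite ger0_norm// ltW.
  - by move=> w; rewrite normrM (ger0_norm K0) ler_wpM2l.
  by rewrite expectation_cst (@expectationZl _ _ _ _ _ _ k%:R)// lerD2l ler_wpM2l.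
have mpf := measurable_funB mp mf.
rewrite ler_norml; apply/andP; split.
  rewrite -mulN1r -(expectationZl P _ mDD bDD).
  apply: (@ler_expectation _ _ _ _ _ _ (e + (2 * K + e) * k%:R) (e + (2 * K + e) * k%:R)) => //.
  - exact: measurable_funM.
  - by move=> w; rewrite mulN1r normrN.
  - by move=> w; apply: (le_trans (bound w)); apply: le_trans (bDD w); exact: ler_norm.
  - by move=> w; rewrite mulN1r; have := bound w; rewrite ler_norml => /andP[].
apply: (@ler_expectation _ _ _ _ _ _ (e + (2 * K + e) * k%:R) (e + (2 * K + e) * k%:R)) => //.
- by move=> w; apply: (le_trans (bound w)); apply: le_trans (bDD w); exact: ler_norm.
- by move=> w; exact: le_trans (ler_norm _) (bound w).
Qed.

End one_space.

Context d d' (T : measurableType d) (T' : measurableType d').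
Context (P : probability T R) (P' : probability T' R).
Context (xi : nat -> T -> 'rV[R]_k) (zeta : T' -> 'rV[R]_k).
Hypotheses (mxi : forall n j, measurable_fun setT (fun w => xi n w 0 j))
  (mzeta : forall j, measurable_fun setT (fun w => zeta w 0 j)).

(** Expectations of trigonometric polynomials converge by hypothesis and linearity. A bounded
    continuous function is replaced by one of them on a large cube, outside which all laws involved
    have small mass by [tail_charfun]. *)
Theorem levy_continuity :
  (forall z : 'I_k -> R, \int[P]_w cos (\sum_j z j * xi n w 0 j) @[n --> \oo] -->
     \int[P']_w cos (\sum_j z j * zeta w 0 j)) ->
  (forall z : 'I_k -> R, \int[P]_w sin (\sum_j z j * xi n w 0 j) @[n --> \oo] -->
     \int[P']_w sin (\sum_j z j * zeta w 0 j)) ->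
  cvg_distribution P xi P' zeta.
Proof.
move=> cvg_c cvg_s f cf [K bf].
have cvg_trig p : trig_poly p ->
    \int[P]_w p (xi n w) @[n --> \oo] --> \int[P']_w p (zeta w).
  elim => [z|z|f1 f2 t1 c1 t2 c2|c f' t' c'].
  - exact: cvg_c.
  - exact: cvg_s.
  - have [M1 b1] := trig_bounded t1; have [M2 b2] := trig_bounded t2.
    rewrite (expectationD _ (measurable_trig mzeta t1) (measurable_trig mzeta t2)
      (fun w => b1 _) (fun w => b2 _)).
    under eq_fun do rewrite (expectationD _ (measurable_trig (mxi _) t1)
      (measurable_trig (mxi _) t2) (fun w => b1 _) (fun w => b2 _)).
    exact: cvgD.
  - have [M' b'] := trig_bounded t'.
    rewrite (expectationZl _ _ (measurable_trig mzeta t') (fun w => b' _)).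
    under eq_fun do rewrite (expectationZl _ _ (measurable_trig (mxi _) t') (fun w => b' _)).
    exact: cvgMr.
have K0 : 0 <= K by exact: le_trans (normr_ge0 _) (bf 0).
apply/cvgrPdist_le => e0 e0_gt0.
(* Two shares for replacing [f] by [p] under each of the two laws, one for the convergence of the
   expectations of [p]. *)
pose e := e0 / 5.
have e_gt0 : 0 < e by rewrite divr_gt0.
pose e1 := e / ((2 * K + e) * k.+1%:R).
have den : 0 < (2 * K + e) * k.+1%:R by rewrite mulr_gt0// ltr_wpDl// mulr_ge0.
have e1_gt0 : 0 < e1 by rewrite divr_gt0.
have bound : e + (2 * K + e) * (k%:R * e1) <= 2 * e.
  have : (2 * K + e) * (k.+1%:R * e1) = e.
    by rewrite /e1; field; move: den; rewrite pmulr_lgt0 ?ltr0n// => /gt_eqF ->; rewrite gt_eqF.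
  have : (2 * K + e) * (k%:R * e1) <= (2 * K + e) * (k.+1%:R * e1).
    rewrite ler_wpM2l//; first by rewrite addr_ge0 ?mulr_ge0// ltW.
    by rewrite ler_wpM2r ?(ltW e1_gt0)// ler_nat.
  lra.
pose tau m j := \int[uniform_prob (@ltr01 R)]_v
  \int[P']_w (1 - cos (v * (m.+1%:R^-1 * zeta w 0 j))).
pose taun n m j := \int[uniform_prob (@ltr01 R)]_v
  \int[P]_w (1 - cos (v * (m.+1%:R^-1 * xi n w 0 j))).
(* The cube is chosen from the limit law alone; since [taun n m j] converges to [tau m j], it suits
   the law of [xi n] for all large n. *)
have [m hm] : exists m, forall j, 2 * tau m j < e1.
  near \oo => m; exists m; near: m; apply: filter_forall => j.
  have : 2 * tau m j @[m --> \oo] --> 2 * (0 : R).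
    by apply: cvgMr; exact: cvg_uniform_one_sub_cos.
  by rewrite mulr0 => /cvgr_lt; apply.
have cvg_tau j : 2 * taun n m j @[n --> \oo] --> 2 * tau m j.
  apply: cvgMr.
  have mS d2 (S : measurableType d2) (Q : probability S R) (Y : S -> R) :
      measurable_fun setT Y ->
      measurable_fun setT (fun v : R => \int[Q]_w (1 - cos (v * (m.+1%:R^-1 * Y w)))).
    move=> mY; have := @measurable_expectation _ _ R _ R Q
      (fun x => 1 - cos (x.1 * (m.+1%:R^-1 * Y x.2))); apply => //.
    apply: measurable_funB => //; apply: measurable_cos; apply: measurable_funM => //.
    apply: measurable_funM => //; exact: measurableT_comp mY _.
    have b (x : R) : `|1 - cos x| <= 2.
    by rewrite ler_norml; have := cos_geN1 x; have := cos_le1 x; lra.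
  have mc d2 (S : measurableType d2) (v : R) (Y : S -> R) : measurable_fun setT Y ->
      measurable_fun setT (fun w => cos (v * (m.+1%:R^-1 * Y w))).
    by move=> mY; apply: measurable_cos; apply: measurable_funM => //; exact: measurable_funM.
  apply: (@cvg_Rintegral _ _ _ _ _ _ _ (fun=> 2)) => //.
  - by move=> n; exact: mS.
  - move=> v _.
    have subE d2 (S : measurableType d2) (Q : probability S R) (Y : S -> R) :
        measurable_fun setT Y -> \int[Q]_w (1 - cos (v * (m.+1%:R^-1 * Y w))) =
        1 - \int[Q]_w cos (v * (m.+1%:R^-1 * Y w)).
      move=> mY; rewrite (@expectationB _ _ _ _ _ _ 1 1) ?expectation_cst//.
      - exact: mc.
      - by move=> w; rewrite normr1.
      - by move=> w; exact: norm_cos_le1.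
    under eq_fun do rewrite subE//.
    rewrite subE//.
    apply: cvgB; first exact: cvg_cst.
    have := cvg_c (fun i => if i == j then v / m.+1%:R else 0).
    have sumE (x : 'rV[R]_k) : \sum_i (if i == j then v / m.+1%:R else 0) * x 0 i =
        v * (m.+1%:R^-1 * x 0 j).
      rewrite (bigD1 j)//= eqxx big1 => [|i /negbTE ->]; last by rewrite mul0r.
      by rewrite addr0 mulrA.
    under [in X in _ --> X -> _]eq_Rintegral do rewrite sumE.
    by under eq_fun do under eq_Rintegral do rewrite sumE.
  - by apply: (@bounded_integrable _ _ _ _ _ 2) => // w; rewrite ger0_norm.
  - move=> n v _; apply: ler_norm_expectation => //.
    by apply: measurable_funB => //; exact: mc.
have u0 : 0 < m.+1%:R^-1 :> R by rewrite invr_gt0.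
have M0 : 0 < 2 / m.+1%:R^-1 :> R by rewrite divr_gt0.
have [p [tp pf bp]] := trig_approx cf bf M0 e_gt0.
have closeZ := expectation_trig_close mzeta cf bf tp pf bp e_gt0 (e1 := e1) (P := P') (fun j =>
  le_trans (tail_charfun P' (mzeta j) u0) (ltW (hm j))).
near=> n.
have hn : forall j, 2 * taun n m j < e1.
  near: n; apply: filter_forall => j.
  by have := cvg_tau j => /cvgr_lt; apply.
have closeX := expectation_trig_close (mxi n) cf bf tp pf bp e_gt0 (e1 := e1) (P := P) (fun j =>
  le_trans (tail_charfun P (mxi n j) u0) (ltW (hn j))).
have closep : `|\int[P']_w p (zeta w) - \int[P]_w p (xi n w)| <= e.
  by near: n; have /cvgrPdist_le := cvg_trig p tp; apply.
have e0E : e0 = 5 * e by rewrite /e; field.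
move: closeZ closeX closep bound; rewrite e0E !ler_norml => /andP[? ?] /andP[? ?] /andP[? ?] ?.
by apply/andP; split; lra.
Unshelve. all: by end_near. Qed.

End levy_continuity.

Section equality_in_law.
Context (R : realType) d d' (T : measurableType d) (T' : measurableType d').
Context (P : probability T R) (P' : probability T' R) (X : T -> R) (Y : T' -> R).
Hypotheses (mX : measurable_fun setT X) (mY : measurable_fun setT Y).

(** The continuity theorem in dimension 1, applied to a constant sequence. *)
Lemma charfun_inj :
  (forall z, \int[P]_w cos (z * X w) = \int[P']_w cos (z * Y w)) ->
  (forall z, \int[P]_w sin (z * X w) = \int[P']_w sin (z * Y w)) ->
  forall f : R -> R, continuous f -> (exists M, forall x, `|f x| <= M) ->
  \int[P]_w f (X w) = \int[P']_w f (Y w).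
Proof.
move=> eqc eqs f cf [M bf].
have cvg : cvg_distribution P (fun _ w => \row_(j < 1) X w) P' (fun w => \row_(j < 1) Y w).
  apply: levy_continuity.
  - by move=> n j; under eq_fun do rewrite mxE.
  - by move=> j; under eq_fun do rewrite mxE.
  - move=> z; under eq_fun do under eq_Rintegral do rewrite big_ord1 mxE.
    by under eq_Rintegral do rewrite big_ord1 mxE; rewrite eqc; exact: cvg_cst.
  - move=> z; under eq_fun do under eq_Rintegral do rewrite big_ord1 mxE.
    by under eq_Rintegral do rewrite big_ord1 mxE; rewrite eqs; exact: cvg_cst.
have cf1 : continuous (fun x : 'rV[R]_1 => f (x 0 0)).
  by move=> x; apply: continuous_comp; [exact: coord_continuous|exact: cf].
have := cvg _ cf1 (ex_intro _ M (fun x => bf _)).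
under eq_fun do under eq_Rintegral do rewrite mxE.
under [X in _ --> X]eq_Rintegral do rewrite mxE.
by move=> /cvg_lim; rewrite lim_cst//; apply.
Qed.

End equality_in_law.

Section equality_of_means.
Context (R : realType).

Let cvg_truncation d (T : measurableType d) (P : probability T R) (X : T -> R) :
  measurable_fun setT X ->
  ((\int[P]_w Num.min (Num.max (X w) 0) m%:R)%:E @[m --> \oo] -->
   \int[P]_w (maxe (X w)%:E 0))%E.
Proof.
move=> mX.
have mmin m : measurable_fun setT (fun w => Num.min (Num.max (X w) 0) m%:R).
  by apply: measurable_minr => //; exact: measurable_maxr.
have min0 m w : 0 <= Num.min (Num.max (X w) 0) m%:R.
  by rewrite le_min le_max lexx orbT ler0n.
have fineE m : ((\int[P]_w Num.min (Num.max (X w) 0) m%:R)%:E =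
    \int[P]_w (Num.min (Num.max (X w) 0) m%:R)%:E)%E.
  rewrite /Rintegral fineK//; apply: integrable_fin_num => //.
  apply: (@bounded_integrable _ _ _ _ _ m%:R) => // w.
  by rewrite ger0_norm// ge_min lexx orbT.
under eq_fun do rewrite fineE.
have -> : (\int[P]_w maxe (X w)%:E 0 = \int[P]_w (limn
    (fun m => (Num.min (Num.max (X w) 0) m%:R)%:E)))%E; last first.
  apply: cvg_monotone_convergence => //.
  - by move=> m; exact/measurable_EFinP.
  - by move=> m w _; rewrite lee_fin.
  - move=> w _ m n mn; rewrite lee_fin le_min ge_min lexx/= ge_min.
    by rewrite ler_nat mn orbT.
apply: eq_integral => w _; apply/esym/cvg_lim => //.
rewrite -EFin_max; apply: cvg_near_cst; near=> m.
congr EFin; apply/min_idPl.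
by near: m; exact: nbhs_infty_ger.
Unshelve. all: by end_near. Qed.

(** The positive and negative parts, obtained with [s = 1] and [s = -1], are monotone limits of
    bounded continuous functions of the variable; working in the extended reals allows infinite
    means. This is used to identify the means of all the [X_u]. *)
Lemma eq_expectation d d' (T : measurableType d) (T' : measurableType d')
    (P : probability T R) (P' : probability T' R) (X : T -> R) (Y : T' -> R) :
  measurable_fun setT X -> measurable_fun setT Y ->
  (forall f : R -> R, continuous f -> (exists M, forall x, `|f x| <= M) ->
    \int[P]_w f (X w) = \int[P']_w f (Y w)) ->
  ('E_P[X] = 'E_P'[Y])%E.
Proof.
move=> mX mY eqf; rewrite !unlock [LHS]integralE [RHS]integralE.
have eq_part (s : R) : (\int[P]_w maxe (s * X w)%:E 0 = \int[P']_w maxe (s * Y w)%:E 0)%E.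
  have /cvg_lim <-// : ((\int[P]_w Num.min (Num.max (s * X w) 0) m%:R)%:E @[m --> \oo] -->
      \int[P]_w maxe (s * X w)%:E 0)%E.
    by apply: cvg_truncation; exact: measurable_funM.
  apply/cvg_lim => //.
  rewrite (_ : (fun m => _) = fun m =>
    (\int[P']_w Num.min (Num.max (s * Y w) 0) m%:R)%:E).
    by apply: cvg_truncation; exact: measurable_funM.
  apply/funext => m; congr EFin.
  apply: (eqf (fun x : R => Num.min (Num.max (s * x) 0) m%:R)).
    move=> x.
    apply: (@continuous_min _ _ (fun x : R => Num.max (s * x) 0) (fun=> m%:R)); last exact: cvg_cst.
    apply: (@continuous_max _ _ (fun x : R => s * x) (fun=> 0)); last exact: cvg_cst.
    by apply: cvgMr; exact: cvg_id.
  exists m%:R => x; rewrite ger0_norm; last by rewrite le_min le_max lexx orbT ler0n.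
  by rewrite ge_min lexx orbT.
congr (_ - _)%E.
  transitivity (\int[P]_w maxe (1 * X w)%:E 0)%E.
    by apply: eq_integral => w _; rewrite funeposE mul1r.
  by rewrite eq_part; apply: eq_integral => w _; rewrite funeposE mul1r.
transitivity (\int[P]_w maxe (-1 * X w)%:E 0)%E.
  by apply: eq_integral => w _; rewrite funenegE mulN1r.
by rewrite eq_part; apply: eq_integral => w _; rewrite funenegE mulN1r.
Qed.

End equality_of_means.

(** * Levy bases *)

Lemma has_exponent_polar d (T : measurableType d) (R : realType) (P : probability T R)
    (X : T -> R) (psi : R -> R[i]) (z : R) : has_exponent P X psi ->
  polar_charfun P (fun w => z * X w) (expR (complex.Re (psi z))) (complex.Im (psi z)).
Proof.
move=> /(_ z) /eqP; rewrite /charfun /cintegral /cexp eq_complex /= => /andP[/eqP re /eqP im].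
split.
  move: re; rewrite !mul0r subr0 => <-.
  by apply: eq_Rintegral => w _; rewrite !mul0r expR0 mul1r subr0.
move: im; rewrite !mul0r addr0 => <-.
by apply: eq_Rintegral => w _; rewrite !mul0r expR0 mul1r addr0.
Qed.

Lemma mutually_independent_comp d (T : measurableType d) (R : realType)
    (P : probability T R) n (X : 'I_n -> T -> R) (f : 'I_n -> R -> R) :
  (forall i, measurable_fun setT (f i)) -> mutually_independent P X ->
  mutually_independent P (fun i w => f i (X i w)).
Proof.
move=> mf indX U mU.
have := indX (fun i => f i @^-1` U i); apply => i.
by rewrite -[X in measurable X]setTI; exact: mf.
Qed.

Section levy_basis_families.
Context (R : realType) d (T : measurableType d) (P : probability T R).
Context (gamma b : R) (nu : {measure set R -> \bar R}) (L : set (R * R) -> T -> R).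
Hypothesis L_basis : levy_basis P gamma b nu L.

Lemma leb20 : leb2 (@set0 (R * R)) = 0%E.
Proof. by rewrite /leb2 measure0. Qed.

Lemma leb2_ge0 (A : set (R * R)) : (0 <= leb2 A)%E.
Proof. exact: measure_ge0. Qed.

Lemma le_leb2 (A B : set (R * R)) : measurable A -> measurable B -> A `<=` B ->
  (leb2 A <= leb2 B)%E.
Proof. by move=> mA mB AB; apply: le_measure => //; rewrite inE. Qed.

Lemma leb2_fin_num (A : set (R * R)) : (leb2 A < +oo)%E -> leb2 A \is a fin_num.
Proof. by move=> A_fin; rewrite ge0_fin_numE// leb2_ge0. Qed.

(** Additivity along a sequence of empty sets makes the multiples [n L(set0)] converge; their
    successive differences then tend to 0 and are all equal to [L(set0)]. *)
Lemma levy_basis_set0 : {ae P, forall w, L set0 w = 0}.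
Proof.
have := levy_basis_sigma_additive L_basis (A := fun=> set0).
rewrite bigcup0// leb20 => h.
have {h} := h (fun=> measurable0) _ (ltry 0); move=> /(_ _)/wrap[|].
  by apply/trivIsetP => i j _ _ _; rewrite set0I.
apply: filterS => w; under eq_fun do rewrite sumr_const card_ord.
move=> cv; have cv1 := cv; rewrite -(cvg_shiftS (fun n => L set0 w *+ n)) in cv1.
have : L set0 w *+ n.+1 - L set0 w *+ n @[n --> \oo] --> L set0 w - L set0 w.
  exact: cvgB.
under eq_fun do rewrite mulrSr addrC addKr.
by rewrite subrr => /cvg_lim; rewrite lim_cst//; apply.
Qed.

(** Countable additivity for the sequence A, B followed by empty sets. *)
Lemma levy_basis_setU (A B : set (R * R)) : measurable A -> measurable B ->
  A `&` B = set0 -> (leb2 (A `|` B) < +oo)%E ->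
  {ae P, forall w, L (A `|` B) w = L A w + L B w}.
Proof.
move=> mA mB AB0 fin.
pose C n := if n is 0%N then A else if n is 1%N then B else set0.
have mC n : measurable (C n) by case: n => [|[|n]] //; exact: measurable0.
have tC : trivIset setT C.
  apply/trivIsetP => -[|[|i]] [|[|j]] _ _ //= _; rewrite ?set0I ?setI0//.
  by rewrite setIC.
have UC : \bigcup_n C n = A `|` B.
  apply/seteqP; split => [x [[|[|n]] _ //= Cx]|x [Ax|Bx]]; [by left|by right| |].
    by exists 0%N.
  by exists 1%N.
have := levy_basis_sigma_additive L_basis mC tC; rewrite UC => /(_ fin) sC.
move: sC levy_basis_set0; apply: filterS2 => w cv L0.
have cst : (\sum_(i < n) L (C i) w) @[n --> \oo] --> L A w + L B w.
  apply: cvg_near_cst; near=> n.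
  have -> : n = n.-2.+2 by rewrite -[LHS]prednK ?prednK// -?subn1 ?subn_gt0;
    near: n; exact: nbhs_infty_gt.
  rewrite big_ord_recl big_ord_recl /= big1 ?addr0//.
by apply: cvg_unique cv cst.
Unshelve. all: by end_near. Qed.

Lemma levy_basis_bigsetU (I : choiceType) (s : seq I) (B : I -> set (R * R)) : uniq s ->
  (forall i, measurable (B i)) -> trivIset setT B ->
  (leb2 (\big[setU/set0]_(i <- s) B i) < +oo)%E ->
  {ae P, forall w, L (\big[setU/set0]_(i <- s) B i) w = \sum_(i <- s) L (B i) w}.
Proof.
move=> + mB tB; elim: s => [_ _|i s IH /= /andP[iNs us] fin].
  by apply: filterS levy_basis_set0 => w; rewrite !big_nil.
have mU : measurable (\big[setU/set0]_(i <- s) B i) by exact: bigsetU_measurable.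
have disj : B i `&` \big[setU/set0]_(j <- s) B j = set0.
  apply/seteqP; split => // x [Bix]; rewrite -bigcup_seq => -[j /= js Bjx].
  by rewrite (tB i j _ _ _)// in iNs; [rewrite js in iNs|exists x].
rewrite big_cons in fin.
have fin' : (leb2 (\big[setU/set0]_(j <- s) B j) < +oo)%E.
  apply: le_lt_trans fin; apply: le_leb2 => //; first exact: measurableU.
move: (IH us fin') (levy_basis_setU (mB i) mU disj fin); apply: filterS2 => w h1 h2.
by rewrite !big_cons h2 h1.
Qed.

Context (N : nat) (A : 'I_N -> set (R * R)).
Hypotheses (mA : forall k, measurable (A k)) (finA : forall k, (leb2 (A k) < +oo)%E).

(* The points belonging to the [A k] with k in S and to no other; the points
   outside all the [A k] are left out. *)
Definition atom (S : {set 'I_N}) : set (R * R) :=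
  [set p | S != finset.set0 /\ forall k, (k \in S) <-> A k p].

Lemma measurable_atom S : measurable (atom S).
Proof.
have [->|S0] := eqVneq S finset.set0.
  by rewrite (_ : atom _ = set0)//; apply/seteqP; split => // p []; rewrite eqxx.
rewrite (_ : atom S = \bigcap_(k in [set: 'I_N]) (if k \in S then A k else ~` A k)).
  apply: fin_bigcap_measurable => // k _.
  by case: ifP => _ //; exact: measurableC.
apply/seteqP; split => [p [_ h] k _|p h]; first by case: ifPn => [/h//|kS /h]; exact/negP.
split => // k; have := h k I; case: ifPn => // _ nA; split => //.
Qed.

Lemma atom_subset (S : {set 'I_N}) k : k \in S -> atom S `<=` A k.
Proof. by move=> kS p [_ h]; apply/h. Qed.

Lemma atom_finite S : (leb2 (atom S) < +oo)%E.
Proof.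
have [->|/set0Pn[k kS]] := eqVneq S finset.set0.
  rewrite (_ : atom _ = set0) ?leb20//.
  by apply/seteqP; split => // p []; rewrite eqxx.
apply: le_lt_trans (finA k); apply: le_leb2 => //; first exact: measurable_atom.
exact: atom_subset.
Qed.

Lemma trivIset_atom : trivIset setT atom.
Proof.
move=> S S' _ _ [p [[_ h] [_ h']]]; apply/setP => k.
by apply/idP/idP => [/h/h'|/h'/h].
Qed.

Lemma bigcup_atom (k : 'I_N) : \big[setU/set0]_(S <- seq.filter (fun S : {set 'I_N} => k \in S) (index_enum _)) atom S = A k.
Proof.
rewrite -bigcup_seq; apply/seteqP; split => [p [S /= /[!mem_filter] /andP[kS _]]|p Akp].
  exact: atom_subset.
have kS : k \in [set i | `[< A i p >]]%SET by rewrite inE; exact/asboolP.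
exists [set i | `[< A i p >]]%SET; first by rewrite /= mem_filter kS mem_index_enum.
split; first by apply/set0Pn; exists k.
by move=> i; rewrite inE; split => [/asboolP|/asboolP].
Qed.

Context (theta : 'I_N -> R).

Definition atom_weight (S : {set 'I_N}) : R := \sum_(k in S) theta k.

Definition atom_measure (S : {set 'I_N}) : R := fine (leb2 (atom S)).

Lemma levy_basis_atoms : {ae P, forall w,
  \sum_k theta k * L (A k) w = \sum_S atom_weight S * L (atom S) w}.
Proof.
have all_k : {ae P, forall w, forall k,
    L (A k) w = \sum_(S <- seq.filter (fun S : {set 'I_N} => k \in S) (index_enum _)) L (atom S) w}.
  apply: filter_forall => k.
  have := levy_basis_bigsetU (filter_uniq (fun S : {set 'I_N} => k \in S)
    (index_enum_uniq _)) measurable_atom trivIset_atom.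
  by rewrite bigcup_atom; apply; exact: finA.
apply: filterS all_k => w LE.
under eq_bigr => k _ do rewrite LE big_filter mulr_sumr big_mkcond/=.
rewrite exchange_big/=; apply: eq_bigr => S _.
by rewrite /atom_weight mulr_suml [RHS]big_mkcond.
Qed.

(** The atoms are disjoint, so their values are independent, and the log-characteristic function of
    the combination is the sum of the area of each atom times psi at its weight. *)
Lemma levy_basis_polar : polar_charfun P (fun w => \sum_k theta k * L (A k) w)
  (expR (\sum_S atom_measure S * psi_re gamma b nu (atom_weight S)))
  (\sum_S atom_measure S * psi_im gamma b nu (atom_weight S)).
Proof.
have mL S : measurable_fun setT (L (atom S)).
  by apply: levy_basis_measurable L_basis _ _ _; [exact: measurable_atom|exact: atom_finite].
(* Independence is stated for families indexed by ordinals, so the atoms are enumerated. *)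
pose X (i : 'I_#|{set 'I_N}|) w := atom_weight (enum_val i) * L (atom (enum_val i)) w.
have mX i : measurable_fun setT (X i) by exact: measurable_funM.
have indX : mutually_independent P X.
  apply: (@mutually_independent_comp _ _ _ _ _ (fun i => L (atom (enum_val i)))
    (fun i x => atom_weight (enum_val i) * x)).
    by move=> i; exact: measurable_funM.
  apply: (levy_basis_independent L_basis) => [i|i|].
  - exact: measurable_atom.
  - exact: atom_finite.
  - move=> i j _ _ /(trivIset_atom (i := enum_val i) I I).
    exact: enum_val_inj.
have [] := polar_charfun_sum mX indX (fun i => has_exponent_polar _
  (levy_basis_exponent L_basis (measurable_atom (enum_val i)) (atom_finite (enum_val i)))).
have reindex (F : {set 'I_N} -> R) :
    \sum_(i < #|{set 'I_N}|) F (enum_val i) = \sum_S F S.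
  by rewrite -(big_enum_val F); exact: eq_bigl.
rewrite -expR_sum.
under [X in expR X]eq_bigr => i _ do rewrite /= mul0r subr0.
under [X in cos X]eq_bigr => i _ do rewrite /= mul0r addr0.
under [X in sin X]eq_bigr => i _ do rewrite /= mul0r addr0.
rewrite (reindex (fun S => atom_measure S * psi_re gamma b nu (atom_weight S))).
rewrite (reindex (fun S => atom_measure S * psi_im gamma b nu (atom_weight S))).
have mSum : measurable_fun setT (fun w => \sum_S atom_weight S * L (atom S) w).
  by apply: measurable_sum => S; exact: measurable_funM.
have mSum' : measurable_fun setT (fun w => \sum_k theta k * L (A k) w).
  apply: measurable_sum => k; apply: measurable_funM => //.
  exact: levy_basis_measurable L_basis _ _ _.
have sumX w : \sum_i X i w = \sum_S atom_weight S * L (atom S) w.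
  exact: (reindex (fun S => atom_weight S * L (atom S) w)).
move=> hc hs; split.
  rewrite -hc; apply: eq_ae_expectation; [exact: measurable_cos| |].
    by under eq_fun do rewrite sumX; exact: measurable_cos.
  by apply: filterS levy_basis_atoms => w ->; rewrite sumX.
rewrite -hs; apply: eq_ae_expectation; [exact: measurable_sin| |].
  by under eq_fun do rewrite sumX; exact: measurable_sin.
by apply: filterS levy_basis_atoms => w ->; rewrite sumX.
Qed.

End levy_basis_families.

(** * Geometry of the trawl sets *)

Section plane_translation.
Context (R : realType).

Lemma lebesgue_measure_shift (c : R) (A : set R) : measurable A ->
  lebesgue_measure ((fun x => x + c) @^-1` A) = lebesgue_measure A.
Proof.
have mf : measurable_fun [set: measurableTypeR R]
    ((fun x => x + c) : measurableTypeR R -> measurableTypeR R).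
  exact: measurable_funD.
pose f : {mfun measurableTypeR R >-> measurableTypeR R} := HB.pack
  ((fun x => x + c) : measurableTypeR R -> measurableTypeR R)
  (isMeasurableFun.Build _ _ _ _ _ mf).
move=> mA; rewrite -[LHS]/(pushforward lebesgue_measure f A).
apply/esym/lebesgue_measure_unique => //= _ [[x y]] _ <-.
rewrite /pushforward (_ : f @^-1` _ = `]x - c, y - c]%classic); last first.
  by apply/seteqP; split => z /=; rewrite !in_itv/= ltrBlDr lerBrDr.
rewrite !lebesgue_measure_itv/= !lte_fin ltrD2r.
by case: ifP => // _; rewrite -!EFinD; congr EFin; ring.
Qed.

Lemma leb2_shift (c : R) (A : set (R * R)) : measurable A ->
  leb2 ((fun p => (p.1 + c, p.2)) @^-1` A) = leb2 A.
Proof.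
have mf : measurable_fun [set: (measurableTypeR R * measurableTypeR R)%type]
    ((fun p => (p.1 + c, p.2)) : measurableTypeR R * measurableTypeR R ->
     measurableTypeR R * measurableTypeR R).
  apply/measurable_fun_pairP; split => /=; last exact: measurable_snd.
  by apply: measurable_funD; [exact: measurable_fst|exact: measurable_cst].
pose f : {mfun (measurableTypeR R * measurableTypeR R)%type >->
    (measurableTypeR R * measurableTypeR R)%type} := HB.pack
  ((fun p => (p.1 + c, p.2)) : measurableTypeR R * measurableTypeR R ->
     measurableTypeR R * measurableTypeR R)
  (isMeasurableFun.Build _ _ _ _ _ mf).
move=> mA; rewrite -[LHS]/(pushforward (@leb2 R) f A).
apply/esym; rewrite /leb2; apply: (@product_measure_unique _ _ _ _ _ _ _
  (pushforward (lebesgue_measure \x lebesgue_measure)%E f)) => // B C mB mC.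
rewrite -[LHS]/((lebesgue_measure \x lebesgue_measure)%E (((fun x => x + c) @^-1` B) `*` C)).
rewrite product_measure1E//; last first.
  by rewrite -[X in measurable X]setTI; apply: measurable_funD.
by congr (_ * _)%E; exact: lebesgue_measure_shift.
Qed.

End plane_translation.

Section trawl_sets.
Context (R : realType) (a : R -> R).
Hypothesis a_trawl : trawl_function a.

(** [a] is arbitrary on the negative half-line; [ext] agrees with it on [0, +oo[ and is measurable
    everywhere. *)
Let ext (x : R) : R := a (Num.max x 0).

Let measurable_ext : measurable_fun setT ext.
Proof.
have /measurable_int/measurable_EFinP ma := trawl_integrable a_trawl.
have mmax : measurable_fun setT (fun x : R => Num.max x 0) by exact: measurable_maxr.
apply: (measurable_comp _ _ ma mmax) => //.
by move=> _ [x _ <-] /=; rewrite in_itv/= le_max lexx orbT.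
Qed.

Lemma trawl_set_atE (t : R) :
  trawl_set_at a t = [set p | p.1 <= t /\ 0 <= p.2 <= a (t - p.1)].
Proof.
apply/seteqP; split => [_ [[x y] /= [x0 xy] <-]|[x y] /= [xt xy]] /=.
  by rewrite gerDr opprD addrCA subrr addr0.
exists (x - t, y); rewrite /= ?subrK//; split; first by rewrite subr_le0.
by rewrite opprB.
Qed.

Lemma measurable_trawl_set_at (t : R) : measurable (trawl_set_at a t).
Proof.
rewrite trawl_set_atE (_ : [set p | _] =
  [set p | p.1 <= t] `&` ([set p | 0 <= p.2] `&` [set p | p.2 <= ext (t - p.1)])).
  apply: measurableI; last apply: measurableI.
  - by rewrite -[X in measurable X]setTI; apply: measurable_fun_le.
  - by rewrite -[X in measurable X]setTI; apply: measurable_fun_le.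
  - rewrite -[X in measurable X]setTI; apply: measurable_fun_le => //.
    by apply: (measurableT_comp measurable_ext); exact: measurable_funB.
apply/seteqP; split => -[x y] /=; rewrite /ext.
  move=> [xt /andP[y0 ya]]; split => //; split => //.
  by rewrite max_l// subr_ge0.
by move=> [xt [y0]]; rewrite max_l ?subr_ge0// => ya; split => //; rewrite y0.
Qed.

Lemma leb2_trawl_set_at (t : R) : leb2 (trawl_set_at a t) = leb2 (trawl_set_at a 0).
Proof.
rewrite -(leb2_shift t (measurable_trawl_set_at t)); congr leb2.
apply/seteqP; split => -[x y]; rewrite !trawl_set_atE /=.
  by rewrite gerDr opprD addrCA subrr addr0 sub0r.
by rewrite gerDr opprD addrCA subrr addr0 sub0r.
Qed.

(** The sections of the set at time 0 are the intervals [0, a(-x)], so that its area is the integral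
    of [a] after a change of sign. *)
Lemma leb2_trawl_set_at_fin (t : R) : (leb2 (trawl_set_at a t) < +oo)%E.
Proof.
rewrite leb2_trawl_set_at /leb2 /product_measure1.
have /integrableP[_] := trawl_integrable a_trawl.
apply: le_lt_trans; rewrite le_eqVlt; apply/orP; left; apply/eqP.
transitivity (\int[lebesgue_measure]_(x in `]-oo, 0%R]) (ext (- x))%:E)%E.
  rewrite [RHS]integral_mkcond; apply: eq_integral => x _ /=.
  rewrite patchE; case: ifPn => [|].
    rewrite inE/= in_itv/= => x0.
    rewrite (_ : xsection _ _ = `[0, a (- x)]%classic); last first.
      rewrite /xsection trawl_set_atE; apply/seteqP; split => y /=; rewrite inE/= in_itv/=.
        by rewrite sub0r => -[].
      by rewrite sub0r.
    rewrite lebesgue_measure_itv/= /ext max_l ?oppr_ge0// lte_fin.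
    case: ifPn => [_|]; first by rewrite oppr0 adde0.
    rewrite -leNgt => h; congr EFin; apply/eqP; rewrite eq_le h.
    by rewrite (trawl_ge0 a_trawl)// oppr_ge0.
  rewrite notin_setE/= in_itv/= => x0.
  rewrite (_ : xsection _ _ = set0) ?measure0//.
  by rewrite /xsection trawl_set_atE; apply/seteqP; split => y //=; rewrite inE/= => -[].
rewrite -(@ge0_integration_by_substitution0 _ (EFin \o ext)).
- apply: eq_integral => x; rewrite inE/= in_itv/= andbT => x0.
  by rewrite /ext max_l// ger0_norm// (trawl_ge0 a_trawl).
- by apply/measurable_EFinP; exact: measurable_ext.
- by move=> r; rewrite lee_fin (trawl_ge0 a_trawl)// le_max lexx orbT.
Qed.

End trawl_sets.

Section indicator_combinations.
Context d (T : measurableType d) (R : realType) (mu : {measure set T -> \bar R}).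

Lemma integrable_indicator (E : set T) : measurable E -> (mu E < +oo)%E ->
  mu.-integrable setT (EFin \o (\1_E : T -> R)).
Proof.
move=> mE finE; apply/integrableP; split.
  by apply/measurable_EFinP; exact: measurable_indic.
under eq_integral do rewrite /= ger0_norm//.
by rewrite integral_indic// setIT.
Qed.

Lemma Rintegral_indicator (E : set T) : measurable E ->
  \int[mu]_x (\1_E x : R) = fine (mu E).
Proof. by move=> mE; rewrite /Rintegral integral_indic// setIT. Qed.

Lemma indicator_combination (J : finType) (c : J -> R) (E : J -> set T) :
  (forall j, measurable (E j)) -> (forall j, (mu (E j) < +oo)%E) ->
  mu.-integrable setT (EFin \o (fun x => \sum_j c j * (\1_(E j) x : R))) /\
  \int[mu]_x (\sum_j c j * (\1_(E j) x : R)) = \sum_j c j * fine (mu (E j)).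
Proof.
move=> mE finE; rewrite /index_enum; elim: (Finite.enum J) => [|j s [IHi IH]].
  split.
    by under eq_fun do rewrite big_nil; exact: integrable0.
  by under eq_Rintegral do rewrite big_nil; rewrite big_nil /Rintegral integral0.
have ij := integrable_indicator (mE j) (finE j).
have icj : mu.-integrable setT (EFin \o (fun x => c j * (\1_(E j) x : R))).
  exact: (integrableZl measurableT (c j) ij).
split.
  under eq_fun do rewrite big_cons.
  exact: (integrableD measurableT icj IHi).
under eq_Rintegral do rewrite big_cons.
by rewrite RintegralD// big_cons IH RintegralZl// Rintegral_indicator.
Qed.

End indicator_combinations.

(** * The weight carried by a point of the plane *)

Section weight_function.
Context (R : realType) (N : nat) (A : 'I_N -> set (R * R)) (theta : 'I_N -> R).
Hypotheses (mA : forall k, measurable (A k)) (finA : forall k, (leb2 (A k) < +oo)%E).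

Local Notation mu2 := (@lebesgue_measure R \x @lebesgue_measure R)%E.

Definition weight_at (p : R * R) : R := \sum_k theta k * (\1_(A k) p : R).

Let alive p : {set 'I_N} := [set k | `[< A k p >]]%SET.

Let weight_at_alive p : weight_at p = atom_weight theta (alive p).
Proof.
rewrite /weight_at /atom_weight [RHS]big_mkcond; apply: eq_bigr => k _.
rewrite inE; case: asboolP => h; first by rewrite indicE mem_set// mulr1.
by rewrite indicE memNset// mulr0.
Qed.

Let atom_sum (G : R -> R) p : G 0 = 0 ->
  \sum_S G (atom_weight theta S) * (\1_(atom A S) p : R) = G (weight_at p).
Proof.
move=> G0; rewrite weight_at_alive (bigD1 (alive p))//= big1 => [|S Sne].
  have [->|ne] := eqVneq (alive p) finset.set0.
    by rewrite /atom_weight big_set0 G0 mul0r addr0.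
  rewrite indicE mem_set ?mulr1 ?addr0//; split => // k; rewrite inE.
  by split => [/asboolP|/asboolP].
rewrite indicE memNset ?mulr0// => -[_ h]; move/eqP: Sne; apply.
by apply/setP => k; rewrite inE; apply/idP/asboolP => [/h|/h].
Qed.

Lemma integrable_weight (G : R -> R) : G 0 = 0 ->
  mu2.-integrable setT (EFin \o (fun p => G (weight_at p))).
Proof.
move=> G0; have [+ _] := indicator_combination (mu := mu2) (fun S => G (atom_weight theta S))
  (measurable_atom mA) (atom_finite mA finA).
by under eq_fun do rewrite atom_sum//.
Qed.

(** The weight is constant on each atom, so that a sum over atoms becomes an integral over the plane
    and the atoms never have to be listed. The condition [G 0 = 0] disposes of the points outside
    all the [A k], which belong to no atom. *)
Lemma Rintegral_weight (G : R -> R) : G 0 = 0 ->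
  \int[mu2]_p G (weight_at p) = \sum_S atom_measure A S * G (atom_weight theta S).
Proof.
move=> G0; have [_] := indicator_combination (mu := mu2) (fun S => G (atom_weight theta S))
  (measurable_atom mA) (atom_finite mA finA).
under eq_Rintegral do rewrite atom_sum//.
by move=> ->; apply: eq_bigr => S _; rewrite mulrC.
Qed.

Lemma levy_basis_weight_polar d (T : measurableType d) (P : probability T R) gamma b
    (nu : {measure set R -> \bar R}) (L : set (R * R) -> T -> R) :
  levy_measure nu -> levy_basis P gamma b nu L ->
  polar_charfun P (fun w => \sum_k theta k * L (A k) w)
    (expR (\int[mu2]_p psi_re gamma b nu (weight_at p)))
    (\int[mu2]_p psi_im gamma b nu (weight_at p)).
Proof.
move=> nu_levy L_basis; rewrite !Rintegral_weight ?psi_re0 ?psi_im0//.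
exact: levy_basis_polar.
Qed.

End weight_function.

Section area.
Context (R : realType).
Implicit Types (X Y : set (R * R)).

Definition area X : R := fine (leb2 X).

Lemma le_area X Y : measurable X -> measurable Y -> (leb2 Y < +oo)%E -> X `<=` Y ->
  area X <= area Y.
Proof.
move=> mX mY finY XY; have leXY := le_leb2 mX mY XY.
by rewrite fine_le// ?leb2_fin_num//; exact: le_lt_trans finY.
Qed.

Lemma areaD X Y : measurable X -> measurable Y -> (leb2 X < +oo)%E ->
  area (X `\` Y) = area X - area (X `&` Y).
Proof.
move=> mX mY finX; rewrite /area /leb2 measureD//.
rewrite fineB//; apply: leb2_fin_num => //.
by apply: le_lt_trans finX; apply: le_leb2 => //; exact: measurableI.
Qed.

Lemma measurable_rectangle (u v c e : R) : measurable (`]u, v] `*` `[c, e] : set (R * R)).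
Proof. by apply: measurableX. Qed.

Lemma leb2_rectangle (u v c e : R) : u <= v -> c <= e ->
  leb2 (`]u, v] `*` `[c, e]) = ((v - u) * (e - c))%:E.
Proof.
move=> uv ce; rewrite /leb2 product_measure1E//.
rewrite (_ : (v - u) * (e - c) = fine (v - u)%:E * fine (e - c)%:E)//.
rewrite EFinM; congr (_ * _)%E.
  transitivity (lebesgue_measure (`]u, v]%classic : set R)) => //.
  rewrite lebesgue_measure_itv/= lte_fin; move: uv.
  by rewrite le_eqVlt => /predU1P[->|uv]; [rewrite ltxx subrr|rewrite uv -EFinD].
transitivity (lebesgue_measure (`[c, e]%classic : set R)) => //.
rewrite lebesgue_measure_itv/= lte_fin; move: ce.
by rewrite le_eqVlt => /predU1P[->|ce]; [rewrite ltxx subrr|rewrite ce -EFinD].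
Qed.

End area.

(** * Points that leave, or enter, a monotone family of sets *)

Section crossing.
Context (R : realType) (th : nat -> R) (N : nat) (G : R -> R).
Hypotheses (th0 : \sum_(k < N.+1) th k = 0) (G0 : G 0 = 0).

Let w j := \sum_(k < j) th k.

(** A point that belongs to the sets of index below m only has as weight the partial sum of [th] up
    to m. A point of all the sets has weight 0 because [th] sums to 0, and so has a point of none:
    only crossings contribute. *)
Lemma decreasing_crossing (c : nat -> bool) : (forall k, c k.+1 -> c k) ->
  G (\sum_(k < N.+1) th k * (c k)%:R) = \sum_(j < N) G (w j.+1) * (c j && ~~ c j.+1)%:R.
Proof.
move=> dc; have dcle i j : (i <= j)%N -> c j -> c i.
  elim: j => [|j IH]; first by rewrite leqn0 => /eqP ->.
  by rewrite leq_eqVlt => /predU1P[->//|/IH h /dc /h].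
have [cN|cN] := boolP (c N).
  rewrite (eq_bigr (fun k : 'I_N.+1 => th k)) ?th0 ?G0 => [|k _]; last first.
    by rewrite (dcle _ N)// ?mulr1// -ltnS.
  by rewrite big1// => j _; rewrite (dcle j.+1 N)// andbF mulr0.
have ex : exists j, ~~ c j by exists N.
case: (ex_minnP ex) => m cm minm.
have mN : (m <= N)%N by exact: minm.
have cE k : c k = (k < m)%N.
  apply/idP/idP => [ck|km]; first by rewrite ltnNge; apply: contra cm => /dcle; apply.
  by apply: contraTT km => /minm; rewrite -leqNgt.
have -> : \sum_(k < N.+1) th k * (c k)%:R = w m.
  rewrite /w (big_ord_widen N.+1 th (leqW mN)) [RHS]big_mkcond.
  by apply: eq_bigr => k _; rewrite cE; case: ifP; rewrite ?mulr1 ?mulr0.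
case: m {minm cm} mN cE => [_ cE|m mN cE].
  by rewrite /w big_ord0 G0 big1// => j _; rewrite cE ltn0 mulr0.
rewrite (bigD1 (Ordinal mN))//= !cE ltnSn ltnn mulr1 big1 ?addr0// => j jm.
rewrite !cE ltnS -leqNgt -eqn_leq.
by case: eqP => [jm'|]; rewrite ?mulr0//; move/eqP: jm; case; exact/val_inj.
Qed.

(** A point that belongs to the sets from index m on has as weight the remaining part of the sum,
    which is minus the partial sum since the total is 0. *)
Lemma increasing_crossing (c : nat -> bool) : ~~ c 0%N -> (forall k, c k -> c k.+1) ->
  G (\sum_(k < N.+1) th k * (c k)%:R) = \sum_(j < N) G (- w j.+1) * (c j.+1 && ~~ c j)%:R.
Proof.
move=> c0 ic; have icle i j : (i <= j)%N -> c i -> c j.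
  elim: j => [|j IH]; first by rewrite leqn0 => /eqP ->.
  by rewrite leq_eqVlt => /predU1P[->//|/IH h /h /ic].
have [cN|cN] := boolP (c N); last first.
  rewrite big1 ?G0 => [|k _]; last first.
    by rewrite (negbTE (contra (icle k N _) cN)) ?mulr0// -ltnS.
  rewrite big1// => j _; rewrite (negbTE (contra (icle j.+1 N _) cN)) ?mulr0//.
have ex : exists j, c j by exists N.
case: (ex_minnP ex) => m cm minm.
have mN : (m <= N)%N by exact: minm.
have cE k : c k = (m <= k)%N.
  by apply/idP/idP => [/minm//|/icle]; apply.
have -> : \sum_(k < N.+1) th k * (c k)%:R = - w m.
  apply/eqP; rewrite -addr_eq0; apply/eqP; rewrite -[RHS]th0.
  rewrite /w (big_ord_widen N.+1 th (leqW mN)) [X in _ + X]big_mkcond -big_split/=.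
  apply: eq_bigr => k _; rewrite cE leqNgt.
  by case: ifP; rewrite ?mulr1 ?mulr0 ?add0r ?addr0.
case: m {minm} cm mN cE => [|m] cm mN cE; first by rewrite cm in c0.
rewrite (bigD1 (Ordinal mN))//= !cE ltnSn ltnn mulr1 big1 ?addr0// => j jm.
rewrite !cE ltnS -leqNgt -eqn_leq.
by case: eqP => [jm'|]; rewrite ?mulr0//; move/eqP: jm; case; exact/val_inj.
Qed.

End crossing.

Lemma three_errors (R : realDomainType) (I x y x' y' c : R) : `|I - (x + y)| <= c ->
  `|x - x'| <= c -> `|y - y'| <= c -> `|I - (x' + y')| <= 3 * c.
Proof.
rewrite !ler_norml => /andP[? ?] /andP[? ?] /andP[? ?].
by apply/andP; split; lra.
Qed.

(** * Areas of the pieces cut out by the shifted trawl sets *)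

Section trawl_weights.
Context (R : realType) (a : R -> R).
Hypothesis a_trawl : trawl_function a.
Context (Dl : R) (N : nat) (th : nat -> R).
Hypotheses (Dl0 : 0 < Dl) (th0 : \sum_(k < N.+1) th k = 0).

Local Notation mu2 := (@lebesgue_measure R \x @lebesgue_measure R)%E.

Definition trawl_grid (k : nat) : set (R * R) := trawl_set_at a (k%:R * Dl).

Let A (k : 'I_N.+1) := trawl_grid k.
Let aN := a (N%:R * Dl).
Let Theta := weight_at A th.
Let w j := \sum_(k < j) th k.

Let mA k : measurable (trawl_grid k). Proof. exact: measurable_trawl_set_at. Qed.

Let finA k : (leb2 (trawl_grid k) < +oo)%E. Proof. exact: leb2_trawl_set_at_fin. Qed.

Let finAI k X : measurable X -> (leb2 (trawl_grid k `&` X) < +oo)%E.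
Proof.
by move=> mX; apply: le_lt_trans (finA k); apply: le_leb2 => //; exact: measurableI.
Qed.

Let finAD k X : measurable X -> (leb2 (trawl_grid k `\` X) < +oo)%E.
Proof.
by move=> mX; apply: le_lt_trans (finA k); apply: le_leb2 => //; exact: measurableD.
Qed.

Let area_grid k l : area (trawl_grid k) = area (trawl_grid l).
Proof. by rewrite /area /trawl_grid !(leb2_trawl_set_at a_trawl (_ * _)). Qed.

Let area_gridD k l : area (trawl_grid k `\` trawl_grid l) = area (trawl_grid l `\` trawl_grid k).
Proof.
rewrite (areaD (mA k) (mA l) (finA k)) (areaD (mA l) (mA k) (finA l)).
by rewrite setIC (area_grid k l).
Qed.

Let gridP k p : trawl_grid k p <-> p.1 <= k%:R * Dl /\ 0 <= p.2 <= a (k%:R * Dl - p.1).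
Proof. by rewrite /trawl_grid trawl_set_atE. Qed.

Let tmono i j : (i <= j)%N -> i%:R * Dl <= j%:R * Dl.
Proof. by move=> ij; rewrite ler_wpM2r ?ler_nat// ltW. Qed.

Let t0 i : 0 <= i%:R * Dl. Proof. by rewrite mulr_ge0// ltW. Qed.

Let a0N : aN <= a 0. Proof. exact: (trawl_noninc a_trawl). Qed.

Let aN0 : 0 <= aN. Proof. exact: trawl_ge0. Qed.

Let le_a0 x : 0 <= x -> a x <= a 0. Proof. by move=> x0; exact: (trawl_noninc a_trawl). Qed.

(** Points of nonpositive abscissa can only leave as the set moves. A point of [entering j] belongs
    to the sets of index j+1 to N exactly, because its height is at most [a (N Dl)]. The points of
    [residual] may enter and leave again before N: they are not classified, and their area is small
    because [a] is continuous at 0. *)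
Let leaving j := (trawl_grid 0 `&` trawl_grid j) `\` trawl_grid j.+1.
Let entering j : set (R * R) := `]j%:R * Dl, j.+1%:R * Dl] `*` `[0, aN].
Let residual : set (R * R) := `]0, N%:R * Dl] `*` `[aN, a 0].

Let mleaving j : measurable (leaving j).
Proof. by apply: measurableD => //; exact: measurableI. Qed.

Let finleaving j : (leb2 (leaving j) < +oo)%E.
Proof.
by apply: le_lt_trans (finA 0%N); apply: le_leb2 => // p [[]].
Qed.

Let fin_rectangle u v c e : u <= v -> c <= e -> (leb2 (`]u, v] `*` `[c, e] : set (R * R)) < +oo)%E.
Proof. by move=> uv ce; rewrite leb2_rectangle// ltry. Qed.

Let area_entering j : area (entering j) = Dl * aN.
Proof.
rewrite /area leb2_rectangle//; last exact: tmono.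
by rewrite -[j.+1%:R]natr1 /=; ring.
Qed.

Let area_residual : area residual = N%:R * Dl * (a 0 - aN).
Proof. by rewrite /area leb2_rectangle//= ?subr0. Qed.

(** Two consecutive sets have the same area, so what leaves has the area of what enters, and the
    latter lies in a rectangle of sides [Dl] and [a 0]. *)
Let area_leaving_le j : area (leaving j) <= Dl * a 0.
Proof.
apply: (@le_trans _ _ (area (trawl_grid j `\` trawl_grid j.+1))).
  apply: le_area => //; [exact: measurableD|exact: finAD|].
  by move=> p [[_ ?] ?].
rewrite area_gridD (_ : Dl * a 0 = area (`]j%:R * Dl, j.+1%:R * Dl] `*` `[0, a 0])).
  apply: le_area => //; [exact: measurableD|exact: measurable_rectangle| |].
    by apply: fin_rectangle; [exact: tmono|exact: trawl_ge0].
  move=> p [/gridP[pj /andP[p0 pa]] /gridP nj]; split => /=; rewrite in_itv/=.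
    rewrite pj andbT ltNge; apply/negP => pj'; apply: nj; split => //.
    rewrite p0 (le_trans pa)//; apply: (trawl_noninc a_trawl).
      by rewrite subr_ge0.
    by rewrite lerD2r tmono.
  by rewrite p0 (le_trans pa)// le_a0// subr_ge0.
rewrite /area leb2_rectangle//; [|exact: tmono|exact: trawl_ge0].
by rewrite -[j.+1%:R]natr1 /=; ring.
Qed.

Let noninc_at p k : p.1 <= 0 -> trawl_grid k.+1 p -> trawl_grid k p.
Proof.
move=> p0 /gridP[_ /andP[p20 p2]]; apply/gridP; split; first exact: le_trans p0 (t0 k).
rewrite p20 (le_trans p2)//; apply: (trawl_noninc a_trawl).
  by rewrite subr_ge0 (le_trans p0).
by rewrite lerD2r tmono.
Qed.

Let grid_chain p i j : p.1 <= 0 -> (i <= j)%N -> trawl_grid j p -> trawl_grid i p.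
Proof.
move=> p0; elim: j => [|j IH]; first by rewrite leqn0 => /eqP ->.
by rewrite leq_eqVlt => /predU1P[->//|/IH h /(noninc_at p0)].
Qed.

Let grid0_le0 p : trawl_grid 0 p -> p.1 <= 0.
Proof. by move=> /gridP[]; rewrite mul0r. Qed.

(** The areas telescope to that of the points of the first set missing from the last, which equals
    the area of the points of the last missing from the first; these include the rectangle of height
    [aN]. With the upper bound on each piece, this controls the total error made by replacing every
    area by [Dl a 0]. *)
Let sum_area_leaving : N%:R * Dl * aN <= \sum_(j < N) area (leaving j).
Proof.
have telescope n : \sum_(j < n) area (leaving j) =
    area (trawl_grid 0) - area (trawl_grid 0 `&` trawl_grid n).
  elim: n => [|n IH]; first by rewrite big_ord0 setIid subrr.
  rewrite big_ord_recr/= IH /leaving (areaD _ (mA _) (finAI _ (mA _))); last exact: measurableI.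
  have -> : trawl_grid 0 `&` trawl_grid n `&` trawl_grid n.+1 = trawl_grid 0 `&` trawl_grid n.+1.
    apply/seteqP; split => [p [[? _] ?]|p [p0 pn]]//; split => //; split => //.
    by apply: noninc_at => //; exact: grid0_le0.
  by rewrite addrA subrK.
rewrite telescope -(areaD (mA _) (mA _) (finA _)) area_gridD.
rewrite (_ : _ * aN = area (`]0, N%:R * Dl] `*` `[0, aN])); last first.
  by rewrite /area leb2_rectangle//= ?subr0.
apply: le_area => //; [exact: measurable_rectangle|exact: measurableD|exact: finAD|].
move=> p [/=]; rewrite !in_itv/= => /andP[p1 p1N] /andP[p2 p2N]; split.
  apply/gridP; split => //; rewrite p2 (le_trans p2N)//.
  by apply: (trawl_noninc a_trawl); [rewrite subr_ge0|rewrite gerBl ltW].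
by move=> /grid0_le0; rewrite leNgt p1.
Qed.

Let indicator_bool (X : set (R * R)) p : (\1_X p : R) = (`[< X p >])%:R.
Proof. by rewrite indicE; congr (_%:R); apply/idP/asboolP => [/set_mem|/mem_set]. Qed.

(** The classification into leaving and entering points is exact outside [residual], where nothing
    but the bound K is used. *)
Let pointwise (G : R -> R) (K : R) p : G 0 = 0 -> `|G (Theta p)| <= K ->
  `|G (Theta p) - \sum_(j < N) (G (w j.+1) * (\1_(leaving j) p : R) +
       G (- w j.+1) * (\1_(entering j) p : R))| <= K * (\1_residual p : R).
Proof.
move=> G0 GK; have K0 : 0 <= K by exact: le_trans GK.
have res0 : 0 <= K * (\1_residual p : R) by rewrite mulr_ge0.
have ThetaE : Theta p = \sum_(k < N.+1) th k * (`[< trawl_grid k p >])%:R.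
  by apply: eq_bigr => k _; rewrite indicator_bool.
have [p0|p0] := leP p.1 0.
  suff -> : \sum_(j < N) (G (w j.+1) * (\1_(leaving j) p : R) +
      G (- w j.+1) * (\1_(entering j) p : R)) = G (Theta p) by rewrite subrr normr0.
  rewrite ThetaE (decreasing_crossing th0 G0 (c := fun k => `[< trawl_grid k p >])); last first.
    by move=> k /asboolP/(noninc_at p0)/asboolP.
  apply: eq_bigr => j _; rewrite !indicator_bool.
  rewrite (asboolF (P := entering j p)) ?mulr0 ?addr0; last first.
    by case=> /=; rewrite in_itv/= => /andP[]; rewrite ltNge (le_trans p0).
  congr (_ * _%:R); congr nat_of_bool; rewrite -asbool_neg -asbool_and.
  apply: asbool_equiv_eq; split => [[[]]//|[pj pj1]]; split => //; split => //.
  exact: grid_chain pj.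
have leaving0 j : (\1_(leaving j) p : R) = 0.
  rewrite indicator_bool asboolF// => -[[/grid0_le0]].
  by rewrite leNgt p0.
under eq_bigr do rewrite leaving0 mulr0 add0r.
have [pr|pr] := pselect (0 <= p.2 <= aN).
  suff -> : \sum_(j < N) G (- w j.+1) * (\1_(entering j) p : R) = G (Theta p).
    by rewrite subrr normr0.
  have gridE (k : 'I_N.+1) : `[< trawl_grid k p >] = (p.1 <= k%:R * Dl).
    apply/asboolP/idP => [/gridP[]//|pk]; apply/gridP; split => //.
    move: pr => /andP[-> /le_trans]; apply.
    apply: (trawl_noninc a_trawl); first by rewrite subr_ge0.
    by rewrite lerBlDr ler_wpDr ?(ltW p0)// tmono// -ltnS.
  rewrite ThetaE; under [in RHS]eq_bigr do rewrite gridE.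
  rewrite (increasing_crossing th0 G0 (c := fun k => p.1 <= k%:R * Dl)); last 2 first.
  - by rewrite mul0r -ltNge.
  - by move=> k /le_trans; apply; exact: tmono.
  apply: eq_bigr => j _; rewrite indicator_bool; congr (_ * _%:R); congr nat_of_bool.
  rewrite -ltNge andbC; apply/asboolP/idP => [[/=]|h]; first by rewrite in_itv.
  by split => /=; rewrite in_itv.
rewrite big1 ?subr0 => [|j _]; last first.
  by rewrite indicator_bool asboolF ?mulr0// => -[_ /=]; rewrite in_itv/=.
have [h|h] := pselect (residual p).
  by rewrite indicator_bool asboolT// mulr1.
rewrite ThetaE big1 ?G0 ?normr0// => k _; rewrite asboolF ?mulr0// => /gridP[pk /andP[p2 pa]].
apply: h; split => /=; rewrite in_itv/=.
  by rewrite p0 (le_trans pk)// tmono// -ltnS.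
rewrite (le_trans pa) ?le_a0 ?subr_ge0// andbT.
by rewrite leNgt; apply/negP => /ltW pN; apply: pr; rewrite p2.
Qed.

Lemma integrable_trawl_weight (G : R -> R) : G 0 = 0 ->
  mu2.-integrable setT (EFin \o (fun p => G (weight_at A th p))).
Proof. by move=> G0; apply: integrable_weight => // k; [exact: mA|exact: finA]. Qed.

(** Three errors, each at most K times the area of [residual]: the unclassified points, and the
    replacement of the areas of the leaving and of the entering pieces by [Dl a 0]. *)
Lemma trawl_weight_integral (G : R -> R) (K : R) : G 0 = 0 ->
  (forall p, `|G (weight_at A th p)| <= K) ->
  (forall j, (j <= N)%N -> `|G (\sum_(k < j) th k)| <= K /\ `|G (- \sum_(k < j) th k)| <= K) ->
  `|\int[mu2]_p G (weight_at A th p) -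
    Dl * a 0 * \sum_(j < N) (G (\sum_(k < j.+1) th k) + G (- \sum_(k < j.+1) th k))|
  <= 3 * (K * (N%:R * Dl * (a 0 - a (N%:R * Dl)))).
Proof.
move=> G0 GK Gw; have K0 : 0 <= K by exact: le_trans (GK (0, 0)).
have intG := integrable_trawl_weight G0.
have [intl Il] := indicator_combination (mu := mu2) (fun j : 'I_N => G (w j.+1))
  (fun j => mleaving j) (fun j => finleaving j).
have [inte Ie] := indicator_combination (mu := mu2) (fun j : 'I_N => G (- w j.+1))
  (fun j => measurable_rectangle _ _ _ _) (fun j : 'I_N => fin_rectangle (tmono (leqnSn j)) aN0).
have mres : measurable residual by exact: measurable_rectangle.
have finres : (mu2 residual < +oo)%E by exact: fin_rectangle.
have intr := integrable_indicator (mu := mu2) mres finres.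
have intKr := integrableZl measurableT K intr.
have intle := integrableD measurableT intl inte.
have intD := integrableB measurableT intG intle.
have main : `|\int[mu2]_p G (Theta p) -
    (\sum_(j < N) G (w j.+1) * area (leaving j) + \sum_(j < N) G (- w j.+1) * area (entering j))|
    <= K * area residual.
  rewrite /area -[X in _ - (X + _)]Il -[X in _ - (_ + X)]Ie -(Rintegral_indicator mu2 mres).
  rewrite -RintegralD// -RintegralB// -RintegralZl//.
  apply: (le_trans (le_normr_Rintegral _ intD)) => //.
  apply: le_Rintegral => //; first exact: integrable_norm.
  by move=> p _; rewrite /= -big_split/=; exact: pointwise.
rewrite area_residual in main.
have step1 : `|\sum_(j < N) G (w j.+1) * area (leaving j) - \sum_(j < N) G (w j.+1) * (Dl * a 0)|
    <= K * (N%:R * Dl * (a 0 - aN)).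
  rewrite -sumrB; apply: (le_trans (ler_norm_sum _ _ _)).
  apply: (@le_trans _ _ (\sum_(j < N) (K * (Dl * a 0 - area (leaving j))))).
    apply: ler_sum => j _; rewrite -mulrBr normrM distrC.
    rewrite [X in _ * X]ger0_norm ?subr_ge0// ler_wpM2r ?subr_ge0//.
    by have [] := Gw j.+1 (ltn_ord j).
  rewrite -mulr_sumr ler_wpM2l// sumrB sumr_const card_ord.
  rewrite -[X in X - _]mulr_natl mulrA [leRHS]mulrBr lerD2l lerN2.
  exact: sum_area_leaving.
have step2 : `|\sum_(j < N) G (- w j.+1) * area (entering j) - \sum_(j < N) G (- w j.+1) * (Dl * a 0)|
    <= K * (N%:R * Dl * (a 0 - aN)).
  rewrite -sumrB; apply: (le_trans (ler_norm_sum _ _ _)).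
  apply: (@le_trans _ _ (\sum_(j < N) (K * (Dl * (a 0 - aN))))).
    apply: ler_sum => j _; rewrite -mulrBr normrM area_entering (distrC (Dl * aN)) -mulrBr.
    have pos : 0 <= Dl * (a 0 - aN) by rewrite mulr_ge0 ?subr_ge0// (ltW Dl0).
    rewrite [X in _ * X]ger0_norm// ler_wpM2r//.
    by have [] := Gw j.+1 (ltn_ord j).
  by rewrite sumr_const card_ord -[leLHS]mulr_natl mulrCA -mulrA.
have -> : Dl * a 0 * \sum_(j < N) (G (w j.+1) + G (- w j.+1)) =
    \sum_(j < N) G (w j.+1) * (Dl * a 0) + \sum_(j < N) G (- w j.+1) * (Dl * a 0).
  by rewrite -big_split mulr_sumr; apply: eq_bigr => j _ /=; ring.
exact: (three_errors main step1 step2).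
Qed.

(** All the shifted sets have the same area and the coefficients sum to 0. This is what kills the
    linear part of the imaginary exponent. *)
Lemma Rintegral_trawl_weight : \int[mu2]_p weight_at A th p = 0.
Proof.
have [_] := indicator_combination (mu := mu2) (fun k : 'I_N.+1 => th k)
  (fun k => mA k) (fun k => finA k).
rewrite /weight_at => ->.
rewrite (eq_bigr (fun k : 'I_N.+1 => th k * area (trawl_grid 0))).
  by rewrite -mulr_suml th0 mul0r.
by move=> k _; rewrite -(area_grid k).
Qed.

(** A point lying in all the sets or in none has weight 0. The remaining ones are covered by two
    pieces of area at most [N Dl a 0], which shrinks with the scale; the asymptotic independence of
    different scales rests on this. *)
Lemma trawl_weight_support : exists D : set (R * R), [/\ measurable D,
  (leb2 D <= (2 * (N%:R * Dl * a 0))%:E)%E &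
  forall p, weight_at A th p != 0 -> D p].
Proof.
pose E : set (R * R) := `]0, N%:R * Dl] `*` `[0, a 0].
have mE : measurable E by exact: measurable_rectangle.
have finE : (leb2 E < +oo)%E by apply: fin_rectangle => //; exact: trawl_ge0.
have areaE : area E = N%:R * Dl * a 0.
  by rewrite /area leb2_rectangle//= ?subr0//; exact: trawl_ge0.
have m0N : measurable (trawl_grid 0 `\` trawl_grid N) by exact: measurableD.
exists ((trawl_grid 0 `\` trawl_grid N) `|` E); split.
- exact: measurableU.
- apply: (le_trans (measureU2 mu2 m0N mE)).
  rewrite (_ : (_ + _)%E = (area (trawl_grid 0 `\` trawl_grid N) + area E)%:E); last first.
    by rewrite EFinD /area !fineK ?leb2_fin_num// finAD.
  rewrite lee_fin area_gridD areaE.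
  suff : area (trawl_grid N `\` trawl_grid 0) <= area E by rewrite areaE; lra.
  apply: le_area => //; first exact: measurableD.
  move=> p [/gridP[pN /andP[p2 pa]] n0]; split => /=; rewrite in_itv/=.
    rewrite pN andbT ltNge; apply/negP => p10; apply: n0.
    by apply: (grid_chain p10 (leq0n N)); apply/gridP; rewrite p2.
  by rewrite p2 (le_trans pa)// le_a0// subr_ge0.
- move=> p /eqP nz; apply: contrapT => /not_orP[n0N nE]; apply: nz.
  have [p0|p0] := leP p.1 0.
    have [pN|pN] := pselect (trawl_grid N p).
      rewrite -[RHS]th0; apply: eq_bigr => k _.
      rewrite indicE mem_set ?mulr1//; apply: (grid_chain p0 _ pN).
      by rewrite -ltnS.
    rewrite /weight_at big1// => k _; rewrite indicE memNset ?mulr0// => pk.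
    by apply: n0N; split => //; exact: (grid_chain p0 (leq0n k)).
  rewrite /weight_at big1// => k _; rewrite indicE memNset ?mulr0// => /gridP[pk /andP[p2 pa]].
  apply: nE; split => /=; rewrite in_itv/=.
    by rewrite p0 (le_trans pk)// tmono// -ltnS.
  by rewrite p2 (le_trans pa)// le_a0// subr_ge0.
Qed.

End trawl_weights.

(** * The log-characteristic function at scale n *)

Section prelimit.
Context (R : realType) (a : R -> R) (a_trawl : trawl_function a).
Context (Delta : nat -> R) (Delta_gt0 : forall n, 0 < Delta n)
  (nDelta_cvg0 : n%:R * Delta n @[n --> \oo] --> (0 : R)).
Context (beta : R) (beta_gt0 : 0 < beta).
Context (s : nat -> R) (s_gt0 : forall n, (0 < n)%N -> 0 < s n)
  (s_powR : forall n, s n `^ beta = n%:R * Delta n).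
Context (k : nat) (t z : 'I_k -> R) (t_ge0 : forall i, 0 <= t i).

Local Notation mu2 := (@lebesgue_measure R \x @lebesgue_measure R)%E.

Definition steps (n : nat) (i : 'I_k) : nat := Num.truncn (n%:R * t i).
(** A common bound for the numbers of steps attached to all the [t i]. *)
Definition horizon (n : nat) : nat := Num.truncn (n%:R * \sum_i t i).

(* [Z^n_t] puts the weight [([nt] - j)^+ / n] on the j-th increment of X; the
   subtraction is truncated. *)
Definition ramp (n j : nat) : R := n%:R^-1 * \sum_i z i * ((steps n i - j)%N)%:R.

(** The coefficient of [X_(l Delta_n)] in the linear combination of the normalised Z. The multiple
    [[nt]] of [X_0] falls on [l = 0], from which the term [l = 0] of the partial sum is still
    subtracted. The partial sums of these coefficients are the ramps divided by [s n]. *)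
Definition coef (n l : nat) : R := (s n)^-1 * (n%:R^-1 *
  \sum_i z i * ((l == 0%N)%:R * (steps n i)%:R - ((l < steps n i)%N)%:R)).

Let B : R := \sum_i `|z i| * t i.
Let H : R := \sum_i t i.

Let H0 : 0 <= H. Proof. exact: sumr_ge0. Qed.
Let B0 : 0 <= B. Proof. by apply: sumr_ge0 => i _; rewrite mulr_ge0. Qed.

Lemma steps_horizon n i : (steps n i <= horizon n)%N.
Proof.
apply: le_truncn; rewrite ler_wpM2l// (bigD1 i)//= lerDl.
by apply: sumr_ge0.
Qed.

Lemma horizon_le n : (horizon n)%:R <= n%:R * H.
Proof. by rewrite /horizon truncn_le// mulr_ge0. Qed.

Lemma steps_le n i : (steps n i)%:R <= n%:R * t i.
Proof. by rewrite /steps truncn_le// mulr_ge0. Qed.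

Let sum_unit (N m : nat) : \sum_(l < m.+1) ((nat_of_ord l == 0%N)%:R * N%:R - ((l < N)%N)%:R) =
  ((N - m.+1)%N)%:R :> R.
Proof.
elim: m => [|m IH].
  rewrite big_ord1 eqxx mul1r; case: N => [|N]; first by rewrite subrr.
  by rewrite /= subSS subn0 -natr1 addrK.
rewrite big_ord_recr/= IH mul0r sub0r.
have [Nm|mN] := leqP N m.+1.
  by rewrite (eqP (_ : (N - m.+1)%N == 0%N)) ?subn_eq0// (eqP (_ : (N - m.+2)%N == 0%N)) ?subn_eq0 ?subr0// leqW.
by rewrite -[(N - m.+1)%N]prednK ?subn_gt0// -subnS -natr1 addrK.
Qed.

Lemma sum_coef n m : \sum_(l < m.+1) coef n l = (s n)^-1 * ramp n m.+1.
Proof.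
rewrite /coef /ramp -mulr_sumr -mulr_sumr exchange_big/=; congr (_ * (_ * _)).
by apply: eq_bigr => i _; rewrite -mulr_sumr sum_unit.
Qed.

Lemma sum_coef0 n : \sum_(l < (horizon n).+1) coef n l = 0.
Proof.
rewrite sum_coef /ramp big1 ?mulr0// => i _.
by rewrite (eqP (_ : (_ - _)%N == 0%N)) ?mulr0// subn_eq0 leqW// steps_horizon.
Qed.

Lemma ramp_le n j : `|ramp n j| <= B.
Proof.
rewrite /ramp; case: n => [|n]; first by rewrite invr0 mul0r normr0.
rewrite normrM ger0_norm ?invr_ge0// mulrC ler_pdivrMr// /B mulr_suml.
apply: (le_trans (ler_norm_sum _ _ _)); apply: ler_sum => i _.
rewrite normrM -mulrA ler_wpM2l// ger0_norm// mulrC.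
by apply: le_trans (steps_le _ _); rewrite ler_nat leq_subr.
Qed.

Lemma sum_norm_coef n : (0 < n)%N -> \sum_(l < (horizon n).+1) `|coef n l| <= (s n)^-1 * (2 * B).
Proof.
case: n => // n _.
have s0 : 0 < s n.+1 by exact: s_gt0.
apply: (@le_trans _ _ (\sum_(l < (horizon n.+1).+1) (s n.+1)^-1 * (n.+1%:R^-1 *
    \sum_i `|z i| * ((nat_of_ord l == 0%N)%:R * (steps n.+1 i)%:R + ((l < steps n.+1 i)%N)%:R)))).
  apply: ler_sum => l _; rewrite /coef normrM ger0_norm ?invr_ge0 ?(ltW s0)//.
  rewrite ler_wpM2l ?invr_ge0 ?(ltW s0)// normrM ger0_norm ?invr_ge0// ler_wpM2l ?invr_ge0//.
  apply: (le_trans (ler_norm_sum _ _ _)); apply: ler_sum => i _.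
  rewrite normrM ler_wpM2l//; apply: (le_trans (ler_normB _ _)).
  by rewrite !ger0_norm// mulr_ge0.
rewrite -mulr_sumr ler_wpM2l ?invr_ge0 ?(ltW s0)// -mulr_sumr mulrC ler_pdivrMr//.
rewrite exchange_big/= /B mulr_sumr mulr_suml; apply: ler_sum => i _.
rewrite -mulr_sumr mulrCA -mulrA ler_wpM2l// big_split/=.
rewrite big_ord_recl/= mul1r big1 => [|l _]; last by rewrite mul0r.
rewrite addr0.
have -> : \sum_(l < (horizon n.+1).+1) ((l < steps n.+1 i)%N)%:R = (steps n.+1 i)%:R :> R.
  rewrite -natr_sum -big_mkcond/= sum1_card; congr (_%:R).
  have le := leqW (steps_horizon n.+1 i).
  transitivity #|[pred l : 'I_(horizon n.+1).+1 | l < steps n.+1 i]%N|; first exact: eq_card.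
  rewrite -sum1_card -(big_mkord (fun l => (l < steps n.+1 i)%N) (fun=> 1%N)).
  by rewrite -(big_nat_widen 0 _ _ (fun=> true))//= sum_nat_const_nat subn0 muln1.
by have := steps_le n.+1 i; lra.
Qed.

Let Theta n (p : R * R) := weight_at (fun l : 'I_(horizon n).+1 =>
  trawl_grid a (Delta n) l) (fun l => coef n l) p.

Lemma norm_weight_le n p : (0 < n)%N -> `|Theta n p| <= (s n)^-1 * (2 * B).
Proof.
move=> n0; apply: (le_trans (ler_norm_sum _ _ _)); apply: le_trans (sum_norm_coef n0).
apply: ler_sum => l _; rewrite normrM ler_piMr// indicE.
by case: (_ \in _); rewrite ?normr1 ?normr0.
Qed.

Let horizon_Delta n : (horizon n)%:R * Delta n <= H * (n%:R * Delta n).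
Proof. by rewrite mulrA [H * _]mulrC ler_wpM2r ?horizon_le// ltW. Qed.

Let cvg_residual (C : R) : C * (a 0 - a ((horizon n)%:R * Delta n)) @[n --> \oo] --> (0 : R).
Proof.
rewrite -[X in _ --> X](mulr0 C); apply: cvgMr.
rewrite -[X in _ --> X](subrr (a 0)); apply: cvgB; first exact: cvg_cst.
have /continuous_within_itvcyP[_ ca] := trawl_continuous a_trawl.
apply/cvgrPdist_lt => e e0.
have [x x0 ax] : exists2 x, 0 < x & a 0 - a x < e.
  near (0 : R)^'+ => x; exists x; first by near: x; exact: nbhs_right_gt.
  apply: le_lt_trans (ler_norm _) _; near: x.
  by have /cvgrPdist_lt := ca; apply.
have cvgH : H * (n%:R * Delta n) @[n --> \oo] --> H * 0 by exact: cvgMr.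
rewrite mulr0 in cvgH.
near=> n; have hx : (horizon n)%:R * Delta n <= x.
  apply: (le_trans (horizon_Delta n)).
  by near: n; have /cvgr_le := cvgH; apply.
have h0 : 0 <= (horizon n)%:R * Delta n by rewrite mulr_ge0// ltW.
rewrite ger0_norm ?subr_ge0 ?(trawl_noninc a_trawl)//.
apply: le_lt_trans ax; rewrite lerD2l lerN2; exact: (trawl_noninc a_trawl).
Unshelve. all: by end_near. Qed.

(** Here [s n^(-beta) = 1/(n Delta_n)] compensates the area of order [n Delta_n]. What is left is
    the oscillation of [a] on an interval that shrinks to 0. *)
Let weight_error n (G : R -> R) (C : R) : (0 < n)%N -> G 0 = 0 ->
  (forall u, `|u| * s n <= 2 * B -> `|G u| <= C * s n `^ (- beta)) ->
  `|\int[mu2]_p G (Theta n p) - Delta n * a 0 * \sum_(j < horizon n)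
      (G ((s n)^-1 * ramp n j.+1) + G (- ((s n)^-1 * ramp n j.+1)))|
  <= 3 * (C * (H * (a 0 - a ((horizon n)%:R * Delta n)))).
Proof.
move=> n0 G0 GC; have sn := s_gt0 n0.
have nD0 : 0 < n%:R * Delta n by rewrite mulr_gt0// ltr0n.
have C0 : 0 <= C.
  have := GC 0; rewrite normr0 mul0r mulr_ge0// G0 normr0 => /(_ isT).
  by rewrite pmulr_lge0// powR_gt0.
have sE : s n `^ (- beta) = (n%:R * Delta n)^-1 by rewrite powRN s_powR.
have wE j : \sum_(l < j.+1) coef n l = (s n)^-1 * ramp n j.+1 by exact: sum_coef.
have bound (u : R) : `|u| <= (s n)^-1 * (2 * B) -> `|G u| <= C * s n `^ (- beta).
  by move=> h; apply: GC; rewrite -ler_pdivlMr// mulrC.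
have bramp j : `|(s n)^-1 * ramp n j| <= (s n)^-1 * (2 * B).
  rewrite normrM ger0_norm ?invr_ge0 ?(ltW sn)// ler_wpM2l ?invr_ge0 ?(ltW sn)//.
  by apply: (le_trans (ramp_le _ _)); rewrite ler_peMl// ler1n.
under eq_bigr do rewrite -wE.
apply: (le_trans (trawl_weight_integral a_trawl (Delta_gt0 n) (sum_coef0 n) G0
  (K := C * s n `^ (- beta)) _ _)).
- by move=> p; apply: bound; exact: norm_weight_le.
- move=> [|j] _; first by rewrite big_ord0 oppr0 G0 normr0 mulr_ge0// powR_ge0.
  by rewrite wE; split; apply: bound; rewrite ?normrN; exact: bramp.
rewrite ler_wpM2l// sE -[leLHS]mulrA ler_wpM2l// mulrA ler_wpM2r//.
  by rewrite subr_ge0 (trawl_noninc a_trawl)// mulr_ge0// ltW.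
rewrite mulrC ler_pdivrMr//; exact: horizon_Delta.
Qed.

Context (r i : R -> R) (C0 : R) (reg : regular_exponent r i beta C0).

Let B20 : 0 <= 2 * B. Proof. exact: mulr_ge0. Qed.

Let im0 : i 0 = 0.
Proof. by apply/eqP; rewrite -eqNr -(regular_imN reg) oppr0. Qed.

Let s_le1 : \forall n \near \oo, (0 < n)%N /\ 0 < s n <= 1.
Proof.
near=> n; have n0 : (0 < n)%N by near: n; exact: nbhs_infty_gt.
split => //; rewrite s_gt0//= leNgt; apply/negP => s1.
have : n%:R * Delta n < 1 by near: n; have /cvgr_lt := nDelta_cvg0; apply.
rewrite -s_powR ltNge => /negP; apply.
rewrite -[leLHS](powRr0 (s n)) ler_powR// ltW//.
Unshelve. all: by end_near. Qed.

(** Once compensated, the imaginary part is still odd, so that the contributions of leaving and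
    entering points cancel exactly and only the error remains; the linear compensation itself
    integrates to 0. *)
Lemma cvg_weight_im : \int[mu2]_p i (Theta n p) @[n --> \oo] --> (0 : R).
Proof.
have [C hC hb] := regular_bound reg (A := 2 * B) B20.
apply/norm_cvg0P; apply: (@squeeze_cvgr _ _ _ _ (fun=> 0)
  (fun n => 3 * (C * (H * (a 0 - a ((horizon n)%:R * Delta n)))))).
- near=> n; rewrite normr_ge0/=.
  have [n0 s01] : (0 < n)%N /\ 0 < s n <= 1 by near: n; exact: s_le1.
  pose eta u := i u - u * s n * i (s n)^-1.
  have etaN u : eta (- u) = - eta u.
    by rewrite /eta (regular_imN reg) !mulNr opprB opprK addrC.
  have eta0 : eta 0 = 0 by rewrite /eta im0 !mul0r subrr.
  have := weight_error n0 eta0 (C := C) (fun u hu => (hb _ _ s01 hu).2).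
  rewrite [X in _ - _ * X]big1 ?mulr0 ?subr0 => [|j _]; last by rewrite etaN subrr.
  apply: le_trans; rewrite le_eqVlt; apply/orP; left; apply/eqP; congr `|_|.
  rewrite /eta RintegralB//.
  + under [X in _ = _ - X]eq_Rintegral do rewrite -mulrA mulrC.
    rewrite RintegralZl//; last exact: (@integrable_trawl_weight R a a_trawl _ _ _ id).
    by rewrite Rintegral_trawl_weight// ?mulr0 ?subr0// ?sum_coef0.
  + exact: integrable_trawl_weight.
  + by apply: (@integrable_trawl_weight R a a_trawl _ _ _ (fun u => u * s n * i (s n)^-1));
      rewrite !mul0r.
- exact: cvg_cst.
- rewrite -[X in _ --> X](mulr0 3); apply: cvgMr.
  by under eq_fun do rewrite mulrA; exact: cvg_residual.
Unshelve. all: by end_near. Qed.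

(** The real part is even, so both kinds of points contribute the same, whence the factor 2. In the
    asymptotics, the relative error is made small by the choice of [eta], and the additive constant
    is multiplied by an area of order [n Delta_n]. *)
Lemma cvg_weight_re : \int[mu2]_p r (Theta n p) + 2 * a 0 * C0 *
  (n%:R^-1 * \sum_(j < horizon n) `|ramp n j.+1| `^ beta) @[n --> \oo] --> (0 : R).
Proof.
have [C hC hb] := regular_bound reg (A := 2 * B) B20.
have a00 : 0 <= a 0 by exact: trawl_ge0.
apply/cvgrPdist_le => e e0.
(* [D] majorises the factor of the relative error; the added 1 makes it positive. *)
pose D := 2 * a 0 * H * B `^ beta + 1.
have D0 : 0 < D by rewrite ltr_wpDl// !mulr_ge0// powR_ge0.
have e2 : 0 < e / 2 / D by rewrite !divr_gt0.
have [C1 hC1 asym] := regular_asymptotics reg e2.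
have cvg1 : 3 * (C * (H * (a 0 - a ((horizon n)%:R * Delta n)))) +
    2 * a 0 * C1 * H * (n%:R * Delta n) @[n --> \oo] --> (3 * 0 + 2 * a 0 * C1 * H * 0 : R).
  apply: cvgD; apply: cvgMr => //.
  by under eq_fun do rewrite mulrA; exact: cvg_residual.
rewrite !mulr0 addr0 in cvg1.
near=> n; have [n0 s01] : (0 < n)%N /\ 0 < s n <= 1 by near: n; exact: s_le1.
have /andP[sn _] := s01.
have nD0 : 0 < n%:R * Delta n by rewrite mulr_gt0// ltr0n.
have err := weight_error n0 (regular_re0 reg) (C := C) (fun u hu => (hb _ _ s01 hu).1).
have small : 3 * (C * (H * (a 0 - a ((horizon n)%:R * Delta n)))) +
    2 * a 0 * C1 * H * (n%:R * Delta n) <= e / 2.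
  by near: n; have /cvgr_le := cvg1; apply; rewrite divr_gt0.
pose S := \sum_(j < horizon n) `|ramp n j.+1| `^ beta.
have sumE : `|Delta n * a 0 * \sum_(j < horizon n)
      (r ((s n)^-1 * ramp n j.+1) + r (- ((s n)^-1 * ramp n j.+1))) +
    2 * a 0 * C0 * (n%:R^-1 * S)| <=
    e / 2 / D * (2 * a 0 * H * B `^ beta) + 2 * a 0 * C1 * H * (n%:R * Delta n).
  have rampE j : `|(s n)^-1 * ramp n j.+1| `^ beta = (n%:R * Delta n)^-1 * `|ramp n j.+1| `^ beta.
    rewrite normrM powRM// ger0_norm ?invr_ge0 ?(ltW sn)//; congr (_ * _).
    by rewrite -s_powR -powR_inv1 ?(ltW sn)// -powRrM mulN1r powRN.
  rewrite (_ : _ + _ = Delta n * a 0 * 2 * \sum_(j < horizon n)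
      (r ((s n)^-1 * ramp n j.+1) + C0 * `|(s n)^-1 * ramp n j.+1| `^ beta)); last first.
    have -> : \sum_(j < horizon n) (r ((s n)^-1 * ramp n j.+1) + r (- ((s n)^-1 * ramp n j.+1))) =
        2 * \sum_(j < horizon n) r ((s n)^-1 * ramp n j.+1).
      by rewrite mulr_sumr; apply: eq_bigr => j _; rewrite (regular_reN reg); ring.
    rewrite [in RHS]big_split/= -[X in _ = _ * (_ + X)]mulr_sumr.
    under [X in _ = _ * (_ + _ * X)]eq_bigr do rewrite rampE.
    rewrite -[X in _ = _ * (_ + _ * X)]mulr_sumr -/S.
    by field; rewrite !gt_eqF// ltr0n.
  rewrite normrM ger0_norm; last by rewrite !mulr_ge0// ltW.
  have sum_le : `|\sum_(j < horizon n)
      (r ((s n)^-1 * ramp n j.+1) + C0 * `|(s n)^-1 * ramp n j.+1| `^ beta)| <=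
      n%:R * H * (e / 2 / D * ((n%:R * Delta n)^-1 * B `^ beta) + C1).
    apply: (le_trans (ler_norm_sum _ _ _)).
    apply: (@le_trans _ _ (\sum_(j < horizon n)
      (e / 2 / D * ((n%:R * Delta n)^-1 * B `^ beta) + C1))).
      apply: ler_sum => j _; apply: (le_trans (asym _)); rewrite lerD2r ler_wpM2l ?(ltW e2)//.
      rewrite rampE ler_wpM2l ?invr_ge0 ?(ltW nD0)//.
      by rewrite ge0_ler_powR ?nnegrE ?(ltW beta_gt0)// ramp_le.
    rewrite sumr_const card_ord -[leLHS]mulr_natl ler_wpM2r ?horizon_le//.
    by rewrite addr_ge0// mulr_ge0 ?(ltW e2)// mulr_ge0 ?powR_ge0// invr_ge0 ltW.
  apply: (le_trans (ler_wpM2l _ sum_le)); first by rewrite !mulr_ge0// ltW.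
  rewrite le_eqVlt; apply/orP; left; apply/eqP.
  by field; rewrite !gt_eqF// ltr0n.
have part : e / 2 / D * (2 * a 0 * H * B `^ beta) <= e / 2.
  rewrite -mulrA ler_piMr ?divr_ge0 ?(ltW e0)// mulrC ler_pdivrMr// mul1r.
  by rewrite /D lerDl.
rewrite sub0r normrN -/S.
set I := \int[mu2]_p _ in err *; set U := _ * \sum_(j < _) _ in err sumE.
rewrite (_ : _ + _ = (I - U) + (U + 2 * a 0 * C0 * (n%:R^-1 * S))); last by ring.
apply: (le_trans (ler_normD _ _)); have := lerD err sumE.
by move: small part; lra.
Unshelve. all: by end_near. Qed.

End prelimit.

(** * Two functionals at once *)

Section two_families.
Context (R : realType) (N1 N2 : nat).
Context (A1 : 'I_N1 -> set (R * R)) (th1 : 'I_N1 -> R).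
Context (A2 : 'I_N2 -> set (R * R)) (th2 : 'I_N2 -> R).
Hypotheses (mA1 : forall k, measurable (A1 k)) (finA1 : forall k, (leb2 (A1 k) < +oo)%E).
Hypotheses (mA2 : forall k, measurable (A2 k)) (finA2 : forall k, (leb2 (A2 k) < +oo)%E).

Local Notation mu2 := (@lebesgue_measure R \x @lebesgue_measure R)%E.

Let join {U : Type} (f1 : 'I_N1 -> U) (f2 : 'I_N2 -> U) (k : 'I_(N1 + N2)) : U :=
  match fintype.split k with inl i => f1 i | inr j => f2 j end.

Let sum_join (f1 : 'I_N1 -> R) (f2 : 'I_N2 -> R) :
  \sum_k join f1 f2 k = \sum_k f1 k + \sum_k f2 k.
Proof.
rewrite big_split_ord/=; congr (_ + _); apply: eq_bigr => k _; rewrite /join.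
  by rewrite (unsplitK (inl k)).
by rewrite (unsplitK (inr k)).
Qed.

Let weight_at_join p : weight_at (join A1 A2) (join th1 th2) p =
  weight_at A1 th1 p + weight_at A2 th2 p.
Proof.
rewrite /weight_at -sum_join; apply: eq_bigr => k _; unfold join.
by case: (fintype.split k).
Qed.

Let mjoin k : measurable (join A1 A2 k).
Proof. by rewrite /join; case: (fintype.split k). Qed.

Let finjoin k : (leb2 (join A1 A2 k) < +oo)%E.
Proof. by rewrite /join; case: (fintype.split k). Qed.

Lemma integrable_weightD (G : R -> R) : G 0 = 0 ->
  mu2.-integrable setT (EFin \o (fun p => G (weight_at A1 th1 p + weight_at A2 th2 p))).
Proof.
move=> G0; have := integrable_weight (join th1 th2) mjoin finjoin G0.
by under eq_fun do rewrite weight_at_join.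
Qed.

Lemma levy_basis_weightD_polar d (T : measurableType d) (P : probability T R) gamma b
    (nu : {measure set R -> \bar R}) (L : set (R * R) -> T -> R) :
  levy_measure nu -> levy_basis P gamma b nu L ->
  polar_charfun P (fun w => \sum_k th1 k * L (A1 k) w + \sum_k th2 k * L (A2 k) w)
    (expR (\int[mu2]_p psi_re gamma b nu (weight_at A1 th1 p + weight_at A2 th2 p)))
    (\int[mu2]_p psi_im gamma b nu (weight_at A1 th1 p + weight_at A2 th2 p)).
Proof.
move=> nu_levy L_basis.
have [hc hs] := levy_basis_weight_polar (join th1 th2) mjoin finjoin nu_levy L_basis.
have sumE w : \sum_k join th1 th2 k * L (join A1 A2 k) w =
    \sum_k th1 k * L (A1 k) w + \sum_k th2 k * L (A2 k) w.
  by rewrite -sum_join; apply: eq_bigr => k _; unfold join; case: (fintype.split k).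
under eq_Rintegral do rewrite -weight_at_join.
under [X in polar_charfun _ _ _ X]eq_Rintegral do rewrite -weight_at_join.
split; [rewrite -hc|rewrite -hs]; apply: eq_Rintegral => w _; by rewrite sumE.
Qed.

(** Where the first weight vanishes there is no interaction. On D, which contains its support, the
    subadditivity bound applies: the term in [u] is integrated over the plane, the term in [v] is at
    most [K/l] on a set of small area. *)
Lemma weight_interaction (G r : R -> R) (D : set (R * R)) (l K : R) :
  G 0 = 0 -> r 0 = 0 -> 0 < l -> 0 <= K -> (forall u, r u <= 0) ->
  (forall u v, `|G (u + v) - G u - G v| <= - (l * r u + l^-1 * r v)) ->
  measurable D -> (leb2 D < +oo)%E ->
  (forall p, weight_at A1 th1 p != 0 -> D p) ->
  (forall p, `|r (weight_at A2 th2 p)| <= K) ->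
  `|\int[mu2]_p G (weight_at A1 th1 p + weight_at A2 th2 p)
    - \int[mu2]_p G (weight_at A1 th1 p) - \int[mu2]_p G (weight_at A2 th2 p)|
  <= - (l * \int[mu2]_p r (weight_at A1 th1 p)) + l^-1 * K * fine (leb2 D).
Proof.
move=> G0 r0 l0 K0 r_le0 Gsub mD finD suppD rK.
have i12 := integrable_weightD G0.
have i1 := integrable_weight th1 mA1 finA1 G0.
have i2 := integrable_weight th2 mA2 finA2 G0.
have ir := integrable_weight th1 mA1 finA1 r0.
have iD := integrable_indicator (mu := mu2) mD finD.
have i121 := integrableB measurableT i12 i1.
have i1212 := integrableB measurableT i121 i2.
have irl := integrableZl measurableT (- l) ir.
have iDK := integrableZl measurableT (l^-1 * K) iD.
have irD := integrableD measurableT irl iDK.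
rewrite -!RintegralB// -mulNr -(Rintegral_indicator mu2 mD).
rewrite -RintegralZl// -RintegralZl// -RintegralD//.
apply: (le_trans (le_normr_Rintegral _ i1212)) => //.
apply: le_Rintegral => //; first exact: integrable_norm.
move=> p _ /=; set u := weight_at A1 th1 p; set v := weight_at A2 th2 p.
have [u0|u0] := eqVneq u 0.
  rewrite u0 add0r G0 subr0 subrr normr0 r0 mulr0 add0r.
  by rewrite mulr_ge0// mulr_ge0// invr_ge0 ltW.
rewrite indicE mem_set; last exact: suppD.
rewrite mulr1; apply: (le_trans (Gsub _ _)).
rewrite opprD mulNr lerD2l -mulrN ler_wpM2l ?invr_ge0 ?(ltW l0)//.
by apply: le_trans (rK p); rewrite ler0_norm.
Qed.

End two_families.

Section mixing.
Context d (T : measurableType d) (R : realType) (P : probability T R).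
Context (Y : nat -> T -> R).
Hypotheses (mY : forall n, measurable_fun setT (Y n)) (bY : forall n w, `|Y n w| <= 1).

Let bYY n m w : `|Y n w * Y m w| <= 1.
Proof. by rewrite normrM mulr_ile1. Qed.

Let mYY n m : measurable_fun setT (fun w => Y n w * Y m w).
Proof. exact: measurable_funM. Qed.

(* If E(Y_n xi) stayed above e along a subsequence, the average of m almost
   uncorrelated terms of it would have variance O(1/m) but correlation at least
   e with xi. *)
Lemma cvg_mixing (xi : T -> R) : measurable_fun setT xi -> (forall w, `|xi w| <= 1) ->
  (forall m, \int[P]_w (Y n w * Y m w) @[n --> \oo] --> (0 : R)) ->
  \int[P]_w (Y n w * xi w) @[n --> \oo] --> (0 : R).
Proof.
move=> mxi bxi cov; apply/cvgrPdist_le => e e0.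
apply: contrapT => far.
have far_often N : exists n, (N <= n)%N /\ e < `|\int[P]_w (Y n w * xi w)|.
  apply: contrapT => h; apply: far; exists N => // n /= Nn.
  rewrite sub0r normrN leNgt; apply/negP => en; apply: h; by exists n.
(* The final comparison is between [m + 2 del m^2] and [e^2 m^2]. *)
have [del del0 dele] : exists2 del, 0 < del & 2 * del < e ^+ 2.
  by exists (e ^+ 2 / 4); rewrite ?divr_gt0 ?exprn_gt0//; have := exprn_gt0 2 e0; lra.
(* The sign of the correlation is absorbed in the coefficients c. *)
have [q hq] : exists q : nat -> nat * R, forall j,
    [/\ `|(q j).2| = 1, e < (q j).2 * \int[P]_w (Y (q j).1 w * xi w) &
        forall i, (i < j)%N -> `|\int[P]_w (Y (q j).1 w * Y (q i).1 w)| <= del].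
  have step (s : seq nat) : exists nc : nat * R, [/\ `|nc.2| = 1,
      e < nc.2 * \int[P]_w (Y nc.1 w * xi w) &
      forall m, m \in s -> `|\int[P]_w (Y nc.1 w * Y m w)| <= del].
    have [N hN] : exists N, forall n, (N <= n)%N -> forall m, m \in s ->
        `|\int[P]_w (Y n w * Y m w)| <= del.
      elim: s => [|m s [N hN]]; first by exists 0%N.
      have /cvgrPdist_le/(_ _ del0)[N' _ hN'] := cov m.
      exists (maxn N N') => n; rewrite geq_max => /andP[Nn N'n] m'.
      rewrite in_cons => /predU1P[->|]; last exact: hN.
      by have := hN' n N'n; rewrite sub0r normrN.
    have [n [Nn en]] := far_often N.
    exists (n, Num.sg (\int[P]_w (Y n w * xi w))); split => /=.
    - by rewrite normr_sg -normr_gt0 (lt_trans e0 en).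
    - by rewrite -normrEsg.
    - exact: hN.
  have [next hnext] := choice step.
  (* [hist j] lists the indices selected before step j. Each new index is chosen as a function of
     that list, late enough to be almost uncorrelated with all of it. *)
  pose hist := fix hist j := if j is j'.+1 then rcons (hist j') (next (hist j')).1 else [::].
  have hist_mem i j : (i < j)%N -> (next (hist i)).1 \in hist j.
    elim: j => // j IH; rewrite ltnS leq_eqVlt => /predU1P[->|/IH h] /=.
      by rewrite mem_rcons mem_head.
    by rewrite mem_rcons in_cons h orbT.
  exists (fun j => next (hist j)) => j; have [h1 h2 h3] := hnext (hist j).
  by split => // i ij; apply: h3; exact: hist_mem.
pose S m w : R := \sum_(j < m) (q j).2 * Y (q j).1 w.
have mq j : measurable_fun setT (fun w => (q j).2 * Y (q j).1 w) by exact: measurable_funM.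
have mS m : measurable_fun setT (S m) by exact: measurable_sum.
have bS m w : `|S m w| <= m%:R.
  apply: (le_trans (ler_norm_sum _ _ _)); rewrite -[m in leRHS]card_ord -sumr_const.
  by apply: ler_sum => j _; have [h _ _] := hq j; rewrite normrM h mul1r.
have bSxi m w : `|S m w * xi w| <= m%:R.
  by rewrite normrM -[leRHS]mulr1 ler_pM.
have low m : e * m%:R <= \int[P]_w (S m w * xi w).
  elim: m => [|m IH].
    by rewrite mulr0 /S; under eq_Rintegral do rewrite big_ord0 mul0r; rewrite expectation_cst.
  rewrite /S; under eq_Rintegral do rewrite big_ord_recr/= mulrDl -mulrA.
  have [h1 h2 _] := hq m.
  rewrite (@expectationD _ _ _ _ _ _ m%:R 1)//; last 4 first.
  - exact: measurable_funM (mS m) mxi.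
  - by apply: measurable_funM => //; exact: measurable_funM.
  - exact: bSxi.
  - by move=> w; rewrite normrM h1 mul1r normrM mulr_ile1.
  rewrite -natr1 mulrDr mulr1 lerD// (@expectationZl _ _ _ _ _ _ 1) ?ltW//.
    exact: measurable_funM.
  by move=> w; rewrite normrM mulr_ile1.
have up m : \int[P]_w (S m w * S m w) <= m%:R + 2 * del * m%:R ^+ 2.
  elim: m => [|m IH].
    rewrite /S; under eq_Rintegral do rewrite big_ord0 mul0r.
    by rewrite expectation_cst expr0n mulr0 addr0.
  have [h1 _ h3] := hq m.
  pose U w : R := (q m).2 * Y (q m).1 w.
  have bU w : `|U w| <= 1 by rewrite normrM h1 mul1r.
  have mU : measurable_fun setT U by exact: measurable_funM.
  have SE w : S m.+1 w * S m.+1 w = S m w * S m w + (2 * (U w * S m w) + U w * U w).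
    by rewrite /S big_ord_recr/= -/(S m w) -/(U w); ring.
  under eq_Rintegral do rewrite SE.
  have mSS : measurable_fun setT (fun w => S m w * S m w) by exact: measurable_funM.
  have mUS : measurable_fun setT (fun w => U w * S m w) by exact: measurable_funM.
  have mUU : measurable_fun setT (fun w => U w * U w) by exact: measurable_funM.
  have bSS w : `|S m w * S m w| <= m%:R * m%:R by rewrite normrM ler_pM.
  have bUS w : `|U w * S m w| <= 1 * m%:R by rewrite normrM ler_pM.
  have bUU w : `|U w * U w| <= 1 by rewrite normrM mulr_ile1.
  have bUS2 w : `|2 * (U w * S m w)| <= 2 * (1 * m%:R).
    by rewrite normrM (ger0_norm (_ : 0 <= 2)) ?ler_wpM2l.
  have mUS2 : measurable_fun setT (fun w => 2 * (U w * S m w)) by exact: measurable_funM.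
  rewrite (expectationD _ mSS (measurable_funD mUS2 mUU) bSS
    (fun w => le_trans (ler_normD _ _) (lerD (bUS2 w) (bUU w)))).
  rewrite (expectationD _ mUS2 mUU bUS2 bUU) (expectationZl _ _ mUS bUS).
  have UU1 : \int[P]_w (U w * U w) <= 1.
    exact: le_trans (ler_norm _) (ler_norm_expectation P mUU bUU).
  have US : \int[P]_w (U w * S m w) <= del * m%:R.
    rewrite /S; under eq_Rintegral do rewrite mulr_sumr.
    have bterm (j : 'I_m) w : `|U w * ((q j).2 * Y (q j).1 w)| <= 1.
      by have [hj _ _] := hq j; rewrite normrM mulr_ile1// normrM hj mul1r.
    have mterm (j : 'I_m) : measurable_fun setT (fun w => U w * ((q j).2 * Y (q j).1 w)).
      exact: measurable_funM.
    rewrite (expectation_sum _ mterm bterm).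
    apply: (@le_trans _ _ (\sum_(j < m) del)); last first.
      by rewrite sumr_const card_ord -[leLHS]mulr_natr.
    apply: ler_sum => j _; apply: (le_trans (ler_norm _)).
    have [hj _ _] := hq j.
    under eq_Rintegral do rewrite /U mulrACA.
    rewrite (expectationZl _ _ (mYY _ _) (bYY _ _)) normrM normrM h1 hj !mul1r.
    exact: h3.
  have := IH; rewrite -[m.+1%:R]natr1; have m0 : 0 <= m%:R :> R by [].
  have := mulr_ge0 (ltW del0) m0; rewrite sqrrD mulr1 expr1n; move: UU1 US.
  have := ltW del0; lra.
have sq m : 0 <= m%:R + 2 * del * m%:R ^+ 2 - e ^+ 2 * m%:R ^+ 2.
  have em0 : 0 <= e * m%:R by rewrite mulr_ge0// ltW.
  have bxx w : `|xi w * xi w| <= 1 by rewrite normrM mulr_ile1.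
  have mxx : measurable_fun setT (fun w => xi w * xi w) by exact: measurable_funM.
  have mSx : measurable_fun setT (fun w => S m w * xi w) by exact: measurable_funM.
  have mSS : measurable_fun setT (fun w => S m w * S m w) by exact: measurable_funM.
  have bSS w : `|S m w * S m w| <= m%:R * m%:R by rewrite normrM ler_pM.
  (* Expanding this square and using [low], [up] and E(xi^2) <= 1 gives [e^2 m^2 <= m + 2 del m^2],
     which fails for large m. *)
  have : 0 <= \int[P]_w ((S m w - e * m%:R * xi w) ^+ 2).
    by apply: Rintegral_ge0 => w _; exact: sqr_ge0.
  have E w : (S m w - e * m%:R * xi w) ^+ 2 =
      S m w * S m w + ((- 2 * (e * m%:R)) * (S m w * xi w) + (e * m%:R) ^+ 2 * (xi w * xi w)).
    by ring.
  under eq_Rintegral do rewrite E.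
  have m1 : measurable_fun setT (fun w => (- 2 * (e * m%:R)) * (S m w * xi w)).
    exact: measurable_funM.
  have m2 : measurable_fun setT (fun w => (e * m%:R) ^+ 2 * (xi w * xi w)).
    exact: measurable_funM.
  have b1 w := ler_normM_bound (lexx `|- 2 * (e * m%:R)|) (bSxi m w).
  have b2 w := ler_normM_bound (lexx `|(e * m%:R) ^+ 2|) (bxx w).
  rewrite (expectationD _ mSS (measurable_funD m1 m2) bSS
    (fun w => le_trans (ler_normD _ _) (lerD (b1 w) (b2 w)))).
  rewrite (expectationD _ m1 m2 b1 b2) (expectationZl _ _ mSx (bSxi m)) (expectationZl _ _ mxx bxx).
  have xx1 : \int[P]_w (xi w * xi w) <= 1.
    exact: le_trans (ler_norm _) (ler_norm_expectation P mxx bxx).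
  have := ler_wpM2l (sqr_ge0 (e * m%:R)) xx1.
  have := ler_wpM2l em0 (low m); have := up m; rewrite !exprMn; lra.
pose gap := e ^+ 2 - 2 * del.
have gap0 : 0 < gap by rewrite subr_gt0.
pose m := (Num.truncn gap^-1).+1.
have mgap : 1 < gap * m%:R.
  by rewrite -ltr_pdivrMl// mulr1 truncnS_gt.
have := sq m; have m0 : 0 < m%:R :> R by rewrite ltr0n.
rewrite leNgt => /negP; apply.
rewrite (_ : _ - _ = m%:R * (1 - gap * m%:R)); last by rewrite /gap; ring.
by rewrite pmulr_rlt0// subr_lt0.
Qed.

End mixing.

(** * Convergence of the trawl functionals *)

Lemma polar_close (R : realType) (x y x' y' : R) : x <= 0 -> x' <= 0 ->
  `|expR x * cos y - expR x' * cos y'| <= `|x - x'| + `|y - y'| /\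
  `|expR x * sin y - expR x' * sin y'| <= `|x - x'| + `|y - y'|.
Proof.
have lip (F F' : R -> R) u v : u <= v ->
    (forall w : R, u <= w <= v -> is_derive w 1 F (F' w)) ->
    (forall w, u <= w <= v -> `|F' w| <= 1) -> `|F u - F v| <= `|u - v|.
  move=> uv dF bF; rewrite distrC [leRHS]distrC.
  have := @mean_value_bound _ F F' u v 0 1 uv dF.
  rewrite mul0r subr0 mul1r [`|v - u|]ger0_norm ?subr_ge0//; apply=> w uwv.
  by rewrite subr0 bF.
have lip_exp (u v : R) : u <= 0 -> v <= 0 -> `|expR u - expR v| <= `|u - v|.
  wlog uv : u v / u <= v.
    move=> h u0 v0; have [uv|/ltW vu] := leP u v; first exact: h.
    by rewrite distrC [leRHS]distrC; exact: h.
  move=> u0 v0; apply: (lip _ expR) => // w /andP[_ wv].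
  by rewrite ger0_norm ?expR_ge0// -expR0 ler_expR (le_trans wv).
have lip_cos (u v : R) : `|cos u - cos v| <= `|u - v|.
  wlog uv : u v / u <= v.
    by move=> h; have [/h//|/ltW/h] := leP u v; rewrite distrC [leRHS]distrC.
  apply: (lip _ (fun w => - sin w)) => // w _; rewrite normrN; exact: norm_sin_le1.
have lip_sin (u v : R) : `|sin u - sin v| <= `|u - v|.
  wlog uv : u v / u <= v.
    by move=> h; have [/h//|/ltW/h] := leP u v; rewrite distrC [leRHS]distrC.
  by apply: (lip _ cos) => // w _; exact: norm_cos_le1.
move=> x0 x'0.
have exp1 : `|expR x'| <= 1 by rewrite ger0_norm ?expR_ge0// -expR0 ler_expR.
have split_prod (c c' : R) : `|c| <= 1 -> `|c - c'| <= `|y - y'| ->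
    `|expR x * c - expR x' * c'| <= `|x - x'| + `|y - y'|.
  move=> c1 cc'; rewrite (_ : _ - _ = (expR x - expR x') * c + expR x' * (c - c')); last by ring.
  apply: (le_trans (ler_normD _ _)); rewrite !normrM; apply: lerD.
    by rewrite -[leRHS]mulr1 ler_pM// lip_exp.
  by rewrite -[leRHS]mul1r ler_pM.
by split; apply: split_prod; rewrite ?lip_cos ?lip_sin ?norm_cos_le1 ?norm_sin_le1.
Qed.

Section asymptotic_independence.
Context (R : realType) d (T : measurableType d) (P : probability T R).
Context (V : nat -> T -> R) (mV : forall n, measurable_fun setT (V n)).
Context (Re Im : nat -> R) (Re2 Im2 : nat -> nat -> R -> R).
Hypotheses (Re_le0 : forall n, Re n <= 0) (Re2_le0 : forall n m e, Re2 n m e <= 0).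
Hypothesis polar1 : forall n, polar_charfun P (V n) (expR (Re n)) (Im n).
Hypothesis polar2 : forall n m e,
  polar_charfun P (fun w => V n w + e * V m w) (expR (Re2 n m e)) (Im2 n m e).
Hypothesis cvg_Re2 : forall m e, e = 1 \/ e = -1 ->
  Re2 n m e - Re n - Re m @[n --> \oo] --> (0 : R).
Hypothesis cvg_Im2 : forall m e, e = 1 \/ e = -1 ->
  Im2 n m e - Im n - e * Im m @[n --> \oo] --> (0 : R).

(** The joint functional has almost the exponent of two independent ones, and [polar_close] turns
    closeness of exponents into closeness of expectations. *)
Let cvg_cos2 m e : e = 1 \/ e = -1 ->
  \int[P]_w cos (V n w + e * V m w) -
  expR (Re n + Re m) * cos (Im n + e * Im m) @[n --> \oo] --> (0 : R).
Proof.
move=> eE; apply/norm_cvg0P; apply: (@squeeze_cvgr _ _ _ _ (fun=> 0)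
  (fun n => `|Re2 n m e - Re n - Re m| + `|Im2 n m e - Im n - e * Im m|)).
- near=> n; rewrite normr_ge0/= (polar2 n m e).1.
  have le0 : Re n + Re m <= 0 by rewrite -[leRHS]addr0 lerD.
  have := (polar_close (Im2 n m e) (Im n + e * Im m) (Re2_le0 n m e) le0).1.
  by rewrite !opprD !addrA.
- exact: cvg_cst.
- have h1 : `|Re2 n m e - Re n - Re m| @[n --> \oo] --> `|0 : R|.
    by apply: cvg_norm; exact: cvg_Re2.
  have h2 : `|Im2 n m e - Im n - e * Im m| @[n --> \oo] --> `|0 : R|.
    by apply: cvg_norm; exact: cvg_Im2.
  by move: h2 => /(cvgD h1); rewrite normr0 addr0.
Unshelve. all: by end_near. Qed.

(** [cvg_mixing] applied to the centred variables [f (V n) - E f (V n)]; the factor 1/2 brings them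
    back within the bound 1. *)
Let cvg_stable_gen (f : R -> R) (E : set T) :
  (forall n, measurable_fun setT (fun w => f (V n w))) ->
  (forall x, `|f x| <= 1) -> measurable E ->
  (forall m, \int[P]_w (f (V n w) * f (V m w)) -
    (\int[P]_w f (V n w)) * (\int[P]_w f (V m w))
    @[n --> \oo] --> (0 : R)) ->
  \int[P]_w (f (V n w) * (\1_E w : R)) -
    (\int[P]_w f (V n w)) * fine (P E) @[n --> \oo] --> (0 : R).
Proof.
move=> mf bf mE cov.
pose e n := \int[P]_w f (V n w).
have be n : `|e n| <= 1 by exact: ler_norm_expectation.
pose Y n w := 2^-1 * (f (V n w) - e n).
have mY n : measurable_fun setT (Y n) by apply: measurable_funM => //; exact: measurable_funB.
have bY n w : `|Y n w| <= 1.
  rewrite normrM ger0_norm ?invr_ge0// ler_pdivrMl// mulr1.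
  by apply: ler_normB_bound; rewrite ?be ?bf.
have bff n m w : `|f (V n w) * f (V m w)| <= 1.
  by rewrite normrM mulr_ile1.
have covY m : \int[P]_w (Y n w * Y m w) @[n --> \oo] --> (0 : R).
  rewrite (_ : (fun n => _) = fun n => 4^-1 *
    (\int[P]_w (f (V n w) * f (V m w)) - e n * e m)).
    by rewrite -[X in _ --> X](mulr0 4^-1); apply: cvgMr; exact: cov.
  apply/funext => n.
  have E1 w : Y n w * Y m w = 4^-1 * (f (V n w) * f (V m w)
     + ((- e m) * f (V n w) + ((- e n) * f (V m w) + e n * e m))).
    by rewrite /Y; field.
  under eq_Rintegral do rewrite E1.
  have mff : measurable_fun setT (fun w => f (V n w) * f (V m w)).
    exact: measurable_funM.
  have m1 : measurable_fun setT (fun w => - e m * f (V n w)) by exact: measurable_funM.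
  have m2 : measurable_fun setT (fun w => - e n * f (V m w)) by exact: measurable_funM.
  have m3 : measurable_fun setT (fun w => - e n * f (V m w) + e n * e m).
    exact: measurable_funD.
  have be' j : `|- e j| <= 1 by rewrite normrN.
  have b1 w := ler_normM_bound (be' m) (bf (V n w)).
  have b2 w := ler_normM_bound (be' n) (bf (V m w)).
  have b3 := ler_normM_bound (be n) (be m).
  have b23 w := ler_normD_bound (b2 w) b3.
  have b123 w := ler_normD_bound (b1 w) (b23 w).
  rewrite (expectationZl _ _ (measurable_funD mff (measurable_funD m1 m3))
    (fun w => ler_normD_bound (bff n m w) (b123 w))).
  rewrite (expectationD _ mff (measurable_funD m1 m3) (bff n m) b123).
  rewrite (expectationD _ m1 m3 b1 b23) (expectationD _ m2 (measurable_cst (e n * e m)) b2 (fun=> b3)).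
  rewrite (expectationZl _ _ (mf n) (fun w => bf _)) (expectationZl _ _ (mf m) (fun w => bf _)).
  by rewrite expectation_cst -/(e n) -/(e m); ring.
have b1E w : `|\1_E w : R| <= 1.
  by rewrite indicE; case: (_ \in _); rewrite ?normr1 ?normr0.
have mI : measurable_fun setT (\1_E : T -> R) by exact: measurable_indic.
have := cvg_mixing mY bY mI b1E covY.
move=> /(cvgM (cvg_cst (2 : R))); rewrite mulr0; apply: cvg_trans; apply: near_eq_cvg; near=> n.
have mfI : measurable_fun setT (fun w => f (V n w) * (\1_E w : R)).
  exact: measurable_funM.
have bfI w : `|f (V n w) * (\1_E w : R)| <= 1.
  by rewrite normrM mulr_ile1.
have meI : measurable_fun setT (fun w => - e n * (\1_E w : R)) by exact: measurable_funM.
have beI w : `|- e n * (\1_E w : R)| <= 1 by rewrite normrM normrN mulr_ile1.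
have E1 w : Y n w * (\1_E w : R) =
    2^-1 * (f (V n w) * (\1_E w : R) + (- e n) * (\1_E w : R)).
  by rewrite /Y; ring.
rewrite /=; under eq_Rintegral do rewrite E1.
rewrite (expectationZl _ _ (measurable_funD mfI meI) (fun w => ler_normD_bound (bfI w) (beI w))).
rewrite (expectationD _ mfI meI bfI beI) (expectationZl _ _ mI b1E) expectation_indic//.
by rewrite -/(e n); field.
Unshelve. all: by end_near. Qed.

(** A product of cosines is half the sum of the cosines of the sum and of the difference: hence the
    joint laws of [V n + e V m] for [e = 1] and [e = -1]. *)
Let cov_cos m : \int[P]_w (cos (V n w) * cos (V m w)) -
    (\int[P]_w cos (V n w)) * (\int[P]_w cos (V m w))
    @[n --> \oo] --> (0 : R).
Proof.
have h1 := cvg_cos2 m (or_introl erefl); have h2 := cvg_cos2 m (or_intror erefl).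
move: h2 => /(cvgD h1)/(cvgM (cvg_cst (2^-1 : R))); rewrite addr0 mulr0.
apply: cvg_trans; apply: near_eq_cvg; near=> n; rewrite /= !fctE /=.
have E w : cos (V n w) * cos (V m w) =
    2^-1 * (cos (V n w + 1 * V m w) +
            cos (V n w + -1 * V m w)).
  by rewrite mul1r mulN1r cosB cosD; field.
under [in RHS]eq_Rintegral do rewrite E.
have mc e : measurable_fun setT (fun w => cos (V n w + e * V m w)).
  by apply: measurable_cos; apply: measurable_funD => //; exact: measurable_funM.
rewrite (expectationZl _ _ (measurable_funD (mc 1) (mc (-1)))
  (fun w => ler_normD_bound (norm_cos_le1 _) (norm_cos_le1 _))).
rewrite (expectationD _ (mc 1) (mc (-1)) (fun w => norm_cos_le1 _) (fun w => norm_cos_le1 _)).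
rewrite (polar1 n).1 (polar1 m).1 expRD mul1r mulN1r cosB cosD.
by field.
Unshelve. all: by end_near. Qed.

Let cov_sin m : \int[P]_w (sin (V n w) * sin (V m w)) -
    (\int[P]_w sin (V n w)) * (\int[P]_w sin (V m w))
    @[n --> \oo] --> (0 : R).
Proof.
have h1 := cvg_cos2 m (or_introl erefl); have h2 := cvg_cos2 m (or_intror erefl).
move: h1 => /(cvgB h2)/(cvgM (cvg_cst (2^-1 : R))); rewrite subr0 mulr0.
apply: cvg_trans; apply: near_eq_cvg; near=> n; rewrite /= !fctE /=.
have E w : sin (V n w) * sin (V m w) =
    2^-1 * (cos (V n w + -1 * V m w) -
            cos (V n w + 1 * V m w)).
  by rewrite mul1r mulN1r cosB cosD; field.
under [in RHS]eq_Rintegral do rewrite E.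
have mc e : measurable_fun setT (fun w => cos (V n w + e * V m w)).
  by apply: measurable_cos; apply: measurable_funD => //; exact: measurable_funM.
rewrite (expectationZl _ _ (measurable_funB (mc (-1)) (mc 1))
  (fun w => ler_normB_bound (norm_cos_le1 _) (norm_cos_le1 _))).
rewrite (expectationB _ (mc (-1)) (mc 1) (fun w => norm_cos_le1 _) (fun w => norm_cos_le1 _)).
rewrite (polar1 n).2 (polar1 m).2 expRD mul1r mulN1r cosB cosD.
by field.
Unshelve. all: by end_near. Qed.

Context (psi : nat -> R) (psi_ge0 : forall n, 0 <= psi n)
  (cvg_Re : Re n + psi n @[n --> \oo] --> (0 : R)) (cvg_Im : Im n @[n --> \oo] --> (0 : R)).

(** Up to o(1), the expectation restricted to E is P(E) times the full one, and the latter is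
    [exp(- psi n)] with phase 0. The sequence [psi n] is kept as it is. *)
Theorem stable_charfun (E : set T) : measurable E ->
  \int[P]_w (cos (V n w) * (\1_E w : R)) -
    fine (P E) * expR (- psi n) @[n --> \oo] --> (0 : R) /\
  \int[P]_w (sin (V n w) * (\1_E w : R)) @[n --> \oo] --> (0 : R).
Proof.
move=> mE.
have hc := cvg_stable_gen (fun n => measurable_cos (mV n)) (@norm_cos_le1 R) mE cov_cos.
have hs := cvg_stable_gen (fun n => measurable_sin (mV n)) (@norm_sin_le1 R) mE cov_sin.
have le0 n : - psi n <= 0 by rewrite oppr_le0.
have close : `|Re n + psi n| + `|Im n| @[n --> \oo] --> (0 : R).
  have h1 : `|Re n + psi n| @[n --> \oo] --> `|0 : R| by apply: cvg_norm.
  have h2 : `|Im n| @[n --> \oo] --> `|0 : R| by apply: cvg_norm.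
  by move: h2 => /(cvgD h1); rewrite normr0 addr0.
have hpc n := polar_close (Im n) 0 (Re_le0 n) (le0 n).
have c1 : expR (Re n) * cos (Im n) - expR (- psi n) @[n --> \oo] --> (0 : R).
  apply/norm_cvg0P; apply: squeeze_cvgr _ (cvg_cst 0) close.
  by near=> n; rewrite normr_ge0/=; have := (hpc n).1; rewrite cos0 mulr1 opprK subr0.
have s1 : expR (Re n) * sin (Im n) @[n --> \oo] --> (0 : R).
  apply/norm_cvg0P; apply: squeeze_cvgr _ (cvg_cst 0) close.
  by near=> n; rewrite normr_ge0/=; have := (hpc n).2; rewrite sin0 mulr0 opprK !subr0.
split.
  move: c1 => /(cvgM (cvg_cst (fine (P E))))/(cvgD hc); rewrite mulr0 addr0.
  apply: cvg_trans; apply: near_eq_cvg; near=> n; rewrite /= !fctE /=.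
  by rewrite (polar1 n).1; ring.
move: s1 => /(cvgM (cvg_cst (fine (P E))))/(cvgD hs); rewrite mulr0 addr0.
apply: cvg_trans; apply: near_eq_cvg; near=> n; rewrite /= !fctE /=.
by rewrite (polar1 n).2; ring.
Unshelve. all: by end_near. Qed.

End asymptotic_independence.

Section trawl_functional.
Context (R : realType) d (T : measurableType d) (P : probability T R).
Context (gamma b : R) (nu : {measure set R -> \bar R}) (nu_levy : levy_measure nu).
Context (L : set (R * R) -> T -> R) (L_basis : levy_basis P gamma b nu L).
Context (a : R -> R) (a_trawl : trawl_function a).
Context (Delta : nat -> R) (Delta_gt0 : forall n, 0 < Delta n)
  (nDelta_cvg0 : n%:R * Delta n @[n --> \oo] --> (0 : R)).
Context (beta C0 : R) (beta_gt0 : 0 < beta).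
Context (reg : regular_exponent (psi_re gamma b nu) (psi_im gamma b nu) beta C0).
Context (s : nat -> R) (s_gt0 : forall n, (0 < n)%N -> 0 < s n)
  (s_powR : forall n, s n `^ beta = n%:R * Delta n).
Context (k : nat) (t z : 'I_k -> R) (t_ge0 : forall i, 0 <= t i).

Local Notation mu2 := (@lebesgue_measure R \x @lebesgue_measure R)%E.
Local Notation X := (trawl_process L a).

Lemma measurable_trawl_process u : measurable_fun setT (X u).
Proof.
by apply: levy_basis_measurable L_basis _ _ _;
  [exact: measurable_trawl_set_at|exact: leb2_trawl_set_at_fin].
Qed.

(** All the sets [A_u] have the same area, so the [X_u] have the same characteristic function, hence
    the same mean. *)
Lemma trawl_process_mean u : ('E_P[X u] = 'E_P[X 0])%E.
Proof.
have polar v z' := has_exponent_polar z' (levy_basis_exponent L_basis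
  (measurable_trawl_set_at a_trawl v) (leb2_trawl_set_at_fin a_trawl v)).
apply: eq_expectation; try exact: measurable_trawl_process.
apply: charfun_inj; try exact: measurable_trawl_process.
  by move=> z'; rewrite (polar u z').1 (polar 0 z').1 !leb2_trawl_set_at.
by move=> z'; rewrite (polar u z').2 (polar 0 z').2 !leb2_trawl_set_at.
Qed.

Definition trawl_functional (n : nat) (w : T) : R :=
  \sum_i z i * ((s n)^-1 * Zproc P X Delta n (t i) w).

(** The centring disappears: the common mean is multiplied by [[nt]] and subtracted [[nt]] times. *)
Lemma trawl_functionalE n w : trawl_functional n w =
  \sum_(l < (horizon t n).+1) coef s t z n l * L (trawl_grid a (Delta n) l) w.
Proof.
pose x l := L (trawl_grid a (Delta n) l) w.
have XE u : centered P X u w = X u w - fine 'E_P[X 0]%E by rewrite /centered trawl_process_mean.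
have ZE i : Zproc P X Delta n (t i) w =
    n%:R^-1 * ((steps t n i)%:R * x 0%N - \sum_(l < steps t n i) x l).
  rewrite /Zproc /partial_sum -/(steps t n i) XE big_mkord.
  under eq_bigr do rewrite XE.
  rewrite sumrB sumr_const card_ord -[_ *+ steps t n i]mulr_natl.
  rewrite (_ : x 0%N = X 0 w); last by rewrite /x /trawl_grid mul0r.
  rewrite (_ : \sum_(l < _) X _ w = \sum_(l < steps t n i) x l)//.
  by ring.
rewrite /trawl_functional; under eq_bigr do rewrite ZE.
under [RHS]eq_bigr do rewrite -/(x _) /coef mulr_sumr mulr_sumr mulr_suml.
rewrite exchange_big/=; apply: eq_bigr => i _.
under [RHS]eq_bigr => l _ do rewrite -mulrA -mulrA -mulrA.
rewrite -mulr_sumr -mulr_sumr -mulr_sumr mulrCA; congr (_ * _).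
rewrite mulrCA; congr (_ * (_ * _)).
under [RHS]eq_bigr => l _ do rewrite mulrBl.
rewrite sumrB; congr (_ - _).
  rewrite big_ord_recl/= mul1r big1 ?addr0// => l _.
  by rewrite !mul0r.
rewrite (big_ord_widen (horizon t n).+1 x (leqW (steps_horizon t_ge0 n i))) big_mkcond.
by apply: eq_bigr => l _; case: ifP; rewrite ?mul1r ?mul0r.
Qed.

Lemma measurable_Zproc n u : measurable_fun setT (Zproc P X Delta n u).
Proof.
have mc v : measurable_fun setT (centered P X v).
  by apply: measurable_funB => //; exact: measurable_trawl_process.
apply: measurable_funB; apply: measurable_funM => //.
by rewrite /partial_sum; under eq_fun do rewrite big_mkord; exact: measurable_sum.
Qed.

Lemma measurable_trawl_functional n : measurable_fun setT (trawl_functional n).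
Proof.
apply: measurable_sum => i; apply: measurable_funM => //.
by apply: measurable_funM => //; exact: measurable_Zproc.
Qed.

Let A n (l : 'I_(horizon t n).+1) := trawl_grid a (Delta n) l.
Let c n (l : 'I_(horizon t n).+1) := coef s t z n l.
Let r := psi_re gamma b nu.
Let i := psi_im gamma b nu.
Let Theta n p := weight_at (@A n) (@c n) p.
Let Re n := \int[mu2]_p r (Theta n p).
Let Im n := \int[mu2]_p i (Theta n p).

Let mA n l : measurable (@A n l). Proof. exact: measurable_trawl_set_at. Qed.
Let finA n l : (leb2 (@A n l) < +oo)%E. Proof. exact: leb2_trawl_set_at_fin. Qed.

Let i0 : i 0 = 0. Proof. exact: psi_im0. Qed.
Let r0 : r 0 = 0. Proof. exact: psi_re0. Qed.

Let Re_le0 n : Re n <= 0.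
Proof.
rewrite /Re Rintegral_weight//; apply: sumr_le0 => S _.
by rewrite mulr_ge0_le0 ?psi_re_le0// fine_ge0// leb2_ge0.
Qed.

Let weightZ e n p : weight_at (@A n) (fun l => e * c l) p = e * Theta n p.
Proof. by rewrite /Theta /weight_at mulr_sumr; apply: eq_bigr => l _; rewrite mulrA. Qed.

Let Re2 n m e := \int[mu2]_p r (Theta n p + e * Theta m p).
Let Im2 n m e := \int[mu2]_p i (Theta n p + e * Theta m p).

Let polar2 n m e : polar_charfun P (fun w => trawl_functional n w + e * trawl_functional m w)
  (expR (Re2 n m e)) (Im2 n m e).
Proof.
have := levy_basis_weightD_polar (@c n) (fun l => e * @c m l) (@mA n) (@finA n) (@mA m) (@finA m)
  nu_levy L_basis.
have weightE p : weight_at (@A n) (@c n) p + weight_at (@A m) (fun l => e * c l) p =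
    Theta n p + e * Theta m p by rewrite weightZ.
rewrite (_ : \int[mu2]_p psi_re _ _ _ _ = Re2 n m e); last first.
  by apply: eq_Rintegral => p _; rewrite weightE.
rewrite (_ : \int[mu2]_p psi_im _ _ _ _ = Im2 n m e); last first.
  by apply: eq_Rintegral => p _; rewrite weightE.
have E w : \sum_l @c n l * L (@A n l) w + \sum_l (e * @c m l) * L (@A m l) w =
    trawl_functional n w + e * trawl_functional m w.
  rewrite !trawl_functionalE mulr_sumr; congr (_ + _).
  by apply: eq_bigr => l _; rewrite mulrA.
by under eq_fun do rewrite E.
Qed.

Let polar1 n : polar_charfun P (trawl_functional n) (expR (Re n)) (Im n).
Proof.
have := levy_basis_weight_polar (@c n) (@mA n) (@finA n) nu_levy L_basis.
by rewrite (_ : (fun w => _) = trawl_functional n)//; apply/funext => w; rewrite trawl_functionalE.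
Qed.

Let Re2_le0 n m e : Re2 n m e <= 0.
Proof.
have i2 := integrable_weightD (@c n) (fun l => e * @c m l) (@mA n) (@finA n) (@mA m) (@finA m) r0.
rewrite -oppr_ge0 -mulN1r -RintegralZl//.
  by apply: Rintegral_ge0 => p _; rewrite mulN1r oppr_ge0 psi_re_le0.
by move: i2; under eq_fun do rewrite weightZ.
Qed.

Let S n := n%:R^-1 * \sum_(j < horizon t n) `|ramp t z n j.+1| `^ beta.

Let cvg_Re : Re n + 2 * a 0 * C0 * S n @[n --> \oo] --> (0 : R).
Proof. exact: (cvg_weight_re a_trawl Delta_gt0 nDelta_cvg0 beta_gt0 s_gt0 s_powR z t_ge0 reg). Qed.

Let cvg_Im : Im n @[n --> \oo] --> (0 : R).
Proof. exact: (cvg_weight_im a_trawl Delta_gt0 nDelta_cvg0 beta_gt0 s_gt0 s_powR z t_ge0 reg). Qed.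

Let S_bounded : exists Q, forall n, `|S n| <= Q.
Proof.
exists ((\sum_i t i) * (\sum_i `|z i| * t i) `^ beta) => n.
have B0 : 0 <= \sum_i `|z i| * t i by apply: sumr_ge0 => j _; rewrite mulr_ge0.
have H0 : 0 <= \sum_i t i by exact: sumr_ge0.
rewrite /S; case: n => [|n]; first by rewrite invr0 mul0r normr0 mulr_ge0// powR_ge0.
rewrite ger0_norm; last by rewrite mulr_ge0 ?invr_ge0// sumr_ge0// => j _; exact: powR_ge0.
rewrite ler_pdivrMl//.
apply: (@le_trans _ _ (\sum_(j < horizon t n.+1) (\sum_i `|z i| * t i) `^ beta)).
  by apply: ler_sum => j _; rewrite ge0_ler_powR ?nnegrE ?(ltW beta_gt0)// ramp_le.
rewrite sumr_const card_ord -[leLHS]mulr_natl mulrA ler_wpM2r ?powR_ge0//.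
exact: horizon_le.
Qed.

Let Re_bounded : exists2 Q, 0 < Q & \forall n \near \oo, - Re n <= Q.
Proof.
have [Q hQ] := S_bounded; have Q0 : 0 <= Q by exact: le_trans (hQ 0%N).
have q0 : 0 <= `|2 * a 0 * C0| * Q by rewrite mulr_ge0.
exists (1 + `|2 * a 0 * C0| * Q); first by rewrite ltr_pwDl.
near=> n.
have h : `|0 - (Re n + 2 * a 0 * C0 * S n)| <= 1.
  by near: n; have /cvgrPdist_le := cvg_Re; apply.
have := ler_normM_bound (lexx `|2 * a 0 * C0|) (hQ n).
by move: h; rewrite !ler_norml => /andP[? ?] /andP[? ?]; lra.
Unshelve. all: by end_near. Qed.

(** The scale m is fixed. With [l] small compared with the bounded quantities [- Re n], the
    contribution of scale n is at most half of the tolerance, uniformly in n; [l] being fixed, the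
    other contribution carries the area of the support of the n-th weight, which tends to 0. *)
Let interaction (G : R -> R) m e V : \int[mu2]_p G (e * Theta m p) = V -> G 0 = 0 ->
  (forall l u v, 0 < l -> `|G (u + v) - G u - G v| <= - (l * r u + l^-1 * r v)) ->
  \int[mu2]_p G (Theta n p + e * Theta m p) - \int[mu2]_p G (Theta n p)
    - V @[n --> \oo] --> (0 : R).
Proof.
move=> <- G0 Gsub; have [Q Q0 hQ] := Re_bounded.
have [K K0 hK] : exists2 K, 0 <= K & forall p, `|r (e * Theta m p)| <= K.
  have sum0 : 0 <= \sum_l `|e * @c m l| by apply: sumr_ge0.
  (* At [e = 1] this bounds the real part on bounded sets of frequencies, and the weight at scale m
     is bounded by the sum of its coefficients. *)
  have [C hC hb] := regular_bound reg sum0.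
  exists C => // p.
  have ub : `|e * Theta m p| * 1 <= \sum_l `|e * @c m l|.
    rewrite mulr1 -weightZ; apply: (le_trans (ler_norm_sum _ _ _)).
    apply: ler_sum => l _; rewrite normrM ler_piMr// indicE.
    by case: (_ \in _); rewrite ?normr1 ?normr0.
  have h01 : 0 < (1 : R) <= 1 by rewrite ltr01 lexx.
  by have := (hb 1 _ h01 ub).1; rewrite powR1 mulr1.
apply/cvgrPdist_le => e' e'0.
pose l := e' / (2 * Q); have l0 : 0 < l by rewrite divr_gt0// mulr_gt0.
have a00 : 0 <= a 0 by exact: trawl_ge0.
pose H := \sum_i t i; have H0 : 0 <= H by exact: sumr_ge0.
have cvgD : l^-1 * K * (2 * (H * a 0)) * (n%:R * Delta n) @[n --> \oo] -->
    l^-1 * K * (2 * (H * a 0)) * 0 by exact: cvgMr.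
rewrite mulr0 in cvgD.
near=> n; rewrite sub0r normrN.
have [D [mD leD suppD]] := trawl_weight_support a_trawl (Delta_gt0 n) (sum_coef0 s z t_ge0 n).
have finD : (leb2 D < +oo)%E by rewrite (le_lt_trans leD)// ltry.
have := weight_interaction (th1 := @c n) (th2 := fun l => e * @c m l)
  (@mA n) (@finA n) (@mA m) (@finA m) G0 r0 l0 K0 (fun u => regular_re_le0 reg u)
  (fun u v => Gsub l u v l0) mD finD suppD.
have e1 : \int[mu2]_p G (weight_at (@A n) (@c n) p + weight_at (@A m) (fun l => e * c l) p) =
    \int[mu2]_p G (Theta n p + e * Theta m p).
  by apply: eq_Rintegral => p _; rewrite weightZ.
have e2 : \int[mu2]_p G (weight_at (@A m) (fun l => e * c l) p) =
    \int[mu2]_p G (e * Theta m p).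
  by apply: eq_Rintegral => p _; rewrite weightZ.
rewrite e1 e2 => h.
have {}h := h (fun p => eq_ind_r (fun x => `|r x| <= K) (hK p) (weightZ e m p)).
rewrite -/(Theta n _) in h.
apply: (le_trans h).
rewrite -/(Re n).
have fD : fine (leb2 D) <= 2 * (H * a 0) * (n%:R * Delta n).
  apply: (@le_trans _ _ (2 * ((horizon t n)%:R * Delta n * a 0))).
    by rewrite -lee_fin fineK// leb2_fin_num.
  rewrite (_ : 2 * (H * a 0) * _ = 2 * (n%:R * H * Delta n * a 0)); last by ring.
  by rewrite ler_wpM2l// ler_wpM2r// ler_wpM2r ?(ltW (Delta_gt0 n))// horizon_le.
have h1 : l^-1 * K * fine (leb2 D) <= e' / 2.
  apply: (le_trans (ler_wpM2l _ fD)); first by rewrite mulr_ge0// invr_ge0 ltW.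
  rewrite [leLHS]mulrA; near: n. by have /cvgr_le := cvgD; apply; rewrite divr_gt0.
have h2 : - (l * Re n) <= e' / 2.
  have : - Re n <= Q by near: n; exact: hQ.
  move=> /(ler_wpM2l (ltW l0)); rewrite mulrN => /le_trans; apply.
  by rewrite le_eqVlt; apply/orP; left; apply/eqP; rewrite /l; field; rewrite gt_eqF.
by rewrite (_ : e' = e' / 2 + e' / 2) ?lerD//; field.
Unshelve. all: by end_near. Qed.

Let cvg_Re2 m e : e = 1 \/ e = -1 -> Re2 n m e - Re n - Re m @[n --> \oo] --> (0 : R).
Proof.
move=> eE; apply: (interaction _ r0 (regular_re_sub reg)).
apply: eq_Rintegral => p _; case: eE => ->; rewrite ?mul1r// mulN1r.
exact: (regular_reN reg).
Qed.

Let cvg_Im2 m e : e = 1 \/ e = -1 -> Im2 n m e - Im n - e * Im m @[n --> \oo] --> (0 : R).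
Proof.
move=> eE; apply: (interaction _ i0 (regular_im_sub reg)).
transitivity (\int[mu2]_p (e * i (Theta m p))).
  apply: eq_Rintegral => p _; case: eE => ->; rewrite ?mul1r// !mulN1r.
  exact: (regular_imN reg).
by apply: RintegralZl => //; exact: (integrable_weight (@c m) (@mA m) (@finA m) i0).
Qed.

Hypothesis C0_ge0 : 0 <= C0.

Theorem trawl_functional_charfun (E : set T) : measurable E ->
  \int[P]_w (cos (trawl_functional n w) * (\1_E w : R)) -
    fine (P E) * expR (- (2 * a 0 * C0 *
      (n%:R^-1 * \sum_(j < horizon t n) `|ramp t z n j.+1| `^ beta))) @[n --> \oo] --> (0 : R) /\
  \int[P]_w (sin (trawl_functional n w) * (\1_E w : R)) @[n --> \oo] --> (0 : R).
Proof.
have psi_ge0 n : 0 <= 2 * a 0 * C0 * S n.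
  apply: mulr_ge0.
    by apply: mulr_ge0 => //; apply: mulr_ge0 => //; exact: trawl_ge0.
  by apply: mulr_ge0; rewrite ?invr_ge0// sumr_ge0// => j _; exact: powR_ge0.
exact: (stable_charfun measurable_trawl_functional Re_le0 Re2_le0 polar1 polar2
  cvg_Re2 cvg_Im2 psi_ge0 cvg_Re cvg_Im).
Qed.

End trawl_functional.

(** * The limit processes *)

Section gaussian_charfun.
Context (R : realType) (v : R).
Hypothesis v_gt0 : 0 < v.
Local Notation mu := (@lebesgue_measure R).
Implicit Types x z theta : R.

Let p x : R := normal_pdf 0 (Num.sqrt v) x.
Let k : R := normal_peak (Num.sqrt v).

Let sqrt_neq0 w : 0 < w -> Num.sqrt w != 0 :> R.
Proof. by move=> w0; rewrite gt_eqF// sqrtr_gt0. Qed.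

Let pE x : p x = k * expR (- (x * x / (v + v))).
Proof.
rewrite /p normal_pdfE ?sqrt_neq0// /normal_fun subr0 sqr_sqrtr ?ltW//.
by rewrite mulr2n mulNr expr2.
Qed.

Let p_ge0 x : 0 <= p x. Proof. exact: normal_pdf_ge0. Qed.

Let k_ge0 : 0 <= k. Proof. exact: normal_peak_ge0. Qed.

Let mp : measurable_fun setT p. Proof. exact: measurable_normal_pdf. Qed.

Let integrable_p : mu.-integrable setT (EFin \o p).
Proof. exact: integrable_normal_pdf. Qed.

Let dp x : is_derive x 1 p (- (x / v) * p x).
Proof.
rewrite (_ : p = fun x => k * expR (- (x * x * (v + v)^-1))); last exact/funext/pE.
derive_by; rewrite (_ : v + v = 2 * v); last by ring.
by field; rewrite gt_eqF.
Qed.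

Let norm_mul_le x : `|x| <= (1 + 4 * v) * expR (x * x / (4 * v)).
Proof.
have h : 1 + x * x / (4 * v) <= expR (x * x / (4 * v)) by exact: expR_ge1Dx.
apply: (@le_trans _ _ ((1 + 4 * v) * (1 + x * x / (4 * v)))); last first.
  by rewrite ler_pM2l// ltr_pwDl// mulr_ge0// ltW.
have -> : (1 + 4 * v) * (1 + x * x / (4 * v)) =
    1 + x * x + (4 * v + x * x / (4 * v)) by field; rewrite gt_eqF.
have h2 : 0 <= 4 * v + x * x / (4 * v).
  have v40 : 0 <= 4 * v by rewrite mulr_ge0// ltW.
  by rewrite addr_ge0// divr_ge0// -expr2 sqr_ge0.
apply: (@le_trans _ _ (1 + x * x)); last by rewrite lerDl.
rewrite -expr2 -real_normK ?num_real//.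
by rewrite -subr_ge0; nra.
Qed.

(** [|x| p x] is at most a constant times the normal density of variance 2v, since [|x|] is absorbed
    by [exp(x^2/(4v))]. *)
Let integrable_norm_p : mu.-integrable setT (EFin \o (fun x => `|x| * p x)).
Proof.
have v2 : 0 < v + v by rewrite addr_gt0.
pose q x : R := normal_pdf 0 (Num.sqrt (v + v)) x.
have k'0 : 0 < normal_peak (Num.sqrt (v + v)) by rewrite normal_peak_gt0// sqrt_neq0.
apply: (@le_integrable _ _ _ mu setT _ _
    (fun x => (((1 + 4 * v) * (k / normal_peak (Num.sqrt (v + v))))%:E * (q x)%:E)%E)) => //.
- by apply/measurable_EFinP; apply: measurable_funM => //; exact: measurableT_comp.
- move=> x _; rewrite -EFinM lee_fin [leLHS]normrM normr_id (ger0_norm (p_ge0 x)) pE.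
  rewrite [leRHS]ger0_norm; last first.
    rewrite !mulr_ge0 ?normal_pdf_ge0 ?invr_ge0 ?(ltW k'0)//.
    by rewrite addr_ge0// mulr_ge0// ltW.
  rewrite /q normal_pdfE ?sqrt_neq0// /normal_fun subr0 sqr_sqrtr ?(ltW v2)//.
  have -> : - x ^+ 2 / ((v + v) *+ 2) = x * x / (4 * v) - x * x / (v + v).
    by rewrite -(mulr_natr (v + v)); field; rewrite (gt_eqF v_gt0) gt_eqF.
  rewrite expRD; have := norm_mul_le x; move: k'0.
  set A := expR (x * x / _); set B := expR (- _); set c := normal_peak _ => c0 h.
  have -> : (1 + 4 * v) * (k / c) * (c * (A * B)) = (1 + 4 * v) * A * (k * B).
    by field; rewrite gt_eqF.
  by rewrite ler_wpM2r// mulr_ge0// expR_ge0.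
- by apply: integrableZl => //; exact: integrable_normal_pdf.
Qed.

Let cvg_p : p n%:R @[n --> \oo] --> (0 : R).
Proof.
have v2 : 0 < v + v by rewrite addr_gt0.
apply: (@squeeze_cvgr _ _ _ _ (fun=> 0) (fun n : nat => k * (1 + (v + v)) * harmonic n)).
- apply: nearW => n; rewrite p_ge0 /= pE expRN; set E := expR _.
  have h : 1 + n%:R * n%:R / (v + v) <= E by exact: expR_ge1Dx.
  have E0 : 0 < E by exact: expR_gt0.
  rewrite -[leRHS]mulrA; apply: ler_wpM2l => //; rewrite /harmonic/= ler_pdivlMr// mulrC.
  rewrite ler_pdivrMr//.
  apply: (@le_trans _ _ ((1 + (v + v)) * (1 + n%:R * n%:R / (v + v)))); last first.
    by rewrite ler_pM2l// addr_gt0.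
  have -> : (1 + (v + v)) * (1 + n%:R * n%:R / (v + v)) =
     (n%:R * n%:R + 1) + (v + v + n%:R * n%:R / (v + v)) :> R by field; rewrite gt_eqF.
  apply: (@le_trans _ _ (n%:R * n%:R + 1)); last by rewrite lerDl addr_ge0// ?divr_ge0// ltW.
  by rewrite -natr1 lerD2r -natrM ler_nat; case: n {h E E0} => // n; rewrite leq_pmulr.
- exact: cvg_cst.
- rewrite -[X in _ --> X](mulr0 (k * (1 + (v + v)))); apply: cvgM; first exact: cvg_cst.
  exact: cvg_harmonic.
Qed.

(** The shift [theta] treats cosine and sine together: [theta = 0] and [theta = -pi/2]. *)
Let phase theta z : R := \int[mu]_x (cos (z * x + theta) * p x).

Let affine_measurable z theta : measurable_fun setT (fun x => z * x + theta).
Proof. by apply: measurable_funD => //; exact: measurable_funM. Qed.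

Let mcos z theta : measurable_fun setT (fun x => cos (z * x + theta)).
Proof. exact: measurable_cos. Qed.

Let msin z theta : measurable_fun setT (fun x => sin (z * x + theta)).
Proof. exact: measurable_sin. Qed.

Let integrable_bounded_mul (f : R -> R) g : measurable_fun setT f ->
  (forall x, `|f x| <= 1) -> mu.-integrable setT (EFin \o g) ->
  mu.-integrable setT (EFin \o (fun x => f x * g x)).
Proof.
move=> mf bf ig; apply: (le_integrable _ _ _ ig) => //.
- apply/measurable_EFinP; apply: measurable_funM => //.
  by apply/measurable_EFinP; exact: measurable_int ig.
- by move=> x _ /=; rewrite lee_fin normrM ler_piMl.
Qed.

Let integrable_mul_p : mu.-integrable setT (EFin \o (fun x => x * p x)).
Proof.
apply: (le_integrable _ _ _ integrable_norm_p) => //.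
- by apply/measurable_EFinP; exact: measurable_funM.
- by move=> x _ /=; rewrite lee_fin !normrM normr_id.
Qed.

Let phase_derive theta z :
  is_derive z 1 (phase theta) (- \int[mu]_x (sin (z * x + theta) * (x * p x))).
Proof.
pose f z x := cos (z * x + theta) * p x.
have df z' x : is_derive z' 1 (f^~ x) (- (x * sin (z' * x + theta) * p x)).
  by rewrite /f; derive_by; ring.
have df1 z' x : partial1of2 f z' x = - (x * sin (z' * x + theta) * p x).
  by rewrite partial1of2E; apply: derive_val; exact: df.
have zI : `]z - 1, z + 1[%classic z.
  by rewrite /= in_itv/= ltrBlDr !ltrDl ltr01.
have h1 : forall z', `]z - 1, z + 1[%classic z' -> mu.-integrable setT (EFin \o f z').
  move=> z' _; apply: integrable_bounded_mul => // x; exact: norm_cos_le1.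
have h2 z' x : `]z - 1, z + 1[%classic z' -> setT x -> derivable (f^~ x) z' 1.
  by move=> _ _; apply: (@ex_derive _ _ _ _ _ _ _ (df z' x)).
have G0 x : 0 <= `|x| * p x by rewrite mulr_ge0.
have h3 z' x : `]z - 1, z + 1[%classic z' -> setT x -> `|partial1of2 f z' x| <= `|x| * p x.
  move=> _ _; rewrite df1 normrN !normrM (ger0_norm (p_ge0 x)) ler_wpM2r//.
  by rewrite ler_piMr// norm_sin_le1.
have h := differentiation_under_integral measurableT zI h1 h2 G0 integrable_norm_p h3.
have h' : derivable (phase theta) z 1.
  exact: (derivable_under_integral measurableT zI h1 h2 G0 integrable_norm_p h3).
apply: DeriveDef; first by [].
rewrite -derive1E; etransitivity; first exact: h.
transitivity (\int[mu]_x (- 1 * (sin (z * x + theta) * (x * p x)))).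
  by apply: eq_Rintegral => x _; rewrite df1; ring.
rewrite RintegralZl ?mulN1r//; apply: integrable_bounded_mul => // x.
exact: norm_sin_le1.
Qed.

(* [z cos(z x + theta) p x - (x / v) sin(z x + theta) p x] is the derivative of
   [sin(z x + theta) p x], which vanishes at infinity. *)
Let integration_by_parts theta z :
  \int[mu]_x (sin (z * x + theta) * (x * p x)) = v * z * phase theta z.
Proof.
pose g x := z * (cos (z * x + theta) * p x) - v^-1 * (sin (z * x + theta) * (x * p x)).
have i1 : mu.-integrable setT (EFin \o (fun x => cos (z * x + theta) * p x)).
  by apply: integrable_bounded_mul => // x; exact: norm_cos_le1.
have i2 : mu.-integrable setT (EFin \o (fun x => sin (z * x + theta) * (x * p x))).
  by apply: integrable_bounded_mul => // x; exact: norm_sin_le1.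
have iZ (c : R) f : mu.-integrable setT (EFin \o f) ->
    mu.-integrable setT (EFin \o (fun x => c * f x)).
  by move=> iF; have := integrableZl measurableT c iF.
have ig : mu.-integrable setT (EFin \o g).
  by have := integrableB measurableT (iZ z _ i1) (iZ v^-1 _ i2).
have dg x : is_derive x 1 (fun x => sin (z * x + theta) * p x) (g x).
  have := dp x => dpx; rewrite /g.
  apply: (has_derivativeP (has_derivativeM _ dpx)); first by derive_rules.
  by rewrite /=; field; rewrite gt_eqF.
have cg n : {within `[- n%:R, n%:R], continuous g}.
  apply: derive_within_continuous => x _; have dpx := dp x; eexists; rewrite /g.
  by derive_rules.
have h0 : \int[mu]_x (g x * \1_(`[- n%:R, n%:R]%classic : set R) x)
    @[n --> \oo] --> \int[mu]_x g x.
  apply: (@cvg_Rintegral _ _ _ mu setT _ _ (fun x => `|g x|)) => //.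
  - move=> n; apply: measurable_funM; last exact: measurable_indic.
    by apply/measurable_EFinP; exact: measurable_int ig.
  - move=> x _; apply: cvg_near_cst; near=> n.
    rewrite indicE mem_set ?mulr1//= in_itv/= -ler_norml.
    by near: n; exact: nbhs_infty_ger.
  - by have := integrable_norm ig.
  - by move=> n x _; rewrite normrM indicE ler_piMr// normr_nat lern1 leq_b1.
have {h0} : \int[mu]_x g x = 0.
  apply: (cvg_unique _ h0); first exact: Rhausdorff.
  apply: (@squeeze_cvgr _ _ _ _ (fun n : nat => - (2 * p n%:R))
    (fun n : nat => 2 * p n%:R)).
  - apply: nearW => n; rewrite -ler_norml.
    have pN : p (- n%:R) = p n%:R by rewrite !pE mulrNN.
    rewrite -[X in `|X|](_ : sin (z * n%:R + theta) * p n%:R -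
        sin (z * - n%:R + theta) * p (- n%:R) = _); last first.
      rewrite -(@Rintegral_FTC2 _ (fun x => sin (z * x + theta) * p x) g) ?lerN2//.
      + rewrite Rintegral_mkcond; apply: eq_Rintegral => x _.
        by rewrite patchE indicE; case: ifP => _; rewrite ?mulr1 ?mulr0.
      + by rewrite -subr_ge0 opprK addr_ge0.
    rewrite pN -mulrBl normrM (ger0_norm (p_ge0 _)) ler_wpM2r//.
    by rewrite (le_trans (ler_normB _ _))// lerD ?norm_sin_le1.
  - rewrite -[X in _ --> X]oppr0 -[X in - X](mulr0 2).
    by apply: cvgN; apply: cvgM cvg_p; exact: cvg_cst.
  - by rewrite -[X in _ --> X](mulr0 2); apply: cvgM cvg_p; exact: cvg_cst.
rewrite /g RintegralB//; [|exact: iZ|exact: iZ].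
rewrite !RintegralZl// => /eqP; rewrite subr_eq0 => /eqP h.
by rewrite -mulrA -/(phase _ _) h mulrA divff ?mul1r// gt_eqF.
Unshelve. all: by end_near. Qed.

(** Differentiation under the integral followed by integration by parts gives the equation
    [phase' = - v z phase], so that [phase] times [exp(v z^2 / 2)] is constant. *)
Let phaseE theta z : phase theta z = cos theta * expR (- (v * z ^+ 2 / 2)).
Proof.
have phase0 : phase theta 0 = cos theta.
  rewrite /phase -[RHS]mulr1.
  transitivity (\int[mu]_x (cos theta * p x)).
    by apply: eq_Rintegral => x _; rewrite mul0r add0r.
  rewrite RintegralZl//; congr (_ * _).
  by rewrite /Rintegral integral_normal_pdf.
pose F z := phase theta z * expR (v * (z * z) / 2).
have dF (y : R) : is_derive y 1 F 0.
  have := phase_derive theta y; rewrite integration_by_parts => dph.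
  rewrite /F; apply: (has_derivativeP (has_derivativeM dph _)); first by derive_rules.
  by rewrite /=; field.
have cF a b : a <= b -> F b = F a.
  move=> ab; have := @mean_value_bound _ F (fun=> 0) a b 0 0 ab (fun x _ => dF x).
  rewrite subrr normr0 lexx !mul0r subr0 => /(_ (fun _ _ => isT)).
  by rewrite normr_le0 subr_eq0 => /eqP.
have F0 : F z = F 0 by have [/cF//|/ltW/cF] := leP 0 z.
rewrite expr2 expRN -phase0.
have E0 : expR (v * (z * z) / 2) != 0 by rewrite gt_eqF// expR_gt0.
apply: (mulIf E0); rewrite mulfVK//.
by have := F0; rewrite /F !mulr0 mul0r expR0 mulr1.
Qed.

Lemma integral_cos_normal_pdf z :
  \int[mu]_x (cos (z * x) * normal_pdf 0 (Num.sqrt v) x) = expR (- (v * z ^+ 2 / 2)).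
Proof.
have := phaseE 0 z; rewrite cos0 mul1r => <-.
by apply: eq_Rintegral => x _; rewrite addr0.
Qed.

Lemma integral_sin_normal_pdf z :
  \int[mu]_x (sin (z * x) * normal_pdf 0 (Num.sqrt v) x) = 0.
Proof.
have := phaseE (- (pi / 2)) z; rewrite cosN cos_pihalf mul0r => h0; rewrite -[RHS]h0.
apply: eq_Rintegral => x _; rewrite -/(p x); congr (_ * _).
by rewrite cosD cosN sinN cos_pihalf sin_pihalf; ring.
Qed.

End gaussian_charfun.

(** * Expectations computed from the law of a variable *)

Section law.
Context d (T : measurableType d) (R : realType) (P : probability T R).

Lemma expectation_law (Q : {measure set (measurableTypeR R) -> \bar R}) (X : T -> R) (f : R -> R) (K : R) :
  measurable_fun setT X -> (forall U : set R, measurable U -> P (X @^-1` U) = Q U) ->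
  measurable_fun setT f -> (forall x, `|f x| <= K) ->
  \int[P]_w f (X w) = \int[Q]_x f x.
Proof.
move=> mX lawX mf bf; congr fine.
pose X' : {mfun T >-> measurableTypeR R} :=
  HB.pack (X : T -> measurableTypeR R)
    (isMeasurableFun.Build _ _ T (measurableTypeR R) X mX).
transitivity (\int[distribution P X']_x (f x)%:E)%E; last first.
  by apply: eq_measure_integral => U mU _; exact: lawX.
rewrite [RHS]integral_pushforward//; first exact/measurable_EFinP.
rewrite preimage_setT; apply: (@bounded_integrable _ _ _ P (f \o X) K) => [|w].
  exact: measurableT_comp.
exact: bf.
Qed.

Lemma equal_law_expectation (X Y : T -> R) (f : R -> R) (K : R) :
  measurable_fun setT X -> measurable_fun setT Y ->
  (forall U : set R, measurable U -> P (X @^-1` U) = P (Y @^-1` U)) ->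
  measurable_fun setT f -> (forall x, `|f x| <= K) ->
  \int[P]_w f (X w) = \int[P]_w f (Y w).
Proof.
move=> mX mY XY mf bf.
pose Y' : {mfun T >-> measurableTypeR R} :=
  HB.pack (Y : T -> measurableTypeR R)
    (isMeasurableFun.Build _ _ T (measurableTypeR R) Y mY).
by rewrite (@expectation_law (distribution P Y') _ f K)// -(@expectation_law _ Y f K).
Qed.

Lemma integral_normal_prob (m s : R) (f : R -> R) (K : R) : s != 0 ->
  measurable_fun setT f -> (forall x, `|f x| <= K) ->
  \int[normal_prob m s]_x f x = \int[lebesgue_measure]_x (f x * normal_pdf m s x).
Proof.
move=> s0 mf bf; congr fine.
have fi : (normal_prob m s).-integrable setT (EFin \o f).
  exact: (@bounded_integrable _ _ _ (normal_prob m s) _ _ mf bf).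
rewrite -(Radon_Nikodym_change_of_variables (normal_prob_dominates m s))//=.
under [RHS]eq_integral do rewrite EFinM.
apply: ae_eq_integral => //.
- apply: emeasurable_funM; first exact/measurable_EFinP.
  apply: (measurable_int lebesgue_measure).
  exact/Radon_Nikodym_integrable/normal_prob_dominates.
- apply: emeasurable_funM; first exact/measurable_EFinP.
  by apply/measurable_EFinP; exact: measurable_normal_pdf.
- apply: ae_eqe_mul2l => /=.
  rewrite Radon_NikodymE//=; first exact: normal_prob_dominates.
  move=> dom; case: cid => /= h [h1 h2 h3].
  apply: integral_ae_eq => //=.
  + by apply/measurable_EFinP; exact: measurable_normal_pdf.
  + by move=> E _ mE; rewrite -h3.
Qed.

Lemma normal_polar (X : T -> R) (v z : R) : 0 < v -> measurable_fun setT X ->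
  (forall U : set R, measurable U -> P (X @^-1` U) = normal_prob 0 (Num.sqrt v) U) ->
  polar_charfun P (fun w => z * X w) (expR (- (v * z ^+ 2 / 2))) 0.
Proof.
move=> v0 mX lawX.
have s0 : Num.sqrt v != 0 by rewrite gt_eqF// sqrtr_gt0.
have mz : measurable_fun setT (fun x : R => z * x) by exact: measurable_funM.
have mc : measurable_fun setT (fun x : R => cos (z * x)) by exact: measurable_cos.
have ms : measurable_fun setT (fun x : R => sin (z * x)) by exact: measurable_sin.
have bc (x : R) : `|cos (z * x)| <= 1 by exact: norm_cos_le1.
have bs (x : R) : `|sin (z * x)| <= 1 by exact: norm_sin_le1.
split; rewrite ?cos0 ?sin0 ?mulr1 ?mulr0.
- rewrite (@expectation_law (normal_prob 0 (Num.sqrt v) : {measure set (measurableTypeR R) -> \bar R}) _ _ _ mX lawX mc bc) (integral_normal_prob _ s0 mc bc).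
  exact: integral_cos_normal_pdf.
- rewrite (@expectation_law (normal_prob 0 (Num.sqrt v) : {measure set (measurableTypeR R) -> \bar R}) _ _ _ mX lawX ms bs) (integral_normal_prob _ s0 ms bs).
  exact: integral_sin_normal_pdf.
Qed.

End law.

Section polar_forms.
Context d (T : measurableType d) (R : realType) (P : probability T R).
Implicit Types (X Y : T -> R).

(** Polar form of the complex number [c + i s]. It gives a name to the unknown characteristic
    functions of single increments. *)
Lemma polar_charfun_exists X : exists rho theta, polar_charfun P X rho theta.
Proof.
rewrite /polar_charfun; set c := \int[P]_w cos _; set s := \int[P]_w sin _.
have [rho0|rho_neq0] := eqVneq (c ^+ 2 + s ^+ 2) 0.
  exists 0, 0; rewrite !mul0r.
  move: rho0 => /eqP; rewrite paddr_eq0 ?sqr_ge0// !sqrf_eq0 => /andP[/eqP -> /eqP ->].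
  by [].
pose rho := Num.sqrt (c ^+ 2 + s ^+ 2).
have r2 : 0 < c ^+ 2 + s ^+ 2 by rewrite lt_neqAle eq_sym rho_neq0 addr_ge0 ?sqr_ge0.
have rho0 : 0 < rho by rewrite sqrtr_gt0.
have rhoE : rho ^+ 2 = c ^+ 2 + s ^+ 2 by rewrite sqr_sqrtr// ltW.
have cs : (c / rho) ^+ 2 + (s / rho) ^+ 2 = 1.
  by rewrite !expr_div_n rhoE -mulrDl divff.
have c1 : -1 <= c / rho <= 1.
  by rewrite -ler_norml -ler_sqr ?nnegrE// expr1n real_normK ?num_real// -cs lerDl sqr_ge0.
have sE : Num.sqrt (1 - (c / rho) ^+ 2) = `|s / rho|.
  by rewrite -cs [_ + _ ^+ 2]addrC addrK sqrtr_sqr.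
have cE : rho * (c / rho) = c by rewrite mulrC divfK ?gt_eqF.
have sE' : rho * (s / rho) = s by rewrite mulrC divfK ?gt_eqF.
exists rho; have [s0|/ltW s0] := leP 0 (s / rho).
- exists (acos (c / rho)); rewrite acosK ?in_itv//= sin_acos// sE ger0_norm//.
- exists (- acos (c / rho)); rewrite cosN sinN acosK ?in_itv//= sin_acos// sE ler0_norm//.
  by rewrite opprK cE sE'.
Qed.

(** Polar forms are not unique, but a product of complex numbers depends only on the numbers. *)
Lemma eq_polar_prod n (r t r' t' : 'I_n -> R) :
  (forall i, r i * cos (t i) = r' i * cos (t' i)) ->
  (forall i, r i * sin (t i) = r' i * sin (t' i)) ->
  (\prod_i r i) * cos (\sum_i t i) = (\prod_i r' i) * cos (\sum_i t' i) /\
  (\prod_i r i) * sin (\sum_i t i) = (\prod_i r' i) * sin (\sum_i t' i).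
Proof.
elim: n r t r' t' => [|n IH] r t r' t' ec es; first by rewrite !big_ord0.
rewrite !big_ord_recl; have [hc hs] := IH (r \o lift ord0) (t \o lift ord0)
  (r' \o lift ord0) (t' \o lift ord0) (fun i => ec _) (fun i => es _).
rewrite /= in hc hs; have := ec ord0; have := es ord0; rewrite !cosD !sinD.
move: hc hs; set A := \prod_(i < n) r _; set A' := \prod_(i < n) r' _.
set C := cos (\sum_i t _); set S := sin (\sum_i t _).
set C' := cos (\sum_i t' _); set S' := sin (\sum_i t' _) => hc hs s0 c0; split.
- transitivity (r ord0 * cos (t ord0) * (A * C) - r ord0 * sin (t ord0) * (A * S)).
    by ring.
  by rewrite hc hs s0 c0; ring.
- transitivity (r ord0 * sin (t ord0) * (A * C) + r ord0 * cos (t ord0) * (A * S)).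
    by ring.
  by rewrite hc hs s0 c0; ring.
Qed.

Lemma equal_law_polar X Y (z rho theta : R) :
  measurable_fun setT X -> measurable_fun setT Y ->
  (forall U : set R, measurable U -> P (X @^-1` U) = P (Y @^-1` U)) ->
  polar_charfun P (fun w => z * Y w) rho theta ->
  polar_charfun P (fun w => z * X w) rho theta.
Proof.
move=> mX mY XY [hc hs].
have mz : measurable_fun setT (fun x : R => z * x) by exact: measurable_funM.
split; [rewrite -hc|rewrite -hs].
- by apply: (@equal_law_expectation _ _ _ _ _ _ (fun x => cos (z * x)) 1) => //;
    [exact: measurable_cos|move=> x; exact: norm_cos_le1].
- by apply: (@equal_law_expectation _ _ _ _ _ _ (fun x => sin (z * x)) 1) => //;
    [exact: measurable_sin|move=> x; exact: norm_sin_le1].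
Qed.

Definition adapted (G : set_system T) X :=
  forall U : set R, measurable U -> G (X @^-1` U).

Lemma independent_systems_pair (G1 G2 : set_system T) X Y :
  independent_systems P G1 G2 -> adapted G1 X -> adapted G2 Y ->
  mutually_independent P (fun i : 'I_2 => if i == ord0 then X else Y).
Proof.
move=> ind aX aY U mU; rewrite big_ord_recl big_ord1 /=.
rewrite -(ind _ _ (aX _ (mU ord0)) (aY _ (mU (lift ord0 ord0)))); congr (P _).
apply/seteqP; split => [w h|w [h0 h1] i _].
  by split; [exact: (h ord0 I)|exact: (h (lift ord0 ord0) I)].
by case: (unliftP ord0 i) => [j|] -> //=; rewrite (ord1 j).
Qed.

Lemma polar_charfunD (G1 G2 : set_system T) X Y (r1 r2 t1 t2 : R) :
  measurable_fun setT X -> measurable_fun setT Y ->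
  independent_systems P G1 G2 -> adapted G1 X -> adapted G2 Y ->
  polar_charfun P X r1 t1 -> polar_charfun P Y r2 t2 ->
  polar_charfun P (fun w => X w + Y w) (r1 * r2) (t1 + t2).
Proof.
move=> mX mY ind aX aY pX pY.
have := @polar_charfun_sum _ _ _ P 2 (fun i : 'I_2 => if i == ord0 then X else Y)
  (fun i => if i == ord0 then r1 else r2) (fun i => if i == ord0 then t1 else t2) _
  (independent_systems_pair ind aX aY).
rewrite !big_ord_recl !big_ord0 /= mulr1 addr0 => h.
rewrite (_ : (fun w => X w + Y w) =
    (fun w => \sum_(i < 2) (if i == ord0 then X else Y) w)); last first.
  by apply/funext => w; rewrite !big_ord_recl big_ord0 /= addr0.
by apply: h => i; case: ifP.
Qed.

Lemma expectation_prod_independent (G1 G2 : set_system T) X Y (f g : R -> R) :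
  measurable_fun setT X -> measurable_fun setT Y ->
  independent_systems P G1 G2 -> adapted G1 X -> adapted G2 Y ->
  measurable_fun setT f -> measurable_fun setT g ->
  (forall x, `|f x| <= 1) -> (forall x, `|g x| <= 1) ->
  \int[P]_w (f (X w) * g (Y w)) = (\int[P]_w f (X w)) * (\int[P]_w g (Y w)).
Proof.
move=> mX mY ind aX aY mf mg bf bg.
have := @expectation_prod_mutually_independent _ _ _ P 2
  (fun i : 'I_2 => if i == ord0 then X else Y)
  (fun i : 'I_2 => if i == ord0 then f else g) _ (independent_systems_pair ind aX aY).
rewrite !big_ord_recl !big_ord0 /= mulr1 => <-.
- by apply: eq_Rintegral => w _; rewrite !big_ord_recl big_ord0 /= mulr1.
- by move=> i; case: ifP.
- by move=> i; case: ifP.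
- by move=> i x; case: ifP.
Qed.

Lemma cvg_expectation_ae (f_ : nat -> T -> R) (f : T -> R) (K : R) :
  (forall n, measurable_fun setT (f_ n)) -> measurable_fun setT f ->
  {ae P, forall w, f_ n w @[n --> \oo] --> f w} -> (forall n w, `|f_ n w| <= K) ->
  \int[P]_w f_ n w @[n --> \oo] --> \int[P]_w f w.
Proof.
move=> mf_ mf cf bf.
have [|||||fi _ h] := @dominated_convergence _ _ _ P _ measurableT
    (fun n => EFin \o f_ n) (EFin \o f) (cst K%:E).
- by move=> n; exact/measurable_EFinP.
- exact/measurable_EFinP.
- by apply: filterS cf => w cw _; apply: cvg_EFin => //; exact: nearW.
- exact: finite_measure_integrable_cst.
- by apply: nearW => w n _; rewrite lee_fin.
apply: fine_cvg; rewrite fineK//; exact: integrable_fin_num.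
Qed.

End polar_forms.

Section increments.
Context d (T : measurableType d) (R : realType).
Implicit Types (Y M : R -> T -> R) (s w : nat -> R) (m : nat).

Definition increment_sum M s w m (x : T) : R :=
  \sum_(j < m) w j * (M (s j.+1) x - M (s j) x).

Definition partition_upto s m : Prop :=
  0 <= s 0%N /\ forall j, (j < m)%N -> s j <= s j.+1.

Lemma partition_upto_ge0 s m j : partition_upto s m -> (j <= m)%N -> 0 <= s j.
Proof.
by move=> [s0 ds]; elim: j => // j IH jm; rewrite (le_trans (IH (ltnW jm)))// ds.
Qed.

Lemma measurable_increment_sum M s w m :
  (forall t, 0 <= t -> measurable_fun setT (M t)) -> partition_upto s m ->
  measurable_fun setT (increment_sum M s w m).
Proof.
move=> mM ps; apply: measurable_sum => j; apply: measurable_funM => //.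
by apply: measurable_funB; apply: mM; apply: (partition_upto_ge0 ps) => //; exact: ltnW.
Qed.

Lemma adapted_increment_sum M s w m : partition_upto s m ->
  adapted (sigma_process M) (increment_sum M s w m).
Proof.
move=> ps.
pose G := [set C : set T | exists t, 0 <= t /\
  exists U : set R, measurable U /\ C = M t @^-1` U].
pose M' : R -> g_sigma_algebraType G -> R := M.
have mM t : 0 <= t -> measurable_fun setT (M' t).
  move=> t0 _ U mU; rewrite setTI; apply: sub_sigma_algebra.
  by exists t; split => //; exists U.
move=> U mU.
have : measurable_fun setT (fun x : g_sigma_algebraType G =>
    \sum_(j < m) w j * (M' (s j.+1) x - M' (s j) x)).
  apply: measurable_sum => j; apply: measurable_funM => //.
  by apply: measurable_funB; apply: mM; apply: (partition_upto_ge0 ps) => //; exact: ltnW.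
by move=> /(_ measurableT U mU); rewrite setTI.
Qed.

(** Independence of increments is stated for infinite monotone sequences; the points of the
    partition are frozen after the m-th. *)
Lemma independent_partition_increments (P : probability T R) M s m :
  independent_increments P M -> partition_upto s m ->
  mutually_independent P (fun (j : 'I_m) x => M (s j.+1) x - M (s j) x).
Proof.
move=> ind ps U mU; case: (ps) => s0 ds.
have ds' j : s (minn j m) <= s (minn j.+1 m).
  have [jm|] := boolP (j < m)%N; first by rewrite (minn_idPl (ltnW jm)) (minn_idPl jm) ds.
  by rewrite -leqNgt => mj; rewrite (minn_idPr mj) (minn_idPr (leqW mj)).
have := ind m (fun j => s (minn j m)) _ ds' U mU.
rewrite min0n => /(_ s0) h.
have e (j : 'I_m) : (fun x => M (s (minn j.+1 m)) x - M (s (minn j m)) x) =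
    (fun x => M (s j.+1) x - M (s j) x).
  by rewrite (minn_idPl (ltn_ord j)) (minn_idPl (ltnW (ltn_ord j))).
under eq_bigr do rewrite -e; rewrite -h; congr (P _).
by apply: eq_bigcapr => j _; rewrite e.
Qed.

End increments.

Section two_processes.
Context d (T : measurableType d) (R : realType) (P : probability T R).
Variables (Y1 Y2 : R -> T -> R) (e : R).
Hypothesis mY1 : forall t, 0 <= t -> measurable_fun setT (Y1 t).
Hypothesis mY2 : forall t, 0 <= t -> measurable_fun setT (Y2 t).
Hypothesis ind1 : independent_increments P Y1.
Hypothesis ind2 : independent_increments P Y2.
Hypothesis ind12 : independent_systems P (sigma_process Y1) (sigma_process Y2).
Implicit Types (s w : nat -> R) (m : nat).

Let M t x : R := Y1 t x + e * Y2 t x.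

Let measurable_increment (Y : R -> T -> R) s m (j : 'I_m) :
  (forall t, 0 <= t -> measurable_fun setT (Y t)) -> partition_upto s m ->
  measurable_fun setT (fun x => Y (s j.+1) x - Y (s j) x).
Proof.
move=> mY ps; apply: measurable_funB; apply: mY; apply: (partition_upto_ge0 ps) => //.
exact: ltnW.
Qed.

Let polar_increment_sum (Y : R -> T -> R) s w m (r t : 'I_m -> R) :
  (forall t, 0 <= t -> measurable_fun setT (Y t)) -> independent_increments P Y ->
  partition_upto s m ->
  (forall j : 'I_m, polar_charfun P (fun x => w j * (Y (s j.+1) x - Y (s j) x)) (r j) (t j)) ->
  polar_charfun P (increment_sum Y s w m) (\prod_j r j) (\sum_j t j).
Proof.
move=> mY ind ps; apply: polar_charfun_sum.
- by move=> j; apply: measurable_funM (measurable_increment j mY ps).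
- have mw (j : 'I_m) : measurable_fun setT (fun x : R => w j * x) by exact: measurable_funM.
  exact: (mutually_independent_comp mw (independent_partition_increments ind ps)).
Qed.

Lemma polar_increment (u v z r1 r2 t1 t2 : R) : 0 <= u -> u <= v ->
  polar_charfun P (fun x => z * (Y1 v x - Y1 u x)) r1 t1 ->
  polar_charfun P (fun x => z * e * (Y2 v x - Y2 u x)) r2 t2 ->
  polar_charfun P (fun x => z * (M v x - M u x)) (r1 * r2) (t1 + t2).
Proof.
move=> u0 uv p1 p2; pose s (i : nat) := if i is 0%N then u else v.
have ps : partition_upto s 1 by split => // -[].
have := polar_charfunD (measurable_increment_sum (fun=> z) mY1 ps)
  (measurable_increment_sum (fun=> z * e) mY2 ps) ind12
  (adapted_increment_sum _ ps) (adapted_increment_sum _ ps) _ _.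
have eY (Y : R -> T -> R) (c : R) : increment_sum Y s (fun=> c) 1 =
    (fun x => c * (Y v x - Y u x)).
  by apply/funext => x; rewrite /increment_sum big_ord1.
rewrite !eY => /(_ _ _ _ _ p1 p2).
by congr polar_charfun; apply/funext => x; rewrite /M; ring.
Qed.

(** The increments of each process are mutually independent, and the two processes are independent
    of each other; the mutual independence of the increments of M is thus reached by summing [Y1]
    and [Y2] separately and then joining the two sums. The polar forms met on the way are exchanged
    for the given ones by [eq_polar_prod]. *)
Lemma polar_two_processes s w m (r t : 'I_m -> R) : partition_upto s m ->
  (forall j : 'I_m, polar_charfun P (fun x => w j * (M (s j.+1) x - M (s j) x)) (r j) (t j)) ->
  polar_charfun P (increment_sum M s w m) (\prod_j r j) (\sum_j t j).
Proof.
move=> ps pM.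
have /fin_all_exists[r1] (j : 'I_m) :=
  polar_charfun_exists P (fun x => w j * (Y1 (s j.+1) x - Y1 (s j) x)).
move=> /fin_all_exists[t1] p1.
have /fin_all_exists[r2] (j : 'I_m) :=
  polar_charfun_exists P (fun x => w j * e * (Y2 (s j.+1) x - Y2 (s j) x)).
move=> /fin_all_exists[t2] p2.
have pU := polar_increment_sum mY1 ind1 ps p1.
have pV := @polar_increment_sum Y2 s (fun j => w j * e) m r2 t2 mY2 ind2 ps p2.
have a1 := @adapted_increment_sum _ _ _ Y1 s w m ps.
have a2 := @adapted_increment_sum _ _ _ Y2 s (fun j => w j * e) m ps.
have := polar_charfunD (measurable_increment_sum w mY1 ps)
  (measurable_increment_sum (fun j => w j * e) mY2 ps) ind12 a1 a2 pU pV.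
rewrite -big_split -big_split /=.
have -> : (fun x => increment_sum Y1 s w m x + increment_sum Y2 s (fun j => w j * e) m x) =
    increment_sum M s w m.
  apply/funext => x; rewrite /increment_sum -big_split; apply: eq_bigr => j _.
  by rewrite /M /=; ring.
have q (j : 'I_m) : polar_charfun P (fun x => w j * (M (s j.+1) x - M (s j) x))
    (r1 j * r2 j) (t1 j + t2 j).
  apply: polar_increment => //; first by apply: (partition_upto_ge0 ps); exact: ltnW.
  by case: ps => _; exact.
case=> hc hs; rewrite /polar_charfun hc hs.
by apply: eq_polar_prod => j; [rewrite -(q j).1 -(pM j).1|rewrite -(q j).2 -(pM j).2].
Qed.

Lemma polar_two_processes_real s w m (r : nat -> R) : partition_upto s m ->
  (forall j, (j < m)%N -> polar_charfun P (fun x => w j * (M (s j.+1) x - M (s j) x)) (r j) 0) ->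
  polar_charfun P (increment_sum M s w m) (\prod_(j < m) r j) 0.
Proof.
move=> ps h; have := @polar_two_processes s w m r (fun=> 0) ps (fun j => h j (ltn_ord j)).
by rewrite big1_eq.
Qed.

Lemma measurable_two_processes t : 0 <= t -> measurable_fun setT (M t).
Proof.
by move=> t0; apply: measurable_funD; [exact: mY1|apply: measurable_funM => //; exact: mY2].
Qed.

End two_processes.

(* The three properties of [M] from which the law of its integrals is computed. *)
Record stable_increments d (T : measurableType d) (R : realType) (P : probability T R)
    (G : set_system T) (M : R -> T -> R) (c beta : R) : Prop := StableIncrements {
  stable_increments_measurable : forall t, 0 <= t -> measurable_fun setT (M t) ;
  stable_increments_polar : forall (s w : nat -> R) m, partition_upto s m ->
    polar_charfun P (increment_sum M s w m)
      (expR (- (c * \sum_(j < m) `|w j| `^ beta * (s j.+1 - s j)))) 0 ;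
  stable_increments_independent : forall (s w : nat -> R) m E, partition_upto s m -> G E ->
    \int[P]_x (cos (increment_sum M s w m x) * (\1_E x : R)) =
      fine (P E) * \int[P]_x cos (increment_sum M s w m x) /\
    \int[P]_x (sin (increment_sum M s w m x) * (\1_E x : R)) =
      fine (P E) * \int[P]_x sin (increment_sum M s w m x) }.

Section stable_increments_two_processes.
Context d d' (T : measurableType d) (T' : measurableType d') (R : realType).
Variables (P' : probability T' R) (pr : {mfun T' >-> T}) (Y1 Y2 : R -> T' -> R) (e : R).
Hypothesis mY1 : forall t, 0 <= t -> measurable_fun setT (Y1 t).
Hypothesis mY2 : forall t, 0 <= t -> measurable_fun setT (Y2 t).
Hypothesis ind1 : independent_increments P' Y1.
Hypothesis ind2 : independent_increments P' Y2.
Hypothesis indB : independent_pair_of_base P' pr Y1 Y2.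

Let G : set_system T' := [set pr @^-1` A | A in measurable].
Let M t x : R := Y1 t x + e * Y2 t x.

Let adapted_two (s w : nat -> R) m : partition_upto s m ->
  adapted <<s sigma_process Y1 `|` sigma_process Y2 >> (increment_sum M s w m).
Proof.
move=> ps; pose H := sigma_process Y1 `|` sigma_process Y2.
have mY (Y : R -> T' -> R) t : sigma_process Y `<=` H -> 0 <= t ->
    measurable_fun setT (Y t : g_sigma_algebraType H -> R).
  move=> YH t0 _ U mU; rewrite setTI; apply: sub_sigma_algebra; apply: YH.
  by apply: sub_sigma_algebra; exists t; split => //; exists U.
have mM t : 0 <= t -> measurable_fun setT (M t : g_sigma_algebraType H -> R).
  move=> t0; apply: measurable_funD.
    by apply: mY => // x; left.
  by apply: measurable_funM => //; apply: mY => // x; right.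
move=> U mU.
have : measurable_fun setT (increment_sum M s w m : g_sigma_algebraType H -> R).
  exact: (@measurable_increment_sum _ (g_sigma_algebraType H) R M s w m mM ps).
by move=> /(_ measurableT U mU); rewrite setTI.
Qed.

Let adapted_indic E : G E -> adapted G (\1_E : T' -> R).
Proof.
move=> [A mA <-] U mU; exists ((\1_A : T -> R) @^-1` U); last first.
  have -> : \1_(pr @^-1` A) = (\1_A : T -> R) \o pr :> (T' -> R).
    apply/funext => x; rewrite /= !indicE; by congr (nat_of_bool _)%:R.
  by [].
have := @measurable_indic _ T R setT A mA measurableT U mU.
by rewrite setTI.
Qed.

Lemma stable_increments_two_processes (c beta : R) :
  (forall u v z : R, 0 <= u -> u <= v ->
    polar_charfun P' (fun x => z * (M v x - M u x))
      (expR (- (c * (`|z| `^ beta * (v - u))))) 0) ->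
  stable_increments P' G M c beta.
Proof.
move=> pM; have [ind12 indG] := indB.
have mM := measurable_two_processes e mY1 mY2.
split => // [s w m ps|s w m E ps GE].
  have := @polar_two_processes_real _ _ _ P' Y1 Y2 e mY1 mY2 ind1 ind2 ind12 s w m
    (fun j => expR (- (c * (`|w j| `^ beta * (s j.+1 - s j))))) ps.
  rewrite mulr_sumr -sumrN expR_sum; apply => j jm; apply: pM.
    by apply: (partition_upto_ge0 ps); exact: ltnW.
  by case: ps => _; exact.
have mE : measurable E by case: GE => A mA <-; exact: measurable_funPTI.
have mV : measurable_fun setT (increment_sum M s w m) by exact: measurable_increment_sum.
(* The product formula takes functions bounded by 1 on the whole line; [clip] is one, and it fixes
   the values 0 and 1 of the indicator. *)
pose clip (x : R) : R := \1_([set y : R | 0 <= y <= 1]) x * x.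
have mclip : measurable_fun setT clip.
  apply: measurable_funM => //; apply: measurable_indic.
  rewrite (_ : [set y : R | 0 <= y <= 1] = `[0, 1]%classic); first exact: measurable_itv.
  by apply/seteqP; split => x; rewrite /= in_itv.
have bclip x : `|clip x| <= 1.
  rewrite /clip indicE; case: (boolP (x \in _)); rewrite ?mul0r ?normr0// inE /= mul1r.
  by move=> /andP[x0 x1]; rewrite ger0_norm.
have clipE x : clip (\1_E x) = \1_E x.
  by rewrite /clip !indicE; case: (x \in E); rewrite ?mulr0// mulr1 mem_set//= ler01 lexx.
have key (f : R -> R) : measurable_fun setT f -> (forall x, `|f x| <= 1) ->
    \int[P']_x (f (increment_sum M s w m x) * (\1_E x : R)) =
    fine (P' E) * \int[P']_x f (increment_sum M s w m x).
  move=> mf bf; rewrite mulrC -(expectation_indic P' mE).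
  have h := @expectation_prod_independent _ _ _ P' _ _ _ (\1_E) f clip mV
    (measurable_indic mE) indG (adapted_two w ps) (adapted_indic GE) mf mclip bf bclip.
  transitivity (\int[P']_x (f (increment_sum M s w m x) * clip (\1_E x))).
    by apply: eq_Rintegral => x _; rewrite clipE.
  by rewrite h; congr (_ * _); apply: eq_Rintegral => x _; rewrite clipE.
split; apply: key; [exact: continuous_measurable_fun (@continuous_cos R)|exact: norm_cos_le1|
  exact: continuous_measurable_fun (@continuous_sin R)|exact: norm_sin_le1].
Qed.

End stable_increments_two_processes.

(** Two independent increments, each with exponent [z^2 (v - u) / 2], add up to the constant 1 with
    index 2. *)
Lemma brownian_stable_increments d d' (T : measurableType d) (T' : measurableType d')
    (R : realType) (P' : probability T' R) (pr : {mfun T' >-> T}) (B1 B2 : R -> T' -> R) :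
  brownian_motion P' B1 -> brownian_motion P' B2 -> independent_pair_of_base P' pr B1 B2 ->
  stable_increments P' [set pr @^-1` A | A in measurable] (fun t x => B1 t x + B2 t x) 1 2.
Proof.
move=> [mB1 _ iB1 nB1 _] [mB2 _ iB2 nB2 _] ind.
have -> : (fun t x => B1 t x + B2 t x) = (fun t x => B1 t x + 1 * B2 t x).
  by apply/funext => t; apply/funext => x; rewrite mul1r.
apply: stable_increments_two_processes => // u v z u0 uv.
have pB (B : R -> T' -> R) : (forall t, 0 <= t -> measurable_fun setT (B t)) ->
    (forall s t, 0 <= s -> s < t -> forall U : set R, measurable U ->
      P' ((fun w => B t w - B s w) @^-1` U) = normal_prob 0 (Num.sqrt (t - s)) U) ->
    polar_charfun P' (fun x => z * (B v x - B u x)) (expR (- ((v - u) * z ^+ 2 / 2))) 0.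
  move=> mB nB; move: uv; rewrite le_eqVlt => /predU1P[<-|uv].
    rewrite subrr !mul0r oppr0 expR0 /polar_charfun cos0 sin0 !mulr1 mulr0.
    have -> : (fun x => cos (z * (B u x - B u x))) = cst (1 : R).
      by apply/funext => x; rewrite subrr mulr0 cos0.
    have -> : (fun x => sin (z * (B u x - B u x))) = cst (0 : R).
      by apply/funext => x; rewrite subrr mulr0 sin0.
    by rewrite !expectation_cst.
  apply: normal_polar; [by rewrite subr_gt0| |exact: nB].
  by apply: measurable_funB; apply: mB => //; exact/ltW/(le_lt_trans u0).
have p2 := pB _ mB2 nB2; rewrite -[z in fun x => z * _]mulr1 in p2.
have := polar_increment mB1 mB2 ind.1 u0 uv (pB _ mB1 nB1) p2.
rewrite addr0 -expRD; congr polar_charfun; congr expR.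
by rewrite powR_mulrn// real_normK ?num_real//; field.
Qed.

(** * The law of the increments of a difference of Levy processes, from its law at time 1 *)

Section real_exponent.
Context d (T : measurableType d) (R : realType) (P : probability T R).

Lemma continuous_expectation_cos (X : T -> R) : measurable_fun setT X ->
  continuous (fun z : R => \int[P]_w cos (z * X w)).
Proof.
move=> mX z.
have mzX (y : R) : measurable_fun setT (fun w => y * X w) by exact: measurable_funM.
have zI : z \in `]z - 1, z + 1[%classic.
  by rewrite inE /= in_itv/= ltrBlDr !ltrDl ltr01.
apply: (@continuity_under_integral _ _ _ P (fun y w => cos (y * X w)) setT measurableT
    (z - 1) (z + 1) _ _ (cst 1) _ _ z zI).
- move=> y _; apply: (@bounded_integrable _ _ _ P (fun w => cos (y * X w)) 1).
    exact: measurable_cos.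
  by move=> w; exact: norm_cos_le1.
- have cX w : continuous (fun y : R => cos (y * X w)).
    move=> y; apply: (@is_derive_continuous _ _ y (- sin (y * X w) * X w)).
    by derive_by; ring.
  by apply: nearW => w _ y _; exact: cX.
- exact: finite_measure_integrable_cst.
- by move=> y _; apply: nearW => w _; exact: norm_cos_le1.
Qed.

(** Intermediate values. It selects the sign of a square root along a continuous function. *)
Lemma continuous_nonzero_gt0 (f : R -> R) : continuous f -> 0 < f 0 ->
  (forall z, f z != 0) -> forall z, 0 < f z.
Proof.
move=> cf f0 fn z; rewrite ltNge; apply/negP => fz.
have [z0|/ltW z0] := leP 0 z.
- have [|c _ /eqP] := @IVT R f 0 z 0 z0 (continuous_subspaceT cf); last by rewrite (negbTE (fn c)).
  by rewrite ge_min fz orbT le_max (ltW f0).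
- have [|c _ /eqP] := @IVT R f z 0 0 z0 (continuous_subspaceT cf); last by rewrite (negbTE (fn c)).
  by rewrite ge_min fz le_max (ltW f0) orbT.
Qed.

End real_exponent.

Section levy_difference.
Context d (T : measurableType d) (R : realType) (P : probability T R).
Variables (Y1 Y2 : R -> T -> R) (psi : R -> R[i]) (c beta : R).
Hypothesis levy1 : levy_process P Y1.
Hypothesis levy2 : levy_process P Y2.
Hypothesis ind12 : independent_systems P (sigma_process Y1) (sigma_process Y2).
Hypothesis exponent1 : has_exponent P (Y1 1) psi.
Hypothesis exponent2 : has_exponent P (Y2 1) psi.
Hypothesis psi_stable : forall z, - (2 * complex.Re (psi z)) = c * `|z| `^ beta.
Implicit Types (z h u : R).

Let M t x : R := Y1 t x + -1 * Y2 t x.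
Let D h x : R := M h x - M 0 x.

Let mY1 := levy_measurable levy1.
Let mY2 := levy_measurable levy2.

Let mM t : 0 <= t -> measurable_fun setT (M t).
Proof. exact: (measurable_two_processes (-1) mY1 mY2). Qed.

Let mD h : 0 <= h -> measurable_fun setT (D h).
Proof. by move=> h0; apply: measurable_funB; exact: mM. Qed.

(** Stationarity is given for each process; it passes to M through a common polar form whose value
    need not be known. *)
Let stationary_polar z u h : 0 <= u -> 0 <= h -> exists r t : R,
  polar_charfun P (fun x => z * (M (u + h) x - M u x)) r t /\
  polar_charfun P (fun x => z * D h x) r t.
Proof.
move=> u0 h0.
have [r1 [t1 p1]] := polar_charfun_exists P (fun x => z * Y1 h x).
have [r2 [t2 p2]] := polar_charfun_exists P (fun x => z * -1 * Y2 h x).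
have inc v : 0 <= v -> polar_charfun P (fun x => z * (M (v + h) x - M v x)) (r1 * r2) (t1 + t2).
  move=> v0; have vh : v <= v + h by rewrite lerDl.
  have vh0 := le_trans v0 vh.
  apply: (polar_increment mY1 mY2 ind12 v0 vh).
  - apply: (equal_law_polar _ (mY1 h0) _ p1).
      by apply: measurable_funB; exact: mY1.
    by move=> U mU; exact: (levy_stationary levy1).
  - apply: (equal_law_polar _ (mY2 h0) _ p2).
      by apply: measurable_funB; exact: mY2.
    by move=> U mU; exact: (levy_stationary levy2).
exists (r1 * r2), (t1 + t2); split; first exact: inc.
by have := inc 0 (lexx _); rewrite add0r.
Qed.

Let congr_polar (X : T -> R) r t r' t' : polar_charfun P X r t -> polar_charfun P X r' t' ->
  r * cos t = r' * cos t' /\ r * sin t = r' * sin t'.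
Proof. by move=> [<- <-] [<- <-]. Qed.

(** Subtracting an independent copy cancels the imaginary parts of the exponents and doubles the
    real part. *)
Let polar_at1 z : polar_charfun P (fun x => z * D 1 x) (expR (- (c * `|z| `^ beta))) 0.
Proof.
have law (Y : R -> T -> R) (levyY : levy_process P Y) y : has_exponent P (Y 1) psi ->
    polar_charfun P (fun x => y * (Y 1 x - Y 0 x)) (expR (complex.Re (psi y))) (complex.Im (psi y)).
  move=> eY; apply: (equal_law_polar _ (levy_measurable levyY ler01) _ (has_exponent_polar y eY)).
    by apply: measurable_funB; exact: (levy_measurable levyY).
  by move=> U mU; have := levy_stationary levyY (lexx 0) ler01 mU; rewrite add0r.
have p1 := law Y1 levy1 z exponent1; have [h1 h2] := law Y2 levy2 z exponent2.
have p2 : polar_charfun P (fun x => z * -1 * (Y2 1 x - Y2 0 x))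
    (expR (complex.Re (psi z))) (- complex.Im (psi z)).
  split; rewrite ?cosN ?sinN -?mulrN.
  - by rewrite -h1; apply: eq_Rintegral => x _; rewrite mulrN1 mulNr cosN.
  - rewrite [RHS]mulrN -h2 -[RHS]mulN1r -(@expectationZl _ _ _ P _ _ 1).
    + by apply: eq_Rintegral => x _; rewrite mulrN1 mulNr sinN mulN1r.
    + apply: measurable_sin; apply: measurable_funM => //.
      by apply: measurable_funB; exact: mY2.
    + by move=> x; exact: norm_sin_le1.
have := polar_increment mY1 mY2 ind12 (lexx 0) ler01 p1 p2.
by rewrite subrr -expRD -psi_stable (_ : - - (2 * _) = complex.Re (psi z) + complex.Re (psi z))//; ring.
Qed.

Let polar_multiple z h k r t : 0 <= h -> polar_charfun P (fun x => z * D h x) r t ->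
  polar_charfun P (fun x => z * D (k%:R * h) x) (r ^+ k) (t *+ k).
Proof.
move=> h0 pD; pose s (j : nat) : R := j%:R * h.
have ps : partition_upto s k.
  by split => [|j _]; rewrite /s ?mul0r// ler_wpM2r// ler_nat.
have := @polar_two_processes _ _ _ P Y1 Y2 (-1) mY1 mY2 (levy_independent levy1)
  (levy_independent levy2) ind12 s (fun=> z) k (fun=> r) (fun=> t) ps.
rewrite prodr_const sumr_const card_ord.
have -> : increment_sum (fun t x => Y1 t x + -1 * Y2 t x) s (fun=> z) k =
    (fun x => z * D (k%:R * h) x).
  apply/funext => x; rewrite /increment_sum -mulr_sumr; congr (_ * _).
  by rewrite -(big_mkord xpredT (fun j => M (s j.+1) x - M (s j) x)) telescope_sumr// /D /s mul0r.
apply => j; have sj0 : 0 <= s j by rewrite mulr_ge0.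
have -> : s j.+1 = s j + h by rewrite /s -natr1; ring.
have [r' [t' [p1 p2]]] := stationary_polar z sj0 h0.
have [ec es] := congr_polar p2 pD.
by rewrite /polar_charfun -ec -es.
Qed.

(** The characteristic function over a step h is a square root of the known one over 2h, which is
    positive. Hence it is real and never 0; being continuous and equal to 1 at 0, it is the positive
    root. *)
Let polar_half z h a : 0 <= h ->
  (forall y, polar_charfun P (fun x => y * D (2 * h) x) (expR (- (a * `|y| `^ beta))) 0) ->
  polar_charfun P (fun x => z * D h x) (expR (- (a / 2 * `|z| `^ beta))) 0.
Proof.
move=> h0 p2.
have key y : \int[P]_x sin (y * D h x) = 0 /\
    (\int[P]_x cos (y * D h x)) ^+ 2 = expR (- (a * `|y| `^ beta)).
  have [r [t pD]] := polar_charfun_exists P (fun x => y * D h x).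
  have [ec es] := congr_polar (polar_multiple 2 h0 pD) (p2 y).
  have [-> ->] := pD; move: ec es.
  rewrite cos0 sin0 mulr1 mulr0 mulr2n cosD sinD; set E := expR _ => ec es.
  have E0 : 0 < E by exact: expR_gt0.
  (* The imaginary part of the square is 0, so one of the two parts vanishes; were it the real part,
     the square would not be positive. *)
  have : (r * cos t) * (r * sin t) = 0.
    have : 2 * (r * cos t * (r * sin t)) = 0 by rewrite -[RHS]es; ring.
    by move/eqP; rewrite mulf_eq0 pnatr_eq0 /= => /eqP.
  have e2 : (r * cos t) ^+ 2 - (r * sin t) ^+ 2 = E by rewrite -ec; ring.
  move/eqP; rewrite mulf_eq0 => /orP[/eqP h1|/eqP h1]; last first.
    by rewrite h1 expr0n subr0 in e2.
  move: E0; rewrite -e2 h1 expr0n sub0r oppr_gt0 => /lt_geF.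
  by rewrite sqr_ge0.
have C0 : \int[P]_x cos (0 * D h x) = 1.
  by rewrite -[RHS](expectation_cst P); apply: eq_Rintegral => x _; rewrite mul0r cos0.
have Cgt0 := @continuous_nonzero_gt0 R _ (@continuous_expectation_cos _ _ _ P _ (mD h0)).
rewrite /= C0 in Cgt0.
have {}Cgt0 : forall y, 0 < \int[P]_x cos (y * D h x).
  by apply: Cgt0 => // y; rewrite -sqrf_eq0 (key y).2 gt_eqF// expR_gt0.
split; last by rewrite sin0 mulr0 (key z).1.
rewrite cos0 mulr1.
apply/eqP; rewrite -(@eqrXn2 _ 2) ?(ltW (Cgt0 _)) ?expR_ge0// (key z).2.
by rewrite expr2 -expRD; apply/eqP; congr expR; field.
Qed.

Let polar_dyadic z (k : nat) : polar_charfun P (fun x => z * D (2 ^- k) x)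
  (expR (- (c / 2 ^+ k * `|z| `^ beta))) 0.
Proof.
elim: k z => [|k IH] z; first by rewrite !expr0 invr1 mulr1; exact: polar_at1.
rewrite exprS [c / _](_ : _ = c / 2 ^+ k / 2); last by field; rewrite expf_neq0.
have -> : (2 * 2 ^+ k)^-1 = 2 ^- k / 2 :> R by field; rewrite expf_neq0.
apply: polar_half; first by rewrite divr_ge0// invr_ge0 exprn_ge0.
by move=> y; rewrite mulrC divfK.
Qed.

(** The formula holds at dyadic times, and right-continuity of the paths carries it to [h] along
    dyadic numbers decreasing to it. *)
Lemma polar_levy_difference z h : 0 <= h ->
  polar_charfun P (fun x => z * D h x) (expR (- (c * `|z| `^ beta * h))) 0.
Proof.
(* The successor keeps [u k] strictly above [h], as limits from the right require. *)
move=> h0; pose m k := (Num.truncn (2 ^+ k * h)).+1; pose u (k : nat) : R := (m k)%:R * 2 ^- k.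
have p2 k : (0 : R) < 2 ^+ k by rewrite exprn_gt0.
have hu k : h < u k.
  by rewrite /u ltr_pdivlMr// mulrC truncnS_gt.
have uh k : u k <= h + 2 ^- k.
  rewrite /u /m -natr1 mulrDl mul1r lerD2r ler_pdivrMr// mulrC truncn_le//.
  by rewrite mulr_ge0// ltW.
have cu : u k @[k --> \oo] --> h.
  apply: (@squeeze_cvgr _ _ _ _ (fun=> h) (fun k : nat => h + 2 ^- k)).
  - by apply: nearW => k; rewrite (ltW (hu k)) uh.
  - exact: cvg_cst.
  - rewrite -[X in _ --> X]addr0; apply: cvgD; first exact: cvg_cst.
    under eq_fun do rewrite -exprVn.
    by apply: cvg_expr; rewrite ger0_norm ?invr_ge0// invf_lt1// ltr1n.
have pu k : polar_charfun P (fun x => z * D (u k) x) (expR (- (c * `|z| `^ beta * u k))) 0.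
  have k0 : 0 <= 2 ^- k :> R by rewrite invr_ge0 ltW.
  have := polar_multiple (m k) k0 (polar_dyadic z k).
  rewrite mul0rn -expRM_natl; congr polar_charfun; congr expR; rewrite /u.
  by rewrite -mulr_natl; ring.
have u0 k : 0 <= u k by rewrite (le_trans h0)// ltW.
have cD : {ae P, forall x, D (u k) x @[k --> \oo] --> D h x}.
  apply: filterS2 (levy_cadlag levy1) (levy_cadlag levy2) => x [r1 _] [r2 _].
  have c1 := (cvg_at_rightP _ _ _).1 (r1 h h0) u (conj hu cu).
  have c2 := (cvg_at_rightP _ _ _).1 (r2 h h0) u (conj hu cu).
  apply: cvgB; last exact: cvg_cst.
  by apply: cvgD => //; apply: cvgM => //; exact: cvg_cst.
have cE : expR (- (c * `|z| `^ beta * u k)) @[k --> \oo] --> expR (- (c * `|z| `^ beta * h)).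
  apply: (cvg_comp _ expR); last exact: continuous_expR.
  by apply: cvgN; apply: cvgM => //; exact: cvg_cst.
split; rewrite ?cos0 ?sin0 ?mulr1 ?mulr0.
- have h1 : \int[P]_x cos (z * D (u k) x) @[k --> \oo] --> \int[P]_x cos (z * D h x).
    apply: (@cvg_expectation_ae _ _ _ P _ _ 1).
    + by move=> k; apply: measurable_cos; apply: measurable_funM => //; exact: mD.
    + by apply: measurable_cos; apply: measurable_funM => //; exact: mD.
    + apply: filterS cD => x cx; apply: (cvg_comp _ cos); last exact: continuous_cos.
      by apply: cvgM => //; exact: cvg_cst.
    + by move=> k w; exact: norm_cos_le1.
  apply: (cvg_unique _ h1); first exact: Rhausdorff.
  rewrite (_ : (fun k => \int[P]_x cos (z * D (u k) x)) =
    (fun k => expR (- (c * `|z| `^ beta * u k))))//.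
  by apply/funext => k; rewrite (pu k).1 cos0 mulr1.
- have h1 : \int[P]_x sin (z * D (u k) x) @[k --> \oo] --> \int[P]_x sin (z * D h x).
    apply: (@cvg_expectation_ae _ _ _ P _ _ 1).
    + by move=> k; apply: measurable_sin; apply: measurable_funM => //; exact: mD.
    + by apply: measurable_sin; apply: measurable_funM => //; exact: mD.
    + apply: filterS cD => x cx; apply: (cvg_comp _ sin); last exact: continuous_sin.
      by apply: cvgM => //; exact: cvg_cst.
    + by move=> k w; exact: norm_sin_le1.
  apply: (cvg_unique _ h1); first exact: Rhausdorff.
  rewrite (_ : (fun k => \int[P]_x sin (z * D (u k) x)) = cst 0); first exact: cvg_cst.
  by apply/funext => k; rewrite (pu k).2 sin0 mulr0.
Qed.

Lemma polar_levy_increment z u v : 0 <= u -> u <= v ->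
  polar_charfun P (fun x => z * (M v x - M u x)) (expR (- (c * (`|z| `^ beta * (v - u))))) 0.
Proof.
move=> u0 uv; have h0 : 0 <= v - u by rewrite subr_ge0.
have [r [t [p1 p2]]] := stationary_polar z u0 h0.
rewrite [u + _]addrC subrK in p1.
have [ec es] := congr_polar p2 (polar_levy_difference z h0).
by have [e1 e2] := p1; split; rewrite ?e1 ?e2 ?ec ?es mulrA.
Qed.

End levy_difference.

Lemma levy_stable_increments d d' (T : measurableType d) (T' : measurableType d')
    (R : realType) (P' : probability T' R) (pr : {mfun T' >-> T}) (Y1 Y2 : R -> T' -> R)
    (psi : R -> R[i]) (c beta : R) :
  levy_process P' Y1 -> levy_process P' Y2 -> independent_pair_of_base P' pr Y1 Y2 ->
  has_exponent P' (Y1 1) psi -> has_exponent P' (Y2 1) psi ->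
  (forall z, - (2 * complex.Re (psi z)) = c * `|z| `^ beta) ->
  stable_increments P' [set pr @^-1` A | A in measurable] (fun t x => Y1 t x - Y2 t x) c beta.
Proof.
move=> L1 L2 ind e1 e2 he.
have -> : (fun t x => Y1 t x - Y2 t x) = (fun t x => Y1 t x + -1 * Y2 t x).
  by apply/funext => t; apply/funext => x; rewrite mulN1r.
apply: stable_increments_two_processes => //; 
  [exact: (levy_measurable L1)|exact: (levy_measurable L2)|exact: (levy_independent L1)|
   exact: (levy_independent L2)|].
move=> u v z; exact: (polar_levy_increment L1 L2 ind.1 e1 e2 he).
Qed.

(** * Integrals of deterministic functions *)

Lemma uniform_expectation_le (R : realType) (g : R -> R) (K : R) :
  measurable_fun setT g -> (forall v, 0 <= g v) -> (forall v, 0 <= v <= 1 -> g v <= K) ->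
  \int[uniform_prob (@ltr01 R)]_v g v <= K.
Proof.
move=> mg g0 gK; rewrite /Rintegral integral_uniform; last 2 first.
- exact/measurable_EFinP.
- by move=> v; rewrite lee_fin.
rewrite subr0 invr1 mul1e.
have i1 : (\int[lebesgue_measure]_(x in `[0%R, 1%R]) K%:E = K%:E :> \bar R)%E.
  by rewrite integral_cst//= lebesgue_measure_itv/= lte_fin ltr01 sube0 mule1.
have h : (\int[lebesgue_measure]_(x in `[0%R, 1%R]) (g x)%:E <= K%:E)%E.
  rewrite -i1; apply: ge0_le_integral => //.
  - by move=> x _; rewrite lee_fin.
  - by apply/measurable_EFinP; exact: measurable_funTS.
rewrite -lee_fin fineK// ge0_fin_numE; first exact: (le_lt_trans h (ltry _)).
by apply: integral_ge0 => x _; rewrite lee_fin.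
Qed.

Lemma tail_le d (T : measurableType d) (R : realType) (P : probability T R) (V : T -> R)
    (u K : R) : measurable_fun setT V -> 0 < u ->
  (forall v, 0 <= v <= 1 -> 1 - \int[P]_w cos (v * u * V w) <= K) ->
  fine (P [set w | 2 / u <= `|V w|]) <= 2 * K.
Proof.
move=> mV u0 hK; apply: (le_trans (tail_charfun P mV u0)).
rewrite ler_pM2l//; apply: uniform_expectation_le.
- have := @measurable_expectation _ _ (measurableTypeR R) _ R P (fun x : R * T => 1 - cos (x.1 * (u * V x.2))) _
    (fun x => _); apply.
  + apply: measurable_funB => //; apply: measurable_cos; apply: measurable_funM => //.
    by apply: measurable_funM => //; exact: measurableT_comp mV _.
  + by move=> x; rewrite subr_ge0 cos_le1.
- by move=> v; apply: Rintegral_ge0 => w _; rewrite subr_ge0 cos_le1.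
- move=> v v01; apply: (le_trans _ (hK v v01)).
  rewrite le_eqVlt (_ : \int[P]_w _ = 1 - \int[P]_w cos (v * u * V w)) ?eqxx//.
  have mc : measurable_fun setT (fun w => cos (v * u * V w)).
    by apply: measurable_cos; exact: measurable_funM.
  rewrite -[in RHS](expectation_cst P 1) -(@expectationB _ _ _ P _ _ 1 1)//.
  + by apply: eq_Rintegral => w _; rewrite mulrA.
  + by move=> w; rewrite normr1.
  + by move=> w; exact: norm_cos_le1.
Qed.

(** * Step functions and common refinements *)

Section refinement.
Context (R : realType).
Implicit Types (s u c : nat -> R) (g : R -> R).

Lemma partition_monotone v n i j : (forall j, (j < n)%N -> v j <= v j.+1) ->
  (i <= j)%N -> (j <= n)%N -> v i <= v j :> R.
Proof.
move=> dv; elim: j => [|j IHj]; first by rewrite leqn0 => /eqP ->.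
rewrite leq_eqVlt ltnS => /predU1P[->//|ij] jN.
by rewrite (le_trans (IHj ij (ltnW jN)))// dv.
Qed.

Definition step_fun s c m (r : R) : R := \sum_(j < m) c j * (s j < r <= s j.+1)%R%:R.

Lemma step_funE s c m r : (forall j, (j < m)%N -> s j <= s j.+1) -> s 0%N < r <= s m ->
  exists j, [/\ (j < m)%N, s j < r <= s j.+1 & step_fun s c m r = c j].
Proof.
elim: m => [|m IH] ds /andP[s0r rm]; first by move: (lt_le_trans s0r rm); rewrite ltxx.
have ds' j : (j < m)%N -> s j <= s j.+1 by move=> jm; apply: ds; exact: ltnW.
rewrite /step_fun big_ord_recr /=; have [rsm|smr] := leP r (s m).
  have [||j [jm sj e]] := IH; [exact: ds'|by rewrite s0r|].
  by exists j; split => //; [exact: ltnW|rewrite mulr0 addr0 -e].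
exists m; rewrite smr rm; split => //=; rewrite mulr1 big1 ?add0r// => j _.
have sjm : s j.+1 <= s m by apply: (partition_monotone ds').
by rewrite (lt_geF (le_lt_trans sjm smr)) andbF mulr0.
Qed.

Lemma indicator_increments g u N x : (forall i, (i < N)%N -> u i <= u i.+1) ->
  (exists2 k, (k <= N)%N & u k = x) ->
  \sum_(i < N) (u i.+1 <= x)%R%:R * (g (u i.+1) - g (u i)) = g x - g (u 0%N).
Proof.
elim: N => [|N IH] du [k kN ukx].
  by rewrite big_ord0; move: kN ukx; rewrite leqn0 => /eqP -> ->; rewrite subrr.
have du' i : (i < N)%N -> u i <= u i.+1 by move=> iN; apply: du; exact: ltnW.
have hle i j := @partition_monotone u N.+1 i j du.
rewrite big_ord_recr /=; have [xN|xN] := leP (u N.+1) x.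
- have uN1 : u N.+1 = x by apply/le_anti; rewrite xN -ukx hle.
  rewrite -uN1 mul1r (eq_bigr (fun i : 'I_N => g (u i.+1) - g (u i))); last first.
    by move=> i _; rewrite hle ?mul1r// ltnS; exact: ltnW.
  by rewrite -(big_mkord xpredT (fun i => g (u i.+1) - g (u i))) telescope_sumr// addrC subrKA.
- rewrite mul0r addr0 IH//; exists k => //.
  rewrite -ltnS ltn_neqAle kN andbT; apply/eqP => kE.
  by move: xN; rewrite -ukx kE ltxx.
Qed.

(** The indicator of a cell of [s] is a difference of two indicators of half-lines, whose sums
    telescope because the points of [s] occur among those of [u]. Evaluation at the right end point
    suits cells open on the left. *)
Lemma step_sum_refinement g s c m u N : (forall j, (j < m)%N -> s j <= s j.+1) ->
  (forall i, (i < N)%N -> u i <= u i.+1) ->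
  (forall j, (j <= m)%N -> exists2 k, (k <= N)%N & u k = s j) ->
  \sum_(j < m) c j * (g (s j.+1) - g (s j)) =
  \sum_(i < N) step_fun s c m (u i.+1) * (g (u i.+1) - g (u i)).
Proof.
move=> ds du su.
under [RHS]eq_bigr do rewrite mulr_suml; rewrite exchange_big/=; apply: eq_bigr => j _.
transitivity (c j * \sum_(i < N)
    ((u i.+1 <= s j.+1)%R%:R - (u i.+1 <= s j)%R%:R) * (g (u i.+1) - g (u i))).
  under eq_bigr do rewrite mulrBl; rewrite sumrB.
  by rewrite !indicator_increments//; [congr (_ * _); ring|exact/su/ltnW|exact: su].
rewrite mulr_sumr; apply: eq_bigr => i _; rewrite mulrA; congr (_ * _ * _).
have [uj|uj] := leP (u i.+1) (s j); last by rewrite subr0.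
by rewrite (le_trans uj (ds j (ltn_ord j))) subrr.
Qed.

(** All points of both subdivisions, sorted; repeated points only create empty cells. *)
Lemma common_refinement s s' m m' t : (forall j, (j < m)%N -> s j <= s j.+1) ->
  (forall j, (j < m')%N -> s' j <= s' j.+1) -> s 0%N = 0 -> s m = t -> s' 0%N = 0 -> s' m' = t ->
  exists (u : nat -> R) N, [/\ u 0%N = 0, u N = t, forall i, (i < N)%N -> u i <= u i.+1,
    forall j, (j <= m)%N -> exists2 k, (k <= N)%N & u k = s j &
    forall j, (j <= m')%N -> exists2 k, (k <= N)%N & u k = s' j].
Proof.
move=> ds ds' s0 sm s'0 s'm.
pose l := [seq s j | j <- iota 0 m.+1] ++ [seq s' j | j <- iota 0 m'.+1].
pose q := sort <=%R l.
have sz : size q = (m.+1 + m'.+1)%N by rewrite size_sort size_cat !size_map !size_iota.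
pose N := (size q).-1.
have szN : size q = N.+1 by rewrite /N prednK// sz.
have l0t x : x \in l -> 0 <= x <= t.
  rewrite mem_cat => /orP[]/mapP[j]; rewrite mem_iota add0n ltnS => jm ->.
    by rewrite -{1}s0 -sm !(@partition_monotone s m).
  by rewrite -{1}s'0 -s'm !(@partition_monotone s' m').
have mem_s j : (j <= m)%N -> s j \in l.
  by move=> jm; rewrite mem_cat map_f ?orTb// mem_iota add0n ltnS.
have mem_s' j : (j <= m')%N -> s' j \in l.
  by move=> jm; rewrite mem_cat (map_f s') ?orbT// mem_iota add0n ltnS.
have srt : sorted <=%R q by apply: sort_sorted; exact: le_total.
have du i : (i < N)%N -> q`_i <= q`_i.+1.
  by move=> iN; apply: (sortedP 0 srt); rewrite szN ltnS.
have find x : x \in l -> exists2 k, (k <= N)%N & q`_k = x.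
  rewrite -(mem_sort <=%R) -/q => xq; exists (index x q); last exact: nth_index.
  by rewrite -ltnS -szN index_mem.
have inq k : (k <= N)%N -> q`_k \in l.
  by move=> kN; rewrite -(mem_sort <=%R) mem_nth// szN ltnS.
exists (fun i => q`_i), N; split => //.
- apply/le_anti; have /andP[-> _] := l0t _ (inq 0%N isT).
  have [|k kN e] := find 0; first by rewrite -s0 mem_s.
  by have := @partition_monotone (nth 0 q) N 0 k du isT kN; rewrite e => ->.
- apply/le_anti; have /andP[_ ->] := l0t _ (inq N (leqnn _)).
  have [|k kN e] := find t; first by rewrite -sm mem_s.
  by rewrite -e (@partition_monotone (fun i => q`_i) N).
- by move=> j /mem_s/find.
- by move=> j /mem_s'/find.
Qed.

End refinement.

(** * Almost sure convergence and convergence in probability *)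

Section almost_sure_limits.
Context d (T : measurableType d) (R : realType) (P : probability T R).
Implicit Types (J : nat -> T -> R) (I : T -> R).

Lemma fine_probability_le (A B : set T) : measurable A -> measurable B -> A `<=` B ->
  fine (P A) <= fine (P B).
Proof. by move=> mA mB AB; rewrite fine_le// ?fin_num_measure// le_measure// inE. Qed.

Lemma measurable_deviation (V W : T -> R) (e : R) :
  measurable_fun setT V -> measurable_fun setT W ->
  measurable [set w | e <= `|V w - W w|].
Proof.
move=> mV mW; rewrite -[X in measurable X]setTI; apply: measurable_fun_le => //.
by apply: measurableT_comp => //; exact: measurable_funB.
Qed.

Lemma deviation_le (X Y : T -> R) (e : R) : measurable_fun setT X -> measurable_fun setT Y ->
  fine (P [set w | e <= `|X w + Y w|]) <=
  fine (P [set w | e / 2 <= `|X w|]) + fine (P [set w | e / 2 <= `|Y w|]).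
Proof.
move=> mX mY.
have mA (V : T -> R) (a : R) : measurable_fun setT V -> measurable [set w | a <= `|V w|].
  move=> mV; rewrite -[X in measurable X]setTI; apply: measurable_fun_le => //.
  exact: measurableT_comp.
have mX2 := mA _ (e / 2) mX; have mY2 := mA _ (e / 2) mY.
apply: (@le_trans _ _ (fine (P ([set w | e / 2 <= `|X w|] `|` [set w | e / 2 <= `|Y w|])))).
  apply: fine_probability_le; [exact/mA/measurable_funD|exact: measurableU|].
  move=> w /= h; apply: contrapT => /not_orP[/negP + /negP].
  by rewrite -!ltNge => h1 h2; have := ler_normD (X w) (Y w); move: h h1 h2; lra.
rewrite -fineD ?fin_num_measure//.
by apply: fine_le; rewrite ?fin_numD ?fin_num_measure//; [exact: measurableU|exact: measureU2].
Qed.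

Lemma cvg_fine_probability (A : nat -> set T) : (forall n, measurable (A n)) ->
  fine (P (A n)) @[n --> \oo] --> (0 : R) -> (fun n => P (A n)) @ \oo --> 0%E.
Proof.
move=> mA cA; rewrite (_ : (fun n => P (A n)) = (fun n => (fine (P (A n)))%:E)).
  by apply: cvg_EFin => //; exact: nearW.
by apply/funext => n; rewrite fineK// fin_num_measure.
Qed.

(** Borel-Cantelli: almost surely the increments are eventually below [r^n], hence summable. *)
Lemma ae_cvg_of_summable J (A q r : R) : (forall n, measurable_fun setT (J n)) ->
  0 <= A -> 0 <= q < 1 -> 0 <= r < 1 ->
  (forall n, fine (P [set w | r ^+ n <= `|J n.+1 w - J n w|]) <= A * q ^+ n) ->
  {ae P, forall w, cvgn (J ^~ w)}.
Proof.
move=> mJ A0 /andP[q0 q1] /andP[r0 r1] hJ.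
pose F n := [set w | r ^+ n <= `|J n.+1 w - J n w|].
have mF n : measurable (F n) by exact: measurable_deviation.
have sF : (\sum_(0 <= n <oo) P (F n) < +oo)%E.
  apply: (@le_lt_trans _ _ (\sum_(0 <= n <oo) (A * q ^+ n)%:E)%E).
    apply: lee_nneseries => n _; first by [].
    have pF : P (F n) \is a fin_num by exact: fin_num_measure.
    by have := hJ n; rewrite -lee_fin fineK.
  have q1' : `|q| < 1 by rewrite ger0_norm.
  have h := @cvg_geometric_series R A q q1'.
  have -> : (\sum_(0 <= n <oo) (A * q ^+ n)%:E = (A * (1 - q)^-1)%:E)%E.
    apply/cvg_lim => //; rewrite (_ : (fun n => _) = EFin \o series (geometric A q)).
      by apply: cvg_EFin => //; exact: nearW.
    by apply/funext => n; rewrite /= /series/= sumEFin.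
  exact: ltry.
exists (lim_sup_set F); split.
- by apply: bigcap_measurable => // k _; exact: bigcup_measurable.
- exact: lim_sup_set_cvg0.
move=> w ncv; apply: contrapT => nF; apply: ncv.
have [N hN] : exists N, forall n, (N <= n)%N -> `|J n.+1 w - J n w| < r ^+ n.
  apply: contrapT => nN; apply: nF => N _; apply: contrapT => nF; apply: nN.
  exists N => n Nn; rewrite ltNge; apply/negP => Fn; apply: nF; exists n => //.
pose y n := J (n + N)%N w.
suff : cvgn y by move=> cy; apply/cvg_ex; have /cvg_ex[l yl] := cy; exists l; rewrite -(cvg_shiftn N).
have sy : cvgn (series (fun n => y n.+1 - y n)).
  apply: normed_cvg; apply: (@series_le_cvg _ _ (geometric 1 r)) => [n|n|n|].
  - exact: normr_ge0.
  - by rewrite /= mul1r exprn_ge0.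
  - rewrite /= mul1r /y addSn; apply: (le_trans (ltW (hN _ (leq_addl _ _)))).
    by rewrite exprD ler_piMr ?exprn_ge0// exprn_ile1// ltW.
  - by apply: is_cvg_geometric_series; rewrite ger0_norm.
have -> : y = (fun n => y 0%N + series (fun n => y n.+1 - y n) n).
  by apply/funext => n; rewrite /series/= telescope_sumr// addrC subrK.
by apply: is_cvgD => //; exact: is_cvg_cst.
Qed.

(** The upper limit is measurable and defined everywhere, and it is the limit wherever the latter
    exists. *)
Lemma measurable_ae_limit J : (forall n, measurable_fun setT (J n)) ->
  {ae P, forall w, cvgn (J ^~ w)} ->
  exists I, measurable_fun setT I /\ {ae P, forall w, J n w @[n --> \oo] --> I w}.
Proof.
move=> mJ cJ; exists (fun w => fine (limn_esup (fun n => (J n w)%:E))); split.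
- apply: measurableT_comp (@fine_measurable R setT measurableT) _.
  by apply: measurable_fun_limn_esup => n; exact/measurable_EFinP.
- apply: filterS cJ => w cw.
  have cE : (fun n => (J n w)%:E) @ \oo --> (limn (J ^~ w))%:E.
    by apply: cvg_EFin => //; exact: nearW.
  by rewrite (cvg_limn_einf_sup cE).2.
Qed.

Lemma cvg_fine_probability_of_ae J I (e : R) : (forall n, measurable_fun setT (J n)) ->
  measurable_fun setT I -> {ae P, forall w, J n w @[n --> \oo] --> I w} -> 0 < e ->
  fine (P [set w | e <= `|J n w - I w|]) @[n --> \oo] --> (0 : R).
Proof.
move=> mJ mI cJ e0; pose A n := [set w | e <= `|J n w - I w|].
have mA n : measurable (A n) by exact: measurable_deviation.
rewrite -[X in _ --> X](expectation_cst P 0).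
rewrite (_ : (fun n => fine _) = (fun n => \int[P]_w (\1_(A n) w : R))); last first.
  by apply/funext => n; rewrite expectation_indic.
apply: (@cvg_expectation_ae _ _ _ P _ _ 1) => //.
- by move=> n; exact: measurable_indic.
- apply: filterS cJ => w cw; apply: cvg_near_cst.
  move/cvgrPdist_lt : cw => /(_ _ e0); apply: filterS => n h.
  by rewrite indicE memNset//= /A /= => /le_lt_trans /(_ (eq_ind _ (fun x => x < e) h _ (distrC _ _))); rewrite ltxx.
- by move=> n w; rewrite indicE ger0_norm ?ler0n// lern1 leq_b1.
Qed.

(** The integrands differ by at most [e/2] where [J n] and [I] are close and by at most [2K]
    elsewhere. It is applied to [cos] and [sin], with the event of the stable convergence as [E]. *)
Lemma cvg_expectation_probability J I (f : R -> R) (E : set T) (K : R) :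
  (forall n, measurable_fun setT (J n)) -> measurable_fun setT I -> measurable E ->
  measurable_fun setT f -> (forall x, `|f x| <= K) -> (forall x y, `|f x - f y| <= `|x - y|) ->
  (forall e : R, 0 < e -> fine (P [set w | e <= `|J n w - I w|]) @[n --> \oo] --> (0 : R)) ->
  \int[P]_w (f (J n w) * (\1_E w : R)) @[n --> \oo] --> \int[P]_w (f (I w) * (\1_E w : R)).
Proof.
move=> mJ mI mE mf bf lf cJ.
have K0 : 0 <= K by rewrite (le_trans _ (bf 0)).
have mI' := measurable_indic (R := R) mE (D := setT).
have mfE (V : T -> R) : measurable_fun setT V -> measurable_fun setT (fun w => f (V w) * (\1_E w : R)).
  by move=> mV; apply: measurable_funM => //; exact: measurableT_comp.
have bE (x : R) w : `|x| <= K -> `|x * (\1_E w : R)| <= K.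
  by move=> xK; rewrite normrM indicE normr_nat (le_trans _ xK)// ler_piMr// lern1 leq_b1.
apply/cvgrPdist_le => e e0.
pose A n := [set w | e / 2 <= `|J n w - I w|].
have mA n : measurable (A n) by exact: measurable_deviation.
have K2 : 0 < 2 * K + 1 by rewrite ltr_wpDl ?mulr_ge0.
have e2 : 0 < e / 2 by rewrite divr_gt0.
have e3 : 0 < e / 2 / (2 * K + 1) by rewrite divr_gt0.
have /cvgr_le/(_ _ e3) := cJ _ e2; apply: filterS => n hA.
rewrite distrC -(@expectationB _ _ _ P _ _ K K); [|exact: mfE|exact: mfE|by move=> w; exact: bE|by move=> w; exact: bE].
have mAi : measurable_fun setT (\1_(A n) : T -> R) by exact: measurable_indic.
have ub w : `|f (J n w) * (\1_E w : R) - f (I w) * (\1_E w : R)| <=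
    e / 2 + (2 * K + 1) * (\1_(A n) w : R).
  have h1 (x : R) : `|x * (\1_E w : R)| <= `|x|.
    by rewrite normrM ler_piMr// indicE normr_nat lern1 leq_b1.
  rewrite -mulrBl; apply: (le_trans (h1 _)).
  have [wA|wA] := pselect (A n w).
    rewrite indicE mem_set// mulr1 (le_trans (ler_normB _ _))//.
    have := bf (J n w); have := bf (I w); move: e2; lra.
  rewrite indicE memNset// mulr0 addr0; apply: (le_trans (lf _ _)); apply: ltW.
  by rewrite ltNge; apply/negP.
have b1 w : `|f (J n w) * (\1_E w : R) - f (I w) * (\1_E w : R)| <= K + K.
  by rewrite (le_trans (ler_normB _ _))// lerD// bE.
have mD : measurable_fun setT (fun w => f (J n w) * (\1_E w : R) - f (I w) * (\1_E w : R)).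
  by apply: measurable_funB; exact: mfE.
have i1 := bounded_integrable P mD b1.
apply: (le_trans (le_normr_Rintegral _ i1)) => //.
apply: (@le_trans _ _ (\int[P]_w (e / 2 + (2 * K + 1) * (\1_(A n) w : R)))).
  apply: (@ler_expectation _ _ _ P _ _ (K + K) (e / 2 + (2 * K + 1))) => //.
  - exact: measurableT_comp.
  - by apply: measurable_funD => //; exact: measurable_funM.
  - by move=> w; rewrite normr_id.
  - move=> w; rewrite indicE ger0_norm; last by rewrite addr_ge0 ?(ltW e2)// mulr_ge0 ?(ltW K2).
    by rewrite lerD2l ler_piMr ?lern1 ?leq_b1// ltW.
have bI (w : T) : `|\1_(A n) w : R| <= 1 by rewrite indicE normr_nat lern1 leq_b1.
rewrite (@expectationD _ _ _ P _ _ (e / 2) (2 * K + 1)) => //; last 3 first.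
- exact: measurable_funM.
- by move=> w; rewrite ger0_norm// ltW.
- by move=> w; rewrite normrM (ger0_norm (ltW K2)) ler_piMr// ltW.
rewrite expectation_cst (@expectationZl _ _ _ P _ _ 1)// expectation_indic//.
rewrite [leRHS](splitr e) lerD2l mulrC -ler_pdivlMr//.
Qed.

Lemma cvg_deviation_sum (k : nat) (X : 'I_k -> nat -> T -> R) (Y : 'I_k -> T -> R) (z : 'I_k -> R) :
  (forall i n, measurable_fun setT (X i n)) -> (forall i, measurable_fun setT (Y i)) ->
  (forall i (e : R), 0 < e ->
    fine (P [set w | e <= `|X i n w - Y i w|]) @[n --> \oo] --> (0 : R)) ->
  forall e : R, 0 < e ->
    fine (P [set w | e <= `|\sum_i z i * X i n w - \sum_i z i * Y i w|]) @[n --> \oo] --> (0 : R).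
Proof.
move=> mX mY cX.
have mXY i n : measurable_fun setT (fun w => z i * (X i n w - Y i w)).
  by apply: measurable_funM => //; exact: measurable_funB.
have cZ i (e : R) : 0 < e ->
    fine (P [set w | e <= `|z i * (X i n w - Y i w)|]) @[n --> \oo] --> (0 : R).
  move=> e0; have [z0|z0] := eqVneq (z i) 0.
    rewrite (_ : (fun n => _) = cst 0); first exact: cvg_cst.
    apply/funext => n; rewrite (_ : [set w | _] = set0) ?measure0//.
    by apply/seteqP; split => // w /=; rewrite z0 mul0r normr0 leNgt e0.
  have zi0 : 0 < `|z i| by rewrite normr_gt0.
  rewrite (_ : (fun n => _) = (fun n => fine (P [set w | e / `|z i| <= `|X i n w - Y i w|]))).
    exact: cX (divr_gt0 e0 zi0).
  apply/funext => n; congr (fine (P _)).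
  by apply/seteqP; split => w /=; rewrite normrM ler_pdivrMr// mulrC.
suff H (s : seq 'I_k) (e : R) : 0 < e ->
    fine (P [set w | e <= `|\sum_(i <- s) z i * (X i n w - Y i w)|]) @[n --> \oo] --> (0 : R).
  move=> e e0; rewrite (_ : (fun n => _) =
    (fun n => fine (P [set w | e <= `|\sum_i z i * (X i n w - Y i w)|]))); first exact: H.
  apply/funext => n; congr (fine (P _)).
  have eS w : \sum_i z i * X i n w - \sum_i z i * Y i w = \sum_i z i * (X i n w - Y i w).
    by rewrite -sumrB; apply: eq_bigr => i _; rewrite mulrBr.
  by apply/seteqP; split => w /=; rewrite eS.
elim: s e => [|i s IH] e e0.
  rewrite (_ : (fun n => _) = cst 0); first exact: cvg_cst.
  apply/funext => n; rewrite (_ : [set w | _] = set0) ?measure0//.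
  by apply/seteqP; split => // w /=; rewrite big_nil normr0 leNgt e0.
have e2 : 0 < e / 2 by rewrite divr_gt0.
apply: (@squeeze_cvgr _ _ _ _ (fun=> 0) (fun n =>
  fine (P [set w | e / 2 <= `|z i * (X i n w - Y i w)|]) +
  fine (P [set w | e / 2 <= `|\sum_(j <- s) z j * (X j n w - Y j w)|]))).
- apply: nearW => n; rewrite fine_ge0//=.
  have := @deviation_le (fun w => z i * (X i n w - Y i w))
    (fun w => \sum_(j <- s) z j * (X j n w - Y j w)) e (mXY i n) _.
  rewrite (_ : [set w | e <= `|\sum_(j <- i :: s) _|] =
    [set w | e <= `|z i * (X i n w - Y i w) + \sum_(j <- s) z j * (X j n w - Y j w)|]); last first.
    by apply/seteqP; split => w /=; rewrite big_cons.
  by apply; apply: measurable_sum => j; exact: mXY.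
- exact: cvg_cst.
- by rewrite -[X in _ --> X]addr0; apply: cvgD; [exact: cZ|exact: IH].
Qed.

End almost_sure_limits.

(** * Existence of the integral *)

Section stochastic_integral.
Context d (T : measurableType d) (R : realType) (P : probability T R).
Variables (G : set_system T) (M : R -> T -> R) (K beta : R).
Hypothesis sM : stable_increments P G M K beta.
Hypothesis K_ge0 : 0 <= K.
Hypothesis beta_gt0 : 0 < beta.
Variables (f : R -> R) (t : R).
Implicit Types (s c : nat -> R) (m : nat).

Definition subdivision s m : Prop :=
  [/\ s 0%N = 0, s m = t & forall j, (j < m)%N -> s j <= s j.+1].

Definition approximates s c m (e : R) : Prop :=
  forall j r, (j < m)%N -> s j < r <= s j.+1 -> `|c j - f r| <= e.

Lemma subdivision_upto s m : subdivision s m -> partition_upto s m.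
Proof. by case=> s0 _ ds; split => //; rewrite s0. Qed.

Lemma measurable_subdivision_sum s c m : subdivision s m ->
  measurable_fun setT (increment_sum M s c m).
Proof.
by move=> /subdivision_upto; apply: measurable_increment_sum; exact: stable_increments_measurable sM.
Qed.

(** On a common refinement the difference of the two sums is again a sum of weighted increments,
    with weights at most [e]. Its characteristic function at y is at least [exp(- K t (y e)^beta)],
    and [tail_le] turns this into a tail bound. *)
Lemma tail_difference s c m s' c' m' (e delta : R) : 0 <= e -> 0 < delta ->
  subdivision s m -> subdivision s' m' ->
  (forall r, 0 < r <= t -> `|step_fun s c m r - step_fun s' c' m' r| <= e) ->
  fine (P [set w | delta <= `|increment_sum M s c m w - increment_sum M s' c' m' w|]) <=
  2 * (K * t * (2 / delta * e) `^ beta).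
Proof.
move=> e0 d0 ss ss' he; have [s0 sm ds] := ss; have [s'0 s'm ds'] := ss'.
have [u [N [u0 uN du us us']]] := common_refinement ds ds' s0 sm s'0 s'm.
pose h i := step_fun s c m (u i.+1) - step_fun s' c' m' (u i.+1).
have pu : partition_upto u N by split => //; rewrite u0.
have eV : (fun w => increment_sum M s c m w - increment_sum M s' c' m' w) =
    increment_sum M u h N.
  apply/funext => w; rewrite /increment_sum.
  rewrite (step_sum_refinement (fun x => M x w) c ds du us).
  rewrite (step_sum_refinement (fun x => M x w) c' ds' du us') -sumrB.
  by apply: eq_bigr => i _; rewrite -mulrBl.
(* With this frequency the threshold [2/U] of the tail bound is [delta]. *)
pose U := 2 / delta; have U0 : 0 < U by rewrite divr_gt0.
have := @tail_le _ _ _ P (increment_sum M u h N) U (K * t * (U * e) `^ beta) _ U0.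
rewrite /U invf_div mulrCA divff// mulr1 -eV; apply.
  by apply: measurable_funB; exact: measurable_subdivision_sum.
move=> v /andP[v0 v1].
have := (stable_increments_polar sM (fun i => v * U * h i) pu).1.
rewrite cos0 mulr1 => hcos.
rewrite (_ : \int[P]_w _ = \int[P]_w cos (increment_sum M u (fun i => v * U * h i) N w)); last first.
  apply: eq_Rintegral => w _; congr cos.
  have -> := congr1 (fun g => g w) eV.
  by rewrite /increment_sum mulr_sumr; apply: eq_bigr => i _; rewrite !mulrA.
rewrite hcos; set S := \sum_(i < N) _.
have hS : S <= t * (U * e) `^ beta.
  have -> : t = \sum_(i < N) (u i.+1 - u i).
    by rewrite -(big_mkord xpredT (fun i => u i.+1 - u i)) telescope_sumr// uN u0 subr0.
  rewrite mulr_suml; apply: ler_sum => i _; rewrite [leRHS]mulrC.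
  have := du i (ltn_ord i); rewrite le_eqVlt => /predU1P[->|ui]; first by rewrite subrr !mulr0.
  apply: ler_wpM2r; first by rewrite subr_ge0 ltW.
  apply: (@ge0_ler_powR _ _ (ltW beta_gt0)); rewrite ?nnegrE//; first exact: mulr_ge0 (ltW U0) e0.
  rewrite [`|v * U * h i|]normrM [`|v * U|]normrM (ger0_norm v0) (gtr0_norm U0).
  apply: (@le_trans _ _ (1 * U * e)); last by rewrite mul1r.
  apply: ler_pM => //; [by rewrite mulr_ge0 ?(ltW U0)|by rewrite ler_pM2r|].
  apply: he; apply/andP; split.
    by rewrite (le_lt_trans _ ui)// (partition_upto_ge0 pu)// ltnW.
  by rewrite -uN (@partition_monotone _ u N).
have := expR_ge1Dx (- (K * S)) => h1.
apply: (@le_trans _ _ (K * S)); first by move: h1; rewrite -/S; lra.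
by rewrite -mulrA ler_wpM2l.
Qed.

Lemma approximates_step s c m e r : subdivision s m -> approximates s c m e ->
  0 < r <= t -> `|step_fun s c m r - f r| <= e.
Proof.
move=> [s0 sm ds] ha rt; rewrite -s0 -sm in rt.
by have [j [jm sj ->]] := step_funE c ds rt; exact: ha.
Qed.

Lemma tail_approximations s c m s' c' m' (e e' delta : R) : 0 <= e -> 0 <= e' -> 0 < delta ->
  subdivision s m -> subdivision s' m' -> approximates s c m e -> approximates s' c' m' e' ->
  fine (P [set w | delta <= `|increment_sum M s c m w - increment_sum M s' c' m' w|]) <=
  2 * (K * t * (2 / delta * (e + e')) `^ beta).
Proof.
move=> e0 e'0 d0 ss ss' ha ha'; apply: tail_difference => //; first exact: addr_ge0.
move=> r rt; apply: (le_trans (ler_distD (f r) _ _)).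
by rewrite lerD// ?[`|f r - _|]distrC; apply: approximates_step rt.
Qed.

Hypothesis t_ge0 : 0 <= t.
Variable C : R.
Hypothesis C_ge0 : 0 <= C.
Variables (s_ c_ : nat -> nat -> R) (m_ : nat -> nat).
Hypothesis s_subdivision : forall n, subdivision (s_ n) (m_ n).
Hypothesis s_approximates : forall n, approximates (s_ n) (c_ n) (m_ n) (C * 4 ^- n).

Let J n := increment_sum M (s_ n) (c_ n) (m_ n).

Let mJ n : measurable_fun setT (J n).
Proof. exact: measurable_subdivision_sum. Qed.

Let e_ge0 n : 0 <= C * 4 ^- n.
Proof. by rewrite mulr_ge0// invr_ge0 exprn_ge0. Qed.

(** Errors [4^(-n)] against thresholds [2^(-n)] leave probabilities of order [2^(-n beta)], which
    are summable. *)
Let ae_cvgJ : {ae P, forall w, cvgn (J ^~ w)}.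
Proof.
pose q : R := 2^-1 `^ beta; pose A := 2 * (K * t * (4 * C) `^ beta).
have h2 : 0 <= 2^-1 :> R by rewrite invr_ge0.
have h21 : 2^-1 < 1 :> R by rewrite invf_lt1// ltr1n.
have q01 : 0 <= q < 1.
  rewrite powR_ge0/=; have := @gt0_ltr_powR _ _ beta_gt0 2^-1 1.
  by rewrite powR1 !nnegrE; apply.
have A0 : 0 <= A by rewrite !mulr_ge0// powR_ge0.
apply: (@ae_cvg_of_summable _ _ _ P J A q 2^-1) => //; first by rewrite h2.
move=> n.
have hJ : approximates (s_ n.+1) (c_ n.+1) (m_ n.+1) (C * 4 ^- n).
  move=> j r jm sj; apply: (le_trans (s_approximates jm sj)).
  rewrite ler_wpM2l// lef_pV2 ?posrE ?exprn_gt0//.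
  by rewrite ler_weXn2l ?ler1n.
have d0 : 0 < 2^-1 ^+ n :> R by rewrite exprn_gt0// invr_gt0.
have := tail_approximations (e_ge0 n) (e_ge0 n) d0 (s_subdivision n.+1)
  (s_subdivision n) hJ (@s_approximates n).
move=> /le_trans; apply.
rewrite (_ : 2 / 2^-1 ^+ n * _ = 4 * C * 2^-1 ^+ n); last first.
  rewrite !exprVn invrK (_ : 4 = 2 * 2 :> R); last by ring.
  by rewrite exprMn; field; rewrite expf_neq0.
rewrite powRM ?mulr_ge0 ?exprn_ge0// (_ : (2^-1 ^+ n) `^ beta = q ^+ n); last first.
  by rewrite /q -(powR_mulrn n h2) -(powR_mulrn n (powR_ge0 _ _)) -!powRrM mulrC.
by rewrite /A !mulrA.
Qed.

Let cvg_e : C * 4 ^- n @[n --> \oo] --> (0 : R).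
Proof.
rewrite -[X in _ --> X](mulr0 C); apply: cvgM; first exact: cvg_cst.
under eq_fun do rewrite -exprVn.
by apply: cvg_expr; rewrite ger0_norm ?invr_ge0// invf_lt1// ltr1n.
Qed.

(** The limit of one fast sequence of step sums serves for all: any other admissible sequence is
    close to it in probability by [tail_approximations]. *)
Lemma is_stoch_integral_exists : exists I, is_stoch_integral P M f t I.
Proof.
have [I [mI cI]] := measurable_ae_limit mJ ae_cvgJ.
exists I; split => // m s c s0 sm ds ha e e0.
have ss n : subdivision (s n) (m n) by split => //; exact: ds.
pose S n := increment_sum M (s n) (c n) (m n).
have mS n : measurable_fun setT (S n) by exact: measurable_subdivision_sum.
apply: (@cvg_fine_probability _ _ _ P (fun n => [set w | e <= `|S n w - I w|])).
  by move=> n; exact: measurable_deviation.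
have e2 : 0 < e / 2 by rewrite divr_gt0.
have cJI := cvg_fine_probability_of_ae mJ mI cI e2.
apply/cvgrPdist_le => eta eta0.
have eta2 : 0 < eta / 2 by rewrite divr_gt0.
(* [xi] is found by solving the tail bound for the uniform error. *)
have [xi xi0 hxi] : exists2 xi : R, 0 < xi &
    2 * (K * t * (2 / (e / 2) * (xi + xi)) `^ beta) <= eta / 2.
  have Kt : 0 <= 2 * (K * t) by rewrite !mulr_ge0.
  have Kt1 : 0 < 2 * (K * t) + 1 by rewrite ltr_wpDl.
  pose D := eta / 2 / (2 * (K * t) + 1); have D0 : 0 < D by rewrite !divr_gt0.
  pose U := 2 / (e / 2); have U0 : 0 < U by rewrite divr_gt0.
  exists (D `^ beta^-1 / (2 * U)); first by apply: divr_gt0; [exact: powR_gt0|exact: mulr_gt0].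
  rewrite -/U (_ : U * _ = D `^ beta^-1); last by field; rewrite gt_eqF.
  rewrite -powRrM mulVf ?gt_eqF// powRr1 ?(ltW D0)// mulrA /D.
  by rewrite mulrCA ler_piMr ?(ltW eta2)// ler_pdivrMr// mul1r lerDl.
near=> n; rewrite sub0r normrN ger0_norm; last exact: fine_ge0.
rewrite [leRHS](splitr eta).
have := @deviation_le _ _ _ P (fun w => S n w - J n w) (fun w => J n w - I w) e
  (measurable_funB (mS n) (mJ n)) (measurable_funB (mJ n) mI).
rewrite (_ : [set w | e <= `|S n w - J n w + (J n w - I w)|] =
  [set w | e <= `|S n w - I w|]); last first.
  by apply/seteqP; split => w /=; rewrite subrKA.
move=> /le_trans; apply.
apply: lerD; last first.
  near: n; move/cvgrPdist_le : cJI => /(_ _ eta2).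
  apply: filterS => n; rewrite sub0r normrN; exact: le_trans (ler_norm _).
apply: (le_trans _ hxi).
have hn : C * 4 ^- n <= xi.
  near: n; move/cvgrPdist_le : cvg_e => /(_ xi xi0).
  apply: filterS => n; rewrite sub0r normrN; exact: le_trans (ler_norm _).
have hs : approximates (s n) (c n) (m n) xi.
  by near: n; exact: (ha _ xi0).
have hJ : approximates (s_ n) (c_ n) (m_ n) xi.
  by move=> j r jm sj; apply: le_trans hn; exact: s_approximates.
exact: (tail_approximations (ltW xi0) (ltW xi0) e2 (ss n) (s_subdivision n) hs hJ).
Unshelve. all: by end_near. Qed.

End stochastic_integral.

Lemma cos_lipschitz_norm (R : realType) (x y : R) : `|cos x - cos y| <= `|x - y|.
Proof.
wlog xy : x y / x <= y => [h|].
  by have [/h//|/ltW/h] := leP x y; rewrite distrC [leRHS]distrC.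
by rewrite distrC (le_trans (cos_lipschitz xy))// distrC ler_norm.
Qed.

Lemma sin_lipschitz_norm (R : realType) (x y : R) : `|sin x - sin y| <= `|x - y|.
Proof.
rewrite -!cosBpihalf (_ : x - y = (x - pi / 2) - (y - pi / 2)); last by ring.
exact: cos_lipschitz_norm.
Qed.

Section linear_integral.
Context d (T : measurableType d) (R : realType) (P : probability T R).
Variables (G : set_system T) (M : R -> T -> R) (K beta : R).
Hypothesis sM : stable_increments P G M K beta.
Hypothesis K_ge0 : 0 <= K.
Hypothesis beta_gt0 : 0 < beta.

Section time_grid.
Variable t : R.
Hypothesis t_ge0 : 0 <= t.

Let N n := Num.truncn (n%:R * t).
(** The points j/n up to j = [nt], then t itself. The weight of the cell from j/n to (j+1)/n is
    [([nt] - (j+1))^+ / n], as in [ramp n j.+1]; it is 0 on the last, shorter cell. *)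
Definition time_grid (n j : nat) : R := if (j <= N n)%N then j%:R / n%:R else t.
Definition time_grid_weight (n j : nat) : R := (N n - j.+1)%N%:R / n%:R.

Let N_le n : (N n)%:R <= n%:R * t.
Proof. by rewrite truncn_le// mulr_ge0. Qed.

Let N_gt n : n%:R * t < (N n)%:R + 1.
Proof. by rewrite natr1 truncnS_gt. Qed.

Lemma time_grid_subdivision n : subdivision t (time_grid n) (N n).+1.
Proof.
split; first by rewrite /time_grid leq0n mul0r.
  by rewrite /time_grid ltnn.
move=> j; rewrite ltnS /time_grid => jN; rewrite jN; case: leqP => [Nj|_]; last by rewrite ler_wpM2r ?invr_ge0// ler_nat.
case: n jN Nj => [|n] jN Nj; first by rewrite invr0 mulr0.
rewrite ler_pdivrMr// mulrC; apply: (le_trans _ (N_le _)).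
by rewrite ler_nat.
Qed.

Lemma time_grid_approximates n : (0 < n)%N ->
  approximates (fun r => t - r) (time_grid n) (time_grid_weight n) (N n).+1 (2 / n%:R).
Proof.
move=> n0 j r jN; have n0' : 0 < n%:R :> R by rewrite ltr0n.
rewrite ltnS in jN; rewrite /time_grid jN /time_grid_weight => /andP[jr].
rewrite ltr_pdivrMr// in jr.
have hN := N_le n; have hN' := N_gt n.
case: leqP => [Nj rt|jN' rj].
  have jE : j = N n by apply/eqP; rewrite eqn_leq jN.
  rewrite (_ : (N n - j.+1)%N = 0%N); last by apply/eqP; rewrite subn_eq0 leqW.
  rewrite mul0r sub0r normrN ger0_norm ?subr_ge0// ler_pdivlMr//.
  by rewrite jE in jr; nra.
rewrite ler_pdivlMr// -natr1 in rj; rewrite natrB// -natr1.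
rewrite (_ : _ - (t - r) = ((N n)%:R - (j%:R + 1) - n%:R * t + r * n%:R) / n%:R); last first.
  by field; rewrite gt_eqF.
rewrite normrM [`|n%:R^-1|]ger0_norm ?invr_ge0// ler_wpM2r ?invr_ge0//.
by rewrite ler_norml; apply/andP; split; lra.
Qed.

Lemma stoch_integral_linear :
  is_stoch_integral P M (fun r => t - r) t (stoch_integral P M (fun r => t - r) t).
Proof.
apply: (@xgetPex _ (fun=> 0) [set I | is_stoch_integral P M (fun r => t - r) t I]).
(* The existence result is stated for errors [C 4^(-n)], which the grids with [4^n] points per unit
   of time provide. *)
have h n : approximates (fun r => t - r) (time_grid (4 ^ n)) (time_grid_weight (4 ^ n)) (N (4 ^ n)).+1
    (2 * 4 ^- n).
  by rewrite -natrX; apply: time_grid_approximates; rewrite expn_gt0.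
have [I hI] := is_stoch_integral_exists sM K_ge0 beta_gt0 t_ge0 (ler0n R 2)
   (fun n => time_grid_subdivision (4 ^ n)) h.
by exists I.
Qed.

Lemma cvg_grid_sum (e : R) : 0 < e ->
  fine (P [set w | e <= `|increment_sum M (time_grid n) (time_grid_weight n) (N n).+1 w -
    stoch_integral P M (fun r => t - r) t w|]) @[n --> \oo] --> (0 : R).
Proof.
move=> e0; have [_ h] := stoch_integral_linear.
have := h (fun n => (N n).+1) time_grid time_grid_weight (fun n => _) (fun n => _) (fun n => _) _ e e0.
move=> h'; apply: (@fine_cvg _ _ _ _ _ 0); apply: h' => [n|n|n|eta eta0].
- by have [] := time_grid_subdivision n.
- by have [] := time_grid_subdivision n.
- by have [_ _] := time_grid_subdivision n.
near=> n; move=> j r jN sj; have n0 : (0 < n)%N by near: n; exact: nbhs_infty_gt.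
apply: (le_trans (time_grid_approximates n0 jN sj)).
rewrite ler_pdivrMr ?ltr0n// mulrC -ler_pdivrMr//; near: n; exact: nbhs_infty_ger.
Unshelve. all: by end_near. Qed.

End time_grid.

Section law.
Variables (k : nat) (t : 'I_k -> R) (z : 'I_k -> R).
Hypothesis t_ge0 : forall i, 0 <= t i.

Let I i := stoch_integral P M (fun r => t i - r) (t i).

Lemma measurable_stoch_integral_linear i : measurable_fun setT (I i).
Proof. by have [] := stoch_integral_linear (t_ge0 i). Qed.

Let S n i := increment_sum M (time_grid (t i) n) (time_grid_weight (t i) n) (Num.truncn (n%:R * t i)).+1.

Let mS n i : measurable_fun setT (S n i).
Proof. exact: (measurable_subdivision_sum sM _ (time_grid_subdivision (t_ge0 i) n)). Qed.

Let V n w := \sum_i z i * S n i w.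

(** The weights vanish beyond [[n t_i]], so that the sums for the different [t_i] all extend to the
    common horizon and merge into one sum over the uniform grid, with the ramps as weights. *)
Let VE n : V n = increment_sum M (fun j => j%:R / n%:R) (fun j => ramp t z n j.+1) (horizon t n).
Proof.
apply/funext => w; rewrite /V /increment_sum.
pose D j := M (j.+1%:R / n%:R) w - M (j%:R / n%:R) w.
transitivity (\sum_i z i * \sum_(j < horizon t n) (steps t n i - j.+1)%N%:R / n%:R * D j).
  apply: eq_bigr => i _; congr (_ * _); rewrite /S /increment_sum.
  rewrite big_ord_recr /= [X in _ + X * _](_ : _ = 0) ?mul0r ?addr0; last first.
    by rewrite /time_grid_weight (_ : (_ - _)%N = 0%N) ?mul0r//; apply/eqP; rewrite subn_eq0.
  rewrite -[RHS](big_mkord xpredT (fun j => (steps t n i - j.+1)%N%:R / n%:R * D j)).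
  rewrite (big_cat_nat (n := steps t n i)) ?steps_horizon//=.
  rewrite [X in _ = _ + X]big_nat_cond [X in _ = _ + X]big1 ?addr0; last first.
    move=> j /andP[/andP[Nj _] _]; rewrite (_ : (_ - _)%N = 0%N) ?mul0r//.
    by apply/eqP; rewrite subn_eq0 leqW.
  rewrite big_mkord; apply: eq_bigr => j _; rewrite /time_grid_weight /time_grid.
  by rewrite (ltnW (ltn_ord j)) ltn_ord.
under eq_bigr do rewrite mulr_sumr; rewrite exchange_big/=; apply: eq_bigr => j _.
rewrite /ramp mulr_sumr mulr_suml; apply: eq_bigr => i _; rewrite /D.
by rewrite [n%:R^-1 * _]mulrC !mulrA.
Qed.

Let uniform_upto n : partition_upto (fun j => j%:R / n%:R : R) (horizon t n).
Proof.
split => [|j _]; first by rewrite mul0r.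
by rewrite ler_wpM2r ?invr_ge0// ler_nat.
Qed.

(** The characteristic function of the step sum is known exactly, and the sum tends to the integral
    in probability; the factor P(E) comes from the independence of M and the base sigma-field. *)
Lemma stoch_integral_linear_charfun E : measurable E -> G E ->
  fine (P E) * expR (- (K * (n%:R^-1 * \sum_(j < horizon t n) `|ramp t z n j.+1| `^ beta)))
    @[n --> \oo] --> \int[P]_w (cos (\sum_i z i * I i w) * (\1_E w : R)) /\
  \int[P]_w (sin (\sum_i z i * I i w) * (\1_E w : R)) = 0.
Proof.
move=> mE GE.
have mV n : measurable_fun setT (V n).
  by apply: measurable_sum => i; exact: measurable_funM.
have mI : measurable_fun setT (fun w => \sum_i z i * I i w).
  apply: measurable_sum => i; apply: measurable_funM => //.
  exact: measurable_stoch_integral_linear.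
have cV := cvg_deviation_sum z (fun i n => mS n i) measurable_stoch_integral_linear
  (fun i => @cvg_grid_sum (t i) (t_ge0 i)).
have cC := cvg_expectation_probability mV mI mE
  (continuous_measurable_fun (@continuous_cos R)) (@norm_cos_le1 R) (@cos_lipschitz_norm R) cV.
have cS := cvg_expectation_probability mV mI mE
  (continuous_measurable_fun (@continuous_sin R)) (@norm_sin_le1 R) (@sin_lipschitz_norm R) cV.
have [hc hs] : (forall n, \int[P]_w (cos (V n w) * (\1_E w : R)) = fine (P E) *
    expR (- (K * (n%:R^-1 * \sum_(j < horizon t n) `|ramp t z n j.+1| `^ beta)))) /\
    (forall n, \int[P]_w (sin (V n w) * (\1_E w : R)) = 0).
  suff H n : \int[P]_w (cos (V n w) * (\1_E w : R)) = fine (P E) *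
    expR (- (K * (n%:R^-1 * \sum_(j < horizon t n) `|ramp t z n j.+1| `^ beta))) /\
    \int[P]_w (sin (V n w) * (\1_E w : R)) = 0.
    by split => n; have [] := H n.
  have [h1 h2] := stable_increments_independent sM (fun j => ramp t z n j.+1) (uniform_upto n) GE.
  have [p1 p2] := stable_increments_polar sM (fun j => ramp t z n j.+1) (uniform_upto n).
  rewrite VE h1 h2 p1 p2 cos0 sin0 !mulr0 mulr1; split => //.
  do 4 congr (_ _); rewrite mulr_sumr; apply: eq_bigr => j _.
  by rewrite -mulrBl -natr1 addrC addKr mul1r mulrC.
split; first by move: cC; rewrite (eq_cvg _ _ hc).
have {}hs : (fun n => \int[P]_w (sin (V n w) * (\1_E w : R))) = cst 0 by exact/funext.
by rewrite hs in cS; apply: (cvg_unique _ cS); [exact: Rhausdorff|exact: cvg_cst].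
Qed.

End law.

End linear_integral.

(** * Stable convergence *)

Section conditional_expectation.
Context d (T : measurableType d) (R : realType) (P : probability T R).
Variables (E : set T) (mE : measurable E).
Hypothesis PE_gt0 : (0 < P E)%E.

Let PE_lty : (P E < +oo)%E.
Proof. exact: (le_lt_trans (probability_le1 P mE) (ltry _)). Qed.

Let pE : 0 < fine (P E).
Proof. by rewrite fine_gt0// PE_gt0. Qed.

Let cond_probE A : measurable A -> cond_prob P mE A = (P (A `&` E) * (fine (P E))^-1%:E)%E.
Proof.
move=> mA; rewrite -[LHS]/((if (P (setT `&` E) == 0%E) || (P (setT `&` E) == +oo%E)
  then fun U => P U else fun U => P (U `&` E) * (fine (P (setT `&` E)))^-1%:E)%E A) setTI.
by rewrite (gt_eqF PE_gt0) (lt_eqF PE_lty).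
Qed.

(** The complement of [E] is negligible for the conditional law, which on [E] is a multiple of
    [P]. *)
Let ge0_cond_expectation (f : T -> R) (K : R) : measurable_fun setT f -> (forall w, 0 <= f w <= K) ->
  \int[cond_prob P mE]_w f w = (fine (P E))^-1 * \int[P]_w (f w * (\1_E w : R)).
Proof.
move=> mf bf.
have bf' w : `|f w| <= K by have /andP[f0 fK] := bf w; rewrite ger0_norm.
have mEc : measurable (~` E) by exact: measurableC.
have pi0 : 0 <= (fine (P E))^-1 by rewrite invr_ge0 ltW.
rewrite /Rintegral (@negligible_integral _ _ _ _ setT (~` E)) //; last 2 first.
- exact: (@bounded_integrable _ _ _ (cond_prob P mE) _ _ mf bf').
- by apply: (etrans (cond_probE mEc)); rewrite setICl measure0 mul0e.
rewrite setDE setTI setCK.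
rewrite (@eq_measure_integral _ _ _ _ (mscale (NngNum pi0) P)); last first.
  by move=> A mA AE; apply: (etrans (cond_probE mA)); rewrite setIidl// /mscale/= muleC.
rewrite ge0_integral_mscale//; last 2 first.
- by apply/measurable_EFinP; exact: measurable_funTS.
- by move=> w _; rewrite lee_fin; have /andP[] := bf w.
have i1 := bounded_integrable P mf bf'.
rewrite fineM//=; last first.
  by apply: integrable_fin_num => //; exact: (integrableS measurableT).
congr (_ * _); rewrite integral_mkcond; congr fine; apply: eq_integral => w _.
by rewrite patchE indicE; case: ifP => _; rewrite ?mulr1 ?mulr0.
Qed.

(** Adding [K] reduces to a non-negative function. *)
Lemma cond_expectation (f : T -> R) (K : R) : measurable_fun setT f -> (forall w, `|f w| <= K) ->
  \int[cond_prob P mE]_w f w = (fine (P E))^-1 * \int[P]_w (f w * (\1_E w : R)).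
Proof.
move=> mf bf.
have m1 : measurable_fun setT (\1_E : T -> R) by exact: measurable_indic.
have K0 : 0 <= K by rewrite (le_trans _ (bf point)).
have mfK : measurable_fun setT (fun w => f w + K) by exact: measurable_funD.
have bfK w : 0 <= f w + K <= K + K.
  have := bf w; rewrite ler_norml => /andP[h1 h2].
  by rewrite lerD2r h2 andbT -lerBlDr sub0r.
have bK (w : T) : 0 <= cst K w <= K by rewrite K0 lexx.
have bE (x : R) w : `|x * (\1_E w : R)| <= `|x|.
  by rewrite normrM ler_piMr// indicE normr_nat lern1 leq_b1.
have bfK' w : `|f w + K| <= K + K by have /andP[h0 h1] := bfK w; rewrite ger0_norm.
have bcK (w : T) : `|cst K w : R| <= K by rewrite ger0_norm.
transitivity (\int[cond_prob P mE]_w ((f w + K) - cst K w)).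
  by apply: eq_Rintegral => w _; rewrite addrK.
rewrite (expectationB (cond_prob P mE) mfK (measurable_cst K) bfK' bcK).
rewrite (ge0_cond_expectation mfK bfK) (ge0_cond_expectation (measurable_cst K) bK).
rewrite -mulrBr -(@expectationB _ _ _ P _ _ (K + K) K).
- by congr (_ * _); apply: eq_Rintegral => w _; rewrite -mulrBl addrK.
- exact: measurable_funM.
- exact: measurable_funM.
- by move=> w; exact: le_trans (bE _ _) (bfK' w).
- by move=> w; exact: le_trans (bE _ _) (bcK w).
Qed.

End conditional_expectation.

Section stable_convergence.
Context d d' (T : measurableType d) (T' : measurableType d') (R : realType).
Context (P : probability T R) (P' : probability T' R) (pr : {mfun T' >-> T}).
Hypothesis ext : prob_extension P P' pr.

(** After division by P(E), which equals the probability of the preimage of E on the extension, this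
    is the continuity theorem for the conditional laws. *)
Lemma stable_cvg_charfun k (xi : nat -> T -> 'rV[R]_k) (zeta : T' -> 'rV[R]_k) :
  (forall n j, measurable_fun setT (fun w => xi n w 0 j)) ->
  (forall j, measurable_fun setT (fun w => zeta w 0 j)) ->
  (forall (z : 'I_k -> R) (E : set T), measurable E ->
    \int[P]_w (cos (\sum_j z j * xi n w 0 j) * (\1_E w : R)) @[n --> \oo] -->
      \int[P']_w (cos (\sum_j z j * zeta w 0 j) * (\1_(pr @^-1` E) w : R)) /\
    \int[P]_w (sin (\sum_j z j * xi n w 0 j) * (\1_E w : R)) @[n --> \oo] -->
      \int[P']_w (sin (\sum_j z j * zeta w 0 j) * (\1_(pr @^-1` E) w : R))) ->
  stable_cvg measurable P xi P' pr zeta.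
Proof.
move=> mxi mzeta h E mE _ PE0.
have PE0' : (0 < P' (pr @^-1` E))%E by rewrite ext.
have mX (z : 'I_k -> R) n : measurable_fun setT (fun w => \sum_j z j * xi n w 0 j).
  by apply: measurable_sum => j; exact: measurable_funM.
have mZ (z : 'I_k -> R) : measurable_fun setT (fun w => \sum_j z j * zeta w 0 j).
  by apply: measurable_sum => j; exact: measurable_funM.
have bc (x : R) := norm_cos_le1 x; have bs (x : R) := norm_sin_le1 x.
apply: levy_continuity => // z; have [hc hs] := h z E mE.
- rewrite (cond_expectation _ PE0' (measurable_cos (mZ z)) (fun w => bc _)).
  rewrite (_ : (fun n => _) = (fun n => (fine (P E))^-1 *
      \int[P]_w (cos (\sum_j z j * xi n w 0 j) * (\1_E w : R)))); last first.
    by apply/funext => n; rewrite (cond_expectation _ PE0 (measurable_cos (mX z n)) (fun w => bc _)).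
  by rewrite ext//; apply: cvgM => //; exact: cvg_cst.
- rewrite (cond_expectation _ PE0' (measurable_sin (mZ z)) (fun w => bs _)).
  rewrite (_ : (fun n => _) = (fun n => (fine (P E))^-1 *
      \int[P]_w (sin (\sum_j z j * xi n w 0 j) * (\1_E w : R)))); last first.
    by apply/funext => n; rewrite (cond_expectation _ PE0 (measurable_sin (mX z n)) (fun w => bs _)).
  by rewrite ext//; apply: cvgM => //; exact: cvg_cst.
Qed.

End stable_convergence.

Section trawl_convergence.
Context (R : realType) d (T : measurableType d) (P : probability T R).
Context (gamma b : R) (nu : {measure set R -> \bar R}) (nu_levy : levy_measure nu).
Context (L : set (R * R) -> T -> R) (L_basis : levy_basis P gamma b nu L).
Context (a : R -> R) (a_trawl : trawl_function a).
Context (Delta : nat -> R) (Delta_gt0 : forall n, 0 < Delta n)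
  (nDelta_cvg0 : n%:R * Delta n @[n --> \oo] --> (0 : R)).
Context (beta C0 : R) (beta_gt0 : 0 < beta) (C0_ge0 : 0 <= C0)
  (reg : regular_exponent (psi_re gamma b nu) (psi_im gamma b nu) beta C0).
Context (s : nat -> R) (s_gt0 : forall n, (0 < n)%N -> 0 < s n)
  (s_powR : forall n, s n `^ beta = n%:R * Delta n).
Context d' (T' : measurableType d') (P' : probability T' R) (pr : {mfun T' >-> T}).
Hypothesis ext : prob_extension P P' pr.
Variables (M : R -> T' -> R) (K sigma : R).
Hypothesis sM : stable_increments P' [set pr @^-1` A | A in measurable] M K beta.
Hypothesis K_ge0 : 0 <= K.
Hypothesis matching : K * `|sigma| `^ beta = 2 * a 0 * C0.

(** [sigma] is absorbed into the coefficients [z i], hence multiplies the ramps, and [|sigma|^beta]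
    comes out of the sum; [matching] then makes the exponents on both sides equal for every n,
    before any limit. *)
Theorem trawl_stable_fd_cvg :
  stable_fd_cvg (@measurable d T) P
    (fun n t w => (s n)^-1 * Zproc P (trawl_process L a) Delta n t w) P' pr
    (fun t w => sigma * stoch_integral P' M (fun r => t - r) t w).
Proof.
move=> k t t0.
have mI i := measurable_stoch_integral_linear sM K_ge0 beta_gt0 t0 i.
apply: stable_cvg_charfun => //.
- move=> n j; rewrite (_ : (fun w => _) =
      trawl_functional P L a Delta s t (fun i => (i == j)%:R) n).
    exact: (measurable_trawl_functional L_basis a_trawl).
  apply/funext => w; rewrite mxE /trawl_functional (bigD1 j)//= eqxx mul1r big1 ?addr0//.
  by move=> i /negbTE ->; rewrite mul0r.
- move=> j; rewrite (_ : (fun w => _) =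
      (fun w => sigma * stoch_integral P' M (fun r => t j - r) (t j) w)).
    exact: measurable_funM.
  by apply/funext => w; rewrite mxE.
move=> z E mE.
have [hc hs] := trawl_functional_charfun nu_levy L_basis a_trawl Delta_gt0 nDelta_cvg0
  beta_gt0 reg s_gt0 s_powR z t0 C0_ge0 mE.
have mE' : measurable (pr @^-1` E) by exact: measurable_funPTI.
have GE : [set pr @^-1` A | A in measurable] (pr @^-1` E) by exists E.
have [hc' hs'] := stoch_integral_linear_charfun sM K_ge0 beta_gt0 (fun i => z i * sigma) t0 mE' GE.
have eX n w : \sum_j z j * (\row_i ((s n)^-1 *
    Zproc P (trawl_process L a) Delta n (t i) w)) 0 j = trawl_functional P L a Delta s t z n w.
  by apply: eq_bigr => j _; rewrite mxE.
have eZ w : \sum_j z j * (\row_i (sigma * stoch_integral P' M (fun r => t i - r) (t i) w)) 0 j =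
    \sum_i z i * sigma * stoch_integral P' M (fun r => t i - r) (t i) w.
  by apply: eq_bigr => j _; rewrite mxE mulrA.
have main n : \int[P]_w (cos (trawl_functional P L a Delta s t z n w) * (\1_E w : R)) =
    (\int[P]_w (cos (trawl_functional P L a Delta s t z n w) * (\1_E w : R)) -
      fine (P E) * expR (- (2 * a 0 * C0 *
      (n%:R^-1 * \sum_(j < horizon t n) `|ramp t z n j.+1| `^ beta)))) +
      fine (P' (pr @^-1` E)) * expR (- (K * (n%:R^-1 *
        \sum_(j < horizon t n) `|ramp t (fun i => z i * sigma) n j.+1| `^ beta))).
  rewrite ext// -matching.
  rewrite (_ : K * `|sigma| `^ beta * _ = K * (n%:R^-1 *
      \sum_(j < horizon t n) `|ramp t (fun i => z i * sigma) n j.+1| `^ beta)).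
    by rewrite subrK.
  rewrite -mulrA; congr (_ * _); rewrite mulrCA; congr (_ * _).
  rewrite mulr_sumr; apply: eq_bigr => j _.
  rewrite -powRM//; congr (_ `^ _); rewrite -normrM; congr `|_|.
  by rewrite /ramp mulrCA; congr (_ * _); rewrite mulr_sumr; apply: eq_bigr => i _; ring.
split.
- rewrite (eq_Rintegral _ (fun w _ => congr1 (fun x => cos x * (\1_(pr @^-1` E) w : R)) (eZ w))).
  rewrite -[X in _ --> X]add0r; apply: cvg_trans (cvgD hc hc').
  apply: near_eq_cvg; apply: nearW => n; rewrite (eq_Rintegral _ (fun w _ =>
    congr1 (fun x => cos x * (\1_E w : R)) (eX n w))).
  by rewrite [RHS]main.
- rewrite (eq_Rintegral _ (fun w _ => congr1 (fun x => sin x * (\1_(pr @^-1` E) w : R)) (eZ w))).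
  rewrite hs'; apply: cvg_trans hs.
  apply: near_eq_cvg; apply: nearW => n; exact: (eq_Rintegral _ (fun w _ =>
    congr1 (fun x => sin x * (\1_E w : R)) (esym (eX n w)))).
Qed.

End trawl_convergence.

(** Read off from the integrals that converge to it, since for [beta > 1] the formula is a product
    with two negative factors. *)
Lemma one_sub_cos_constant_ge0 (R : realType) (beta : R) : 0 < beta < 2 ->
  0 <= one_sub_cos_constant beta.
Proof.
move=> b02; have h := cvg_one_sub_cos_integral b02.
rewrite -(cvg_lim (@Rhausdorff R) h); apply: limr_ge; first by apply/cvg_ex; eexists; exact: h.
apply: nearW => m; apply: Rintegral_ge0 => y _.
by rewrite mulr_ge0 ?powR_ge0// subr_ge0 cos_le1.
Qed.

(** The asymmetry of the stable law enters the imaginary part only. For [beta = 1] the two constants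
    agree because [2 Kp = Kp + Km]. The leading 2 accounts for the difference of two copies. *)
Lemma stable_exponent_re (R : realType) (beta Kp Km c g z : R) : beta != 0 ->
  (beta = 1 -> Kp = Km) ->
  - (2 * complex.Re (stable_exponent beta (beta * c * Kp) (beta * c * Km) g z)) =
  2 * c * (beta * (Kp + Km) * one_sub_cos_constant beta) * `|z| `^ beta.
Proof.
move=> b0 hb1; rewrite /stable_exponent /one_sub_cos_constant.
have [b1|b1] := eqVneq beta 1; last by rewrite /=; ring.
by rewrite (hb1 b1) b1 powRr1//=; field.
Qed.

Theorem theorem1 (R : realType)
  (d : measure_display) (T : measurableType d) (P : probability T R)
  (P_complete : measure_is_complete P)
  (gamma b : R) (nu : {measure set R -> \bar R})
  (b_ge0 : 0 <= b) (nu_levy : levy_measure nu)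
  (L : set (R * R) -> T -> R) (L_basis : levy_basis P gamma b nu L)
  (dS : measure_display) (TS : measurableType dS) (PS : probability TS R)
  (seed : {RV PS >-> R})
  (seed_exponent : has_exponent PS seed (levy_exponent gamma b nu))
  (seed_integrable : PS.-integrable setT (EFin \o seed))
  (a : R -> R) (a_trawl : trawl_function a) (a_C1 : C1_near0 a)
  (Delta : nat -> R)
  (Delta_gt0 : forall n, 0 < Delta n)
  (Delta_noninc : forall n, Delta n.+1 <= Delta n)
  (Delta_cvg0 : Delta n @[n --> \oo] --> (0 : R))
  (nDelta_cvg0 : n%:R * Delta n @[n --> \oo] --> (0 : R)) :
  (0 < b ->
   forall (sigma : R), sigma ^+ 2 = b ^+ 2 * a 0 ->
   forall (d' : measure_display) (T' : measurableType d')
     (P' : probability T' R) (pr : {mfun T' >-> T}) (B1 B2 : R -> T' -> R),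
   prob_extension P P' pr ->
   brownian_motion P' B1 -> brownian_motion P' B2 ->
   independent_pair_of_base P' pr B1 B2 ->
   stable_fd_cvg (@measurable d T) P
     (fun n t w => (Num.sqrt (n%:R * Delta n))^-1
                   * Zproc P (trawl_process L a) Delta n t w)
     P' pr
     (fun t w => sigma
                 * stoch_integral P' (fun r w' => B1 r w' + B2 r w')
                     (fun r => t - r) t w))
  /\
  (b = 0 ->
   forall (beta Kp Km : R), 0 < beta < 2 ->
   0 <= Kp -> 0 <= Km -> 0 < Kp + Km ->
   tails_regular nu beta Kp Km ->
   (beta = 1 -> Kp = Km /\ pv_exists nu) ->
   forall (d' : measure_display) (T' : measurableType d')
     (P' : probability T' R) (pr : {mfun T' >-> T}) (Y1 Y2 : R -> T' -> R),
   prob_extension P P' pr ->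
   levy_process P' Y1 -> levy_process P' Y2 ->
   independent_pair_of_base P' pr Y1 Y2 ->
   let rho := beta * a 0 in
   let tgamma := gamma + pv nu in
   has_exponent P' (Y1 1) (stable_exponent beta (rho * Kp) (rho * Km) tgamma) ->
   has_exponent P' (Y2 1) (stable_exponent beta (rho * Kp) (rho * Km) tgamma) ->
   stable_fd_cvg (@measurable d T) P
     (fun n t w => ((n%:R * Delta n) `^ beta^-1)^-1
                   * Zproc P (trawl_process L a) Delta n t w)
     P' pr
     (fun t w => stoch_integral P' (fun s w' => Y1 s w' - Y2 s w')
                   (fun s => t - s) t w)).
Proof.
have nD_ge0 n : 0 <= n%:R * Delta n by rewrite mulr_ge0// ltW.
have nD_gt0 n : (0 < n)%N -> 0 < n%:R * Delta n by move=> n0; rewrite mulr_gt0// ltr0n.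
have a0 : 0 <= a 0 by exact: trawl_ge0.
split.
- move=> _ sigma sigmaE d' T' P' pr B1 B2 ext BM1 BM2 ind.
  (* Index 2, [C0 = b^2/2] and [K = 1]: the matching condition is [sigma^2 = b^2 a(0)]. *)
  apply: (trawl_stable_fd_cvg nu_levy L_basis a_trawl Delta_gt0 nDelta_cvg0 _ _
    (gaussian_regular_exponent gamma b nu_levy) _ _ ext
    (brownian_stable_increments BM1 BM2 ind)) => //.
  + by rewrite divr_ge0// sqr_ge0.
  + by move=> n n0; rewrite sqrtr_gt0 nD_gt0.
  + by move=> n; rewrite powR_mulrn// sqr_sqrtr.
  + by rewrite powR_mulrn// real_normK ?num_real// sigmaE; field.
- move=> b0 beta Kp Km beta02 Kp0 Km0 _ tails beta1 d' T' P' pr Y1 Y2 ext L1 L2 ind rho tgamma e1 e2.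
  have beta_gt0 : 0 < beta by case/andP: beta02.
  have C0 : 0 <= beta * (Kp + Km) * one_sub_cos_constant beta.
    by rewrite mulr_ge0 ?one_sub_cos_constant_ge0// mulr_ge0 ?addr_ge0// ltW.
  (* With [c = a 0] the constant of [Y1 - Y2] is [2 a(0) C0], so that the matching condition holds
     with [sigma = 1]. *)
  have sI := levy_stable_increments L1 L2 ind e1 e2
    (fun z => stable_exponent_re (a 0) tgamma z (lt0r_neq0 beta_gt0) (fun b1 => (beta1 b1).1)).
  rewrite (_ : (fun t w => stoch_integral _ _ _ t w) = (fun t w => 1 *
      stoch_integral P' (fun s w' => Y1 s w' - Y2 s w') (fun s => t - s) t w)); last first.
    by apply/funext => t; apply/funext => w; rewrite mul1r.
  apply: (trawl_stable_fd_cvg nu_levy L_basis a_trawl Delta_gt0 nDelta_cvg0 beta_gt0 C0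
    (stable_regular_exponent gamma nu_levy b0 beta02 Kp0 Km0 tails) _ _ ext sI).
  + by move=> n n0; rewrite powR_gt0// nD_gt0.
  + by move=> n; rewrite -powRrM mulVf ?gt_eqF// powRr1.
  + by rewrite mulr_ge0// mulr_ge0.
  + by rewrite normr1 powR1 mulr1.
Qed.
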